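(* Monotone answerability of a Boolean conjunctive query with respect to a schema with result bounds whose constraints are unary inclusion dependencies and functional dependencies is decidable, and the problem is in $\mathrm{EXPTIME}$.
   Context: An inclusion dependency is a TGD $R(\vec x)\rightarrow\exists\vec y\,S(\vec z)$ with single body and head atoms and no repeated variables; it is unary (UID) if exactly one variable is exported from body to head. A functional dependency (FD) $D\rightarrow j$ on a relation $R$ asserts that any two $R$-facts agreeing on the positions in $D$ agree on position $j$. A schema consists of a relational signature, constraints, and access methods, each on a relation $R$ with a set of input positions and possibly a result bound $k\in\mathbb{N}_{>0}$. An access on instance $I$ binds the input positions to values of $I$; its matching tuples $M$ are the $R$-tuples agreeing with the binding; a valid output is $J\subseteq M$ with $J=M$ if no bound, and for result bound $k$, $|J|\le k$ and $\forall j\le k$: $|M|\ge j\Rightarrow|J|\ge j$. A monotone plan is a sequence of middleware commands $T:=E$ (relational algebra without difference over earlier tables) and access commands $T\Leftarrow\mathrm{mt}\Leftarrow E$ (each tuple of $E$ used as a binding, union of chosen valid outputs stored in $T$), ending with $\mathrm{Return}\ T_0$; it answers $Q$ if on every (finite or infinite) instance $I$ satisfying the constraints and for every choice of valid outputs, its output is $Q(I)$. $Q$ is monotone answerable if some monotone plan answers it. *)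

(* Defs.v *)
From mathcomp Require Import all_boot.
From Stdlib Require List.

Set Implicit Arguments.
Unset Strict Implicit.
Unset Printing Implicit Defensive.

(* A unary inclusion dependency R(x_1..x_n) -> exists y, S(z_1..z_m) with no
   repeated variables and exactly one exported variable, which sits at position
   u_spos of R and position u_tpos of S. *)
Record uid := UID { u_src : nat; u_spos : nat; u_tgt : nat; u_tpos : nat }.

Record fd := FD { f_rel : nat; f_lhs : seq nat; f_rhs : nat }.

Record method := Method { m_rel : nat; m_in : seq nat; m_bound : option nat }.

Record schema := Schema {
  s_ar : seq nat;
  s_uid : seq uid;
  s_fd : seq fd;
  s_meth : seq method }.

Definition arity (S : schema) (R : nat) : nat := nth 0 (s_ar S) R.
Definition is_rel (S : schema) (R : nat) : bool := R < size (s_ar S).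
Definition is_pos (S : schema) (R p : nat) : bool := is_rel S R && (p < arity S R).

Definition wf_uid (S : schema) (u : uid) : bool :=
  is_pos S (u_src u) (u_spos u) && is_pos S (u_tgt u) (u_tpos u).
Definition wf_fd (S : schema) (f : fd) : bool :=
  is_pos S (f_rel f) (f_rhs f) && all (is_pos S (f_rel f)) (f_lhs f).
Definition wf_method (S : schema) (m : method) : bool :=
  [&& is_rel S (m_rel m), all (is_pos S (m_rel m)) (m_in m), uniq (m_in m)
    & if m_bound m is Some k then 0 < k else true].

Definition wf_schema (S : schema) : Prop :=
  all (wf_uid S) (s_uid S) /\ all (wf_fd S) (s_fd S) /\ all (wf_method S) (s_meth S).

(* Boolean conjunctive queries: a list of atoms R(x_1,...,x_n), variables are
   nats, all existentially quantified. *)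
Definition atom := (nat * seq nat)%type.
Definition bcq := seq atom.

Definition wf_query (S : schema) (q : bcq) : Prop :=
  all (fun a => is_rel S a.1 && (size a.2 == arity S a.1)) q.

Definition table (D : Type) := seq D -> Prop.
Definition instance (D : Type) := nat -> table D.

Definition wf_instance (S : schema) D (I : instance D) : Prop :=
  forall R t, I R t -> is_rel S R /\ size t = arity S R.

Definition sat_uid D (I : instance D) (u : uid) : Prop :=
  forall t, I (u_src u) t ->
    exists t', I (u_tgt u) t' /\ onth t' (u_tpos u) = onth t (u_spos u).

Definition sat_fd D (I : instance D) (f : fd) : Prop :=
  forall t t', I (f_rel f) t -> I (f_rel f) t' ->
    (forall d, d \in f_lhs f -> onth t d = onth t' d) ->
    onth t (f_rhs f) = onth t' (f_rhs f).

Definition sat_constraints (S : schema) D (I : instance D) : Prop :=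
  (forall u, List.In u (s_uid S) -> sat_uid I u) /\
  (forall f, List.In f (s_fd S) -> sat_fd I f).

Definition cq_holds D (I : instance D) (q : bcq) : Prop :=
  exists v : nat -> option D,
    forall a, a \in q -> exists t, I a.1 t /\ map v a.2 = map Some t.

Definition at_least D (n : nat) (A : table D) : Prop :=
  exists l : seq (seq D), List.NoDup l /\ size l = n /\ (forall x, List.In x l -> A x).
Definition at_most D (n : nat) (A : table D) : Prop :=
  exists l : seq (seq D), size l <= n /\ (forall x, A x -> List.In x l).

Definition matching D (I : instance D) (m : method) (b : seq D) : table D :=
  fun t => I (m_rel m) t /\ size b = size (m_in m) /\
    (forall k, k < size (m_in m) -> onth t (nth 0 (m_in m) k) = onth b k).

Definition valid_output D (I : instance D) (m : method) (b : seq D) (J : table D)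
  : Prop :=
  let M := matching I m b in
  (forall t, J t -> M t) /\
  match m_bound m with
  | None => forall t, M t -> J t
  | Some k => at_most k J /\
      (forall j, j <= k -> at_least j M -> at_least j J)
  end.

(* Relational algebra without difference (positional, no constants). *)
Inductive rexpr :=
| ETab of nat
| EUnit
| EUnion of rexpr & rexpr
| EProd of rexpr & rexpr
| EProj of seq nat & rexpr
| ESel of nat & nat & rexpr.

Fixpoint rexpr_arity (env : seq nat) (e : rexpr) : option nat :=
  match e with
  | ETab t => onth env t
  | EUnit => Some 0
  | EUnion e1 e2 =>
      match rexpr_arity env e1, rexpr_arity env e2 with
      | Some n1, Some n2 => if n1 == n2 then Some n1 else None
      | _, _ => None end
  | EProd e1 e2 =>
      match rexpr_arity env e1, rexpr_arity env e2 with
      | Some n1, Some n2 => Some (n1 + n2)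
      | _, _ => None end
  | EProj cols e1 =>
      match rexpr_arity env e1 with
      | Some n => if all (fun c => c < n) cols then Some (size cols) else None
      | None => None end
  | ESel i j e1 =>
      match rexpr_arity env e1 with
      | Some n => if (i < n) && (j < n) then Some n else None
      | None => None end
  end.

Fixpoint rexpr_eval D (env : seq (table D)) (e : rexpr) : table D :=
  match e with
  | ETab t => nth (fun _ => False) env t
  | EUnit => fun t => t = [::]
  | EUnion e1 e2 => fun t => rexpr_eval env e1 t \/ rexpr_eval env e2 t
  | EProd e1 e2 => fun t => exists t1 t2,
      t = t1 ++ t2 /\ rexpr_eval env e1 t1 /\ rexpr_eval env e2 t2
  | EProj cols e1 => fun t => exists u,
      rexpr_eval env e1 u /\ map (onth u) cols = map Some t
  | ESel i j e1 => fun t => rexpr_eval env e1 t /\ onth t i = onth t j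
  end.

(* Commands: middleware command T := E, and access command T <= mt <= E
   (mt given as an index into the schema's list of access methods).
   Each command writes a new table, appended to the environment. *)
Inductive command :=
| CMid of rexpr
| CAcc of nat & rexpr.

Record plan := Plan { p_cmds : seq command; p_ret : nat }.

Fixpoint wt_cmds (S : schema) (env : seq nat) (cs : seq command) : option (seq nat) :=
  match cs with
  | [::] => Some env
  | CMid e :: cs' =>
      if rexpr_arity env e is Some n then wt_cmds S (rcons env n) cs' else None
  | CAcc mi e :: cs' =>
      match onth (s_meth S) mi, rexpr_arity env e with
      | Some m, Some n =>
          if n == size (m_in m) then wt_cmds S (rcons env (arity S (m_rel m))) cs'
          else None
      | _, _ => None end
  end.

Definition wt_plan (S : schema) (P : plan) : Prop :=
  exists env, wt_cmds S [::] (p_cmds P) = Some env /\ p_ret P < size env.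

Inductive exec (S : schema) D (I : instance D)
  : seq command -> seq (table D) -> seq (table D) -> Prop :=
| exec_nil env : exec S I [::] env env
| exec_mid e cs env env' :
    exec S I cs (rcons env (rexpr_eval env e)) env' ->
    exec S I (CMid e :: cs) env env'
| exec_acc mi m e cs env env' (J : seq D -> table D) :
    onth (s_meth S) mi = Some m ->
    (forall b, rexpr_eval env e b -> valid_output I m b (J b)) ->
    exec S I cs
      (rcons env (fun t => exists b, rexpr_eval env e b /\ J b t)) env' ->
    exec S I (CAcc mi e :: cs) env env'.

Definition plan_answers (S : schema) (P : plan) (q : bcq) : Prop :=
  wt_plan S P /\
  forall (D : Type) (I : instance D), wf_instance S I -> sat_constraints S I ->
  forall envf, exec S I (p_cmds P) [::] envf ->
  forall t, nth (fun _ => False) envf (p_ret P) t <-> (t = [::] /\ cq_holds I q).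

Definition monotone_answerable (S : schema) (q : bcq) : Prop :=
  exists P : plan, plan_answers S P q.

Fixpoint bin_aux (fuel n : nat) : seq bool :=
  match fuel with
  | 0 => [::]
  | f.+1 => if n == 0 then [::] else odd n :: bin_aux f n./2
  end.
Definition binary (n : nat) : seq bool := bin_aux n n.

Definition enc_nat (n : nat) : seq bool :=
  flatten [seq [:: true; b] | b <- binary n] ++ [:: false].
Definition enc_list T (f : T -> seq bool) (s : seq T) : seq bool :=
  flatten [seq true :: f x | x <- s] ++ [:: false].
Definition enc_option T (f : T -> seq bool) (o : option T) : seq bool :=
  if o is Some x then true :: f x else [:: false].

Definition enc_uid (u : uid) : seq bool :=
  enc_nat (u_src u) ++ enc_nat (u_spos u) ++ enc_nat (u_tgt u) ++ enc_nat (u_tpos u).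
Definition enc_fd (f : fd) : seq bool :=
  enc_nat (f_rel f) ++ enc_list enc_nat (f_lhs f) ++ enc_nat (f_rhs f).
Definition enc_method (m : method) : seq bool :=
  enc_nat (m_rel m) ++ enc_list enc_nat (m_in m) ++ enc_option enc_nat (m_bound m).
Definition enc_schema (S : schema) : seq bool :=
  enc_list enc_nat (s_ar S) ++ enc_list enc_uid (s_uid S) ++
  enc_list enc_fd (s_fd S) ++ enc_list enc_method (s_meth S).
Definition enc_atom (a : atom) : seq bool := enc_nat a.1 ++ enc_list enc_nat a.2.
Definition enc_input (S : schema) (q : bcq) : seq bool :=
  enc_schema S ++ enc_list enc_atom q.

(* Deterministic single-tape Turing machines over input alphabet {0,1}, tape
   alphabet {0,1,blank} (None = blank). *)
Inductive move := MLeft | MRight | MStay.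

Record TM := TMachine {
  tm_Q : finType;
  tm_start : tm_Q;
  tm_acc : tm_Q;
  tm_rej : tm_Q;
  tm_delta : tm_Q -> option bool -> tm_Q * option bool * move }.

Record config (M : TM) := Config {
  c_state : tm_Q M;
  c_left : seq (option bool);   (* cells left of the head, nearest first *)
  c_cur : option bool;
  c_right : seq (option bool) }.

Definition tm_halted (M : TM) (q : tm_Q M) : bool := (q == tm_acc M) || (q == tm_rej M).

Definition tm_step (M : TM) (c : config M) : config M :=
  if tm_halted (c_state c) then c else
  let: (q', w, mv) := tm_delta (c_state c) (c_cur c) in
  match mv with
  | MStay => Config q' (c_left c) w (c_right c)
  | MLeft => match c_left c with
             | [::] => Config q' [::] w (c_right c)
             | a :: l => Config q' l a (w :: c_right c) end
  | MRight => match c_right c with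
              | [::] => Config q' (w :: c_left c) None [::]
              | a :: r => Config q' (w :: c_left c) a r end
  end.

Definition tm_init (M : TM) (x : seq bool) : config M :=
  match x with
  | [::] => Config (tm_start M) [::] None [::]
  | b :: r => Config (tm_start M) [::] (Some b) (map Some r)
  end.

Definition tm_decides_in (M : TM) (x : seq bool) (n : nat) (P : Prop) : Prop :=
  let c := iter n (@tm_step M) (tm_init M x) in
  tm_halted (c_state c) /\ ((c_state c == tm_acc M) <-> P).

(* Main.v *)
Require Import Defs.
From mathcomp Require Import all_boot.
From mathcomp Require Import zify.
From mathcomp Require Import boolp.
Set Implicit Arguments. Unset Strict Implicit. Unset Printing Implicit Defensive.

(* Answerability is characterised by a fixed Datalog program: after guessing three functions on the
   polynomially many numbers that occur in the input, a query is answerable iff the goal predicate is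
   derivable.  Soundness of the criterion builds a pair of instances with a common access part from the
   facts that are not derivable; completeness turns a derivation into a plan.  All predicates have bounded arity,
   so the derivable facts and the guesses are coded by numbers below N = 2^(poly (size input)), and derivability is
   a bounded arithmetic formula.  Bounded formulas are evaluated by LOOP-like programs over
   registers bounded by a power of N, which a one-tape machine runs in time polynomial in N. *)

(** A monotone plan cannot separate two instances on which every access can be answered alike, so
    the criterion describes an extreme such pair: the first world contains the query, and both
    contain everything that accesses can reveal. Under a result bound an access certifies only the
    positions that its inputs determine through the functional dependencies, together with the
    positions where all facts of a relation agree; the others may hold fresh values, and infinitely
    many copies make every bound harmless. A unary dependency passes on a single element, so apart
    from the agreeing positions facts hang together in a forest, and a created fact is typed by its
    relation and its inherited position. The second world is still infinite: what is guessed is a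
    finite description of a match of the query in it, whose new elements are named after query
    variables. Two obstacles shape the coding. Arities are written in binary, so all positions
    absent from the input share one representative [js]. And least models are not computed:
    membership becomes a quantifier over all closed sets of facts, each a number below [N]. *)

Module TapeRegisters.
Import Defs.
Import all_boot zify.

(** * A counter machine with a read-once input, simulated on one tape *)

Inductive instr :=
| IInc of nat & nat
| IDec of nat & nat & nat
| IPop of nat & nat & nat
| IGoto of nat
| IHalt of bool.

Section Region.
Variable k : nat.
Hypothesis k_gt0 : 0 < k.

(* Register [r] is the number of cells equal to [true] at positions congruent to [r] modulo [k]. *)
Fixpoint rval (off : nat) (l : seq bool) : nat :=
  match l, off with
  | [::], _ => 0
  | b :: l', 0 => b + rval k.-1 l'
  | _ :: l', o.+1 => rval o l'
  end.

Fixpoint rinc (off : nat) (l : seq bool) : seq bool :=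
  match l, off with
  | [::], _ => rcons (nseq off false) true
  | true :: l', 0 => true :: rinc k.-1 l'
  | false :: l', 0 => true :: l'
  | b :: l', o.+1 => b :: rinc o l'
  end.

(** On a zero register the scan runs off the written region and turns the blanks it passes into
    [false]. This lengthens the region without changing any register; reaching a blank is what
    answers the zero test. *)
Fixpoint rdec (off : nat) (l : seq bool) : seq bool :=
  match l, off with
  | [::], _ => nseq off.+1 false
  | true :: l', 0 => false :: l'
  | false :: l', 0 => false :: rdec k.-1 l'
  | b :: l', o.+1 => b :: rdec o l'
  end.

Lemma rval_nseq o m : rval o (nseq m false) = 0.
Proof. by elim: m o => [|m IH] [|o] //=; rewrite IH. Qed.

Lemma rval_rcons o m : o < k -> m < k ->
  rval o (rcons (nseq m false) true) = (o == m).
Proof.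
elim: m o => [|m IH] [|o] //= ok mk; last by rewrite IH // ltnW.
by rewrite add0n IH ?(ltnW mk) ?prednK //; case: eqP => // e; lia.
Qed.

Lemma rval_inc o l : o < k -> rval o (rinc o l) = (rval o l).+1.
Proof.
elim: l o => [|b l IH] o ok /=.
  by rewrite rval_rcons // eqxx.
case: o ok => [|o] ok /=; last by case: b => /=; rewrite IH // ltnW.
by case: b => //=; rewrite IH // prednK.
Qed.

Lemma rval_inc_neq o p l : o < k -> p < k -> o != p -> rval o (rinc p l) = rval o l.
Proof.
elim: l o p => [|b l IH] o p ok pk ne /=.
  by rewrite rval_rcons // (negbTE ne).
have kk : k.-1 < k by rewrite prednK.
case: o ok ne => [|o] ok; case: p pk => [|p] pk //= ne.
- by case: b => /=; rewrite IH // ?(ltnW pk) // neq_ltn; apply/orP; right; rewrite -ltnS prednK.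
- by case: b => //=; rewrite IH // ?(ltnW ok) // neq_ltn; apply/orP; left; rewrite -ltnS prednK.
- by case: b => /=; rewrite IH // ltnW.
Qed.

Lemma rval_dec o l : o < k -> rval o (rdec o l) = (rval o l).-1.
Proof.
elim: l o => [|b l IH] o ok.
  by rewrite rval_nseq.
case: o ok => [|o] ok /=; last by case: b => /=; rewrite IH // ltnW.
by case: b => //=; rewrite IH // prednK.
Qed.

Lemma rval_dec_neq o p l : o < k -> p < k -> o != p -> rval o (rdec p l) = rval o l.
Proof.
elim: l o p => [|b l IH] o p ok pk ne.
  by rewrite rval_nseq.
have kk : k.-1 < k by rewrite prednK.
case: o ok ne => [|o] ok; case: p pk => [|p] pk //= ne.
- by case: b => /=; rewrite IH // ?(ltnW pk) // neq_ltn; apply/orP; right; rewrite -ltnS prednK.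
- by case: b => //=; rewrite IH // ?(ltnW ok) // neq_ltn; apply/orP; left; rewrite -ltnS prednK.
- by case: b => /=; rewrite IH // ltnW.
Qed.

Lemma size_rinc o l : o < k -> size (rinc o l) <= size l + k.
Proof.
elim: l o => [|b l IH] o ok /=; first by rewrite size_rcons size_nseq.
have kk : k.-1 < k by rewrite prednK.
case: o ok => [|o] ok; case: b => /=; rewrite addSn ltnS ?IH ?leq_addr //; exact: ltnW.
Qed.

Lemma size_rdec o l : o < k -> size (rdec o l) <= size l + k.
Proof.
elim: l o => [|b l IH] o ok /=; first by rewrite size_nseq.
have kk : k.-1 < k by rewrite prednK.
case: o ok => [|o] ok; case: b => /=; rewrite addSn ltnS ?IH ?leq_addr //; exact: ltnW.
Qed.
End Region.

Section Machine.
Variables (prog : seq instr) (k : nat).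
Hypothesis k_gt0 : 0 < k.

(** A state is a verdict or a program counter with a mode and an offset. Mode 0 dispatches, 1 and 2
    scan for an increment and a decrement, 3 and 4 return after success and failure, 5 to 7 are the
    three legs of a pop. The offset counts the cells still to be skipped; in mode 7 it holds the
    popped bit. *)
Definition mstate : finType := (bool + 'I_(size prog).+1 * ('I_8 * 'I_k.+1))%type.
Definition mk (pc mode off : nat) : mstate := inr (inord pc, (inord mode, inord off)).
Definition fetch pc := nth (IHalt false) prog pc.

Definition after_scan (pc : nat) (ok : bool) : nat :=
  match fetch pc with
  | IInc _ n => n
  | IDec _ n z => if ok then n else z
  | _ => 0
  end.

Definition after_pop (pc bit : nat) : nat :=
  match fetch pc with IPop n0 n1 ne => nth ne [:: n0; n1] bit | _ => 0 end.

Definition delta (q : mstate) (c : option bool) : mstate * option bool * move :=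
  match q with
  | inl b => (q, c, MStay)
  | inr (pc', (m', o')) =>
    let pc := nat_of_ord pc' in
    match nat_of_ord m', nat_of_ord o' with
    | 0, _ => match fetch pc with
              | IInc r _ => (mk pc 1 r, c, MRight)
              | IDec r _ _ => (mk pc 2 r, c, MRight)
              | IPop _ _ _ => (mk pc 5 0, c, MLeft)
              | IGoto n => (mk n 0 0, c, MStay)
              | IHalt b => (inl b, c, MStay)
              end
    | 1, o.+1 => (mk pc 1 o, Some (c == Some true), MRight)
    | 1, 0 => if c == Some true then (mk pc 1 k.-1, c, MRight)
              else (mk pc 3 0, Some true, MLeft)
    | 2, o.+1 => (mk pc 2 o, Some (c == Some true), MRight)
    | 2, 0 => match c with
              | Some true => (mk pc 3 0, Some false, MLeft)
              | Some false => (mk pc 2 k.-1, c, MRight)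
              | None => (mk pc 4 0, Some false, MLeft) end
    | 3, _ => if c is Some _ then (q, c, MLeft) else (mk (after_scan pc true) 0 0, c, MStay)
    | 4, _ => if c is Some _ then (q, c, MLeft) else (mk (after_scan pc false) 0 0, c, MStay)
    | 5, _ => if c is Some _ then (q, c, MLeft) else (mk pc 6 0, c, MRight)
    | 6, _ => if c is Some b then (mk pc 7 b, None, MRight)
              else (mk (after_pop pc 2) 0 0, c, MStay)
    | _, b => if c is Some _ then (q, c, MRight) else (mk (after_pop pc b) 0 0, c, MStay)
    end
  end.

#[local] Arguments delta : simpl never.
#[local] Arguments mk : simpl never.

(** The start state is mode 6 of instruction 0, which therefore has to be a pop: the first input bit
    is erased at once, and the blank left behind marks the left end of the unread input from then
    on. *)
Definition machine : TM := TMachine (mk 0 6 0) (inl true) (inl false) delta.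

Notation cfg := (config machine).
Definition conf (q : mstate) l c r : cfg := @Config machine q l c r.
Definition conf_r (q : mstate) l r : cfg :=
  if r is a :: r' then conf q l a r' else conf q l None [::].
Definition conf_l (q : mstate) l r : cfg :=
  if l is a :: l' then conf q l' a r else conf q [::] (head None r) (behead r).

Notation step := (@tm_step machine).

Definition reach n (c c' : cfg) := exists2 m, m <= n & iter m step c = c'.

Lemma reach_trans n1 n2 c1 c2 c3 : reach n1 c1 c2 -> reach n2 c2 c3 -> reach (n1 + n2) c1 c3.
Proof.
move=> [m1 l1 <-] [m2 l2 <-]; exists (m2 + m1); first by rewrite addnC leq_add.
by rewrite iterD.
Qed.

Lemma reach1 n c1 c2 c3 : step c1 = c2 -> reach n c2 c3 -> reach n.+1 c1 c3.
Proof. by move=> h H; apply: (@reach_trans 1 n c1 c2 c3) => //; exists 1. Qed.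

Lemma reach0 c n : reach n c c.
Proof. by exists 0. Qed.

Lemma reach_le n n' c c' : n <= n' -> reach n c c' -> reach n' c c'.
Proof. by move=> h [m l e]; exists m => //; exact: leq_trans h. Qed.

Definition wf_instr (i : instr) :=
  match i with
  | IInc r n => (r < k) && (n <= size prog)
  | IDec r n z => [&& r < k, n <= size prog & z <= size prog]
  | IPop n0 n1 ne => [&& n0 <= size prog, n1 <= size prog & ne <= size prog]
  | IGoto n => n <= size prog
  | IHalt _ => true
  end.
Hypothesis wf_prog : all wf_instr prog.

Lemma stepE pc m o l c r : pc <= size prog -> m < 8 -> o <= k ->
  step (conf (mk pc m o) l c r) =
  let: (q', w, mv) := delta (mk pc m o) c in
  match mv with
  | MStay => conf q' l w r
  | MLeft => conf_l q' l (w :: r)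
  | MRight => conf_r q' (w :: l) r
  end.
Proof.
move=> pcl ml ol; rewrite /tm_step /=.
by case: (delta _ _) => [[q w] mv] /=; case: mv => //; case: r.
Qed.

Lemma deltaE pc m o c : pc <= size prog -> m < 8 -> o <= k ->
  delta (mk pc m o) c =
  match m, o with
    | 0, _ => match fetch pc with
              | IInc r _ => (mk pc 1 r, c, MRight)
              | IDec r _ _ => (mk pc 2 r, c, MRight)
              | IPop _ _ _ => (mk pc 5 0, c, MLeft)
              | IGoto n => (mk n 0 0, c, MStay)
              | IHalt b => (inl b, c, MStay)
              end
    | 1, o.+1 => (mk pc 1 o, Some (c == Some true), MRight)
    | 1, 0 => if c == Some true then (mk pc 1 k.-1, c, MRight)
              else (mk pc 3 0, Some true, MLeft)
    | 2, o.+1 => (mk pc 2 o, Some (c == Some true), MRight)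
    | 2, 0 => match c with
              | Some true => (mk pc 3 0, Some false, MLeft)
              | Some false => (mk pc 2 k.-1, c, MRight)
              | None => (mk pc 4 0, Some false, MLeft) end
    | 3, _ => if c is Some _ then (mk pc m o, c, MLeft) else (mk (after_scan pc true) 0 0, c, MStay)
    | 4, _ => if c is Some _ then (mk pc m o, c, MLeft) else (mk (after_scan pc false) 0 0, c, MStay)
    | 5, _ => if c is Some _ then (mk pc m o, c, MLeft) else (mk pc 6 0, c, MRight)
    | 6, _ => if c is Some b then (mk pc 7 b, None, MRight)
              else (mk (after_pop pc 2) 0 0, c, MStay)
    | _, b => if c is Some _ then (mk pc m o, c, MRight) else (mk (after_pop pc b) 0 0, c, MStay)
  end.
Proof.
by move=> pcl ml ol; rewrite /delta {1}/mk !inordK.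
Qed.

Lemma wf_fetch pc : wf_instr (fetch pc).
Proof.
rewrite /fetch; case: (ltnP pc (size prog)) => h; last by rewrite nth_default.
by move/all_nthP: wf_prog => /(_ (IHalt false) pc h).
Qed.

Lemma after_scan_le pc b : after_scan pc b <= size prog.
Proof.
rewrite /after_scan; have := wf_fetch pc.
by case: (fetch pc) => //= [r n /andP[] | r n z /and3P[_ ? ?]] //; case: b.
Qed.

Lemma after_pop_le pc b : after_pop pc b <= size prog.
Proof.
rewrite /after_pop; have := wf_fetch pc.
case: (fetch pc) => //= n0 n1 ne /and3P[h0 h1 h2].
by case: b => [|[|b]] //=; rewrite nth_nil.
Qed.

Lemma ret_ok pc (ok : bool) A B R : pc <= size prog ->
  reach (size A).+1 (conf_l (mk pc (if ok then 3 else 4) 0) (map Some A ++ None :: B) R)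
    (conf (mk (after_scan pc ok) 0 0) B None (map Some (rev A) ++ R)).
Proof.
move=> pcl; elim: A R => [|a A IH] R.
  apply: (@reach1 0); last exact: reach0.
  by case: (ok); rewrite stepE ?deltaE //=.
rewrite /= rev_cons map_rcons cat_rcons.
apply: reach1 (IH _).
by case: (ok); rewrite stepE ?deltaE //=.
Qed.

(** Induction on the cells [l] still ahead, the passed cells [A] being the accumulator. Once [l] is
    exhausted at most [k] blanks are crossed before the mark is written, and the whole region is
    walked back. *)
Lemma iscan_ok pc o A B l : pc <= size prog -> o < k ->
  reach (size A + 2 * (size l + k) + 2)
    (conf_r (mk pc 1 o) (map Some A ++ None :: B) (map Some l))
    (conf (mk (after_scan pc true) 0 0) B None (map Some (rev A ++ rinc k o l))).
Proof.
move=> pcl; have kk : k.-1 < k by rewrite prednK.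
elim: l o A => [|b l IH] o A ok.
  have: forall o A, o < k -> reach (size A + o.+1 + o.+1 + 2)
    (conf_r (mk pc 1 o) (map Some A ++ None :: B) [::])
    (conf (mk (after_scan pc true) 0 0) B None (map Some (rev A ++ rcons (nseq o false) true))).
    elim=> [|o' IH'] A' ok' /=.
      apply: (@reach_le (size A').+2); first by rewrite addn2 !ltnS -addnA leq_addr.
      apply: reach1; last by rewrite map_cat; apply: (@ret_ok pc true A' B [:: Some true]).
      by rewrite stepE // deltaE.
    have -> : rev A' ++ false :: rcons (nseq o' false) true = rev (false :: A') ++ rcons (nseq o' false) true.
      by rewrite rev_cons cat_rcons.
    apply: (@reach_le (size (false :: A') + o'.+1 + o'.+1 + 2).+1).
      by rewrite /= !addn2 !ltnS !addSn !addnS.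
    apply: reach1; last by apply: IH'; exact: ltnW.
    by rewrite stepE ?deltaE //; exact: ltnW.
  move/(_ o A ok) => /=; apply: reach_le; lia.
have step2 : forall w o', o' < k -> step (conf_r (mk pc 1 o) (map Some A ++ None :: B) (map Some (b :: l))) = conf_r (mk pc 1 o') (map Some (w :: A) ++ None :: B) (map Some l) ->
   reach (size A + 2 * (size (b :: l) + k) + 2) (conf_r (mk pc 1 o) (map Some A ++ None :: B) (map Some (b :: l)))
   (conf (mk (after_scan pc true) 0 0) B None (map Some (rev A ++ w :: rinc k o' l))).
  move=> w o' ok' e.
  apply: (@reach_le (size (w :: A) + 2 * (size l + k) + 2).+1).
    by rewrite /=; lia.
  apply: reach1 e _.
  have -> : rev A ++ w :: rinc k o' l = rev (w :: A) ++ rinc k o' l by rewrite rev_cons cat_rcons.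
  exact: IH.
case: o ok step2 => [|o] ok step2 /=.
  case: b step2 => step2.
    by apply: step2 => //=; rewrite stepE // deltaE.
  apply: (@reach_le (size A).+2); first by rewrite addn2 !ltnS leq_addr.
  apply: reach1; last by rewrite map_cat; apply: (@ret_ok pc true A B).
  by rewrite stepE // deltaE.
by case: b step2 => step2; apply: step2; rewrite ?(ltnW ok) //= stepE ?deltaE //; exact: ltnW.
Qed.

Lemma dscan_ok pc o A B l : pc <= size prog -> o < k ->
  reach (size A + 2 * (size l + k) + 2)
    (conf_r (mk pc 2 o) (map Some A ++ None :: B) (map Some l))
    (conf (mk (after_scan pc (0 < rval k o l)) 0 0) B None (map Some (rev A ++ rdec k o l))).
Proof.
move=> pcl; have kk : k.-1 < k by rewrite prednK.
elim: l o A => [|b l IH] o A ok.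
  have: forall o A, o < k -> reach (size A + o.+1 + o.+1 + 2)
    (conf_r (mk pc 2 o) (map Some A ++ None :: B) [::])
    (conf (mk (after_scan pc false) 0 0) B None (map Some (rev A ++ nseq o.+1 false))).
    elim=> [|o' IH'] A' ok'.
      apply: (@reach_le (size A').+2); first by rewrite addn2 !ltnS -addnA leq_addr.
      apply: reach1; last by rewrite map_cat; apply: (@ret_ok pc false A' B [:: Some false]).
      by rewrite stepE // deltaE.
    have -> : rev A' ++ nseq o'.+2 false = rev (false :: A') ++ nseq o'.+1 false.
      by rewrite rev_cons cat_rcons.
    apply: (@reach_le (size (false :: A') + o'.+1 + o'.+1 + 2).+1).
      by rewrite /= !addn2 !ltnS !addSn !addnS.
    apply: reach1; last by apply: IH'; exact: ltnW.
    by rewrite stepE ?deltaE //; exact: ltnW.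
  move/(_ o A ok) => /=; apply: reach_le; lia.
have step2 : forall w o', o' < k -> step (conf_r (mk pc 2 o) (map Some A ++ None :: B) (map Some (b :: l))) = conf_r (mk pc 2 o') (map Some (w :: A) ++ None :: B) (map Some l) ->
   reach (size A + 2 * (size (b :: l) + k) + 2) (conf_r (mk pc 2 o) (map Some A ++ None :: B) (map Some (b :: l)))
   (conf (mk (after_scan pc (0 < rval k o' l)) 0 0) B None (map Some (rev A ++ w :: rdec k o' l))).
  move=> w o' ok' e.
  apply: (@reach_le (size (w :: A) + 2 * (size l + k) + 2).+1).
    by rewrite /=; lia.
  apply: reach1 e _.
  have -> : rev A ++ w :: rdec k o' l = rev (w :: A) ++ rdec k o' l by rewrite rev_cons cat_rcons.
  exact: IH.
case: o ok step2 => [|o] ok step2 /=.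
  case: b step2 => step2; last first.
    by rewrite add0n; apply: step2 => //=; rewrite stepE // deltaE.
  apply: (@reach_le (size A).+2); first by rewrite addn2 !ltnS leq_addr.
  apply: reach1; last by rewrite map_cat; apply: (@ret_ok pc true A B).
  by rewrite stepE // deltaE.
by case: b step2 => step2; apply: step2; rewrite ?(ltnW ok) //= stepE ?deltaE //; exact: ltnW.
Qed.

Lemma pleft_ok pc A B R : pc <= size prog ->
  reach (size A).+1 (conf_l (mk pc 5 0) (map Some A ++ None :: B) R)
    (conf_r (mk pc 6 0) (None :: B) (map Some (rev A) ++ R)).
Proof.
move=> pcl; elim: A R => [|a A IH] R.
  by apply: (@reach1 0); last exact: reach0; rewrite stepE ?deltaE //=.
rewrite /= rev_cons map_rcons cat_rcons.
by apply: reach1 (IH _); rewrite stepE ?deltaE //=.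
Qed.

Lemma pright_ok pc (b : bool) L A R : pc <= size prog -> R = [::] \/ ohead R = Some None ->
  reach (size A).+1 (conf_r (mk pc 7 b) L (map Some A ++ R))
    (conf (mk (after_pop pc b) 0 0) (map Some (rev A) ++ L) None (behead R)).
Proof.
move=> pcl hR; have bk : b <= k by case: b => //.
elim: A L => [|a A IH] L.
  apply: (@reach1 0); last exact: reach0.
  by case: hR => [->|]; last case: R => [|c R] //= [->]; rewrite stepE // deltaE //; case: (b).
rewrite /= rev_cons map_rcons cat_rcons.
by apply: reach1 (IH _); rewrite /= stepE //= deltaE.
Qed.

(* The head rests on the blank separating the unread input from the registers. *)
Definition home pc e (inp reg : seq bool) : cfg :=
  conf (mk pc 0 0) (map Some (rev inp) ++ nseq e.+1 None) None (map Some reg).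

Definition cstep (s : nat * seq bool * seq bool) : nat * seq bool * seq bool :=
  let: (pc, inp, reg) := s in
  match fetch pc with
  | IInc r n => (n, inp, rinc k r reg)
  | IDec r n z => (if 0 < rval k r reg then n else z, inp, rdec k r reg)
  | IPop n0 n1 ne => match inp with
                     | [::] => (ne, [::], reg)
                     | b :: inp' => (if b then n1 else n0, inp', reg) end
  | IGoto n => (n, inp, reg)
  | IHalt _ => s
  end.

Definition is_home s e := home s.1.1 e s.1.2 s.2.

Lemma cstep_ok s e : s.1.1 <= size prog ->
  (cstep s).1.1 <= size prog /\
  size (cstep s).2 <= size s.2 + k /\ size (cstep s).1.2 <= size s.1.2 /\
  exists e', reach (2 * (size s.1.2 + size s.2 + k) + 9) (is_home s e) (is_home (cstep s) e').
Proof.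
case: s => [[pc inp] reg] /= pcl; rewrite /cstep.
have := wf_fetch pc; case E: (fetch pc) => [r n|r n z|n0 n1 ne|n|b] /= W.
- case/andP: W => rk nl; split=> //; split; [exact: size_rinc | split=> //].
  exists e; rewrite /is_home /=.
  apply: (@reach_le (2 * (size reg + k) + 2).+1).
    by lia.
  apply: reach1; first by rewrite /home stepE ?deltaE ?E //.
  have := @iscan_ok pc r [::] (map Some (rev inp) ++ nseq e.+1 None) reg pcl rk.
  by rewrite /after_scan E.
- case/and3P: W => rk nl zl; split; first by case: ifP.
  split; [exact: size_rdec | split=> //].
  exists e; rewrite /is_home /=.
  apply: (@reach_le (2 * (size reg + k) + 2).+1).
    by lia.
  apply: reach1; first by rewrite /home stepE ?deltaE ?E //.
  have := @dscan_ok pc r [::] (map Some (rev inp) ++ nseq e.+1 None) reg pcl rk.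
  by rewrite /after_scan E.
- case/and3P: W => h0 h1 he.
  have P1 : reach (size inp).+2 (home pc e inp reg)
              (conf_r (mk pc 6 0) (None :: nseq e None) (map Some inp ++ None :: map Some reg)).
    apply: reach1; first by rewrite /home stepE ?deltaE ?E //.
    have := @pleft_ok pc (rev inp) (nseq e None) (None :: map Some reg) pcl.
    by rewrite size_rev revK.
  case: inp P1 => [|b inp] P1 /=.
    split=> //; split; [exact: leq_addr | split=> //].
    exists e; apply: (@reach_le (2 + 1)); first by rewrite ltn_addl.
    apply: reach_trans P1 _ => /=.
    apply: reach1 (reach0 _ _); rewrite stepE // deltaE // /after_pop E //.
  split; first by case: b P1.
  split; first exact: leq_addr.
  split=> //.
  exists e.+1; rewrite /is_home /=.
  apply: (@reach_le ((size inp).+3 + (1 + (size inp).+1))).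
    by lia.
  apply: reach_trans P1 _; apply: (@reach_trans 1).
    by exists 1; [|rewrite /= stepE ?deltaE //].
  have := @pright_ok pc b (None :: None :: nseq e None) inp (None :: map Some reg) pcl (or_intror erefl).
  by rewrite /after_pop E /=; case: (b).
- split=> //; split; [exact: leq_addr | split=> //].
  exists e; apply: (@reach_le 1); first by rewrite ltn_addl.
  by apply: reach1 (reach0 _ _); rewrite /is_home /home stepE // deltaE // E.
- split=> //; split; [exact: leq_addr | split=> //].
  by exists e; exact: reach0.
Qed.

(** Each instruction lengthens the register region by at most [k] cells, so the cost of one step is
    linear in the number of steps made, and the total is quadratic. *)
Lemma citer_ok n s e : s.1.1 <= size prog ->
  (iter n cstep s).1.1 <= size prog /\
  size (iter n cstep s).2 <= size s.2 + n * k /\ size (iter n cstep s).1.2 <= size s.1.2 /\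
  exists e', reach (n * (2 * (size s.1.2 + size s.2 + n * k + k) + 9)) (is_home s e)
                   (is_home (iter n cstep s) e').
Proof.
move=> h; elim: n => [|n [IH1 [IH2 [IH3 [e1 IH4]]]]].
  by rewrite addn0; do !split=> //; exists e; exact: reach0.
have [C1 [C2 [C3 [e2 C4]]]] := cstep_ok e1 IH1; rewrite iterS; split=> //; split.
  by apply: leq_trans C2 _; rewrite mulSn [k + _]addnC addnA leq_add2r.
split; first exact: leq_trans C3 IH3.
exists e2; rewrite [in X in reach X]mulSn addnC; apply: reach_trans (reach_le _ IH4) (reach_le _ C4).
  by rewrite leq_mul // leq_add2r leq_mul // leq_add2r leq_add2l mulSn leq_addl.
rewrite leq_add2r leq_mul // leq_add2r -!addnA leq_add //.
apply: leq_trans IH2 _; rewrite leq_add2l mulSn leq_addl //.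
Qed.

Lemma machine_halts (n0 n1 ne : nat) (inp : seq bool) (n pc : nat) (r : seq bool) rest (b : bool) :
  fetch 0 = IPop n0 n1 ne -> 0 < size inp ->
  iter n cstep (0, inp, [::]) = (pc, rest, r) -> 0 < n -> fetch pc = IHalt b ->
  exists2 t, t <= (size inp).+2 + n * (2 * (size inp + n * k + k) + 9) &
    let c := iter t step (tm_init machine inp) in c_state c = inl b.
Proof.
move=> E0; case: inp => [//|x inp] _; case: n => // n; rewrite iterSr /= E0 => H _ Eb.
(* The first pop starts from the raw input word and not from a home configuration, so it is
   simulated separately. *)
have [] : exists e, reach ((size inp).+2) (tm_init machine (x :: inp)) (is_home (if x then n1 else n0, inp, [::]) e).
  exists 0; apply: (@reach1 _ _ (conf_r (mk 0 7 x) [:: None] (map Some inp))).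
    by rewrite -[tm_init _ _]/(conf (mk 0 6 0) [::] (Some x) (map Some inp)) stepE // deltaE.
  have := @pright_ok 0 x [:: None] inp [::] (leq0n _) (or_introl erefl).
  by rewrite cats0 /after_pop E0; case: (x).
move=> e R1.
have pcl : (if x then n1 else n0) <= size prog.
  by have := wf_fetch 0; rewrite E0 /= => /and3P[? ? ?]; case: (x).
have [C1 [_ [_ [e' C2]]]] := @citer_ok n (if x then n1 else n0, inp, [::]) e pcl.
rewrite H in C1 C2.
have R3 : reach 1 (is_home (pc, rest, r) e') (conf (inl b) (map Some (rev rest) ++ nseq e'.+1 None) None (map Some r)).
  by apply: reach1 (reach0 _ _); rewrite /is_home /home /= stepE // deltaE // Eb.
have [m le1 E] := reach_trans R1 (reach_trans C2 R3).
exists m; last by rewrite /= E.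
apply: leq_trans le1 _; rewrite /= addn0.
have h : 2 * (size inp + n * k + k) + 9 <= 2 * ((size inp).+1 + n.+1 * k + k) + 9.
  by rewrite leq_add2r leq_mul // leq_add2r leq_add // leq_mul.
have := leq_mul (leqnn n) h; rewrite (mulSn n (_ + 9)); lia.
Qed.
End Machine.
End TapeRegisters.

(** * Loop programs and their compilation to the counter machine *)

Module LoopCompiler.
Import Defs TapeRegisters.
Import all_boot zify.

Inductive cmd :=
| Skip
| Inc of nat
| Dec of nat
| Seq of cmd & cmd
| Loop of nat & cmd.

Definition upd (s : nat -> nat) r v : nat -> nat := fun x => if x == r then v else s x.

(* A state paired with the number of counter-machine steps spent so far; [Loop r c] decrements [r] before each execution of [c] until it is zero. *)
Fixpoint run (c : cmd) (p : (nat -> nat) * nat) : (nat -> nat) * nat :=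
  match c with
  | Skip => p
  | Inc r => (upd p.1 r (p.1 r).+1, p.2.+1)
  | Dec r => (upd p.1 r (p.1 r).-1, p.2.+1)
  | Seq c1 c2 => run c2 (run c1 p)
  | Loop r c' =>
    let p' := iter (p.1 r) (fun q =>
      let q' := run c' (upd q.1 r (q.1 r).-1, q.2.+1) in (q'.1, q'.2.+1)) p in
    (p'.1, p'.2.+1)
  end.

Fixpoint writes (c : cmd) (x : nat) : bool :=
  match c with
  | Skip => false
  | Inc r | Dec r => r == x
  | Seq c1 c2 => writes c1 x || writes c2 x
  | Loop r c' => (r == x) || writes c' x
  end.

Fixpoint regs_lt (k : nat) (c : cmd) : bool :=
  match c with
  | Skip => true
  | Inc r | Dec r => r < k
  | Seq c1 c2 => regs_lt k c1 && regs_lt k c2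
  | Loop r c' => (r < k) && regs_lt k c'
  end.

(** A body that never writes the loop register leaves the number of rounds equal to the initial
    value of that register. *)
Fixpoint wfc (c : cmd) : bool :=
  match c with
  | Seq c1 c2 => wfc c1 && wfc c2
  | Loop r c' => ~~ writes c' r && wfc c'
  | _ => true
  end.

Lemma run_unwritten c x p : ~~ writes c x -> (run c p).1 x = p.1 x.
Proof.
elim: c p => [|r|r|c1 IH1 c2 IH2|r c IH] [s t] //=.
- by rewrite eq_sym /upd => /negbTE->.
- by rewrite eq_sym /upd => /negbTE->.
- by rewrite negb_or => /andP[h1 h2]; rewrite IH2 // IH1.
rewrite negb_or eq_sym => /andP[h1 h2].
by elim: (s r) => //= n <-; rewrite IH //= /upd (negbTE h1).
Qed.

Fixpoint code_len (c : cmd) : nat :=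
  match c with
  | Skip => 0
  | Inc _ | Dec _ => 1
  | Seq c1 c2 => code_len c1 + code_len c2
  | Loop _ c' => (code_len c').+2
  end.

Fixpoint code (c : cmd) (a : nat) : seq instr :=
  match c with
  | Skip => [::]
  | Inc r => [:: IInc r a.+1]
  | Dec r => [:: IDec r a.+1 a.+1]
  | Seq c1 c2 => code c1 a ++ code c2 (a + code_len c1)
  | Loop r c' => IDec r a.+1 (a + (code_len c').+2) :: code c' a.+1 ++ [:: IGoto a]
  end.

Lemma size_code c a : size (code c a) = code_len c.
Proof.
elim: c a => //= [c1 IH1 c2 IH2|r c IH] a; rewrite size_cat ?IH1 ?IH2 //.
by rewrite IH addn1.
Qed.

Section Compile.
Variables (prog : seq instr) (k : nat).
Hypothesis k_gt0 : 0 < k.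

Definition models (s : nat -> nat) (l : seq bool) := forall r, r < k -> rval k r l = s r.

Definition code_at (c : cmd) (a : nat) :=
  forall i, i < code_len c -> fetch prog (a + i) = nth (IHalt false) (code c a) i.

Notation step := (cstep prog k).

Lemma code_at_seq c1 c2 a : code_at (Seq c1 c2) a -> code_at c1 a /\ code_at c2 (a + code_len c1).
Proof.
move=> H; split=> i il.
  by rewrite H /= ?nth_cat ?size_code ?il // ltn_addr.
have := H (code_len c1 + i); rewrite /= ltn_add2l addnA => -> //.
by rewrite nth_cat size_code ltnNge leq_addr /= addKn.
Qed.

Lemma code_at_loop r c a : code_at (Loop r c) a ->
  [/\ fetch prog a = IDec r a.+1 (a + (code_len c).+2), code_at c a.+1
    & fetch prog (a.+1 + code_len c) = IGoto a].
Proof.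
move=> H; split=> [|i il|].
- by have := H 0 isT; rewrite addn0.
- have := H i.+1; rewrite addnS -addSn /= => ->; last by rewrite !ltnS ltnW.
  by rewrite nth_cat size_code il.
- have := H (code_len c).+1; rewrite addnS -addSn /= => -> //.
  by rewrite nth_cat size_code ltnn subnn.
Qed.

Lemma models_inc s l r : r < k -> models s l -> models (upd s r (s r).+1) (rinc k r l).
Proof.
move=> rk H x xk; rewrite /upd; case: eqP => [->|/eqP ne].
  by rewrite rval_inc // H.
by rewrite rval_inc_neq // H.
Qed.

Lemma models_dec s l r : r < k -> models s l -> models (upd s r (s r).-1) (rdec k r l).
Proof.
move=> rk H x xk; rewrite /upd; case: eqP => [->|/eqP ne].
  by rewrite rval_dec // H.
by rewrite rval_dec_neq // H.
Qed.

Lemma code_ok c a s t l inp : wfc c -> regs_lt k c -> code_at c a -> models s l ->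
  exists m l', [/\ (run c (s, t)).2 = t + m, iter m step (a, inp, l) = (a + code_len c, inp, l')
    & models (run c (s, t)).1 l'].
Proof.
elim: c a s t l => [|r|r|c1 IH1 c2 IH2|r c IH] a s t l /=.
- by move=> _ _ _ H; exists 0, l; rewrite !addn0.
- move=> _ rk Hc H; exists 1, (rinc k r l); split; rewrite ?addn1 //=; last exact: models_inc.
  by have := Hc 0 isT; rewrite addn0 /= => ->.
- move=> _ rk Hc H; exists 1, (rdec k r l); split; rewrite ?addn1 //=; last exact: models_dec.
  by have := Hc 0 isT; rewrite addn0 /= => ->; rewrite if_same.
- move=> /andP[w1 w2] /andP[r1 r2] /code_at_seq[C1 C2] H.
  have [m1 [l1 [e1 i1 h1]]] := IH1 a s t l w1 r1 C1 H.
  move: e1 h1; case: (run c1 (s, t)) => s1 t1 /= -> h1.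
  have [m2 [l2 [e2 i2 h2]]] := IH2 _ s1 (t + m1) l1 w2 r2 C2 h1.
  exists (m1 + m2), l2; rewrite e2 addnA; split=> //.
  by rewrite addnC iterD i1 i2 addnA.
- move=> /andP[w1 w2] /andP[r1 r2] /code_at_loop[F1 C F2] H.
  set F := fun q : _ * nat => _.
  (* Induction on the value of the loop register with the state generalised; the last test, which
     finds zero, is the extra step [m.+1]. *)
  suff: forall n s t l, s r = n -> models s l -> exists m l',
      [/\ (iter n F (s, t)).2 = t + m, iter m step (a, inp, l) = (a, inp, l'),
      (iter n F (s, t)).1 r = 0 & models (iter n F (s, t)).1 l'].
    move=> /(_ (s r) s t l erefl H) [m [l' [-> i z h]]]; exists m.+1, (rdec k r l'); rewrite addnS; split=> //.
      by rewrite iterS i /= F1 h // z.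
    move=> x xk; case: (x =P r) => [->|/eqP ne]; first by rewrite rval_dec // h // z.
    by rewrite rval_dec_neq // h.
  move=> n {t l H} {}s; elim: n s => [|n IHn] s t l e H.
    by exists 0, l; rewrite /= addn0 e.
  rewrite iterSr.
  have H1 := models_dec r1 H.
  have [m1 [l1 [e1 i1 h1]]] := IH a.+1 _ t.+1 _ w2 r2 C H1.
  have e2 : (F (s, t)).1 r = n.
    by rewrite /F /= run_unwritten //= /upd eqxx e.
  case E: (F (s, t)) e2 => [s2 t2] /= e2.
  have [|m2 [l2 [e3 i3 z3 h3]]] := IHn s2 t2 l1 e2.
    by move: E h1; rewrite /F /= => -[<- _].
  exists (m1.+2 + m2), l2; split=> //.
    rewrite e3; move: E; rewrite /F /= => -[_ <-]; rewrite e1; lia.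
  rewrite addnC iterD; have -> : iter m1.+2 step (a, inp, l) = (a, inp, l1).
    rewrite iterS iterSr; have -> : step (a, inp, l) = (a.+1, inp, rdec k r l).
      by rewrite /cstep F1 H // e.
    by rewrite i1 /cstep F2.
  by rewrite i3.
Qed.
End Compile.
End LoopCompiler.

(** * Arithmetic on registers, with running times *)

Module RegisterRoutines.
Import Defs TapeRegisters LoopCompiler.
Import all_boot zify.

(** Invariant rule for loops. A round pays for its body, one decrement and one jump, hence [C.+2];
    the failing test at the end gives the last 1. *)
Lemma loop_run r c (I : nat -> (nat -> nat) -> Prop) C n s t :
  ~~ writes c r -> s r = n -> I 0 s ->
  (forall i s' t', i < n -> I i s' -> s' r = n - i ->
     I i.+1 (run c (upd s' r (s' r).-1, t')).1 /\ (run c (upd s' r (s' r).-1, t')).2 <= t' + C) ->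
  [/\ I n (run (Loop r c) (s, t)).1, (run (Loop r c) (s, t)).1 r = 0
    & (run (Loop r c) (s, t)).2 <= t + n * C.+2 + 1].
Proof.
move=> w sr I0 IS; rewrite /= sr.
set F := fun q : _ * nat => _.
suff: forall i, i <= n -> [/\ I i (iter i F (s, t)).1, (iter i F (s, t)).1 r = n - i
    & (iter i F (s, t)).2 <= t + i * C.+2].
  by move=> /(_ n (leqnn n)) [h1 h2 h3]; split; rewrite ?h2 ?subnn // addn1 ltnS.
elim=> [|i IH] il; first by rewrite subn0 addn0.
have [h1 h2 h3] := IH (ltnW il).
have [g1 g2] := IS i _ (iter i F (s, t)).2.+1 il h1 h2.
rewrite iterS {1 3 5}/F /=; split; [exact: g1| |].
  by rewrite run_unwritten //= /upd eqxx h2; lia.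
by move: g2 h3; rewrite mulSn; lia.
Qed.

Definition addto r x := Loop r (Inc x).
Definition subto r x := Loop r (Dec x).
Definition clr r := Loop r Skip.
(** Adds [r] to [x] without losing [r]: while [r] is emptied the scratch register [y] is filled as
    well, and [r] is restored from it. *)
Definition copy r x y := Seq (Loop r (Seq (Inc x) (Inc y))) (addto y r).

Ltac upds := rewrite /upd; repeat (case: eqP => ?); subst; try lia.

Lemma addtoP r x s t : r != x ->
  (forall z, (run (addto r x) (s, t)).1 z = if z == r then 0 else if z == x then s x + s r else s z)
  /\ (run (addto r x) (s, t)).2 <= t + 3 * s r + 1.
Proof.
move=> ne; have ne' : r <> x by apply/eqP.
have [||||h1 _ h2] := @loop_run r (Inc x) (fun i s' => forall z, s' z =
    if z == r then s r - i else if z == x then s x + i else s z) 1 (s r) s t.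
- by rewrite /= eq_sym.
- by [].
- by move=> z; upds.
- move=> i s' t' il H H' /=; split; last by lia.
  by move=> z; rewrite /= /upd !H; upds.
split; last by apply: leq_trans h2 _; lia.
by move=> z; rewrite h1; upds.
Qed.

Lemma subtoP r x s t : r != x ->
  (forall z, (run (subto r x) (s, t)).1 z = if z == r then 0 else if z == x then s x - s r else s z)
  /\ (run (subto r x) (s, t)).2 <= t + 3 * s r + 1.
Proof.
move=> ne; have ne' : r <> x by apply/eqP.
have [||||h1 _ h2] := @loop_run r (Dec x) (fun i s' => forall z, s' z =
    if z == r then s r - i else if z == x then s x - i else s z) 1 (s r) s t.
- by rewrite /= eq_sym.
- by [].
- by move=> z; upds.
- move=> i s' t' il H H' /=; split; last by lia.
  by move=> z; rewrite /= /upd !H; upds.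
split; last by apply: leq_trans h2 _; lia.
by move=> z; rewrite h1; upds.
Qed.

Lemma clrP r s t :
  (forall z, (run (clr r) (s, t)).1 z = if z == r then 0 else s z)
  /\ (run (clr r) (s, t)).2 <= t + 2 * s r + 1.
Proof.
have [||||h1 _ h2] := @loop_run r Skip (fun i s' => forall z, s' z =
    if z == r then s r - i else s z) 0 (s r) s t => //.
- by move=> z; upds.
- move=> i s' t' il H H' /=; split; last by lia.
  by move=> z; rewrite /= /upd !H; upds.
split; last by apply: leq_trans h2 _; lia.
by move=> z; rewrite h1; upds.
Qed.

Lemma copyP r x y s t : r != x -> r != y -> x != y -> s y = 0 ->
  (forall z, (run (copy r x y) (s, t)).1 z = if z == x then s x + s r else s z)
  /\ (run (copy r x y) (s, t)).2 <= t + 7 * s r + 2.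
Proof.
move=> rx ry xy sy; have [h1 h2 h3] : [/\ r <> x, r <> y & x <> y] by split; apply/eqP.
have -> : run (copy r x y) (s, t) = run (addto y r) (run (Loop r (Seq (Inc x) (Inc y))) (s, t)) by [].
have [||||g1 _ g2] := @loop_run r (Seq (Inc x) (Inc y)) (fun i s' => forall z, s' z =
    if z == r then s r - i else if z == x then s x + i else if z == y then i else s z) 2 (s r) s t.
- by rewrite /= negb_or ![_ == r]eq_sym rx.
- by [].
- by move=> z; upds.
- move=> i s' t' il H H' /=; split; last by lia.
  by move=> z; rewrite /= /upd !H; upds.
move: g1 g2; case: (run (Loop r _) (s, t)) => s1 t1 g1 g2.
cbn [fst snd] in g1, g2.
have [|k1 k2] := @addtoP y r s1 t1; first by rewrite eq_sym.
split=> [z|]; first by rewrite k1 !g1; upds.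
by move: k2; rewrite !g1; upds.
Qed.
End RegisterRoutines.

(** * Bounded arithmetic expressions and their compilation *)

Module Expressions.
Import Defs TapeRegisters LoopCompiler RegisterRoutines.
Import all_boot zify.

#[local] Arguments run : simpl never.

(** Truncates [x] at [b] by the identity [min(b, x) = x - (x - b)] for truncated subtraction, in
    scratch registers from [y] on. *)
Definition clamp b x y :=
  Seq (copy b y y.+1) (Seq (copy x y.+1 y.+2) (Seq (subto y y.+1) (subto y.+1 x))).

Lemma runS c1 c2 p : run (Seq c1 c2) p = run c2 (run c1 p).
Proof. by []. Qed.

Tactic Notation "runto" constr(H) "as" ident(s1) ident(t1) ident(h1) ident(h2) :=
  move: H => [];
  match goal with |- (forall z, (run ?c ?p).1 z = _) -> _ =>
    case: (run c p) => s1 t1 h1 h2; cbn [fst snd] in h1, h2 end.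

Lemma clampP b x y s t : b < y -> x < y -> b != x -> s y = 0 -> s y.+1 = 0 -> s y.+2 = 0 ->
  (forall z, (run (clamp b x y) (s, t)).1 z = if z == x then minn (s b) (s x) else s z)
  /\ (run (clamp b x y) (s, t)).2 <= t + 10 * (s b + s x) + 6.
Proof.
move=> hb hx /eqP bx y0 y1 y2; rewrite /clamp (runS (copy b _ _)) (runS (copy x _ _)) (runS (subto y _)).
have [||||g1 g2] := @copyP b y y.+1 s t => //; try by apply/eqP; lia.
runto (conj g1 g2) as s1 t1 h1 h2.
have [||||g3 g4] := @copyP x y.+1 y.+2 s1 t1; try by apply/eqP; lia.
  by rewrite h1; upds.
runto (conj g3 g4) as s2 t2 h3 h4.
have [|g5 g6] := @subtoP y y.+1 s2 t2; first by apply/eqP; lia.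
runto (conj g5 g6) as s3 t3 h5 h6.
have [|g7 g8] := @subtoP y.+1 x s3 t3; first by apply/eqP; lia.
split=> [z|]; [rewrite g7 !h5 !h3 !h1|apply: leq_trans g8 _; move: h2 h4 h6; rewrite !h5 !h3 !h1].
  by clear -hb hx bx y0 y1 y2; upds.
by clear -hb hx bx y0 y1 y2; upds.
Qed.

Inductive ex :=
| EVar of nat
| ECst of nat
| EAdd of ex & ex
| ESub of ex & ex
| EMul of ex & ex
| EIter of ex & ex & ex & ex.

(* [EIter b n i f] iterates [f] [n] times from [i], truncating every value at [b], so that values stay polynomially bounded; [f] sees the index and the accumulator as its variables 0 and 1. *)
Fixpoint eval (e : ex) (rho : seq nat) : nat :=
  match e with
  | EVar i => nth 0 rho i
  | ECst n => n
  | EAdd a b => eval a rho + eval b rho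
  | ESub a b => eval a rho - eval b rho
  | EMul a b => eval a rho * eval b rho
  | EIter b n i f =>
    iteri (eval n rho) (fun j acc => minn (eval b rho) (eval f [:: j, acc & rho]))
      (minn (eval b rho) (eval i rho))
  end.

(** [loc] lists the registers of the variables, all below [d]. The value is left in [d] and every
    later register returns to zero, so subterms can reuse them. In an iteration [d] holds the bound,
    [d.+1] the rounds left, [d.+2] the accumulator and [d.+3] the index. *)
Fixpoint cmp (e : ex) (loc : seq nat) (d : nat) : cmd :=
  match e with
  | EVar i => if i < size loc then copy (nth 0 loc i) d d.+1 else Skip
  | ECst n => iter n (Seq (Inc d)) Skip
  | EAdd a b => Seq (cmp a loc d) (Seq (cmp b loc d.+1) (addto d.+1 d))
  | ESub a b => Seq (cmp a loc d) (Seq (cmp b loc d.+1) (subto d.+1 d))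
  | EMul a b => Seq (cmp a loc d) (Seq (cmp b loc d.+1)
      (Seq (Loop d (copy d.+1 d.+2 d.+3)) (Seq (clr d.+1) (addto d.+2 d))))
  | EIter b n i f =>
    Seq (cmp b loc d) (Seq (cmp n loc d.+1) (Seq (cmp i loc d.+2) (Seq (clamp d d.+2 d.+3)
    (Seq (Loop d.+1
      (Seq (cmp f [:: d.+3, d.+2 & loc] d.+4)
      (Seq (clr d.+2) (Seq (addto d.+4 d.+2) (Seq (clamp d d.+2 d.+4) (Inc d.+3))))))
    (Seq (clr d) (Seq (clr d.+3) (addto d.+2 d)))))))
  end.

Definition placed loc (rho : seq nat) d (s : nat -> nat) :=
  [/\ size rho = size loc, (forall i, i < size loc -> nth 0 loc i < d),
      (forall i, i < size loc -> s (nth 0 loc i) = nth 0 rho i) & forall r, d <= r -> s r = 0].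

Lemma cmp_writes e loc d x : (forall i, i < size loc -> nth 0 loc i < d) ->
  x < d -> (forall i, i < size loc -> nth 0 loc i != x) -> ~~ writes (cmp e loc d) x.
Proof.
elim: e loc d => [i|n|a IHa b IHb|a IHa b IHb|a IHa b IHb|b IHb n IHn i IHi f IHf] loc d hl xd hx /=.
- by case: ifP => // il; rewrite /= !negb_or hx // !andbT !neq_ltn; lia.
- by elim: n => //= n IH; rewrite negb_or IH andbT neq_ltn xd orbT.
- rewrite !negb_or IHa ?IHb //; try (by move=> i il; have := hl _ il; lia); lia.
- rewrite !negb_or IHa ?IHb //; try (by move=> i il; have := hl _ il; lia); lia.
- rewrite !negb_or IHa ?IHb //; try (by move=> i il; have := hl _ il; lia); lia.
rewrite !negb_or IHb ?IHn ?IHi ?IHf //; try (by move=> j jl; have := hl _ jl; lia); try lia.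
  by case=> [|[|j]] //= jl; apply: leq_trans (hl j _) _ => //; lia.
by case=> [|[|j]] //= jl; try (apply/eqP; lia); exact: hx.
Qed.

Lemma cmp_wf e loc d : (forall i, i < size loc -> nth 0 loc i < d) -> wfc (cmp e loc d).
Proof.
elim: e loc d => [i|n|a IHa b IHb|a IHa b IHb|a IHa b IHb|b IHb n IHn i IHi f IHf] loc d hl /=.
- by case: ifP => // il; have := hl _ il; rewrite /= !negb_or !andbT !neq_ltn; lia.
- by elim: n => //= n IH.
- rewrite IHa ?IHb //=; try (by move=> i il; have := hl _ il; lia); lia.
- rewrite IHa ?IHb //=; try (by move=> i il; have := hl _ il; lia); lia.
- rewrite IHa ?IHb //=; try (by move=> i il; have := hl _ il; lia); lia.
have hl' : forall j, j < size [:: d.+3, d.+2 & loc] -> nth 0 [:: d.+3, d.+2 & loc] j < d.+4.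
  by case=> [|[|j]] //= jl; apply: leq_trans (hl j _) _ => //; lia.
rewrite IHb ?IHn ?IHi ?IHf //=; try (by move=> j jl; have := hl _ jl; lia).
rewrite !negb_or cmp_writes //=; try lia.
by case=> [|[|j]] /= jl; [lia | lia | have := hl j jl; lia].
Qed.

Lemma regs_lt_le k k' c : k <= k' -> regs_lt k c -> regs_lt k' c.
Proof.
move=> kk; elim: c => //= [r|r|c1 IH1 c2 IH2|r c IH].
- by move=> h; exact: leq_trans kk.
- by move=> h; exact: leq_trans kk.
- by case/andP=> /IH1-> /IH2.
by case/andP=> h /IH ->; rewrite (leq_trans h).
Qed.

Fixpoint regs_bound (c : cmd) : nat :=
  match c with
  | Skip => 0
  | Inc r | Dec r => r.+1
  | Seq c1 c2 => maxn (regs_bound c1) (regs_bound c2)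
  | Loop r c' => maxn r.+1 (regs_bound c')
  end.

Lemma regs_boundP c : regs_lt (regs_bound c) c.
Proof.
elim: c => //= [c1 IH1 c2 IH2|r c IH].
  by rewrite (regs_lt_le _ IH1) ?leq_maxl // (regs_lt_le _ IH2) ?leq_maxr.
by rewrite leq_maxl (regs_lt_le _ IH) // leq_maxr.
Qed.

Lemma placedS loc rho d s v : placed loc rho d s ->
  forall s', (forall z, s' z = if z == d then v else s z) -> placed loc rho d.+1 s'.
Proof.
move=> [h1 h2 h3 h4] s' H; split=> // [i il|i il|r rd].
- by rewrite ltnW // ltnS h2.
- by rewrite H; have := h2 i il; case: eqP => [->|]; rewrite ?ltnn // => _ _; exact: h3.
- by rewrite H; case: eqP => [e|_]; [lia | apply: h4; lia].
Qed.

(** The exponent depends on the expression alone. The bound on the value is part of the claim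
    because it controls the running time of enclosing expressions. *)
Definition ex_spec e c := forall rho M, 2 <= M -> (forall i, nth 0 rho i <= M) ->
  eval e rho <= M ^ c /\
  forall loc d s t, placed loc rho d s ->
    (forall z, (run (cmp e loc d) (s, t)).1 z = if z == d then eval e rho else s z) /\
    (run (cmp e loc d) (s, t)).2 <= t + M ^ c.

Lemma leq_pow M a b : 2 <= M -> a <= b -> M ^ a <= M ^ b.
Proof. by move=> M2; apply: leq_pexp2l; lia. Qed.

Lemma pow_ge1 M c : 2 <= M -> 0 < M ^ c.
Proof. by move=> M2; rewrite expn_gt0; lia. Qed.

(** A factor [2 ^ k] is absorbed by [k] more in the exponent; all constants in the cost estimates
    disappear this way. *)
Lemma const_pow M c k v : 2 <= M -> v <= 2 ^ k * M ^ c -> v <= M ^ (k + c).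
Proof.
move=> M2 h; apply: leq_trans h _; rewrite expnD leq_mul2r; apply/orP; right.
by case: k => [|k] //; rewrite leq_exp2r.
Qed.

Lemma var_spec i : ex_spec (EVar i) 5.
Proof.
move=> rho M M2 H; split; first by rewrite /=; apply: leq_trans (H i) _; rewrite -{1}[M]expn1 leq_pow.
move=> loc d s t [h1 h2 h3 h4]; rewrite [cmp _ _ _]/=; case: ltnP => il; last first.
  rewrite /run /=; split=> [z|]; last exact: leq_addr.
  by case: eqP => // ->; rewrite nth_default ?h1 // h4.
have [||||g1 g2] := @copyP (nth 0 loc i) d d.+1 s t; try (by apply/eqP; have := h2 i il; lia).
  by rewrite h4.
split=> [z|]; first by rewrite g1 h4 // add0n h3.
apply: leq_trans g2 _; rewrite -addnA leq_add2l h3 //.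
apply: (@const_pow M 1 4) => //; rewrite expn1; have := H i; lia.
Qed.

Lemma cst_spec n : ex_spec (ECst n) n.
Proof.
move=> rho M M2 H; have Mn : n <= M ^ n by apply: ltnW; exact: ltn_expl.
split=> // loc d s t [h1 h2 h3 h4]; rewrite [cmp _ _ _]/=.
have [g1 g2] : (forall z, (run (iter n (Seq (Inc d)) Skip) (s, t)).1 z = if z == d then s d + n else s z)
   /\ (run (iter n (Seq (Inc d)) Skip) (s, t)).2 <= t + n.
  clear; elim: n s t => [|n IH] s t; first by rewrite /run /=; split=> [z|]; upds.
  rewrite iterS runS; have [g1 g2] := IH (upd s d (s d).+1) t.+1.
  by split=> [z|]; [rewrite g1; upds|apply: leq_trans g2 _; lia].
split=> [z|]; first by rewrite g1 h4.
by apply: leq_trans g2 _; rewrite leq_add2l.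
Qed.

Lemma binary_spec a b ca cb loc rho M d s t c :
  ex_spec a ca -> ex_spec b cb -> 2 <= M -> (forall i, nth 0 rho i <= M) -> placed loc rho d s ->
  exists s' t', [/\ run (Seq (cmp a loc d) (Seq (cmp b loc d.+1) c)) (s, t) = run c (s', t'),
    forall z, s' z = if z == d then eval a rho else if z == d.+1 then eval b rho else s z
    & t' <= t + M ^ ca + M ^ cb].
Proof.
move=> Ha Hb M2 H P; rewrite (runS (cmp a _ _)) (runS (cmp b _ _)).
have [_ /(_ loc d s t P) Ra] := Ha rho M M2 H.
runto Ra as s1 t1 h1 h2.
have [_ /(_ loc d.+1 s1 t1 (placedS P h1)) Rb] := Hb rho M M2 H.
runto Rb as s2 t2 h3 h4.
exists s2, t2; split=> // [z|]; last by apply: leq_trans h4 _; lia.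
by rewrite h3 h1; upds.
Qed.

Lemma add_spec a b ca cb : ex_spec a ca -> ex_spec b cb -> ex_spec (EAdd a b) (3 + (ca + cb)).
Proof.
move=> Ha Hb rho M M2 H; have [va _] := Ha rho M M2 H; have [vb _] := Hb rho M M2 H.
have pa := pow_ge1 ca M2; have pb := pow_ge1 cb M2.
split.
  apply: const_pow => //=; rewrite expnD; nia.
move=> loc d s t P; rewrite [cmp _ _ _]/=; have [s' [t' [-> h1 h2]]] := binary_spec t (addto d.+1 d) Ha Hb M2 H P.
have [|g1 g2] := @addtoP d.+1 d s' t'; first by apply/eqP; lia.
split=> [z|].
  by case: P => _ _ _ h4; have := h4 d.+1; rewrite g1 !h1; upds.
apply: leq_trans g2 _; rewrite h1 -!addnA; apply: leq_trans (leq_add h2 (leqnn _)) _.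
rewrite -!addnA leq_add2l; apply: const_pow => //=; rewrite expnD.
by rewrite ifN ?eqxx; [nia | apply/eqP; lia].
Qed.

Lemma sub_spec a b ca cb : ex_spec a ca -> ex_spec b cb -> ex_spec (ESub a b) (3 + (ca + cb)).
Proof.
move=> Ha Hb rho M M2 H; have [va _] := Ha rho M M2 H; have [vb _] := Hb rho M M2 H.
have pa := pow_ge1 ca M2; have pb := pow_ge1 cb M2.
split.
  apply: const_pow => //=; rewrite expnD; nia.
move=> loc d s t P; rewrite [cmp _ _ _]/=; have [s' [t' [-> h1 h2]]] := binary_spec t (subto d.+1 d) Ha Hb M2 H P.
have [|g1 g2] := @subtoP d.+1 d s' t'; first by apply/eqP; lia.
split=> [z|].
  by case: P => _ _ _ h4; have := h4 d.+1; rewrite g1 !h1; upds.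
apply: leq_trans g2 _; rewrite h1 -!addnA; apply: leq_trans (leq_add h2 (leqnn _)) _.
rewrite -!addnA leq_add2l; apply: const_pow => //=; rewrite expnD.
by rewrite ifN ?eqxx; [nia | apply/eqP; lia].
Qed.

Lemma mul_spec a b ca cb : ex_spec a ca -> ex_spec b cb -> ex_spec (EMul a b) (5 + (ca + cb)).
Proof.
move=> Ha Hb rho M M2 H; have [va _] := Ha rho M M2 H; have [vb _] := Hb rho M M2 H.
have pa := pow_ge1 ca M2; have pb := pow_ge1 cb M2.
split.
  apply: const_pow => //=; rewrite expnD; nia.
move=> loc d s t P; rewrite [cmp _ _ _]/=.
have [s1 [t1 [-> h1 h2]]] := binary_spec t (Seq (Loop d (copy d.+1 d.+2 d.+3)) (Seq (clr d.+1) (addto d.+2 d))) Ha Hb M2 H P.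
case: P => _ _ _ h4; move: va vb; set u := eval a rho in h1 *; set v := eval b rho in h1 * => va vb.
rewrite (runS (Loop _ _)) (runS (clr _)).
have [||||g1 _ g2] := @loop_run d (copy d.+1 d.+2 d.+3) (fun i s' => forall z, s' z =
    if z == d then u - i else if z == d.+2 then i * v else s1 z) (7 * v + 2) u s1 t1.
- by rewrite /=; lia.
- by rewrite h1 eqxx.
- by move=> z; rewrite mul0n subn0 !h1; have := h4 d.+2; upds.
- move=> i s' t' il H1 H2.
  have [||||g1 g2] := @copyP d.+1 d.+2 d.+3 (upd s' d (s' d).-1) t'; try by apply/eqP; lia.
    by rewrite /upd !H1 !h1; have := h4 d.+3; upds.
  split=> [z|]; first by rewrite g1 /upd !H1 !h1; upds.
  by apply: leq_trans g2 _; rewrite /upd !H1 !h1; upds.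
runto (conj g1 g2) as s2 t2 h5 h6.
have [k1 k2] := @clrP d.+1 s2 t2.
runto (conj k1 k2) as s3 t3 h7 h8.
have [|k3 k4] := @addtoP d.+2 d s3 t3; first by apply/eqP; lia.
split=> [z|].
  have e1 : s d.+1 = 0 by apply: h4.
  have e2 : s d.+2 = 0 by apply: h4; lia.
  by have -> : eval (EMul a b) rho = u * v by []; rewrite k3 !h7 !h5 !h1; clear -e1 e2; upds.
apply: leq_trans k4 _; move: h8; rewrite !h7 !h5 !h1 => h8.
suff: t3 + 3 * (u * v) + 1 <= t + M ^ (5 + (ca + cb)) by upds.
have: t3 <= t2 + 2 * v + 1 by move: h8; upds.
have: M ^ ca + M ^ cb + u * (7 * v + 2).+2 + 1 + 2 * v + 1 + 3 * (u * v) + 1 <= M ^ (5 + (ca + cb)).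
  apply: const_pow => //; rewrite expnD; have : u * v <= M ^ ca * M ^ cb by exact: leq_mul.
  nia.
by move: h2 h6; lia.
Qed.
End Expressions.

(** * The cost of bounded iteration *)

Module ExpressionCode.
Import Defs TapeRegisters LoopCompiler RegisterRoutines Expressions.
Import all_boot zify.
#[local] Arguments run : simpl never.

(** Truncation keeps index and accumulator below [V], a fixed power of [M], in every round, so each
    evaluation of [f] costs at most [V ^ cf]. Without it the exponents would multiply from round to
    round. *)
Lemma iter_spec b n i f cb cn ci cf :
  ex_spec b cb -> ex_spec n cn -> ex_spec i ci -> ex_spec f cf ->
  ex_spec (EIter b n i f) (7 + 2 * (cb + cn + ci).+1 + (cb + cn + ci).+1 * cf).
Proof.
move=> Hb Hn Hi Hf rho M M2 H.
have [vb rb] := Hb rho M M2 H; have [vn rn] := Hn rho M M2 H; have [vi ri] := Hi rho M M2 H.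
set c0 := (cb + cn + ci).+1; set V := M ^ c0; set W := V ^ cf.
have ev : eval (EIter b n i f) rho = iteri (eval n rho) (fun j acc => minn (eval b rho) (eval f [:: j, acc & rho])) (minn (eval b rho) (eval i rho)) by [].
move: vb rb vn rn vi ri ev.
set B := eval b rho; set N := eval n rho; set x0 := eval i rho.
move: (eval _ rho) => res vb rb vn rn vi ri ->.
have MV : M <= V by rewrite -{1}[M]expn1 leq_pow.
have bV : M ^ cb <= V by rewrite leq_pow // /c0; lia.
have nV : M ^ cn <= V by rewrite leq_pow // /c0; lia.
have iV : M ^ ci <= V by rewrite leq_pow // /c0; lia.
have V2 : 2 <= V by exact: leq_trans MV.
have W1 : 0 < W by exact: pow_ge1.
pose acc j := iteri j (fun j a => minn B (eval f [:: j, a & rho])) (minn B x0).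
have accB j : acc j <= B by case: j => [|j] /=; exact: geq_minl.
have body j : j < N -> eval f [:: j, acc j & rho] <= W /\
  forall loc d s t, placed loc [:: j, acc j & rho] d s ->
    (forall z, (run (cmp f loc d) (s, t)).1 z = if z == d then eval f [:: j, acc j & rho] else s z) /\
    (run (cmp f loc d) (s, t)).2 <= t + W.
  move=> jN; apply: Hf => //; case=> [|[|k]] /=; try by have := accB j; lia.
  exact: leq_trans MV.
have total : V * (14 * W + 12 * V + 11) + 1 + 32 * V + 16 <= M ^ (7 + 2 * c0 + c0 * cf).
  rewrite -(addnA 7); apply: const_pow => //.
  have -> : M ^ (2 * c0 + c0 * cf) = V * V * W by rewrite expnD [2 * c0]mulnC !expnM expnS expn1.
  have h1 : V <= V * V * W by rewrite -mulnA leq_pmulr // muln_gt0; lia.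
  have h2 : V * W <= V * V * W by rewrite leq_mul2r leq_pmulr ?orbT //; lia.
  have h3 : V * V <= V * V * W by rewrite leq_pmulr.
  have -> : V * (14 * W + 12 * V + 11) = 14 * (V * W) + 12 * (V * V) + 11 * V by clear; lia.
  by lia.
split; first by apply: leq_trans (accB N) _; apply: leq_trans vb _; rewrite leq_pow //; lia.
move=> loc d s t P; rewrite [cmp _ _ _]/=.
rewrite (runS (cmp b _ _)) (runS (cmp n _ _)) (runS (cmp i _ _)) (runS (clamp _ _ _)) (runS (Loop _ _)) (runS (clr d)) (runS (clr d.+3)).
have Rb := rb loc d s t P; runto Rb as s1 t1 h1 h2.
have P1 := placedS P h1.
have Rn := rn loc d.+1 s1 t1 P1; runto Rn as s2 t2 h3 h4.
have P2 := placedS P1 h3.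
have Ri := ri loc d.+2 s2 t2 P2; runto Ri as s3 t3 h5 h6.
have P3 := placedS P2 h5.
have [l1 l2 l3 l4] := P.
have z0 : s d = 0 by apply: l4.
have z1 : s d.+1 = 0 by apply: l4; lia.
have z2 : s d.+2 = 0 by apply: l4; lia.
have z3 : s d.+3 = 0 by apply: l4; lia.
have z4 : s d.+4 = 0 by apply: l4; lia.
have s3E z : s3 z = if z == d then B else if z == d.+1 then N else if z == d.+2 then x0 else s z.
  by rewrite h5 h3 h1; upds.
have s3z z : d.+3 <= z -> s3 z = 0 by case: P3 => _ _ _; exact.
have [||||||g1 g2] := @clampP d d.+2 d.+3 s3 t3; try lia; try (by apply: s3z; lia).
runto (conj g1 g2) as s4 t4 h7 h8.
have s4E z : s4 z = if z == d then B else if z == d.+1 then N else if z == d.+2 then acc 0 else s z.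
  by rewrite h7 !s3E /acc /=; upds.
set c := Seq (cmp f _ _) _.
have [||||g3 _ g4] := @loop_run d.+1 c (fun j s' => forall z, s' z =
   if z == d then B else if z == d.+1 then N - j else if z == d.+2 then acc j else
   if z == d.+3 then j else s z) (14 * W + 12 * V + 9) N s4 t4.
- rewrite /c /= !negb_or cmp_writes //=; try lia.
    by case=> [|[|k]] /= kl; [lia | lia | have := l2 k kl; lia].
  by case=> [|[|k]] /= kl; [lia | lia | have := l2 k kl; lia].
- by rewrite s4E; upds.
- by move=> z; rewrite s4E; clear -z3; upds.
- move=> j s' t' jN Hs Hd; set s0 := upd _ _ _.
  have s0E z : s0 z = if z == d then B else if z == d.+1 then N - j.+1 else if z == d.+2 then acc j else
   if z == d.+3 then j else s z by rewrite /s0 /upd Hd Hs; upds.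
  have Pf : placed [:: d.+3, d.+2 & loc] [:: j, acc j & rho] d.+4 s0.
    split=> /=; first by rewrite l1.
    - by case=> [|[|k]] /= kl; [lia | lia | have := l2 k kl; lia].
    - case=> [|[|k]] /= kl; rewrite s0E; [by upds | by upds |].
      by have := l2 k kl; rewrite -l3 // => ?; upds.
    by move=> r rd; rewrite s0E; have : s r = 0 by [apply: l4; lia]; upds.
  rewrite /c (runS (cmp f _ _)) (runS (clr _)) (runS (addto _ _)) (runS (clamp _ _ _)).
  have [vf rf] := body j jN.
  have Rf := rf _ _ s0 t' Pf; runto Rf as u1 w1 k1 k2.
  have Rc := @clrP d.+2 u1 w1; runto Rc as u2 w2 k3 k4.
  have [|a1 a2] := @addtoP d.+4 d.+2 u2 w2; first by apply/eqP; lia.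
  runto (conj a1 a2) as u3 w3 k5 k6.
  have u3E z : u3 z = if z == d then B else if z == d.+1 then N - j.+1 else if z == d.+2 then eval f [:: j, acc j & rho] else
   if z == d.+3 then j else s z.
    by rewrite k5 !k3 !k1 !s0E; clear -z4; upds.
  have [||||||a3 a4] := @clampP d d.+2 d.+4 u3 w3; try lia; try (by rewrite u3E; clear -z4; upds).
  + by rewrite u3E; have : s d.+4.+1 = 0 by [apply: l4; lia]; upds.
  + by rewrite u3E; have : s d.+4.+2 = 0 by [apply: l4; lia]; upds.
  runto (conj a3 a4) as u4 w4 k7 k8.
  rewrite /run /=; split=> [z|].
    by rewrite /upd !k7 !u3E -/(acc j); clear; upds.
  have q1 : u1 d.+2 = acc j by rewrite k1 s0E; clear; upds.
  have q2 : u2 d.+4 = eval f [:: j, acc j & rho] by rewrite k3 k1; clear; upds.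
  have q3 : u3 d = B by rewrite u3E; clear; upds.
  have q4 : u3 d.+2 = eval f [:: j, acc j & rho] by rewrite u3E; clear; upds.
  rewrite q1 in k4; rewrite q2 in k6; rewrite q3 q4 in k8.
  by have := accB j; clear -vf k2 k4 k6 k8 vb bV; lia.
runto (conj g3 g4) as s5 t5 h9 h10.
have Rc := @clrP d s5 t5; runto Rc as s6 t6 h11 h12.
have Rc := @clrP d.+3 s6 t6; runto Rc as s7 t7 h13 h14.
have [|k1 k2] := @addtoP d.+2 d s7 t7; first by apply/eqP; lia.
have e1 : s5 d = B by rewrite h9; clear; upds.
have e2 : s6 d.+3 = N by rewrite h11 h9; clear; upds.
have e3 : s7 d.+2 = acc N by rewrite h13 h11 h9; clear; upds.
split=> [z|].
  by rewrite k1 e3 !h13 !h11 !h9 -/(acc N); clear -z0 z1 z2 z3; upds.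
apply: leq_trans k2 _; rewrite e1 in h12; rewrite e2 in h14; rewrite e3.
have e4 : s3 d = B by rewrite s3E; clear; upds.
have e5 : s3 d.+2 = x0 by rewrite s3E; clear; upds.
rewrite e4 e5 in h8.
have q : N * (14 * W + 12 * V + 9).+2 <= V * (14 * W + 12 * V + 11).
  by apply: leq_mul; [exact: leq_trans nV | lia].
have := accB N; clear -h2 h4 h6 h8 h10 h12 h14 vb vn vi bV nV iV q total; lia.
Qed.

Lemma ex_ok e : exists c, ex_spec e c.
Proof.
elim: e => [i|n|a [ca Ha] b [cb Hb]|a [ca Ha] b [cb Hb]|a [ca Ha] b [cb Hb]|b [cb Hb] n [cn Hn] i [ci Hi] f [cf Hf]].
- by exists 5; exact: var_spec.
- by exists n; exact: cst_spec.
- by eexists; apply: add_spec Ha Hb.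
- by eexists; apply: sub_spec Ha Hb.
- by eexists; apply: mul_spec Ha Hb.
- by eexists; apply: iter_spec Hb Hn Hi Hf.
Qed.
End ExpressionCode.

(** * The Turing machine that evaluates an expression at the input word *)

Module TopMachine.
Import Defs TapeRegisters LoopCompiler RegisterRoutines Expressions ExpressionCode.
Import all_boot zify.
#[local] Arguments run : simpl never.

Definition num (x : seq bool) : nat := foldl (fun v (b : bool) => 2 * v + b) 0 x.

Fixpoint powx (a : nat) : ex :=
  if a is a'.+1 then EMul (EAdd (EVar 1) (ECst 2)) (powx a') else ECst 1.

Lemma eval_powx a rho : eval (powx a) rho = (nth 0 rho 1 + 2) ^ a.
Proof. by elim: a => //= a ->; rewrite expnS. Qed.

Definition dbl r y := Seq (Loop r (Seq (Inc y) (Inc y))) (addto y r).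

Lemma dblP r y s t : r != y -> s y = 0 ->
  (forall z, (run (dbl r y) (s, t)).1 z = if z == r then 2 * s r else s z) /\
  (run (dbl r y) (s, t)).2 <= t + 10 * s r + 2.
Proof.
move=> /eqP ne y0; rewrite (runS (Loop _ _)).
have [||||g1 _ g2] := @loop_run r (Seq (Inc y) (Inc y)) (fun i s' => forall z, s' z =
    if z == r then s r - i else if z == y then 2 * i else s z) 2 (s r) s t.
- by rewrite /=; lia.
- by [].
- by move=> z; upds.
- move=> i s' t' il H H'; rewrite /run /=; split; last by lia.
  by move=> z; rewrite /= /upd !H; upds.
runto (conj g1 g2) as s1 t1 h1 h2.
have [|g3 g4] := @addtoP y r s1 t1; first by apply/eqP; lia.
split=> [z|]; first by rewrite g3 !h1; upds.
by apply: leq_trans g4 _; move: h2; rewrite !h1; upds.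
Qed.

Section Top.
Variables (e : ex) (a : nat).

(** Registers 0 and 1 hold the number and the length of the word read so far, the most significant
    bit coming first. *)
Definition read_bit (b : bool) : cmd :=
  Seq (dbl 0 3) (if b then Seq (Inc 0) (Inc 1) else Inc 1).
(** Register 3 receives the exponent [(length + 2) ^ a], and register 2, initially 1, is doubled
    that many times to give [N]. The expression is then evaluated at number, length and [N]. *)
Definition decide : cmd :=
  Seq (cmp (powx a) [:: 0; 1] 3) (Seq (Inc 2) (Seq (Loop 3 (dbl 2 4)) (cmp e [:: 0; 1; 2] 3))).

Definition top_prog : seq instr :=
  let l0 := 1 in let l1 := l0 + (code_len (read_bit false)).+1 in
  let le := l1 + (code_len (read_bit true)).+1 in
  let lh := le + code_len decide in
  [:: IPop l0 l1 le] ++ (rcons (code (read_bit false) l0) (IGoto 0)) ++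
  (rcons (code (read_bit true) l1) (IGoto 0)) ++ code decide le ++
  [:: IDec 3 lh.+1 lh.+2; IHalt true; IHalt false].

Definition top_regs := (maxn (regs_bound decide) 5).+1.

Lemma fetch_cat p1 p2 i : fetch (p1 ++ p2) (size p1 + i) = fetch p2 i.
Proof. by rewrite /fetch nth_cat ltnNge leq_addr /= addKn. Qed.

Lemma code_at_cat p1 p2 c q : q = size p1 -> code_at (p1 ++ code c q ++ p2) c q.
Proof.
move=> -> i il; rewrite fetch_cat /fetch nth_cat size_code il //.
Qed.

Definition pc_bit (b : bool) := if b then 1 + (code_len (read_bit false)).+1 else 1.
Definition pc_end := pc_bit true + (code_len (read_bit true)).+1.

Lemma top_bit b : code_at top_prog (read_bit b) (pc_bit b) /\
  fetch top_prog (pc_bit b + code_len (read_bit b)) = IGoto 0.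
Proof.
have [p1 [p2 [-> s1]]] : exists p1 p2, top_prog = p1 ++ code (read_bit b) (pc_bit b) ++ IGoto 0 :: p2
    /\ pc_bit b = size p1.
  case: b; last by exists [:: IPop 1 (pc_bit true) pc_end]; eexists; rewrite /top_prog -!cats1 -!catA.
  exists ([:: IPop 1 (pc_bit true) pc_end] ++ rcons (code (read_bit false) 1) (IGoto 0)).
  by eexists; split; [rewrite /top_prog -!cats1 -!catA | rewrite size_cat size_rcons size_code].
split; first exact: code_at_cat.
by rewrite s1 fetch_cat /fetch nth_cat size_code ltnn subnn.
Qed.

Lemma top_end : code_at top_prog decide pc_end /\
  [/\ fetch top_prog (pc_end + code_len decide) = IDec 3 (pc_end + code_len decide).+1 (pc_end + code_len decide).+2,
      fetch top_prog (pc_end + code_len decide).+1 = IHalt true &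
      fetch top_prog (pc_end + code_len decide).+2 = IHalt false].
Proof.
have [p1 [-> s1]] : exists p1, top_prog = p1 ++ code decide pc_end ++
   [:: IDec 3 (pc_end + code_len decide).+1 (pc_end + code_len decide).+2; IHalt true; IHalt false]
   /\ pc_end = size p1.
  exists ([:: IPop 1 (pc_bit true) pc_end] ++ rcons (code (read_bit false) 1) (IGoto 0) ++
     rcons (code (read_bit true) (pc_bit true)) (IGoto 0)).
  by rewrite /top_prog -!catA !size_cat !size_rcons !size_code addnA.
split; first exact: code_at_cat.
set p3 := [:: _; _; _].
have E i : fetch (p1 ++ code decide pc_end ++ p3) (pc_end + code_len decide + i) = fetch p3 i.
  by rewrite {2}s1 -(size_code decide pc_end) -addnA !fetch_cat.
by split; [have := E 0 | have := E 1 | have := E 2]; rewrite ?addn0 ?addn1 ?addn2.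
Qed.

Lemma read_bitP b s t : s 3 = 0 ->
  (forall z, (run (read_bit b) (s, t)).1 z = if z == 0 then 2 * s 0 + b else if z == 1 then (s 1).+1 else s z)
  /\ (run (read_bit b) (s, t)).2 <= t + 10 * s 0 + 4.
Proof.
move=> s3; rewrite /read_bit (runS (dbl _ _)).
have [||g1 g2] := @dblP 0 3 s t => //.
runto (conj g1 g2) as s1 t1 h1 h2.
case: b; rewrite /run /= /upd; split; try lia.
  by case=> [|[|z]] /=; rewrite ?h1 /=; lia.
by case=> [|[|z]] /=; rewrite ?h1 /=; lia.
Qed.

Lemma code_wf prog k c q : q + code_len c <= size prog -> regs_lt k c -> all (wf_instr prog k) (code c q).
Proof.
elim: c q => //= [r|r|c1 IH1 c2 IH2|r c IH] q.
- by rewrite addn1 => -> ->.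
- by rewrite addn1 => -> ->.
- by rewrite addnA all_cat => h /andP[r1 r2]; rewrite IH1 ?IH2 //; lia.
by move=> h /andP[-> rc]; rewrite all_cat IH //= ?andbT; lia.
Qed.

Lemma size_top : size top_prog = pc_end + code_len decide + 3.
Proof.
by rewrite /top_prog !size_cat !size_rcons !size_code /pc_end /pc_bit /=; lia.
Qed.

Lemma top_wf : all (wf_instr top_prog top_regs) top_prog.
Proof.
have r4 : 4 < top_regs by rewrite /top_regs ltnS leq_max orbT.
have rb b : regs_lt top_regs (read_bit b) by apply: (@regs_lt_le 5) => //; case: (b).
have rd : regs_lt top_regs decide.
  by apply: regs_lt_le (regs_boundP decide); rewrite /top_regs leqW // leq_maxl.
have S := size_top; have pe : pc_end = pc_bit true + (code_len (read_bit true)).+1 by [].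
have pt : pc_bit true = 1 + (code_len (read_bit false)).+1 by [].
suff: forall p, size p = size top_prog -> all (wf_instr p top_regs) top_prog by apply.
move=> p; rewrite {}S => S.
have h0 : all (wf_instr p top_regs) (code (read_bit false) 1) by apply: code_wf => //; rewrite S; lia.
have h1 : all (wf_instr p top_regs) (code (read_bit true) (pc_bit true)) by apply: code_wf => //; rewrite S; lia.
have h2 : all (wf_instr p top_regs) (code decide pc_end) by apply: code_wf => //; rewrite S; lia.
have -> : top_prog = [:: IPop 1 (pc_bit true) pc_end] ++ rcons (code (read_bit false) 1) (IGoto 0) ++
     rcons (code (read_bit true) (pc_bit true)) (IGoto 0) ++ code decide pc_end ++
   [:: IDec 3 (pc_end + code_len decide).+1 (pc_end + code_len decide).+2; IHalt true; IHalt false] by [].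
rewrite 4!all_cat !all_rcons h0 h1 h2.
have -> : all (wf_instr p top_regs) [:: IPop 1 (pc_bit true) pc_end].
  by cbn [all wf_instr]; rewrite S; lia.
cbn [all wf_instr]; rewrite S; lia.
Qed.

(** The hypothesis on [V] is an invariant of the reading loop: a bit at most doubles [x.+1] while
    the remaining power of two is halved. It bounds the cost of every doubling. *)
Lemma top_reads inp x m V s l : models top_regs s l -> s 0 = x -> s 1 = m ->
  (forall z, 2 <= z -> s z = 0) -> x.+1 * 2 ^ size inp <= V ->
  exists T l' s', [/\ iter T (cstep top_prog top_regs) (0, inp, l) = (pc_end, [::], l'),
    models top_regs s' l', s' 0 = foldl (fun v (b : bool) => 2 * v + b) x inp,
    s' 1 = m + size inp & forall z, 2 <= z -> s' z = 0] /\
    0 < T <= size inp * (10 * V + 6) + 1.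
Proof.
elim: inp x m s l => [|b inp IH] x m s l Hm s0 s1 sz hV.
  by exists 1, l, s; split; [split|]; rewrite ?addn0.
have [C F] := top_bit b.
have r4 : 4 < top_regs by rewrite /top_regs ltnS leq_max orbT.
have wb : wfc (read_bit b) by case: (b).
have rb : regs_lt top_regs (read_bit b) by apply: (@regs_lt_le 5) => //; case: (b).
have [m1 [l1 [e1 i1 h1]]] := @code_ok top_prog top_regs (ltn0Sn _) (read_bit b) (pc_bit b) s 0 l inp wb rb C Hm.
have [g1 g2] := @read_bitP b s 0 (sz 3 isT).
rewrite e1 !add0n in g2.
have [||||T [l' [s' [[i2 h2 a1 a2 a3] /andP[T0 T1]]]]] := IH (2 * x + b) m.+1 _ l1 h1.
- by rewrite g1 s0.
- by rewrite g1 s1.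
- by move=> z z2; rewrite g1; case: z z2 => [|[|z]] // z2; exact: sz.
- apply: leq_trans hV; rewrite /= expnS mulnA leq_mul2r; apply/orP; right; case: (b); lia.
exists (T + (1 + (m1 + 1))), l', s'; split; [split=> //|].
- have -> : iter (T + (1 + (m1 + 1))) (cstep top_prog top_regs) (0, b :: inp, l) =
     iter T (cstep top_prog top_regs) (cstep top_prog top_regs
       (iter m1 (cstep top_prog top_regs) (cstep top_prog top_regs (0, b :: inp, l)))) by rewrite 3!iterD.
  have -> : cstep top_prog top_regs (0, b :: inp, l) = (pc_bit b, inp, l) by case: (b).
  have E2 : cstep top_prog top_regs (pc_bit b + code_len (read_bit b), inp, l1) = (0, inp, l1) by rewrite /cstep F.
  by rewrite i1 E2.
- by rewrite a2 /=; lia.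
have : x <= V by apply: leq_trans hV; rewrite -{1}[x]muln1 leq_mul // expn_gt0.
rewrite s0 in g2 *; rewrite /= mulSn; move: T1 T0 g2; move: (size inp * _) => w; lia.
Qed.

Hypothesis a_gt0 : 0 < a.

Lemma num_lt inp : num inp < 2 ^ size inp.
Proof.
rewrite /num; suff: forall x, foldl (fun v (b : bool) => 2 * v + b) x inp < x.+1 * 2 ^ size inp.
  by move/(_ 0); rewrite mul1n.
elim: inp => [|b inp IH] x /=; first by rewrite muln1.
apply: leq_trans (IH _) _; rewrite expnS mulnA leq_mul2r; apply/orP; right; case: b; lia.
Qed.

Lemma doubling_loop s t p : s 3 = p -> s 4 = 0 -> s 2 = 1 ->
  (forall z, (run (Loop 3 (dbl 2 4)) (s, t)).1 z = if z == 3 then 0 else if z == 2 then 2 ^ p else s z) /\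
  (run (Loop 3 (dbl 2 4)) (s, t)).2 <= t + p * (10 * 2 ^ p + 4) + 1.
Proof.
move=> s3 s4 s2.
have [||||g1 _ g2] := @loop_run 3 (dbl 2 4) (fun i s' => forall z, s' z =
    if z == 3 then p - i else if z == 2 then 2 ^ i else s z) (10 * 2 ^ p + 2) p s t => //.
- by move=> z; rewrite subn0; upds.
- move=> i s' t' il H H'.
  have [||h1 h2] := @dblP 2 4 (upd s' 3 (s' 3).-1) t' => //; first by rewrite /upd /= H.
  split=> [z|]; first by rewrite h1 /upd !H expnS; case: z => [|[|[|[|z]]]] //=; lia.
  apply: leq_trans h2 _; rewrite /upd /= H /=.
  by have : 2 ^ i <= 2 ^ p by [rewrite leq_exp2l // ltnW]; lia.
split=> [z|]; first by rewrite g1 subnn.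
by apply: leq_trans g2 _; lia.
Qed.

Lemma top_ok : exists K, forall inp, 0 < size inp ->
  let N := 2 ^ ((size inp).+2 ^ a) in
  exists2 n, n <= N ^ K &
    c_state (iter n (@tm_step (machine top_prog top_regs)) (tm_init (machine top_prog top_regs) inp))
    = inl (0 < eval e [:: num inp; size inp; N]).
Proof.
have [ce He] := ex_ok e; have [cp Hp] := ex_ok (powx a).
set T0 := 10 + (5 + (cp + ce)).
(* The exponent [5 + T0] bounds the number of instructions and occurs twice because their simulation
   on the tape is quadratic; [top_regs] absorbs the number [k] of registers through [k <= 2 ^ k]. *)
exists (4 + top_regs + ((5 + T0) + (5 + T0))) => inp inp0 N.
set sz := size inp in inp0 N *.
have szN : sz.+2 <= N.
  apply: leq_trans (_ : 2 ^ (sz.+2 ^ 1) <= _); first by rewrite expn1 ltnW // ltn_expl.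
  by rewrite leq_exp2l // leq_pexp2l.
have N2 : 2 <= N by apply: leq_trans szN.
have numN : 2 ^ sz <= N.
  by rewrite leq_exp2l //; apply: leq_trans (_ : sz.+2 ^ 1 <= _); [lia | rewrite leq_pexp2l].
have Hm0 : models top_regs (fun=> 0) [::] by [].
have [] := @top_reads inp 0 0 N (fun=> 0) [::] Hm0 => //; first by rewrite mul1n.
move=> T1 [l1 [s1 [[i1 h1 a1 a2 a3] /andP[T1p T1b]]]].
have rd : regs_lt top_regs decide.
  by apply: regs_lt_le (regs_boundP decide); rewrite /top_regs leqW // leq_maxl.
have [Cd [F1 F2 F3]] := top_end.
have wd : wfc decide.
  rewrite /decide /= !cmp_wf //=; by case=> [|[|[|i]]].
have [m [l2 [e2 i2 h2]]] := @code_ok top_prog top_regs (ltn0Sn _) decide pc_end s1 0 l1 [::] wd rd Cd h1.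
have P0 : placed [:: 0; 1] [:: num inp; sz] 3 s1.
  split=> //; [by case=> [|[|i]] | by case=> [|[|i]] //= _; rewrite ?a1 ?a2 | by move=> r r3; apply: a3; lia].
have b0 i : nth 0 [:: num inp; sz] i <= N.
  case: i => [|[|i]] /=; [exact: leq_trans (ltnW (num_lt inp)) numN | lia | by rewrite nth_nil].
have [vp /(_ _ _ _ 0 P0) Rp] := Hp _ N N2 b0.
have Ev : (run decide (s1, 0)).1 3 = eval e [:: num inp; sz; N] /\ (run decide (s1, 0)).2 <= N ^ T0.
  rewrite /decide (runS (cmp (powx a) _ _)) (runS (Inc 2)) (runS (Loop _ _)).
  runto Rp as s2 t2 k1 k2.
  have ep : eval (powx a) [:: num inp; sz] = sz.+2 ^ a by rewrite eval_powx /= addn2.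
  have R2 : (forall z, (run (Inc 2) (s2, t2)).1 z = if z == 2 then 1 else s2 z) /\ (run (Inc 2) (s2, t2)).2 <= t2.+1.
    by rewrite /run /=; split=> // z; rewrite /upd k1 /= a3.
  runto R2 as s3 t3 k3 k4.
  have [|||g1 g2] := @doubling_loop s3 t3 (sz.+2 ^ a).
  - by rewrite k3 k1 /= ep.
  - by rewrite k3 k1 /= a3.
  - by rewrite k3.
  runto (conj g1 g2) as s4 t4 k5 k6; rewrite -/N in k5 k6.
  have P4 : placed [:: 0; 1; 2] [:: num inp; sz; N] 3 s4.
    split=> //; [by case=> [|[|[|i]]] | by case=> [|[|[|i]]] //= _; rewrite k5 ?k3 ?k1 /= ?a1 ?a2 |].
    by move=> r r3; rewrite k5 k3 k1; have : s1 r = 0 by [apply: a3; lia]; upds.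
  have b4 i : nth 0 [:: num inp; sz; N] i <= N.
    by case: i => [|[|[|i]]] //=; [exact: (b0 0) | exact: (b0 1) | rewrite nth_nil].
  have [_ /(_ _ _ _ t4 P4) [g3 g4]] := He _ N N2 b4.
  split; first by rewrite g3.
  apply: leq_trans g4 _; rewrite /T0 -[10]/(5 + 5) -addnA.
  have pN : sz.+2 ^ a <= N by rewrite ltnW // ltn_expl.
  have pce := pow_ge1 ce N2; have pcp := pow_ge1 cp N2.
  have q : (sz.+2 ^ a) * (10 * N + 4) <= N * (10 * N + 4) by rewrite leq_mul2r pN orbT.
  apply: (@const_pow _ _ 5) => //; rewrite addnA expnD; apply: leq_trans (_ : 2 ^ 5 * (N ^ (5 + 5) * N ^ (cp + ce)) <= _) => //.
  rewrite !expnD; have N5 : N * N <= N ^ 5 * N ^ 5 by rewrite -expnD -{1 2}[N]expn1 -expnD leq_pow.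
  move: (N ^ 5 * N ^ 5) N5 => W N5.
  have h1' : N * N <= W * (N ^ cp * N ^ ce) by apply: leq_trans N5 _; rewrite leq_pmulr // muln_gt0 pcp.
  have W1 : 0 < W by apply: leq_trans N5; rewrite muln_gt0; lia.
  have h2' : N ^ cp <= W * (N ^ cp * N ^ ce) by rewrite mulnA mulnAC leq_pmull // muln_gt0 W1.
  have h3' : N ^ ce <= W * (N ^ cp * N ^ ce) by rewrite mulnA leq_pmull // muln_gt0 W1.
  have h4' : N <= N * N by rewrite leq_pmulr; lia.
  have : t4 <= N ^ cp + 1 + N * (10 * N + 4) + 1 by lia.
  have -> : N * (10 * N + 4) = 10 * (N * N) + 4 * N by lia.
  rewrite -[2 ^ 5]/32; move: h1' h2' h3'; move: (W * (N ^ cp * N ^ ce)) => A; clear -h4' N2; lia.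
have [Ev1 Ev2] := Ev; rewrite e2 add0n in Ev2.
have r3 : 3 < top_regs by rewrite /top_regs ltnS leq_max /= orbT.
have ih : iter (1 + (m + T1)) (cstep top_prog top_regs) (0, inp, [::]) =
  (if 0 < eval e [:: num inp; sz; N] then (pc_end + code_len decide).+1 else (pc_end + code_len decide).+2, [::], rdec top_regs 3 l2).
  have E2 : cstep top_prog top_regs (pc_end + code_len decide, [::], l2) =
    (if 0 < eval e [:: num inp; sz; N] then (pc_end + code_len decide).+1 else (pc_end + code_len decide).+2, [::], rdec top_regs 3 l2).
    by rewrite /cstep F1 h2 // Ev1.
  by rewrite 2!iterD i1 i2 -E2.
have [||t tb th] := @machine_halts top_prog top_regs (ltn0Sn _) top_wf _ _ _ inp _ _ _ _ (0 < eval e [:: num inp; sz; N]) erefl inp0 ih => //.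
  by case: ifP.
exists t => //; apply: leq_trans tb _.
have N2T : N * N <= N ^ T0 by rewrite -{1 2}[N]expn1 -expnD leq_pow.
have NNN : N <= N * N by rewrite leq_pmulr; lia.
have hT : 1 + (m + T1) <= N ^ (5 + T0).
  apply: const_pow => //.
  have : sz * (10 * N + 6) <= N * (10 * N + 6) by rewrite leq_mul2r; apply/orP; right; lia.
  have -> : N * (10 * N + 6) = 10 * (N * N) + 6 * N by lia.
  by move: N2T NNN Ev2 T1b N2; move: (N * N) (N ^ T0) (sz * _) => A1 A2 A3; lia.
move: (1 + (m + T1)) hT => T hT.
apply: const_pow => //; rewrite (expnD 2) (expnD N (5 + T0)).
have ZN : N <= N ^ (5 + T0) by rewrite -{1}[N]expn1 leq_pow.
move: (N ^ (5 + T0)) hT ZN => Z hT ZN.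
have kk : top_regs <= 2 ^ top_regs by rewrite ltnW // ltn_expl.
have k1 : 0 < top_regs by [].
move: (2 ^ top_regs) kk k1 => kp; move: top_regs => k kk k1.
have q : T * (2 * (sz + T * k + k) + 9) <= Z * (2 * (Z + Z * kp + kp) + 9).
  apply: leq_mul => //; rewrite leq_add2r leq_mul2l /= leq_add //; rewrite leq_add //; first lia.
  exact: leq_mul.
apply: leq_trans (leq_add (leqnn _) q) _; rewrite -/sz.
have r1 : Z <= Z * Z by rewrite leq_pmulr; lia.
have r2 : Z * Z <= kp * (Z * Z) by rewrite leq_pmull; lia.
have r3' : Z * kp <= kp * (Z * Z) by rewrite mulnC leq_mul2l r1 orbT.
have -> : Z * (2 * (Z + Z * kp + kp) + 9) = 2 * (Z * Z) + 2 * (kp * (Z * Z)) + 2 * (Z * kp) + 9 * Z by lia.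
rewrite -[2 ^ 4]/16 -mulnA; move: (kp * (Z * Z)) (Z * Z) (Z * kp) r1 r2 r3' => A1 A2 A3; lia.
Qed.
End Top.
End TopMachine.

(** * Definability by bounded expressions *)

Module Definable.
Import Defs TapeRegisters LoopCompiler RegisterRoutines Expressions.
Import all_boot zify.

(** Functions take the whole environment. Bound variables are prepended to it, so under a binder the
    parameters are reached through [drop]. *)
Definition def (f : seq nat -> nat) := exists e, forall rho, eval e rho = f rho.

Fixpoint lift k n (e : ex) : ex :=
  match e with
  | EVar i => EVar (if i < k then i else i + n)
  | ECst c => ECst c
  | EAdd a b => EAdd (lift k n a) (lift k n b)
  | ESub a b => ESub (lift k n a) (lift k n b)
  | EMul a b => EMul (lift k n a) (lift k n b)
  | EIter b m i f => EIter (lift k n b) (lift k n m) (lift k n i) (lift k.+2 n f)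
  end.

Lemma eq_iteri T m (f g : nat -> T -> T) x : (forall i y, f i y = g i y) -> iteri m f x = iteri m g x.
Proof. by move=> E; elim: m => //= m ->. Qed.

Lemma eval_lift n e l r : eval (lift (size l) n e) (l ++ r) = eval e (l ++ drop n r).
Proof.
elim: e l => //= [i|a IHa b IHb|a IHa b IHb|a IHa b IHb|b IHb m IHm i IHi f IHf] l; rewrite ?IHa ?IHb //.
  rewrite !nth_cat; case: (ltnP i (size l)) => il; first by rewrite il.
  by rewrite ltnNge (leq_trans il) ?leq_addr //= nth_drop addnC -addnBA // addnC.
rewrite IHm IHi; apply: eq_iteri => j acc; congr minn.
exact: (IHf [:: j, acc & l]).
Qed.

Lemma def_ext f g : (forall r, f r = g r) -> def f -> def g.
Proof. by move=> E [e H]; exists e => r; rewrite H. Qed.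

Lemma def_shift n f : def f -> def (fun r => f (drop n r)).
Proof. by move=> [e H]; exists (lift 0 n e) => r; rewrite (@eval_lift n e [::] r) /= H. Qed.

Lemma def_var i : def (fun r => nth 0 r i).
Proof. by exists (EVar i). Qed.
Lemma def_cst c : def (fun _ => c).
Proof. by exists (ECst c). Qed.
Lemma def_add f g : def f -> def g -> def (fun r => f r + g r).
Proof. by move=> [a Ha] [b Hb]; exists (EAdd a b) => r /=; rewrite Ha Hb. Qed.
Lemma def_sub f g : def f -> def g -> def (fun r => f r - g r).
Proof. by move=> [a Ha] [b Hb]; exists (ESub a b) => r /=; rewrite Ha Hb. Qed.
Lemma def_mul f g : def f -> def g -> def (fun r => f r * g r).
Proof. by move=> [a Ha] [b Hb]; exists (EMul a b) => r /=; rewrite Ha Hb. Qed.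
Lemma def_iter_gen b n i (f : seq nat -> nat -> nat -> nat) e : def b -> def n -> def i ->
  (forall j acc r, eval e [:: j, acc & r] = f r j acc) ->
  def (fun r => iteri (n r) (fun j acc => minn (b r) (f r j acc)) (minn (b r) (i r))).
Proof.
move=> [b' Hb] [n' Hn] [i' Hi] Hf; exists (EIter b' n' i' e) => r /=.
by rewrite Hb Hn Hi; apply: eq_iteri => j acc; rewrite Hf.
Qed.

Lemma def_iter b n i (f : seq nat -> nat -> nat -> nat) : def b -> def n -> def i ->
  def (fun r => f (drop 2 r) (nth 0 r 0) (nth 0 r 1)) ->
  def (fun r => iteri (n r) (fun j acc => minn (b r) (f r j acc)) (minn (b r) (i r))).
Proof.
move=> hb hn hi [e He]; apply: (def_iter_gen (e := e)) => // j acc r.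
by rewrite He /= drop0.
Qed.

Definition defb (p : seq nat -> bool) := def (fun r => nat_of_bool (p r)).

Lemma def_succ f : def f -> def (fun r => (f r).+1).
Proof.
move=> hf; apply: (@def_ext (fun r => f r + 1)); first by move=> r; rewrite addn1.
by apply: def_add => //; exact: def_cst.
Qed.

Definition ifb (p : bool) (a b : nat) := if p then a else b.

Lemma def_ifb p f g : defb p -> def f -> def g -> def (fun r => ifb (p r) (f r) (g r)).
Proof.
move=> hp hf hg; apply: (@def_ext (fun r => p r * f r + (1 - p r) * g r)).
  by move=> r; rewrite /ifb; case: (p r); rewrite ?mul1n ?mul0n ?addn0 ?add0n.
by apply: def_add; apply: def_mul => //; apply: def_sub => //; exact: def_cst.
Qed.

Lemma def_leq f g : def f -> def g -> defb (fun r => f r <= g r).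
Proof.
move=> hf hg; apply: (@def_ext (fun r => 1 - (f r - g r))); first by move=> r; lia.
by apply: def_sub; [exact: def_cst | exact: def_sub].
Qed.

Lemma def_and p q : defb p -> defb q -> defb (fun r => p r && q r).
Proof.
move=> hp hq; apply: (@def_ext (fun r => p r * q r)); last exact: def_mul.
by move=> r; rewrite mulnb.
Qed.

Lemma def_neg p : defb p -> defb (fun r => ~~ p r).
Proof.
move=> hp; apply: (@def_ext (fun r => 1 - p r)); first by move=> r; case: (p r).
by apply: def_sub => //; exact: def_cst.
Qed.

Lemma def_or p q : defb p -> defb q -> defb (fun r => p r || q r).
Proof.
move=> hp hq; apply: (@def_ext (fun r => ~~ (~~ p r && ~~ q r))).
  by move=> r; rewrite negb_and !negbK.
by apply: def_neg; apply: def_and; exact: def_neg.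
Qed.

Lemma def_imp p q : defb p -> defb q -> defb (fun r => p r ==> q r).
Proof.
move=> hp hq; apply: (@def_ext (fun r => ~~ p r || q r)); first by move=> r; rewrite implybE.
by apply: def_or => //; exact: def_neg.
Qed.

Lemma def_eq f g : def f -> def g -> defb (fun r => f r == g r).
Proof.
move=> hf hg; apply: (@def_ext (fun r => (f r <= g r) && (g r <= f r))).
  by move=> r; rewrite eqn_leq.
by apply: def_and; exact: def_leq.
Qed.

Lemma def_true : defb (fun _ => true).
Proof. exact: def_cst. Qed.
Lemma def_false : defb (fun _ => false).
Proof. exact: def_cst. Qed.

Definition exb b (p : nat -> bool) := has p (iota 0 b).
Definition allb b (p : nat -> bool) := all p (iota 0 b).

Lemma exbP b (p : nat -> bool) : reflect (exists2 i, i < b & p i) (exb b p).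
Proof.
apply: (iffP hasP) => [[i]|[i h1 h2]]; last by exists i; rewrite ?mem_iota.
by rewrite mem_iota => /andP[_ h1] h2; exists i.
Qed.

Lemma allbP b (p : nat -> bool) : reflect (forall i, i < b -> p i) (allb b p).
Proof.
apply: (iffP allP) => [H i ib|H i]; first by apply: H; rewrite mem_iota.
by rewrite mem_iota => /andP[_]; exact: H.
Qed.

Lemma def_exb f (p : seq nat -> nat -> bool) : def f -> defb (fun r => p (drop 1 r) (nth 0 r 0)) ->
  defb (fun r => exb (f r) (p r)).
Proof.
move=> hf hp; apply: (@def_ext (fun r => iteri (f r) (fun j acc => minn 1 (acc + p r j)) (minn 1 0))).
  move=> r; rewrite minn0 /exb; elim: (f r) => [|n IH] //.
  rewrite [LHS]/= IH -[n.+1]addn1 iotaD has_cat /= orbF add0n.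
  by case: (has _ _); case: (p r n).
have [e He] := hp; apply: (@def_iter_gen (fun _ => 1) f (fun _ => 0) (fun r j acc => acc + p r j) (EAdd (EVar 1) (lift 1 1 e))) => //; try exact: def_cst.
move=> j acc r; have /= -> := @eval_lift 1 e [:: j] (acc :: r).
by rewrite He /= !drop0.
Qed.

Lemma def_allb f (p : seq nat -> nat -> bool) : def f -> defb (fun r => p (drop 1 r) (nth 0 r 0)) ->
  defb (fun r => allb (f r) (p r)).
Proof.
move=> hf hp; apply: (@def_ext (fun r => ~~ exb (f r) (fun i => ~~ p r i))).
  by move=> r; rewrite /exb /allb has_predC negbK.
by apply: def_neg; apply: (@def_exb f (fun r i => ~~ p r i)) => //; exact: def_neg.
Qed.

(** Division by counting: the number of positive multiples of [y] up to [x], at most [n] of them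
    being tried. *)
Definition dcount x y n := iteri n (fun i acc => minn x (acc + (i.+1 * y <= x))) 0.

Lemma dcountE x y n : 0 < y -> dcount x y n = minn n (x %/ y).
Proof.
move=> y0; rewrite /dcount; elim: n => [|n IH]; first by rewrite min0n.
rewrite [LHS]/= IH -leq_divRL //; have := leq_div x y; lia.
Qed.

Definition pw N b e := iteri e (fun _ acc => minn N (acc * b)) (minn N 1).

Lemma pwE N b e : 0 < b -> b ^ e <= N -> pw N b e = b ^ e.
Proof.
move=> b0; rewrite /pw; elim: e => [|e IH] h; first by apply/minn_idPr.
have h' : b ^ e <= N by apply: leq_trans h; rewrite expnS leq_pmull.
by rewrite [LHS]/= IH // expnS mulnC; apply/minn_idPr; rewrite -expnS.
Qed.

Definition digit N Z s i := (s %/ pw N Z i) %% Z.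

(** Bit [i] of a word of length [n], counted from the most significant end of its number [X]. *)
Definition bitat X n N i := (i < n) && odd (X %/ pw N 2 (n - i.+1)).

Ltac deft_var :=
  lazymatch goal with
  | |- def (fun r => nth 0 r ?i) => exact: def_var
  | |- def (fun r => nth 0 (drop ?k r) ?i) => apply: (@def_shift k (fun r => nth 0 r i)); deft_var
  | |- def (fun r => nth 0 (drop ?l (drop ?k r)) ?i) => apply: (@def_shift k (fun r => nth 0 (drop l r) i)); deft_var
  | |- def (fun r => nth 0 (drop ?m (drop ?l (drop ?k r))) ?i) => apply: (@def_shift k (fun r => nth 0 (drop m (drop l r)) i)); deft_var
  | |- def (fun r => ?X r) => assumption
  | |- def (fun r => ?X (drop ?k r)) => apply: (@def_shift k X); deft_var
  | |- def (fun r => ?X (drop ?l (drop ?k r))) => apply: (@def_shift k (fun r => X (drop l r))); deft_var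
  | |- def (fun r => ?X (drop ?m (drop ?l (drop ?k r)))) => apply: (@def_shift k (fun r => X (drop m (drop l r)))); deft_var
  | |- def ?X => assumption
  end.

Ltac deft_hook := fail.

Ltac deft :=
  cbv beta;
  lazymatch goal with
  | |- def (fun r => nat_of_bool (@?p_ r)) => change (defb p_); deft
  | |- defb (fun r => @?p_ r && @?q_ r) => apply: (@def_and p_ q_); deft
  | |- defb (fun r => @?p_ r || @?q_ r) => apply: (@def_or p_ q_); deft
  | |- defb (fun r => @?p_ r ==> @?q_ r) => apply: (@def_imp p_ q_); deft
  | |- defb (fun r => ~~ @?p_ r) => apply: (@def_neg p_); deft
  | |- defb (fun r => @?f_ r <= @?g_ r) => apply: (@def_leq f_ g_); deft
  | |- defb (fun r => @eq_op _ (@?f_ r) (@?g_ r)) => apply: (@def_eq f_ g_); deft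
  | |- defb (fun r => exb (@?f_ r) (@?p_ r)) => apply: (@def_exb f_ p_); deft
  | |- defb (fun r => allb (@?f_ r) (@?p_ r)) => apply: (@def_allb f_ p_); deft
  | |- defb (fun _ => true) => exact: def_true
  | |- defb (fun _ => false) => exact: def_false
  | |- def (fun _ => ?c) => exact: def_cst
  | |- def (fun r => ifb (@?p_ r) (@?f_ r) (@?g_ r)) => apply: (@def_ifb p_ f_ g_); deft
  | |- def (fun r => @?f_ r + @?g_ r) => apply: (@def_add f_ g_); deft
  | |- def (fun r => @?f_ r - @?g_ r) => apply: (@def_sub f_ g_); deft
  | |- def (fun r => @?f_ r * @?g_ r) => apply: (@def_mul f_ g_); deft
  | |- def (fun r => (@?f_ r).+1) => apply: (@def_succ f_); deft
  | |- _ => first [deft_hook; deft | deft_var]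
  end.

Lemma def_div f g : def f -> def g -> def (fun r => f r %/ g r).
Proof.
move=> hf hg; apply: (@def_ext (fun r => ifb (0 < g r) (dcount (f r) (g r) (f r)) 0)).
  move=> r; rewrite /ifb; case: (posnP (g r)) => [->|g0]; first by rewrite divn0.
  by rewrite dcountE //; apply/minn_idPr; exact: leq_div.
apply: def_ifb; [deft | | deft].
apply: (@def_ext (fun r => iteri (f r) (fun i acc => minn (f r) (acc + (i.+1 * g r <= f r))) (minn (f r) 0))).
  by move=> r; rewrite minn0.
by apply: (@def_iter f f (fun _ => 0) (fun r i acc => acc + (i.+1 * g r <= f r))) => //; deft.
Qed.

Ltac deft_hook ::= lazymatch goal with
  | |- def (fun r => @?f_ r %/ @?g_ r) => apply: (@def_div f_ g_) end.

Lemma def_mod f g : def f -> def g -> def (fun r => f r %% g r).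
Proof.
move=> hf hg; apply: (@def_ext (fun r => f r - f r %/ g r * g r)); last by deft.
by move=> r; rewrite {1}(divn_eq (f r) (g r)) addKn.
Qed.

Lemma def_odd f : def f -> defb (fun r => odd (f r)).
Proof.
by move=> hf; apply: (@def_ext (fun r => f r %% 2)); [move=> r; rewrite modn2 | apply: def_mod; deft].
Qed.

Lemma def_pw N b e : def N -> def b -> def e -> def (fun r => pw (N r) (b r) (e r)).
Proof.
by move=> hN hb he; apply: (@def_iter N e (fun _ => 1) (fun r _ acc => acc * b r)) => //; deft.
Qed.

Ltac deft_hook ::= lazymatch goal with
  | |- def (fun r => @?f_ r %/ @?g_ r) => apply: (@def_div f_ g_)
  | |- def (fun r => @?f_ r %% @?g_ r) => apply: (@def_mod f_ g_)
  | |- defb (fun r => odd (@?f_ r)) => apply: (@def_odd f_)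
  | |- def (fun r => pw (@?N_ r) (@?f_ r) (@?g_ r)) => apply: (@def_pw N_ f_ g_) end.

Lemma def_digit N Z s i : def N -> def Z -> def s -> def i -> def (fun r => digit (N r) (Z r) (s r) (i r)).
Proof. by move=> hN hZ hs hi; rewrite /digit; deft. Qed.

Lemma def_bitat X n N i : def X -> def n -> def N -> def i -> defb (fun r => bitat (X r) (n r) (N r) (i r)).
Proof. by move=> hX hn hN hi; rewrite /bitat; deft. Qed.
End Definable.

(** * Datalog: syntax and least model *)

Module DatalogSyntax.
Import Defs.
Import all_boot zify.

Inductive trm := V of nat | K of nat.
Definition datom := (nat * seq trm)%type.
Record clause := Clause { c_edb : seq datom; c_idb : seq datom; c_hd : datom }.

Definition tval (v : nat -> nat) (t : trm) := match t with V i => v i | K c => c end.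
Definition tvals v (l : seq trm) := map (tval v) l.

(** The singleton case avoids a trailing [True], so the premises of a concrete rule unfold to a
    plain conjunction. *)
Fixpoint holds (P : nat -> seq nat -> Prop) (v : nat -> nat) (l : seq datom) : Prop :=
  match l with
  | [::] => True
  | [:: a] => P a.1 (tvals v a.2)
  | a :: l' => P a.1 (tvals v a.2) /\ holds P v l'
  end.

Lemma holdsP P v l : holds P v l <-> forall a, List.In a l -> P a.1 (tvals v a.2).
Proof.
elim: l => [|a [|b l] IH] //.
  by split=> [h c [<-|]|H] //; apply: H; left.
case: IH => IH1 IH2; split=> [[h1 h2] c [<-|hc]|H] //; first exact: IH1 h2 c hc.
by split; [apply: H; left | apply: IH2 => c hc; apply: H; right].
Qed.

Section Datalog.
Variables (prog : seq clause) (edb : nat -> seq nat -> Prop).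

(** The least model, as the intersection of all sets closed under the rules. Extensional premises
    are looked up in [edb] and never derived. *)
Definition dl (t : nat) (a : seq nat) : Prop := forall P : nat -> seq nat -> Prop,
  (forall c v, List.In c prog -> holds edb v (c_edb c) -> holds P v (c_idb c) ->
     P (c_hd c).1 (tvals v (c_hd c).2)) -> P t a.

Lemma dl_rule c v : List.In c prog -> holds edb v (c_edb c) -> holds dl v (c_idb c) ->
  dl (c_hd c).1 (tvals v (c_hd c).2).
Proof.
move=> hc he /holdsP hi P HP; apply: (HP _ _ hc he); apply/holdsP => a ha.
exact: hi ha P HP.
Qed.

Lemma dl_ind (P : nat -> seq nat -> Prop) :
  (forall c v, List.In c prog -> holds edb v (c_edb c) -> holds dl v (c_idb c) -> holds P v (c_idb c) ->
     P (c_hd c).1 (tvals v (c_hd c).2)) -> forall t a, dl t a -> P t a.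
Proof.
move=> H t a h; suff [] : dl t a /\ P t a by [].
apply: (h (fun t a => dl t a /\ P t a)) => c v hc he /holdsP hi; split.
  by apply: dl_rule => //; apply/holdsP => b hb; case: (hi b hb).
by apply: H => //; apply/holdsP => b hb; case: (hi b hb).
Qed.
End Datalog.

(** Turns induction over derivations of a concrete program into one conjunct per clause. *)
Fixpoint cases (prog : seq clause) (edb D P : nat -> seq nat -> Prop) : Prop :=
  match prog with
  | [::] => True
  | c :: p => (forall v, holds edb v (c_edb c) -> holds D v (c_idb c) -> holds P v (c_idb c) ->
                 P (c_hd c).1 (tvals v (c_hd c).2)) /\ cases p edb D P
  end.

Lemma cases_in p edb D P c v : cases p edb D P -> List.In c p ->
  holds edb v (c_edb c) -> holds D v (c_idb c) -> holds P v (c_idb c) ->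
  P (c_hd c).1 (tvals v (c_hd c).2).
Proof. by elim: p => //= c' p IH [H1 H2] [<-|hc]; [exact: H1 | exact: IH]. Qed.

Lemma dl_cases prog edb P : cases prog edb (dl prog edb) P -> forall t a, dl prog edb t a -> P t a.
Proof. by move=> H; apply: dl_ind => c v; exact: cases_in H. Qed.
End DatalogSyntax.

(** * The fixed Datalog program *)

Module DatalogProgram.
Import Defs DatalogSyntax.
Import all_boot zify.

(** Triples name fact types and objects. Fact types: [(0,a,0)] is query atom [a], [(1,R,0)] the
    generic fact of [R], [(2,T,l)] a fact of [T] with an accessible element inherited at [l].
    Objects: [(0,v,0)] is a query variable, [(1,R,j)] the common value at a constant position,
    [(2,R,j)] an entry of the generic fact, [(3,z,0)] a null of the guessed match. *)
Definition tri := (nat * nat * nat)%type.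

Notation pE := 1 (only parsing).
Notation pC := 2 (only parsing).
Notation pFC := 3 (only parsing).
Notation pD := 4 (only parsing).
Notation pFD := 5 (only parsing).
Notation pOb := 6 (only parsing).
Notation pEq := 7 (only parsing).
Notation pFE := 8 (only parsing).
Notation pLv := 9 (only parsing).
Notation pAc := 10 (only parsing).
Notation pAT := 11 (only parsing).
Notation pRI := 12 (only parsing).
Notation pRv := 13 (only parsing).
Notation pRev := 14 (only parsing).
Notation pU := 15 (only parsing).
Notation pE2 := 16 (only parsing).
Notation pP2 := 17 (only parsing).
Notation pO2 := 18 (only parsing).
Notation pNO := 19 (only parsing).
Notation pPi := 20 (only parsing).
Notation pSO := 21 (only parsing).
Notation pAO := 22 (only parsing).
Notation pAL := 23 (only parsing).
Notation pGoal := 24 (only parsing).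
(** The last three tags carry the guess. [elab] sends a variable to an object; [ekind] tells how the
    image of an atom arises (0: a fact type revealed by a method, 1: a child of an object at a
    position, 2: any fact of the relation); [enul] describes a null by such a fact, its relation and
    a position. *)
Notation euid := 0 (only parsing).
Notation efd := 1 (only parsing).
Notation elhs := 2 (only parsing).
Notation emeth := 3 (only parsing).
Notation einp := 4 (only parsing).
Notation eunb := 5 (only parsing).
Notation eatm := 6 (only parsing).
Notation earg := 7 (only parsing).
Notation easz := 8 (only parsing).
Notation enq := 9 (only parsing).
Notation epos := 10 (only parsing).
Notation eJ := 11 (only parsing).
Notation esucc := 12 (only parsing).
Notation elab := 13 (only parsing).
Notation ekind := 14 (only parsing).
Notation enul := 15 (only parsing).

Definition prog : seq clause := [::
  Clause [:: (eatm, [:: V 0; V 1])] [::] (pE, [:: V 1]);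
  Clause [:: (euid, [:: V 0; V 1; V 2; V 3])] [:: (pE, [:: V 0])] (pE, [:: V 2]);
  Clause [:: (efd, [:: V 0; V 1; V 2; V 3])] [::] (pFC, [:: V 0; K 0]);
  Clause [:: (elhs, [:: V 0; V 1; V 2]); (efd, [:: V 0; V 3; V 4; V 5]); (esucc, [:: V 1; V 6])] [:: (pFC, [:: V 0; V 1]); (pC, [:: V 3; V 2])] (pFC, [:: V 0; V 6]);
  Clause [:: (efd, [:: V 0; V 1; V 2; V 3])] [:: (pFC, [:: V 0; V 2])] (pC, [:: V 1; V 3]);
  Clause [:: (euid, [:: V 0; V 1; V 2; V 3])] [:: (pC, [:: V 2; V 3])] (pC, [:: V 0; V 1]);
  Clause [:: (einp, [:: V 0; V 1; V 2])] [::] (pD, [:: V 0; V 2]);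
  Clause [:: (emeth, [:: V 0; V 1; V 2])] [:: (pC, [:: V 1; V 3])] (pD, [:: V 0; V 3]);
  Clause [:: (efd, [:: V 0; V 1; V 2; V 3]); (emeth, [:: V 4; V 1; V 5])] [::] (pFD, [:: V 0; V 4; K 0]);
  Clause [:: (elhs, [:: V 0; V 2; V 3]); (esucc, [:: V 2; V 4])] [:: (pFD, [:: V 0; V 1; V 2]); (pD, [:: V 1; V 3])] (pFD, [:: V 0; V 1; V 4]);
  Clause [:: (efd, [:: V 0; V 1; V 2; V 3])] [:: (pFD, [:: V 0; V 4; V 2])] (pD, [:: V 4; V 3]);
  Clause [:: (eunb, [:: V 0]); (eJ, [:: V 1])] [::] (pD, [:: V 0; V 1]);
  Clause [:: (earg, [:: V 0; V 1; V 2])] [::] (pOb, [:: K 0; V 0; K 0; V 1; K 0; V 2; K 0]);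
  Clause [:: (epos, [:: V 0; V 1])] [:: (pE, [:: V 0])] (pOb, [:: K 1; V 0; K 0; V 1; K 2; V 0; V 1]);
  Clause [::] [:: (pLv, [:: V 0; V 1; V 2; V 3]); (pC, [:: V 3; V 4])] (pOb, [:: V 0; V 1; V 2; V 4; K 1; V 3; V 4]);
  Clause [::] [:: (pOb, [:: V 0; V 1; V 2; V 3; V 4; V 5; V 6]); (pOb, [:: V 0; V 1; V 2; V 3; V 7; V 8; V 9])] (pEq, [:: V 4; V 5; V 6; V 7; V 8; V 9]);
  Clause [::] [:: (pEq, [:: V 0; V 1; V 2; V 3; V 4; V 5])] (pEq, [:: V 3; V 4; V 5; V 0; V 1; V 2]);
  Clause [::] [:: (pEq, [:: V 0; V 1; V 2; V 3; V 4; V 5]); (pEq, [:: V 3; V 4; V 5; V 6; V 7; V 8])] (pEq, [:: V 0; V 1; V 2; V 6; V 7; V 8]);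
  Clause [:: (efd, [:: V 0; V 1; V 2; V 3]); (eatm, [:: V 4; V 1]); (eatm, [:: V 5; V 1])] [::] (pFE, [:: V 0; V 4; V 5; K 0]);
  Clause [:: (elhs, [:: V 0; V 3; V 4]); (earg, [:: V 1; V 4; V 5]); (earg, [:: V 2; V 4; V 6]); (esucc, [:: V 3; V 7])] [:: (pFE, [:: V 0; V 1; V 2; V 3]); (pEq, [:: K 0; V 5; K 0; K 0; V 6; K 0])] (pFE, [:: V 0; V 1; V 2; V 7]);
  Clause [:: (efd, [:: V 0; V 1; V 2; V 3]); (earg, [:: V 4; V 3; V 6]); (earg, [:: V 5; V 3; V 7])] [:: (pFE, [:: V 0; V 4; V 5; V 2])] (pEq, [:: K 0; V 6; K 0; K 0; V 7; K 0]);
  Clause [:: (euid, [:: V 0; V 1; V 2; V 3])] [:: (pC, [:: V 2; V 3]); (pE, [:: V 0])] (pEq, [:: K 1; V 0; V 1; K 1; V 2; V 3]);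
  Clause [:: (eatm, [:: V 0; V 1])] [::] (pLv, [:: K 0; V 0; K 0; V 1]);
  Clause [::] [:: (pE, [:: V 0])] (pLv, [:: K 1; V 0; K 0; V 0]);
  Clause [:: (euid, [:: V 0; V 1; V 2; V 3])] [:: (pLv, [:: V 4; V 5; V 6; V 0]); (pAc, [:: V 4; V 5; V 6; V 1])] (pLv, [:: K 2; V 2; V 3; V 2]);
  Clause [:: (euid, [:: V 0; V 1; V 2; V 3])] [:: (pLv, [:: V 4; V 5; V 6; V 0]); (pRv, [:: V 4; V 5; V 6; V 7])] (pLv, [:: K 2; V 2; V 3; V 2]);
  Clause [::] [:: (pLv, [:: K 2; V 0; V 1; V 0])] (pAc, [:: K 2; V 0; V 1; V 1]);
  Clause [::] [:: (pAc, [:: V 0; V 1; V 2; V 3]); (pOb, [:: V 0; V 1; V 2; V 3; V 4; V 5; V 6])] (pAT, [:: V 4; V 5; V 6]);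
  Clause [::] [:: (pAT, [:: V 0; V 1; V 2]); (pEq, [:: V 0; V 1; V 2; V 3; V 4; V 5])] (pAT, [:: V 3; V 4; V 5]);
  Clause [::] [:: (pAT, [:: V 0; V 1; V 2]); (pOb, [:: V 3; V 4; V 5; V 6; V 0; V 1; V 2])] (pAc, [:: V 3; V 4; V 5; V 6]);
  Clause [:: (emeth, [:: V 4; V 3; V 5])] [:: (pLv, [:: V 0; V 1; V 2; V 3])] (pRI, [:: V 0; V 1; V 2; V 4; K 0]);
  Clause [:: (einp, [:: V 3; V 4; V 5]); (esucc, [:: V 4; V 6])] [:: (pRI, [:: V 0; V 1; V 2; V 3; V 4]); (pAc, [:: V 0; V 1; V 2; V 5])] (pRI, [:: V 0; V 1; V 2; V 3; V 6]);
  Clause [:: (emeth, [:: V 3; V 5; V 4])] [:: (pRI, [:: V 0; V 1; V 2; V 3; V 4])] (pRv, [:: V 0; V 1; V 2; V 3]);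
  Clause [::] [:: (pRv, [:: V 0; V 1; V 2; V 3]); (pD, [:: V 3; V 4])] (pAc, [:: V 0; V 1; V 2; V 4]);
  Clause [::] [:: (pAc, [:: K 1; V 0; K 0; V 1]); (pLv, [:: V 2; V 3; V 4; V 0])] (pAc, [:: V 2; V 3; V 4; V 1]);
  Clause [:: (euid, [:: V 0; V 1; V 2; V 3])] [:: (pAc, [:: K 1; V 2; K 0; V 3]); (pLv, [:: V 4; V 5; V 6; V 0])] (pAc, [:: V 4; V 5; V 6; V 1]);
  Clause [::] [:: (pAc, [:: K 2; V 0; V 1; V 2]); (pLv, [:: V 3; V 4; V 5; V 0]); (pAc, [:: V 3; V 4; V 5; V 1])] (pAc, [:: V 3; V 4; V 5; V 2]);
  Clause [::] [:: (pRv, [:: K 2; V 0; V 1; V 2]); (pD, [:: V 2; V 1])] (pRev, [:: V 0; V 1]);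
  Clause [:: (euid, [:: V 0; V 1; V 2; V 3])] [::] (pU, [:: V 0; V 1; V 2; V 3]);
  Clause [:: (euid, [:: V 2; V 3; V 4; V 5])] [:: (pU, [:: V 0; V 1; V 2; V 3])] (pU, [:: V 0; V 1; V 4; V 5]);
  Clause [::] [:: (pRv, [:: V 0; V 1; V 2; V 3]); (pLv, [:: V 0; V 1; V 2; V 4])] (pE2, [:: V 4]);
  Clause [:: (euid, [:: V 0; V 1; V 2; V 3])] [:: (pE2, [:: V 0])] (pE2, [:: V 2]);
  Clause [::] [:: (pRv, [:: V 0; V 1; V 2; V 3]); (pD, [:: V 3; V 4]); (pOb, [:: V 0; V 1; V 2; V 4; V 5; V 6; V 7]); (pLv, [:: V 0; V 1; V 2; V 8])] (pP2, [:: V 5; V 6; V 7; V 8; V 4]);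
  Clause [::] [:: (pAc, [:: V 0; V 1; V 2; V 3]); (pOb, [:: V 0; V 1; V 2; V 3; V 4; V 5; V 6]); (pLv, [:: V 0; V 1; V 2; V 7]); (pU, [:: V 7; V 3; V 8; V 9]); (pRev, [:: V 8; V 9])] (pP2, [:: V 4; V 5; V 6; V 8; V 9]);
  Clause [:: (euid, [:: V 3; V 4; V 5; V 6])] [:: (pP2, [:: V 0; V 1; V 2; V 3; V 4])] (pP2, [:: V 0; V 1; V 2; V 5; V 6]);
  Clause [:: (euid, [:: V 5; V 6; V 3; V 4])] [:: (pP2, [:: V 0; V 1; V 2; V 3; V 4]); (pC, [:: V 3; V 4]); (pE2, [:: V 5])] (pP2, [:: V 0; V 1; V 2; V 5; V 6]);
  Clause [::] [:: (pP2, [:: V 0; V 1; V 2; V 3; V 4]); (pEq, [:: V 0; V 1; V 2; V 5; V 6; V 7])] (pP2, [:: V 5; V 6; V 7; V 3; V 4]);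
  Clause [:: (epos, [:: V 0; V 1])] [:: (pE2, [:: V 0])] (pO2, [:: V 0; V 1; V 0; V 1]);
  Clause [:: (euid, [:: V 2; V 3; V 4; V 5])] [:: (pO2, [:: V 0; V 1; V 2; V 3])] (pO2, [:: V 0; V 1; V 4; V 5]);
  Clause [:: (euid, [:: V 4; V 5; V 2; V 3])] [:: (pO2, [:: V 0; V 1; V 2; V 3]); (pC, [:: V 2; V 3]); (pE2, [:: V 4])] (pO2, [:: V 0; V 1; V 4; V 5]);
  Clause [:: (enul, [:: V 0; K 0; V 1; V 2; V 3; V 4; V 5; V 6])] [:: (pRv, [:: V 1; V 2; V 3; V 4]); (pLv, [:: V 1; V 2; V 3; V 5])] (pNO, [:: V 0]);
  Clause [:: (enul, [:: V 0; K 1; V 1; V 2; V 3; V 4; V 5; V 6])] [:: (pPi, [:: V 1; V 2; V 3; V 5; V 4])] (pNO, [:: V 0]);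
  Clause [:: (enul, [:: V 0; K 2; V 1; V 2; V 3; V 4; V 5; V 6])] [:: (pE2, [:: V 5])] (pNO, [:: V 0]);
  Clause [:: (enul, [:: V 0; V 1; V 2; V 3; V 4; V 5; V 6; V 7])] [:: (pNO, [:: V 0]); (pO2, [:: V 6; V 7; V 8; V 9])] (pPi, [:: K 3; V 0; K 0; V 8; V 9]);
  Clause [::] [:: (pP2, [:: V 0; V 1; V 2; V 3; V 4])] (pPi, [:: V 0; V 1; V 2; V 3; V 4]);
  Clause [:: (ekind, [:: V 0; V 1; V 2; V 3; V 4; V 5]); (eatm, [:: V 0; V 6]); (earg, [:: V 0; V 7; V 8]); (elab, [:: V 8; K 3; V 9; K 0]); (enul, [:: V 9; V 1; V 2; V 3; V 4; V 5; V 6; V 7])] [::] (pSO, [:: V 0; V 7]);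
  Clause [:: (ekind, [:: V 0; K 0; V 1; V 2; V 3; V 4]); (earg, [:: V 0; V 5; V 6]); (elab, [:: V 6; V 7; V 8; V 9])] [:: (pD, [:: V 4; V 5]); (pOb, [:: V 1; V 2; V 3; V 5; V 10; V 11; V 12]); (pEq, [:: V 10; V 11; V 12; V 7; V 8; V 9])] (pSO, [:: V 0; V 5]);
  Clause [:: (earg, [:: V 0; V 1; V 2]); (elab, [:: V 2; V 3; V 4; V 5]); (eatm, [:: V 0; V 6])] [:: (pC, [:: V 6; V 1]); (pPi, [:: V 3; V 4; V 5; V 6; V 1])] (pSO, [:: V 0; V 1]);
  Clause [:: (ekind, [:: V 0; K 1; V 1; V 2; V 3; V 4]); (earg, [:: V 0; V 4; V 5]); (elab, [:: V 5; V 1; V 2; V 3])] [::] (pSO, [:: V 0; V 4]);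
  Clause [:: (ekind, [:: V 0; K 0; V 1; V 2; V 3; V 4]); (eatm, [:: V 0; V 5])] [:: (pRv, [:: V 1; V 2; V 3; V 4]); (pLv, [:: V 1; V 2; V 3; V 5])] (pAO, [:: V 0; K 0]);
  Clause [:: (ekind, [:: V 0; K 1; V 1; V 2; V 3; V 4]); (eatm, [:: V 0; V 5])] [:: (pPi, [:: V 1; V 2; V 3; V 5; V 4])] (pAO, [:: V 0; K 0]);
  Clause [:: (ekind, [:: V 0; K 2; V 1; V 2; V 3; V 4]); (eatm, [:: V 0; V 5])] [:: (pE2, [:: V 5])] (pAO, [:: V 0; K 0]);
  Clause [:: (esucc, [:: V 1; V 2])] [:: (pAO, [:: V 0; V 1]); (pSO, [:: V 0; V 1])] (pAO, [:: V 0; V 2]);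
  Clause [:: (eJ, [:: K 0])] [::] (pAL, [:: K 0]);
  Clause [:: (easz, [:: V 0; V 1]); (esucc, [:: V 0; V 2])] [:: (pAL, [:: V 0]); (pAO, [:: V 0; V 1])] (pAL, [:: V 2]);
  Clause [:: (enq, [:: V 0])] [:: (pAL, [:: V 0])] (pGoal, [::])].

Section Rules.
Variable edb : nat -> seq nat -> Prop.
Notation der := (dl prog edb).

Definition dE (x0 : nat) : Prop := der pE [:: x0].
Definition dC (x0 : nat) (x1 : nat) : Prop := der pC [:: x0; x1].
Definition dFC (x0 : nat) (x1 : nat) : Prop := der pFC [:: x0; x1].
Definition dD (x0 : nat) (x1 : nat) : Prop := der pD [:: x0; x1].
Definition dFD (x0 : nat) (x1 : nat) (x2 : nat) : Prop := der pFD [:: x0; x1; x2].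
Definition dOb (x0 : tri) (x1 : nat) (x2 : tri) : Prop := der pOb [:: x0.1.1; x0.1.2; x0.2; x1; x2.1.1; x2.1.2; x2.2].
Definition dEq (x0 : tri) (x1 : tri) : Prop := der pEq [:: x0.1.1; x0.1.2; x0.2; x1.1.1; x1.1.2; x1.2].
Definition dFE (x0 : nat) (x1 : nat) (x2 : nat) (x3 : nat) : Prop := der pFE [:: x0; x1; x2; x3].
Definition dLv (x0 : tri) (x1 : nat) : Prop := der pLv [:: x0.1.1; x0.1.2; x0.2; x1].
Definition dAc (x0 : tri) (x1 : nat) : Prop := der pAc [:: x0.1.1; x0.1.2; x0.2; x1].
Definition dAT (x0 : tri) : Prop := der pAT [:: x0.1.1; x0.1.2; x0.2].
Definition dRI (x0 : tri) (x1 : nat) (x2 : nat) : Prop := der pRI [:: x0.1.1; x0.1.2; x0.2; x1; x2].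
Definition dRv (x0 : tri) (x1 : nat) : Prop := der pRv [:: x0.1.1; x0.1.2; x0.2; x1].
Definition dRev (x0 : nat) (x1 : nat) : Prop := der pRev [:: x0; x1].
Definition dU (x0 : nat) (x1 : nat) (x2 : nat) (x3 : nat) : Prop := der pU [:: x0; x1; x2; x3].
Definition dE2 (x0 : nat) : Prop := der pE2 [:: x0].
Definition dP2 (x0 : tri) (x1 : nat) (x2 : nat) : Prop := der pP2 [:: x0.1.1; x0.1.2; x0.2; x1; x2].
Definition dO2 (x0 : nat) (x1 : nat) (x2 : nat) (x3 : nat) : Prop := der pO2 [:: x0; x1; x2; x3].
Definition dNO (x0 : nat) : Prop := der pNO [:: x0].
Definition dPi (x0 : tri) (x1 : nat) (x2 : nat) : Prop := der pPi [:: x0.1.1; x0.1.2; x0.2; x1; x2].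
Definition dSO (x0 : nat) (x1 : nat) : Prop := der pSO [:: x0; x1].
Definition dAO (x0 : nat) (x1 : nat) : Prop := der pAO [:: x0; x1].
Definition dAL (x0 : nat) : Prop := der pAL [:: x0].
Definition dGoal : Prop := der pGoal [::].

Lemma rule_nth c i v : nth (Clause [::] [::] (0, [::])) prog i = c -> i < size prog ->
  holds edb v (c_edb c) -> holds der v (c_idb c) -> der (c_hd c).1 (tvals v (c_hd c).2).
Proof.
move=> <- il; apply: dl_rule.
elim: prog i il => //= c' p IH [|i] il; [by left | by right; apply: IH].
Qed.

Ltac rule i l := move=> *; refine (@rule_nth _ i (nth 0 l) erefl isT _ _); rewrite /=; repeat split; assumption.

Lemma E_atm (a R : nat) : edb eatm [:: a; R] -> dE R.
Proof. rule 0 [:: a; R]. Qed.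
Lemma E_uid (R i T j : nat) : edb euid [:: R; i; T; j] -> dE R -> dE T.
Proof. rule 1 [:: R; i; T; j]. Qed.
Lemma FC_0 (k R sz r : nat) : edb efd [:: k; R; sz; r] -> dFC k 0.
Proof. rule 2 [:: k; R; sz; r]. Qed.
Lemma FC_S (k i d R sz r i' : nat) : edb elhs [:: k; i; d] -> edb efd [:: k; R; sz; r] -> edb esucc [:: i; i'] -> dFC k i -> dC R d -> dFC k i'.
Proof. rule 3 [:: k; i; d; R; sz; r; i']. Qed.
Lemma C_fd (k R sz r : nat) : edb efd [:: k; R; sz; r] -> dFC k sz -> dC R r.
Proof. rule 4 [:: k; R; sz; r]. Qed.
(** All values of [R] at [i] occur in [T] at [j], where there is only one value. *)
Lemma C_uid (R i T j : nat) : edb euid [:: R; i; T; j] -> dC T j -> dC R i.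
Proof. rule 5 [:: R; i; T; j]. Qed.
Lemma D_inp (m i x : nat) : edb einp [:: m; i; x] -> dD m x.
Proof. rule 6 [:: m; i; x]. Qed.
Lemma D_C (m R sz j : nat) : edb emeth [:: m; R; sz] -> dC R j -> dD m j.
Proof. rule 7 [:: m; R; sz; j]. Qed.
Lemma FD_0 (k R sz r m sz' : nat) : edb efd [:: k; R; sz; r] -> edb emeth [:: m; R; sz'] -> dFD k m 0.
Proof. rule 8 [:: k; R; sz; r; m; sz']. Qed.
Lemma FD_S (k m i d i' : nat) : edb elhs [:: k; i; d] -> edb esucc [:: i; i'] -> dFD k m i -> dD m d -> dFD k m i'.
Proof. rule 9 [:: k; m; i; d; i']. Qed.
Lemma D_fd (k R sz r m : nat) : edb efd [:: k; R; sz; r] -> dFD k m sz -> dD m r.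
Proof. rule 10 [:: k; R; sz; r; m]. Qed.
Lemma D_unb (m j : nat) : edb eunb [:: m] -> edb eJ [:: j] -> dD m j.
Proof. rule 11 [:: m; j]. Qed.
Lemma Ob_arg (a j v : nat) : edb earg [:: a; j; v] -> dOb (0,a,0) j (0,v,0).
Proof. rule 12 [:: a; j; v]. Qed.
Lemma Ob_gen (R j : nat) : edb epos [:: R; j] -> dE R -> dOb (1,R,0) j (2,R,j).
Proof. rule 13 [:: R; j]. Qed.
Lemma Ob_const (R j : nat) (f : tri) : dLv f R -> dC R j -> dOb f j (1,R,j).
Proof. rule 14 [:: f.1.1; f.1.2; f.2; R; j]. Qed.
Lemma Eq_ob (j : nat) (f x y : tri) : dOb f j x -> dOb f j y -> dEq x y.
Proof. rule 15 [:: f.1.1; f.1.2; f.2; j; x.1.1; x.1.2; x.2; y.1.1; y.1.2; y.2]. Qed.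
Lemma Eq_sym (x y : tri) : dEq x y -> dEq y x.
Proof. rule 16 [:: x.1.1; x.1.2; x.2; y.1.1; y.1.2; y.2]. Qed.
Lemma Eq_trans (x y z : tri) : dEq x y -> dEq y z -> dEq x z.
Proof. rule 17 [:: x.1.1; x.1.2; x.2; y.1.1; y.1.2; y.2; z.1.1; z.1.2; z.2]. Qed.
Lemma FE_0 (k R sz r a b : nat) : edb efd [:: k; R; sz; r] -> edb eatm [:: a; R] -> edb eatm [:: b; R] -> dFE k a b 0.
Proof. rule 18 [:: k; R; sz; r; a; b]. Qed.
Lemma FE_S (k a b i d v u i' : nat) : edb elhs [:: k; i; d] -> edb earg [:: a; d; v] -> edb earg [:: b; d; u] -> edb esucc [:: i; i'] -> dFE k a b i -> dEq (0,v,0) (0,u,0) -> dFE k a b i'.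
Proof. rule 19 [:: k; a; b; i; d; v; u; i']. Qed.
Lemma Eq_fd (k R sz r a b v u : nat) : edb efd [:: k; R; sz; r] -> edb earg [:: a; r; v] -> edb earg [:: b; r; u] -> dFE k a b sz -> dEq (0,v,0) (0,u,0).
Proof. rule 20 [:: k; R; sz; r; a; b; v; u]. Qed.
Lemma Eq_uid (R i T j : nat) : edb euid [:: R; i; T; j] -> dC T j -> dE R -> dEq (1,R,i) (1,T,j).
Proof. rule 21 [:: R; i; T; j]. Qed.
Lemma Lv_atm (a R : nat) : edb eatm [:: a; R] -> dLv (0,a,0) R.
Proof. rule 22 [:: a; R]. Qed.
Lemma Lv_gen (R : nat) : dE R -> dLv (1,R,0) R.
Proof. rule 23 [:: R]. Qed.
(** The fact that a dependency demands for an accessible element starts a new type, in which at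
    first only the inherited position is known. *)
Lemma Lv_acc (R i T j : nat) (f : tri) : edb euid [:: R; i; T; j] -> dLv f R -> dAc f i -> dLv (2,T,j) T.
Proof. rule 24 [:: R; i; T; j; f.1.1; f.1.2; f.2]. Qed.
(** An access returns some element at every position of a revealed fact, determined or not, so all
    facts demanded by it inherit an accessible element. *)
Lemma Lv_rv (R i T j m : nat) (f : tri) : edb euid [:: R; i; T; j] -> dLv f R -> dRv f m -> dLv (2,T,j) T.
Proof. rule 25 [:: R; i; T; j; f.1.1; f.1.2; f.2; m]. Qed.
Lemma Ac_lv (T l : nat) : dLv (2,T,l) T -> dAc (2,T,l) l.
Proof. rule 26 [:: T; l]. Qed.
Lemma AT_ac (j : nat) (f x : tri) : dAc f j -> dOb f j x -> dAT x.
Proof. rule 27 [:: f.1.1; f.1.2; f.2; j; x.1.1; x.1.2; x.2]. Qed.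
Lemma AT_eq (x y : tri) : dAT x -> dEq x y -> dAT y.
Proof. rule 28 [:: x.1.1; x.1.2; x.2; y.1.1; y.1.2; y.2]. Qed.
Lemma Ac_AT (j : nat) (x f : tri) : dAT x -> dOb f j x -> dAc f j.
Proof. rule 29 [:: x.1.1; x.1.2; x.2; f.1.1; f.1.2; f.2; j]. Qed.
Lemma RI_0 (R m sz : nat) (f : tri) : edb emeth [:: m; R; sz] -> dLv f R -> dRI f m 0.
Proof. rule 30 [:: f.1.1; f.1.2; f.2; R; m; sz]. Qed.
Lemma RI_S (m i x i' : nat) (f : tri) : edb einp [:: m; i; x] -> edb esucc [:: i; i'] -> dRI f m i -> dAc f x -> dRI f m i'.
Proof. rule 31 [:: f.1.1; f.1.2; f.2; m; i; x; i']. Qed.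
Lemma Rv_in (m sz R : nat) (f : tri) : edb emeth [:: m; R; sz] -> dRI f m sz -> dRv f m.
Proof. rule 32 [:: f.1.1; f.1.2; f.2; m; sz; R]. Qed.
Lemma Ac_rv (m j : nat) (f : tri) : dRv f m -> dD m j -> dAc f j.
Proof. rule 33 [:: f.1.1; f.1.2; f.2; m; j]. Qed.
(** The generic fact stands for an arbitrary one, so what is accessible in it is accessible in every
    fact of the relation. *)
Lemma Ac_gen (R j : nat) (f : tri) : dAc (1,R,0) j -> dLv f R -> dAc f j.
Proof. rule 34 [:: R; j; f.1.1; f.1.2; f.2]. Qed.
Lemma Ac_uid (R i T j : nat) (f : tri) : edb euid [:: R; i; T; j] -> dAc (1,T,0) j -> dLv f R -> dAc f i.
Proof. rule 35 [:: R; i; T; j; f.1.1; f.1.2; f.2]. Qed.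
(** A fact of [T] whose position [l] is accessible is an instance of the type [(2,T,l)]. *)
Lemma Ac_chd (T l j : nat) (f : tri) : dAc (2,T,l) j -> dLv f T -> dAc f l -> dAc f j.
Proof. rule 36 [:: T; l; j; f.1.1; f.1.2; f.2]. Qed.
Lemma Rev_in (T l m : nat) : dRv (2,T,l) m -> dD m l -> dRev T l.
Proof. rule 37 [:: T; l; m]. Qed.
Lemma U_uid (R i T j : nat) : edb euid [:: R; i; T; j] -> dU R i T j.
Proof. rule 38 [:: R; i; T; j]. Qed.
Lemma U_trans (R i S k T j : nat) : edb euid [:: S; k; T; j] -> dU R i S k -> dU R i T j.
Proof. rule 39 [:: R; i; S; k; T; j]. Qed.
Lemma E2_rv (m R : nat) (f : tri) : dRv f m -> dLv f R -> dE2 R.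
Proof. rule 40 [:: f.1.1; f.1.2; f.2; m; R]. Qed.
Lemma E2_uid (R i T j : nat) : edb euid [:: R; i; T; j] -> dE2 R -> dE2 T.
Proof. rule 41 [:: R; i; T; j]. Qed.
Lemma P2_rv (m j R : nat) (f x : tri) : dRv f m -> dD m j -> dOb f j x -> dLv f R -> dP2 x R j.
Proof. rule 42 [:: f.1.1; f.1.2; f.2; m; j; x.1.1; x.1.2; x.2; R]. Qed.
(** A dependency demands a [T]-fact with the accessible [x] at [l]. It is revealed by a method that
    determines [l], so [x] itself shows there, in the second world too. *)
Lemma P2_chd (j R T l : nat) (f x : tri) : dAc f j -> dOb f j x -> dLv f R -> dU R j T l -> dRev T l -> dP2 x T l.
Proof. rule 43 [:: f.1.1; f.1.2; f.2; j; x.1.1; x.1.2; x.2; R; T; l]. Qed.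
Lemma P2_uid (R i T j : nat) (x : tri) : edb euid [:: R; i; T; j] -> dP2 x R i -> dP2 x T j.
Proof. rule 44 [:: x.1.1; x.1.2; x.2; R; i; T; j]. Qed.
(** Some fact of [R] exists in the second world, and its entry at [i] occurs in [T] at [j], where
    [x] is the only value. *)
Lemma P2_back (T j R i : nat) (x : tri) : edb euid [:: R; i; T; j] -> dP2 x T j -> dC T j -> dE2 R -> dP2 x R i.
Proof. rule 45 [:: x.1.1; x.1.2; x.2; T; j; R; i]. Qed.
Lemma P2_eq (T l : nat) (x y : tri) : dP2 x T l -> dEq x y -> dP2 y T l.
Proof. rule 46 [:: x.1.1; x.1.2; x.2; T; l; y.1.1; y.1.2; y.2]. Qed.
Lemma O2_refl (R j : nat) : edb epos [:: R; j] -> dE2 R -> dO2 R j R j.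
Proof. rule 47 [:: R; j]. Qed.
Lemma O2_uid (S k R i T j : nat) : edb euid [:: R; i; T; j] -> dO2 S k R i -> dO2 S k T j.
Proof. rule 48 [:: S; k; R; i; T; j]. Qed.
Lemma O2_back (S k T j R i : nat) : edb euid [:: R; i; T; j] -> dO2 S k T j -> dC T j -> dE2 R -> dO2 S k R i.
Proof. rule 49 [:: S; k; T; j; R; i]. Qed.
Lemma NO_root (z m T j : nat) (f : tri) : edb enul [:: z; 0; f.1.1; f.1.2; f.2; m; T; j] -> dRv f m -> dLv f T -> dNO z.
Proof. rule 50 [:: z; f.1.1; f.1.2; f.2; m; T; j]. Qed.
Lemma NO_chd (z l T j : nat) (y : tri) : edb enul [:: z; 1; y.1.1; y.1.2; y.2; l; T; j] -> dPi y T l -> dNO z.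
Proof. rule 51 [:: z; y.1.1; y.1.2; y.2; l; T; j]. Qed.
Lemma NO_top (z l T j : nat) (y : tri) : edb enul [:: z; 2; y.1.1; y.1.2; y.2; l; T; j] -> dE2 T -> dNO z.
Proof. rule 52 [:: z; y.1.1; y.1.2; y.2; l; T; j]. Qed.
Lemma Pi_null (z s l T j R i : nat) (y : tri) : edb enul [:: z; s; y.1.1; y.1.2; y.2; l; T; j] -> dNO z -> dO2 T j R i -> dPi (3,z,0) R i.
Proof. rule 53 [:: z; s; y.1.1; y.1.2; y.2; l; T; j; R; i]. Qed.
Lemma Pi_core (R i : nat) (x : tri) : dP2 x R i -> dPi x R i.
Proof. rule 54 [:: x.1.1; x.1.2; x.2; R; i]. Qed.
(** The null was born in the very fact that serves as image of the atom: the descriptions of null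
    and atom coincide. *)
Lemma SO_null (a s l R j v z : nat) (y : tri) : edb ekind [:: a; s; y.1.1; y.1.2; y.2; l] -> edb eatm [:: a; R] -> edb earg [:: a; j; v] -> edb elab [:: v; 3; z; 0] -> edb enul [:: z; s; y.1.1; y.1.2; y.2; l; R; j] -> dSO a j.
Proof. rule 55 [:: a; s; y.1.1; y.1.2; y.2; l; R; j; v; z]. Qed.
Lemma SO_root (a m j v : nat) (f y x : tri) : edb ekind [:: a; 0; f.1.1; f.1.2; f.2; m] -> edb earg [:: a; j; v] -> edb elab [:: v; y.1.1; y.1.2; y.2] -> dD m j -> dOb f j x -> dEq x y -> dSO a j.
Proof. rule 56 [:: a; f.1.1; f.1.2; f.2; m; j; v; y.1.1; y.1.2; y.2; x.1.1; x.1.2; x.2]. Qed.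
(** At a constant position every fact of [R] carries the label as soon as one does. *)
Lemma SO_const (a j v R : nat) (y : tri) : edb earg [:: a; j; v] -> edb elab [:: v; y.1.1; y.1.2; y.2] -> edb eatm [:: a; R] -> dC R j -> dPi y R j -> dSO a j.
Proof. rule 57 [:: a; j; v; y.1.1; y.1.2; y.2; R]. Qed.
Lemma SO_chd (a l v : nat) (y : tri) : edb ekind [:: a; 1; y.1.1; y.1.2; y.2; l] -> edb earg [:: a; l; v] -> edb elab [:: v; y.1.1; y.1.2; y.2] -> dSO a l.
Proof. rule 58 [:: a; y.1.1; y.1.2; y.2; l; v]. Qed.
Lemma AO_root (a m R : nat) (f : tri) : edb ekind [:: a; 0; f.1.1; f.1.2; f.2; m] -> edb eatm [:: a; R] -> dRv f m -> dLv f R -> dAO a 0.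
Proof. rule 59 [:: a; f.1.1; f.1.2; f.2; m; R]. Qed.
Lemma AO_chd (a l R : nat) (y : tri) : edb ekind [:: a; 1; y.1.1; y.1.2; y.2; l] -> edb eatm [:: a; R] -> dPi y R l -> dAO a 0.
Proof. rule 60 [:: a; y.1.1; y.1.2; y.2; l; R]. Qed.
Lemma AO_top (a l R : nat) (y : tri) : edb ekind [:: a; 2; y.1.1; y.1.2; y.2; l] -> edb eatm [:: a; R] -> dE2 R -> dAO a 0.
Proof. rule 61 [:: a; y.1.1; y.1.2; y.2; l; R]. Qed.
Lemma AO_S (a i i' : nat) : edb esucc [:: i; i'] -> dAO a i -> dSO a i -> dAO a i'.
Proof. rule 62 [:: a; i; i']. Qed.
Lemma AL_0 : edb eJ [:: 0] -> dAL 0.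
Proof. rule 63 [:: 0]. Qed.
Lemma AL_S (i sz i' : nat) : edb easz [:: i; sz] -> edb esucc [:: i; i'] -> dAL i -> dAO i sz -> dAL i'.
Proof. rule 64 [:: i; sz; i']. Qed.
Lemma Goal_in (n : nat) : edb enq [:: n] -> dAL n -> dGoal .
Proof. rule 65 [:: n]. Qed.
End Rules.
End DatalogProgram.

(** * Extensional facts read off the input *)

Module ExtensionalFacts.
Import Defs DatalogSyntax DatalogProgram.
Import all_boot zify.
Import boolp.

Section Edb.
Variables (S : schema) (q : bcq) (J : nat -> bool) (g : nat -> seq nat -> bool).

Definition dfd := FD 0 [::] 0.
Definition dmeth := Method 0 [::] None.
Definition datm : atom := (0, [::]).
Definition nfd k := nth dfd (s_fd S) k.
Definition nmeth m := nth dmeth (s_meth S) m.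
Definition natm a := nth datm q a.

(** [J] confines the facts that the input does not list explicitly, so derivations stay in a finite
    domain. The parameter [g] stands for the guess; the worlds are built with the empty one. *)
Definition sedb (t : nat) (a : seq nat) : bool :=
  match t, a with
  | 0, [:: us; up; ut; tp] =>
      has (fun u => [&& u_src u == us, u_spos u == up, u_tgt u == ut & u_tpos u == tp]) (s_uid S)
  | 1, [:: k; R; sz; r] => [&& k < size (s_fd S), f_rel (nfd k) == R, size (f_lhs (nfd k)) == sz & f_rhs (nfd k) == r]
  | 2, [:: k; i; d] => [&& k < size (s_fd S), i < size (f_lhs (nfd k)) & nth 0 (f_lhs (nfd k)) i == d]
  | 3, [:: m; R; sz] => [&& m < size (s_meth S), m_rel (nmeth m) == R & size (m_in (nmeth m)) == sz]
  | 4, [:: m; i; x] => [&& m < size (s_meth S), i < size (m_in (nmeth m)) & nth 0 (m_in (nmeth m)) i == x]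
  | 5, [:: m] => (m < size (s_meth S)) && (m_bound (nmeth m) == None)
  | 6, [:: a; R] => (a < size q) && ((natm a).1 == R)
  | 7, [:: a; j; v] => [&& a < size q, j < size (natm a).2 & nth 0 (natm a).2 j == v]
  | 8, [:: a; sz] => (a < size q) && (size (natm a).2 == sz)
  | 9, [:: n] => n == size q
  | 10, [:: R; j] => is_pos S R j && J j
  | 11, [:: j] => J j
  | 12, [:: i; i'] => [&& i' == i.+1, J i & J i']
  | 13, _ | 14, _ | 15, _ => g t a && all J a
  | _, _ => false
  end.
End Edb.

Lemma dl_mono p (e1 e2 : nat -> seq nat -> Prop) t a : (forall t a, e1 t a -> e2 t a) -> dl p e1 t a -> dl p e2 t a.
Proof.
move=> H h; apply: h => c v hc /holdsP he /holdsP hi; apply: dl_rule => //; apply/holdsP => // b hb.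
by apply: H; exact: he.
Qed.

(* [J] contains every number that can occur in a derivation, and [js] stands for the positions not mentioned in the input. *)
Record admissible S q (J : nat -> bool) (js : nat) : Prop := Admissible {
  adm_edb : forall t a, t < 10 -> sedb S q J (fun _ _ => false) t a -> all J a;
  adm_small : forall i, i <= \sum_(a <- q) (size a.2).+1 + \sum_(f <- s_fd S) (size (f_lhs f)).+1
                 + \sum_(m <- s_meth S) (size (m_in m)).+1 + 50 -> J i;
  adm_js : J js;
  adm_fresh : forall m i, ~ sedb S q J (fun _ _ => false) 4 [:: m; i; js];
  adm_fresh_fd : forall k R sz, ~ sedb S q J (fun _ _ => false) 1 [:: k; R; sz; js];
  adm_fresh_uid : forall R T i, ~ sedb S q J (fun _ _ => false) 0 [:: R; js; T; i]
}.

Definition guess (lf : nat -> nat * nat * nat) (kf : nat -> nat * (nat * nat * nat) * nat)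
    (nf : nat -> nat * (nat * nat * nat) * nat * nat * nat) (t : nat) (a : seq nat) : bool :=
  match t, a with
  | 13, [:: v; x; y; z] => (x, y, z) == lf v
  | 14, [:: a; s; x; y; z; l] => (s, (x, y, z), l) == kf a
  | 15, [:: n; s; x; y; z; l; T; j] => (s, (x, y, z), l, T, j) == nf n
  | _, _ => false
  end.
End ExtensionalFacts.

(** * Consequences of derivability, and the elements of the two worlds *)

Module ProgramFacts.
Import Defs DatalogSyntax DatalogProgram ExtensionalFacts.
Import all_boot zify.
Import boolp.

Lemma hasIn T (p : T -> bool) (s : seq T) : has p s <-> exists x, List.In x s /\ p x.
Proof.
elim: s => [|x s IH] /=; first by split=> // -[x []].
split=> [/orP[px|/IH[y [ys py]]]|[y [[<-|ys] py]]].
- by exists x; split; [left|].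
- by exists y; split; [right|].
- by rewrite py.
by apply/orP; right; apply/IH; exists y.
Qed.

Lemma allIn T (p : T -> bool) (s : seq T) x : all p s -> List.In x s -> p x.
Proof. by elim: s => //= y s IH /andP[py ps] [<-|]; [|exact: IH]. Qed.

Lemma In_nth T (d : T) (s : seq T) i : i < size s -> List.In (nth d s i) s.
Proof. by elim: s i => //= y s IH [|i] h; [left | right; exact: IH]. Qed.

Lemma In_ex_nth T (d : T) (s : seq T) x : List.In x s -> exists2 i, i < size s & nth d s i = x.
Proof.
elim: s => //= y s IH [<-|/IH[i h <-]]; first by exists 0.
by exists i.+1.
Qed.

Ltac dl_each := lazymatch goal with |- _ /\ _ => split; [ | dl_each ] | |- _ => idtac end.
Ltac dl_induct := apply: dl_cases; cbn -[sedb dl]; dl_each; try by []; try by move=> ? _ _ [].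
Ltac dl_induct2 := apply: dl_cases; cbn -[sedb dl leq onth nth mem in_mem eq_op is_true]; dl_each; try by []; try by move=> ? _ _ [].

(** Facts by origin: a query atom, the generic fact of [R] in world [w], or the [T]-fact created for
    the element [e] at position [l]. *)
Inductive vf (X : Type) := VQ (a : nat) | VG (w : bool) (R : nat) | VT (e : X) (T l : nat).
(** Elements by origin: a class of objects, a class of constants private to the second world, an
    entry born at slot [j] of a fact, and the entry at an undetermined position [j] of the [k]-th
    copy of a fact revealed by [m]. *)
Inductive elt :=
| ET (x : tri)
| EK (p : nat * nat)
| ES (v : vf elt) (j : nat)
| EF (v : vf elt) (m k j : nat).
Arguments VQ {X}. Arguments VG {X}.

Section Basics.
Variables (S : schema) (q : bcq) (J : nat -> bool) (js : nat) (g : nat -> seq nat -> bool).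
Hypothesis wfS : wf_schema S.
Hypothesis wfq : wf_query S q.
Hypothesis adm : admissible S q J js.
Notation edb := (fun t a => is_true (sedb S q J g t a)).

Notation E := (dE edb). Notation C := (dC edb). Notation D := (dD edb). Notation Ob := (dOb edb).
Notation Eq := (dEq edb). Notation Lv := (dLv edb). Notation Ac := (dAc edb). Notation AT := (dAT edb).
Notation Rv := (dRv edb). Notation Rev := (dRev edb). Notation U := (dU edb). Notation E2 := (dE2 edb).
Notation P2 := (dP2 edb). Notation O2 := (dO2 edb).

Lemma edb_all t a : t < 10 -> edb t a -> all J a.
Proof.
move=> t10 h; apply: (adm_edb adm t10); move: h => /=.
by move: t t10; do 10 (case=> [//|]).
Qed.

Lemma uidP R i T j : edb euid [:: R; i; T; j] <-> List.In (UID R i T j) (s_uid S).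
Proof.
split=> [/hasIn [[a b c d] [h /and4P[/eqP<- /eqP<- /eqP<- /eqP<-]]]|h] //.
by apply/hasIn; exists (UID R i T j); rewrite /= !eqxx.
Qed.

Lemma uid_pos R i T j : edb euid [:: R; i; T; j] ->
  [/\ is_pos S R i, is_pos S T j, J i, J j & (J R) * (J T)].
Proof.
move=> h; have /= := edb_all (isT : 0 < 10) h; case/and5P=> JR Ji JT Jj _.
move/uidP: h => h; have [W _] := wfS; have := allIn W h.
by rewrite /wf_uid /= => /andP[h1 h2]; split.
Qed.

Lemma fd_wf k R sz r : edb efd [:: k; R; sz; r] ->
  [/\ is_pos S R r, J r & List.In (nfd S k) (s_fd S)] /\
  forall i, i < sz -> is_pos S R (nth 0 (f_lhs (nfd S k)) i) /\ J (nth 0 (f_lhs (nfd S k)) i).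
Proof.
move=> h; have /= := edb_all (isT : 1 < 10) h; case/and5P=> Jk JR Jsz Jr _.
move: h => /= /and4P[hk /eqP eR /eqP es /eqP er].
have hin : List.In (nfd S k) (s_fd S) by apply: In_nth.
have [_ [W _]] := wfS; have := allIn W hin; rewrite /wf_fd eR er => /andP[h1 /all_nthP h2].
split=> // i il; split; first by apply: h2; rewrite es.
have h : edb elhs [:: k; i; nth 0 (f_lhs (nfd S k)) i] by rewrite /= hk es il eqxx.
by have /= /and4P[] := edb_all (isT : 2 < 10) h.
Qed.

Lemma J_small i : i <= 50 -> J i.
Proof. by move=> h; apply: (adm_small adm); lia. Qed.

Lemma leq_sum_In T (F : T -> nat) (s : seq T) x : List.In x s -> F x <= \sum_(y <- s) F y.
Proof.
elim: s => //= y s IH [->|/IH h]; rewrite big_cons; first exact: leq_addr.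
by apply: leq_trans h _; exact: leq_addl.
Qed.

Lemma J_fd k i : k < size (s_fd S) -> i <= size (f_lhs (nfd S k)) -> J i.
Proof.
move=> hk hi; apply: (adm_small adm).
have := @leq_sum_In _ (fun f => (size (f_lhs f)).+1) _ _ (In_nth dfd hk); rewrite -/(nfd S k); lia.
Qed.

Lemma J_meth m i : m < size (s_meth S) -> i <= size (m_in (nmeth S m)) -> J i.
Proof.
move=> hk hi; apply: (adm_small adm).
have := @leq_sum_In _ (fun m => (size (m_in m)).+1) _ _ (In_nth dmeth hk); rewrite -/(nmeth S m); lia.
Qed.

Lemma J_atm a i : a < size q -> i <= size (natm q a).2 -> J i.
Proof.
move=> hk hi; apply: (adm_small adm).
have := @leq_sum_In _ (fun a : atom => (size a.2).+1) _ _ (In_nth datm hk); rewrite -/(natm q a); lia.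
Qed.

Lemma J_q i : i <= size q -> J i.
Proof.
move=> hi; apply: (adm_small adm).
have : size q <= \sum_(a <- q) (size a.2).+1; last by lia.
by elim: (q) => //= a s IH; rewrite big_cons; lia.
Qed.

Lemma atm_wf a R : edb eatm [:: a; R] -> [/\ a < size q, (natm q a).1 = R, is_rel S R & size (natm q a).2 = arity S R].
Proof.
move=> /= /andP[h /eqP e]; split=> //.
  by have := allIn wfq (In_nth datm h); rewrite -/(natm q a) e => /andP[].
by have := allIn wfq (In_nth datm h); rewrite -/(natm q a) e => /andP[_ /eqP].
Qed.

Lemma C_pos R j : C R j -> [/\ is_pos S R j, J j & j <> js].
Proof.
move: R j; suff H : forall t a, dl prog edb t a ->
  (match t, a with pC, [:: R; j] => [/\ is_pos S R j, J j & j <> js] | _, _ => True end).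
  by move=> R j /H.
apply: dl_cases; repeat (split; [by []|]); split.
  move=> v /= h _ _; have [[h1 h2 _] _] := fd_wf h; split=> // e.
  by move: h; rewrite e; exact: (adm_fresh_fd adm).
split.
  move=> v /= h _ _; have [h1 h2 h3 h4 _] := uid_pos h; split=> // e.
  by move: h; rewrite e; exact: (adm_fresh_uid adm).
by repeat (split; [by []|]).
Qed.

Lemma E_rel R : E R -> is_rel S R.
Proof.
move: R; suff H : forall t a, dl prog edb t a ->
  (match t, a with pE, [:: R] => is_rel S R | _, _ => True end) by move=> R /H.
dl_induct; first by move=> v /atm_wf[].
by move=> v /uid_pos[_ /andP[]].
Qed.

Lemma Lv_inv f R : Lv f R -> E R /\
  [\/ edb eatm [:: f.1.2; R] /\ f = (0, f.1.2, 0), f = (1, R, 0) | f = (2, R, f.2)].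
Proof.
move: f R; suff H : forall t a, dl prog edb t a ->
  (match t, a with pE, [:: R] => E R
   | pLv, [:: x; y; z; R] => E R /\ [\/ edb eatm [:: y; R] /\ (x, y, z) = (0, y, 0), (x, y, z) = (1, R, 0) | (x, y, z) = (2, R, z)] | _, _ => True end).
  by move=> [[x y] z] R /H.
dl_induct.
- by move=> v h _ _; exact: E_atm h.
- by move=> v h _ h1; exact: E_uid h h1.
- by move=> v h _ _; split; [exact: E_atm h | exact: Or31].
- by move=> v _ h _; split=> //; exact: Or32.
- by move=> v h _ [[h1 _] _]; split; [exact: E_uid h h1 | exact: Or33].
- by move=> v h _ [[h1 _] _]; split; [exact: E_uid h h1 | exact: Or33].
Qed.

Lemma Lv_fun f R R' : Lv f R -> Lv f R' -> R = R'.
Proof.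
move=> /Lv_inv[_ h1] /Lv_inv[_ h2]; case: h1 => [[h1 e1]|e1|e1]; case: h2 => [[h2 e2]|e2|e2]; try by rewrite e1 in e2; case: e2.
by case: (atm_wf h1) (atm_wf h2) => _ -> _ _ [].
Qed.

Lemma succJ i : J i -> J i.+1 -> edb esucc [:: i; i.+1].
Proof. by move=> h1 h2; rewrite /= eqxx h1 h2. Qed.

Lemma fd_sz k R sz r : edb efd [:: k; R; sz; r] -> [/\ k < size (s_fd S), sz = size (f_lhs (nfd S k)), f_rel (nfd S k) = R & f_rhs (nfd S k) = r].
Proof. by move=> /= /and4P[h /eqP-> /eqP-> /eqP->]. Qed.

Lemma fd_lhs k R sz r i : edb efd [:: k; R; sz; r] -> i < sz -> edb elhs [:: k; i; nth 0 (f_lhs (nfd S k)) i] /\ edb esucc [:: i; i.+1].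
Proof.
move=> /fd_sz[hk -> _ _] il; split; first by rewrite /= hk il eqxx.
by apply: succJ; apply: J_fd hk _ => //; exact: ltnW.
Qed.

(** Hides the loop over the left-hand side that the program runs with an auxiliary predicate. *)
Lemma C_fd' k R sz r : edb efd [:: k; R; sz; r] ->
  (forall i, i < sz -> C R (nth 0 (f_lhs (nfd S k)) i)) -> C R r.
Proof.
move=> h H; apply: (C_fd h); suff G i : i <= sz -> dFC edb k i by exact: G.
elim: i => [|i IH] il; first exact: FC_0 h.
have [h1 h2] := fd_lhs h il; exact: (FC_S h1 h h2 (IH (ltnW il)) (H i il)).
Qed.

Lemma D_fd' k R sz r m sz' : edb efd [:: k; R; sz; r] -> edb emeth [:: m; R; sz'] ->
  (forall i, i < sz -> D m (nth 0 (f_lhs (nfd S k)) i)) -> D m r.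
Proof.
move=> h hm H; apply: (D_fd h); suff G i : i <= sz -> dFD edb k m i by exact: G.
elim: i => [|i IH] il; first exact: FD_0 h hm.
have [h1 h2] := fd_lhs h il; exact: (FD_S h1 h2 (IH (ltnW il)) (H i il)).
Qed.

Definition var a j := nth 0 (natm q a).2 j.

Lemma argP a j : a < size q -> j < size (natm q a).2 -> edb earg [:: a; j; var a j].
Proof. by move=> h1 h2; rewrite /= h1 h2 eqxx. Qed.

Lemma arg_inv a j v : edb earg [:: a; j; v] -> [/\ a < size q, j < size (natm q a).2 & v = var a j].
Proof. by move=> /= /and3P[h1 h2 /eqP<-]. Qed.

Lemma atm_argP a R j : edb eatm [:: a; R] -> is_pos S R j -> edb earg [:: a; j; var a j] /\ J j.
Proof.
move=> /atm_wf[h1 h2 h3 h4] /andP[_ h5]; rewrite -h4 in h5; split; first exact: argP.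
by apply: J_atm h1 _; exact: ltnW.
Qed.

Lemma Eq_fd' k R sz r a b : edb efd [:: k; R; sz; r] -> edb eatm [:: a; R] -> edb eatm [:: b; R] ->
  (forall i, i < sz -> Eq (0, var a (nth 0 (f_lhs (nfd S k)) i), 0) (0, var b (nth 0 (f_lhs (nfd S k)) i), 0)) ->
  Eq (0, var a r, 0) (0, var b r, 0).
Proof.
move=> h ha hb H; have [[pr _ _] pl] := fd_wf h.
have [a1 _] := atm_argP ha pr; have [b1 _] := atm_argP hb pr.
apply: (Eq_fd h a1 b1); suff G i : i <= sz -> dFE edb k a b i by exact: G.
elim: i => [|i IH] il; first exact: FE_0 h ha hb.
have [h1 h2] := fd_lhs h il; have [pi _] := pl i il.
have [a2 _] := atm_argP ha pi; have [b2 _] := atm_argP hb pi.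
exact: (FE_S h1 a2 b2 h2 (IH (ltnW il)) (H i il)).
Qed.

Lemma meth_inv m R sz : edb emeth [:: m; R; sz] ->
  [/\ m < size (s_meth S), m_rel (nmeth S m) = R & sz = size (m_in (nmeth S m))].
Proof. by move=> /= /and3P[h /eqP-> /eqP->]. Qed.

Lemma methP m : m < size (s_meth S) -> edb emeth [:: m; m_rel (nmeth S m); size (m_in (nmeth S m))].
Proof. by move=> h; rewrite /= h !eqxx. Qed.

Lemma inpP m i : m < size (s_meth S) -> i < size (m_in (nmeth S m)) ->
  edb einp [:: m; i; nth 0 (m_in (nmeth S m)) i] /\ edb esucc [:: i; i.+1].
Proof.
move=> h il; split; first by rewrite /= h il eqxx.
by apply: succJ; apply: J_meth h _ => //; exact: ltnW.
Qed.

Lemma inp_pos m x : m < size (s_meth S) -> x \in m_in (nmeth S m) ->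
  [/\ J x, is_pos S (m_rel (nmeth S m)) x, D m x & exists2 i, i < size (m_in (nmeth S m)) & nth 0 (m_in (nmeth S m)) i = x].
Proof.
move=> h hx; have /(nthP 0) [i il e] := hx.
have [h1 h2] := inpP h il; rewrite e in h1.
have /= /and4P[_ _ Jx _] := edb_all (isT : 4 < 10) h1.
have [_ [_ W]] := wfS; have := allIn W (In_nth dmeth h); rewrite -/(nmeth S m).
case/and4P=> _ /allP/(_ x hx) px _ _; split=> //; last by exists i.
exact: D_inp h1.
Qed.

Lemma Rv_in' f m : m < size (s_meth S) -> Lv f (m_rel (nmeth S m)) ->
  (forall x, x \in m_in (nmeth S m) -> Ac f x) -> Rv f m.
Proof.
move=> hm hl H; have h := methP hm; apply: (Rv_in h).
suff G i : i <= size (m_in (nmeth S m)) -> dRI edb f m i by exact: G.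
elim: i => [|i IH] il; first exact: RI_0 h hl.
have [h1 h2] := inpP hm il; apply: (RI_S h1 h2 (IH (ltnW il))).
by apply: H; exact: mem_nth.
Qed.

Lemma Rv_inv f m : Rv f m -> m < size (s_meth S) /\ Lv f (m_rel (nmeth S m)).
Proof.
move: f m; suff H : forall t a, dl prog edb t a ->
  (match t, a with pRI, [:: x; y; z; m; i] => m < size (s_meth S) /\ Lv (x, y, z) (m_rel (nmeth S m))
   | pRv, [:: x; y; z; m] => m < size (s_meth S) /\ Lv (x, y, z) (m_rel (nmeth S m)) | _, _ => True end).
  by move=> [[x y] z] m /H.
dl_induct.
by move=> v /meth_inv[h e _] hl _; rewrite e.
Qed.

Lemma D_inv m j : D m j -> m < size (s_meth S) /\
  (is_pos S (m_rel (nmeth S m)) j /\ J j /\ j <> js \/ m_bound (nmeth S m) = None /\ J j).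
Proof.
move: m j; suff H : forall t a, dl prog edb t a ->
  (match t, a with pFD, [:: k; m; i] => m < size (s_meth S) /\ f_rel (nfd S k) = m_rel (nmeth S m)
   | pD, [:: m; j] => m < size (s_meth S) /\
  (is_pos S (m_rel (nmeth S m)) j /\ J j /\ j <> js \/ m_bound (nmeth S m) = None /\ J j) | _, _ => True end).
  by move=> m j /H.
dl_induct.
- move=> v h _ _; have := h => /= /and3P[hm hi /eqP e]; split=> //; left.
  have /(inp_pos hm)[h1 h2 h3 _] : v 2 \in m_in (nmeth S (v 0)) by rewrite -e mem_nth.
  by do !split=> //; move=> e'; apply: (adm_fresh adm (m := v 0) (i := v 1)); rewrite -e'; exact: h.
- by move=> v /meth_inv[h1 h2 _] /C_pos[h3 h4 h5] _; split=> //; left; rewrite h2.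
- by move=> v [/fd_sz[_ _ e1 _] /meth_inv[h1 e2 _]] _ _; rewrite e1 e2.
- move=> v h _ [h1 h2]; split=> //; left; have [[h3 h4 _] _] := fd_wf h.
  move/fd_sz: (h) => [_ _ e _]; rewrite -h2 e; do !split=> //.
  by move=> e'; move: h; rewrite e'; exact: (adm_fresh_fd adm).
- by move=> v [/andP[h /eqP h1] h2] _ _; split=> //; right.
Qed.

Lemma E2_E R : E2 R -> E R.
Proof.
move: R; suff H : forall t a, dl prog edb t a -> (match t, a with pE2, [:: R] => E R | _, _ => True end) by move=> R /H.
dl_induct; first by move=> v _ [_ h] _; case: (@Lv_inv (_, _, _) _ h).
by move=> v h _ h1; exact: E_uid h h1.
Qed.

Lemma U_facts R i T j : U R i T j ->
  [/\ is_pos S R i, is_pos S T j & (J i * J j)%type] /\ [/\ (E R -> E T), (C T j -> C R i) & (E2 R -> E2 T)].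
Proof.
move: R i T j; suff H : forall t a, dl prog edb t a ->
  (match t, a with pU, [:: R; i; T; j] => [/\ is_pos S R i, is_pos S T j & (J i * J j)%type] /\ [/\ (E R -> E T), (C T j -> C R i) & (E2 R -> E2 T)] | _, _ => True end).
  by move=> R i T j /H.
dl_induct.
- move=> v h _ _; have [h1 h2 h3 h4 _] := uid_pos h; split; split=> //; [exact: E_uid h | exact: C_uid h | exact: E2_uid h].
- move=> v h _ [[h1 h2 h3] [k1 k2 k3]]; have [g1 g2 g3 g4 _] := uid_pos h; split; split=> //; first by rewrite h3 g4.
  + by move/k1; exact: E_uid h.
  + by move=> c; apply: k2; exact: C_uid h c.
  + by move/k3; exact: E2_uid h.
Qed.

Lemma U_cat R i T l T' l' : U R i T l -> U T l T' l' -> U R i T' l'.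
Proof.
move=> h1 h2; move: T l T' l' h2 h1; suff H : forall t a, dl prog edb t a ->
  (match t, a with pU, [:: T; l; T'; l'] => U R i T l -> U R i T' l' | _, _ => True end).
  by move=> T l T' l' /H.
dl_induct; first by move=> v h _ _ hu; exact: U_trans h hu.
by move=> v h _ H hu; exact: U_trans h (H hu).
Qed.

Lemma U_ac R i T l : U R i T l -> E R -> Ac (1, T, 0) l -> Ac (1, R, 0) i.
Proof.
move: R i T l; suff H : forall t a, dl prog edb t a ->
  (match t, a with pU, [:: R; i; T; l] => E R -> Ac (1, T, 0) l -> Ac (1, R, 0) i | _, _ => True end).
  by move=> R i T l /H.
dl_induct; first by move=> v h _ _ hE hA; exact: Ac_uid h hA (Lv_gen hE).
move=> v h hu H hE hA; apply: H => //; have [_ [H1 _ _]] := U_facts hu.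
exact: Ac_uid h hA (Lv_gen (H1 hE)).
Qed.

Lemma U_live R i T l f : U R i T l -> Lv f R -> (Ac f i \/ exists m, Rv f m) -> Lv (2, T, l) T.
Proof.
move=> h h1 h2; move: R i T l h h1 h2; suff H : forall t a, dl prog edb t a ->
  (match t, a with pU, [:: R; i; T; l] => Lv f R -> (Ac f i \/ exists m, Rv f m) -> Lv (2, T, l) T | _, _ => True end).
  by move=> R i T l /H.
dl_induct; first by move=> v h _ _ hl [ha|[m hm]]; [exact: Lv_acc h hl ha | exact: Lv_rv h hl hm].
move=> v h hu H hl ha; have h1 := H hl ha; exact: Lv_acc h h1 (Ac_lv h1).
Qed.

Lemma Ob_inv f j x : Ob f j x -> [\/ [/\ f = (0, f.1.2, 0), edb earg [:: f.1.2; j; x.1.2] & x = (0, x.1.2, 0)],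
  exists R, [/\ f = (1, R, 0), E R, edb epos [:: R; j] & x = (2, R, j)] |
  exists R, [/\ Lv f R, C R j & x = (1, R, j)]].
Proof.
move: f j x; suff H : forall t a, dl prog edb t a ->
  (match t, a with pOb, [:: f1; f2; f3; j; x1; x2; x3] => let f := (f1, f2, f3) in let x := (x1, x2, x3) in
  [\/ [/\ f = (0, f.1.2, 0), edb earg [:: f.1.2; j; x.1.2] & x = (0, x.1.2, 0)],
  exists R, [/\ f = (1, R, 0), E R, edb epos [:: R; j] & x = (2, R, j)] |
  exists R, [/\ Lv f R, C R j & x = (1, R, j)]] | _, _ => True end).
  by move=> [[f1 f2] f3] j [[x1 x2] x3] /H.
dl_induct.
- by move=> v h _ _; exact: Or31.
- by move=> v h h1 _; apply: Or32; exists (v 0).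
- by move=> v _ [h1 h2] _; apply: Or33; exists (v 3).
Qed.

(** Access to position [l] helps only a method with [l] among its inputs. Such a method determines
    [l], and the type would be revealed in the sense of [dRev]. Otherwise the type behaves like the
    generic fact, except at [l] itself. *)
Lemma acc_child_unrevealed T l : ~ Rev T l ->
  (forall j, Ac (2, T, l) j -> j = l \/ Ac (1, T, 0) j) /\ (forall m, Rv (2, T, l) m -> Rv (1, T, 0) m).
Proof.
move=> nR; suff H : forall t a, dl prog edb t a ->
  (match t, a with
   | pAc, [:: x; y; z; j] => (x, y, z) = (2, T, l) -> j = l \/ Ac (1, T, 0) j
   | pRI, [:: x; y; z; m; i] => (x, y, z) = (2, T, l) -> dRI edb (1, T, 0) m i \/ D m l
   | pRv, [:: x; y; z; m] => (x, y, z) = (2, T, l) -> Rv (1, T, 0) m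
   | _, _ => True end).
  by split=> [j /H|m /H]; apply.
have lT f : Lv (2, T, l) f -> f = T /\ Lv (1, T, 0) T.
  by move=> /Lv_inv[hE [[_]|//|[e]]] //; rewrite e; split=> //; exact: Lv_gen.
have nD m : Rv (2, T, l) m -> ~ D m l by move=> h1 h2; apply: nR; exact: Rev_in h1 h2.
dl_induct.
- by move=> v _ _ _ [_ ->]; left.
- move=> v _ [h1 h2] _ [e1 e2 e3]; right; rewrite e1 e2 e3 in h2.
  have [[]//|[R []]//|[R [hl hC ex]]] := @Ob_inv (2, T, l) (v 6) (v 0, v 1, v 2) h2.
  have [eR l1] := lT _ hl; rewrite eR in hC ex; have := Ob_const l1 hC; rewrite -ex => ho; exact (Ac_AT (x := (v 0, v 1, v 2)) h1 ho).
- move=> v h1 h2 _ [e1 e2 e3]; rewrite e1 e2 e3 in h2; have [eR l1] := lT _ h2.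
  by left; rewrite eR in h1; exact: RI_0 h1 l1.
- move=> v [h1 h2] _ [H1 H2] e; case: (H1 e) => h3; last by right.
  case: (H2 e) => [ex|h4]; last by left; exact: RI_S h1 h2 h3 h4.
  by right; rewrite -ex; exact: D_inp h1.
- move=> v h hr H e; case: (H e) => h1; first exact: Rv_in h h1.
  case: e => e1 e2 e3; rewrite e1 e2 e3 in hr; by case: (nD _ _ h1); exact (Rv_in (f := (2, T, l)) h hr).
- by move=> v _ [h1 h2] [H _] e; right; exact: Ac_rv (H e) h2.
- move=> v _ [h1 h2] _ [e1 e2 e3]; rewrite e1 e2 e3 in h2; have [eR l1] := lT _ h2.
  by right; rewrite -eR; exact: h1.
- move=> v h [h1 h2] _ [e1 e2 e3]; rewrite e1 e2 e3 in h2; have [eR l1] := lT _ h2.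
  by right; rewrite eR in h; exact: Ac_uid h h1 l1.
- move=> v _ [h1 [h2 h3]] [H1 [_ H3]] [e1 e2 e3]; rewrite e1 e2 e3 in h2; have [eR l1] := lT _ h2.
  have := H3; rewrite e1 e2 e3 => /(_ erefl) [el|h4].
    by apply: H1; rewrite eR el.
  by right; rewrite eR in h1; exact: Ac_chd h1 l1 h4.
Qed.

(** Equality of constants as far as the second world enforces it: only dependencies of relations
    that are nonempty there are followed. *)
Inductive EqK (p : nat * nat) : nat * nat -> Prop :=
| EqK_refl : EqK p p
| EqK_fwd R i T j : EqK p (R, i) -> edb euid [:: R; i; T; j] -> C T j -> E2 R -> EqK p (T, j)
| EqK_bwd R i T j : EqK p (T, j) -> edb euid [:: R; i; T; j] -> C T j -> E2 R -> EqK p (R, i).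

Lemma EqK_trans p1 p2 p3 : EqK p1 p2 -> EqK p2 p3 -> EqK p1 p3.
Proof.
move=> h1 h2; elim: h2 => [|R i T j _ IH hu hC hE|R i T j _ IH hu hC hE] //.
  exact: EqK_fwd IH hu hC hE.
exact: EqK_bwd IH hu hC hE.
Qed.

Lemma EqK_sym p1 p2 : EqK p1 p2 -> EqK p2 p1.
Proof.
elim=> [|R i T j _ IH hu hC hE|R i T j _ IH hu hC hE]; first exact: EqK_refl.
  by apply: EqK_trans IH; apply: EqK_bwd hu hC hE; exact: EqK_refl.
by apply: EqK_trans IH; apply: EqK_fwd hu hC hE; exact: EqK_refl.
Qed.

Lemma EqK_C p p' : EqK p p' -> C p.1 p.2 -> E2 p.1 -> C p'.1 p'.2 /\ E2 p'.1.
Proof.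
move=> h hC hE; elim: h => [|R i T j _ _ hu hC' hE'|R i T j _ _ hu hC' hE'] //=; split=> //.
  exact: E2_uid hu hE'.
exact: C_uid hu hC'.
Qed.

(** The constant of the first world is forced to occur in the second one at some position of the
    class. *)
Definition RvK p := exists p', EqK p p' /\ P2 (1, p'.1, p'.2) p'.1 p'.2.

Lemma RvK_EqK p p' : EqK p p' -> RvK p -> RvK p'.
Proof. by move=> h [p2 [h1 h2]]; exists p2; split=> //; exact: EqK_trans (EqK_sym h) h1. Qed.

Lemma Eq_const R j : E R -> C R j -> Eq (1, R, j) (1, R, j).
Proof. by move=> hE hC; have h := Ob_const (Lv_gen hE) hC; exact: (Eq_ob h h). Qed.

Lemma EqK_Eq p p' : EqK p p' -> C p.1 p.2 -> E2 p.1 -> Eq (1, p.1, p.2) (1, p'.1, p'.2).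
Proof.
move=> h hC hE; elim: h => [|R i T j _ IH hu hC' hE'|R i T j _ IH hu hC' hE'] /=.
- by apply: Eq_const => //; exact: E2_E.
- by apply: Eq_trans IH _; exact: Eq_uid hu hC' (E2_E hE').
- by apply: Eq_trans IH _; apply: Eq_sym; exact: Eq_uid hu hC' (E2_E hE').
Qed.

Lemma RvK_P2 p : RvK p -> C p.1 p.2 -> E2 p.1 -> P2 (1, p.1, p.2) p.1 p.2.
Proof.
move=> [p' [h h2]] hC hE; elim: h h2 => [|R i T j _ IH hu hC' hE'|R i T j _ IH hu hC' hE'] //= h2; apply: IH => /=.
  apply: P2_eq (Eq_sym (Eq_uid hu hC' (E2_E hE'))); exact: P2_back hu h2 hC' hE'.
apply: P2_eq (Eq_uid hu hC' (E2_E hE')); exact: P2_uid hu h2.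
Qed.

Definition rel (v : vf elt) := match v with VQ a => (natm q a).1 | VG _ R => R | VT _ T _ => T end.
(** Choice applied to equivalent predicates returns the same witness, so equal objects have the same
    representative. *)
Definition rep (x : tri) : tri := choose (fun y => `[< Eq x y >]) x.
Definition repK (p : nat * nat) : nat * nat := choose (fun p' => `[< EqK p p' >]) p.
(** Positions outside the finite domain behave like [js]; with arities in binary there can be
    exponentially many of them. *)
Definition nrm j := if J j then j else js.
Definition DX m j := D m (nrm j).

(** Fresh entries of revealed copies are accessible by construction, being returned by accesses. *)
Fixpoint AccE (e : elt) : Prop :=
  match e with
  | ET x => AT x
  | EK p => AT (1, p.1, p.2)
  | ES v j => Ac (match v with VQ a => (0, a, 0) | VG _ R => (1, R, 0)
                  | VT e' T l => if `[< AccE e' >] then (2, T, l) else (1, T, 0) end) (nrm j)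
  | EF _ _ _ _ => True
  end.

(** A child has the type [(2,T,l)] only if the inherited element is accessible; otherwise nothing
    distinguishes it from the generic fact. *)
Definition phi (v : vf elt) : tri :=
  match v with VQ a => (0, a, 0) | VG _ R => (1, R, 0)
  | VT e T l => if `[< AccE e >] then (2, T, l) else (1, T, 0) end.

Definition Ew (w : bool) R := if w then E2 R else E R.
Definition RevV e T l := AccE e /\ Rev T l.

(** The last clause withholds the child when [e] already occurs in [T] at [l] and accesses expose it
    there: a revealed copy then meets the dependency, and a second fact could violate a functional
    dependency. *)
Definition legit_child (Occ : nat -> nat -> Prop) e T l :=
  [/\ exists R i, Occ R i /\ U R i T l, ~ C T l & ~ (Occ T l /\ RevV e T l)].

(** Occurrences regardless of the world. Legitimacy of facts is decided by this over-approximation,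
    once for both worlds, because the revealed copies have to be common to them. *)
Fixpoint OccV (e : elt) (R j : nat) : Prop :=
  match e with
  | ET x => (exists a v, [/\ edb eatm [:: a; R], edb earg [:: a; j; v] & x = rep (0, v, 0)])
            \/ [/\ C R j, E R & x = rep (1, R, j)]
  | EK p => [/\ C R j, E2 R, ~ RvK (R, j) & repK (R, j) = p]
  | ES v j' => [/\ j = j', is_pos S R j, ~ C R j &
      match v with VQ _ => False | VG w T => T = R /\ Ew w R
      | VT e' T l => [/\ T = R, j <> l & legit_child (OccV e') e' T l] end]
  | EF v m k j' => [/\ j = j', is_pos S R j, ~ DX m j, rel v = R & Rv (phi v) m /\
      match v with VQ a => a < size q | VG w T => Ew w T
      | VT e' T l => legit_child (OccV e') e' T l end]
  end.

Definition VL (v : vf elt) : Prop :=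
  match v with VQ a => a < size q | VG w T => Ew w T
  | VT e' T l => legit_child (OccV e') e' T l end.

(** The value at a constant position. The second world uses the shared constant only where accesses
    force it, so that no match of the query can exploit an unforced coincidence. *)
Definition kap (w : bool) R j := if w && ~~ `[< RvK (R, j) >] then EK (repK (R, j)) else ET (rep (1, R, j)).

Definition el (w : bool) (v : vf elt) j : elt :=
  match v with
  | VQ a => ET (rep (0, var a j, 0))
  | VG b R => if `[< C R j >] then kap w R j else ES v j
  | VT e T l => if `[< C T j >] then kap w T j else if j == l then e else ES v j
  end.

(** Determined positions of a revealed copy keep the true entry; each of the others is fresh for
    every copy number [k]. *)
Definition slotA v m k j := if `[< DX m j >] then el false v j else EF v m k j.

Definition PosA e R j := exists v m k,
  [/\ VL v, Rv (phi v) m, rel v = R, is_pos S R j & slotA v m k j = e].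

Definition new_child (Occ : nat -> nat -> Prop) T l :=
  [/\ exists R i, Occ R i /\ U R i T l, ~ C T l & ~ Occ T l].

(** Occurrences that an element has in world [w] from its creation, as opposed to those in revealed
    copies ([PosA]) and those inherited by children. *)
Fixpoint Birth (w : bool) (e : elt) (R j : nat) : Prop :=
  match e with
  | ET x => (~~ w /\ exists a v, [/\ edb eatm [:: a; R], edb earg [:: a; j; v] & x = rep (0, v, 0)])
            \/ [/\ C R j, Ew w R & kap w R j = ET x]
  | EK p => [/\ C R j, Ew w R & kap w R j = EK p]
  | ES v j' => [/\ j = j', is_pos S R j, ~ C R j &
      match v with VQ _ => False | VG b T => [/\ T = R, b = w & Ew w R]
      | VT e' T l => [/\ T = R, j <> l & new_child (fun R j => PosA e' R j \/ Birth w e' R j) T l] end]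
  | EF v m k j' => False
  end.

Definition Occ w e R j := PosA e R j \/ Birth w e R j.

Definition Vw (w : bool) (v : vf elt) : Prop :=
  match v with
  | VQ a => ~~ w /\ a < size q
  | VG b R => b = w /\ Ew w R
  | VT e T l => new_child (Occ w e) T l
  end.

Definition Iw (w : bool) : instance elt := fun R t =>
  is_rel S R /\
  ((exists v m k, [/\ VL v, Rv (phi v) m, rel v = R & t = mkseq (slotA v m k) (arity S R)])
  \/ exists v, [/\ Vw w v, rel v = R & t = mkseq (el w v) (arity S R)]).

Lemma rep_eq x y : Eq x y -> rep x = rep y.
Proof.
move=> h; rewrite /rep; have hx : Eq x x := Eq_trans h (Eq_sym h).
have hy : Eq y y := Eq_trans (Eq_sym h) h.
rewrite (@eq_choose _ _ (fun z => `[< Eq y z >])); first by apply: choose_id; apply/asboolP; [exact: Eq_sym h | exact: hy].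
by move=> z; apply/asboolP/asboolP => hz; [exact: (Eq_trans (Eq_sym h) hz) | exact: (Eq_trans h hz)].
Qed.

Lemma repP x : Eq x x -> Eq x (rep x).
Proof. by move=> h; apply/asboolP; rewrite /rep; apply: (@chooseP _ (fun z => `[< Eq x z >])); exact/asboolP. Qed.

Lemma rep_inj x y : Eq x x -> Eq y y -> rep x = rep y -> Eq x y.
Proof. by move=> hx hy e; apply: Eq_trans (repP hx) _; rewrite e; exact: Eq_sym (repP hy). Qed.

Lemma AT_rep x : Eq x x -> AT (rep x) <-> AT x.
Proof. by move=> h; split=> ha; [exact: (AT_eq ha (Eq_sym (repP h))) | exact: (AT_eq ha (repP h))]. Qed.

Lemma repK_eq p p' : EqK p p' -> repK p = repK p'.
Proof.
move=> h; rewrite /repK.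
rewrite (@eq_choose _ _ (fun z => `[< EqK p' z >])).
  by apply: choose_id; apply/asboolP; [exact: EqK_sym h | exact: EqK_refl].
by move=> z; apply/asboolP/asboolP => hz; [exact: (EqK_trans (EqK_sym h) hz) | exact: (EqK_trans h hz)].
Qed.

Lemma repKP p : EqK p (repK p).
Proof. by apply/asboolP; rewrite /repK; apply: (@chooseP _ (fun z => `[< EqK p z >])); apply/asboolP; exact: EqK_refl. Qed.

Lemma Ew_E w R : Ew w R -> E R.
Proof. by case: w => //; exact: E2_E. Qed.

Lemma Ew_uid w R i T j : edb euid [:: R; i; T; j] -> Ew w R -> Ew w T.
Proof. by case: w => h; [exact: E2_uid h | exact: E_uid h]. Qed.

Lemma Ew_U w R i T j : U R i T j -> Ew w R -> Ew w T.
Proof. by move/U_facts => [_ [h1 _ h2]]; case: w. Qed.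

Lemma kap_uid w R i T j : edb euid [:: R; i; T; j] -> C T j -> Ew w R -> kap w R i = kap w T j.
Proof.
move=> h hC; have hE := Eq_uid h hC; case: w => /= h2; rewrite /kap /=; last by rewrite (rep_eq (hE h2)).
have k : EqK (R, i) (T, j) by apply: EqK_fwd h hC h2; exact: EqK_refl.
rewrite (rep_eq (hE (E2_E h2))) (repK_eq k).
by have -> : `[< RvK (R, i) >] = `[< RvK (T, j) >] by apply/asboolP/asboolP; [exact: (RvK_EqK k) | exact: (RvK_EqK (EqK_sym k))].
Qed.

Lemma Eq_var a j v : edb earg [:: a; j; v] -> Eq (0, v, 0) (0, v, 0).
Proof. by move=> h; have ho := Ob_arg h; exact: (Eq_ob ho ho). Qed.

Lemma atm_C a R j v : edb eatm [:: a; R] -> edb earg [:: a; j; v] -> C R j -> rep (0, v, 0) = rep (1, R, j).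
Proof. by move=> h1 h2 hC; apply: rep_eq; apply: Eq_ob (Ob_arg h2) (Ob_const (Lv_atm h1) hC). Qed.

Lemma nrmE j : J j -> nrm j = j.
Proof. by rewrite /nrm => ->. Qed.

Lemma DX_C m j : m < size (s_meth S) -> C (m_rel (nmeth S m)) j -> DX m j.
Proof.
move=> hm hC; have [_ hj _] := C_pos hC; rewrite /DX nrmE //.
exact: (D_C (methP hm) hC).
Qed.

(** [elt] is nested through [vf], so the induction principle that reaches the element inside [VT] is
    built by hand. *)
Section EltInd.
Variable P : elt -> Prop.
Definition sub_ok (v : vf elt) := match v with VT e _ _ => P e | _ => True end.
Hypotheses (HT : forall x, P (ET x)) (HK : forall p, P (EK p)).
Hypothesis (HS : forall v j, sub_ok v -> P (ES v j)).
Hypothesis (HF : forall v m k j, sub_ok v -> P (EF v m k j)).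
Fixpoint elt_induction e : P e :=
  match e with
  | ET x => HT x
  | EK p => HK p
  | ES v j => HS j (match v return sub_ok v with VT e _ _ => elt_induction e | VQ _ => I | VG _ _ => I end)
  | EF v m k j => HF m k j (match v return sub_ok v with VT e _ _ => elt_induction e | VQ _ => I | VG _ _ => I end)
  end.
End EltInd.

Definition fresh_pos (v : vf elt) (j : nat) := match v with VQ _ => False | VG _ _ => True | VT _ _ l => j <> l end.

Lemma OccV_ES v j' R j : OccV (ES v j') R j <->
  [/\ j = j', is_pos S R j, ~ C R j, rel v = R & VL v /\ fresh_pos v j].
Proof.
split.
  case: v => [a|w T|e T l] /= [h1 h2 h3 h4] //.
    by case: h4 => h4 h5; split=> //; split=> //; rewrite h4.
  by case: h4 => h4 h5 h6; split=> /=.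
by case=> h1 h2 h3 h4 [h5 h6]; case: v h4 h5 h6 => [a|w T|e T l] //= h4 h5 h6; split=> //; rewrite -h4.
Qed.

Lemma OccV_EF v m k j' R j : OccV (EF v m k j') R j <->
  [/\ j = j', is_pos S R j, ~ DX m j, rel v = R & Rv (phi v) m /\ VL v].
Proof. by []. Qed.

Lemma VQ_atm a : a < size q -> edb eatm [:: a; rel (VQ a)].
Proof. by move=> h; rewrite /= h eqxx. Qed.

Lemma kap_acc w R j : C R j -> Ew w R -> AccE (kap w R j) <-> AT (1, R, j).
Proof.
move=> hC hE; have hq := Eq_const (Ew_E hE) hC; rewrite /kap; case: (w =P true) hE => [->|/eqP]; last first.
  by case: w => //= _ _; exact: AT_rep.
case: asboolP => /= _ hE; first exact: AT_rep.
have := EqK_Eq (repKP (R, j)) hC hE => /= h.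
by split=> ha; [exact: (AT_eq ha (Eq_sym h)) | exact: (AT_eq ha h)].
Qed.

(** An accessible occurrence is accessible through a live fact type, or lies in a revealed fact: the
    premises of the two rules that make child types live. *)
Lemma OccV_live e R i : OccV e R i -> E R /\
  (AccE e -> exists f, Lv f R /\ (Ac f (nrm i) \/ exists m, Rv f m)).
Proof.
move: e R i; pose P e := forall R i, OccV e R i -> E R /\
  (AccE e -> exists f, Lv f R /\ (Ac f (nrm i) \/ exists m, Rv f m)).
have VLP v : sub_ok P v -> VL v -> E (rel v) /\ Lv (phi v) (rel v).
  case: v => [a|w T|e T l] /=.
  - by move=> _ /VQ_atm h; split; [exact: E_atm h | exact: Lv_atm h].
  - by move=> _ /Ew_E h; split=> //; exact: Lv_gen.
  move=> He [[R [i [ho hu]]] _ _]; have [hE hA] := He _ _ ho; have [[_ _ hj] [h2 _ _]] := U_facts hu.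
  split; first exact: h2.
  case: asboolP => [ha|_]; last exact: Lv_gen (h2 hE).
  have [f [hf hc]] := hA ha; apply: (U_live hu hf); move: hc; rewrite nrmE //; exact: hj.1.
move=> e; elim/elt_induction: e => [x|p|v j hv|v m k j hv] R i /=.
- case=> [[a [v [h1 h2 ->]]]|[hC hE ->]].
    split=> [|h]; first exact: E_atm h1.
    exists (0, a, 0); split; [exact: Lv_atm h1 | left].
    have [_ Ji] : edb earg [:: a; i; var a i] /\ J i.
      have [h3 h4 h5] := arg_inv h2; split; first by rewrite -h5.
      by apply: (J_atm h3); exact: ltnW.
    rewrite nrmE //; apply: Ac_AT (Ob_arg h2); apply/AT_rep => //; exact: Eq_var h2.
  split=> // h; exists (1, R, 0); split; [exact: Lv_gen | left].
  have [_ Ji _] := C_pos hC; rewrite nrmE //; apply: Ac_AT (Ob_const (Lv_gen hE) hC).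
  by apply/AT_rep => //; exact: Eq_const.
- case=> hC hE nR <-; have hE' := E2_E hE; split=> // h; exists (1, R, 0); split; [exact: Lv_gen | left].
  have [_ Ji _] := C_pos hC; rewrite nrmE //; apply: Ac_AT (Ob_const (Lv_gen hE') hC).
  exact: (AT_eq h (Eq_sym (EqK_Eq (repKP (R, i)) hC hE))).
- move=> H; have /OccV_ES [-> _ _ <- [hL _]] : OccV (ES v j) R i by exact: H.
  have [h1 h2] := VLP v hv hL; split=> // ha; exists (phi v); split=> //; left; exact: ha.
- move=> H; have /OccV_EF [-> _ _ <- [hr hL]] : OccV (EF v m k j) R i by exact: H.
  by have [h1 h2] := VLP v hv hL; split=> // _; exists (phi v); split=> //; right; exists m.
Qed.

Lemma VL_live v : VL v -> E (rel v) /\ Lv (phi v) (rel v).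
Proof.
case: v => [a|w T|e T l] /=.
- by move=> /VQ_atm h; split; [exact: E_atm h | exact: Lv_atm h].
- by move=> /Ew_E h; split=> //; exact: Lv_gen.
move=> [[R [i [ho hu]]] _ _]; have [hE hA] := OccV_live ho; have [[_ _ hj] [h2 _ _]] := U_facts hu.
split; first exact: h2.
case: asboolP => [ha|_]; last exact: Lv_gen (h2 hE).
have [f [hf hc]] := hA ha; apply: (U_live hu hf); move: hc; rewrite nrmE //; exact: hj.1.
Qed.

Lemma OccV_selfacc e R i : OccV e R i -> J i -> Ac (1, R, 0) i -> AccE e.
Proof.
move=> ho Ji ha; have [hE _] := OccV_live ho; case: e ho => [x|p|v j|v m k j] //=.
- case=> [[a [v [h1 h2 ->]]]|[hC _ ->]].
    apply/AT_rep; first exact: Eq_var h2.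
    by apply: AT_ac (Ob_arg h2); exact: Ac_gen ha (Lv_atm h1).
  apply/AT_rep; first exact: Eq_const.
  exact: AT_ac ha (Ob_const (Lv_gen hE) hC).
- case=> hC hE' nR <-; apply: (AT_eq _ (EqK_Eq (repKP (R, i)) hC hE')).
  exact: AT_ac ha (Ob_const (Lv_gen hE) hC).
- move=> H; have /OccV_ES [e1 _ _ e2 [hL _]] : OccV (ES v j) R i by exact: H.
  rewrite -e1 nrmE //; have [_ hl] := VL_live hL; rewrite e2 in hl; exact: Ac_gen ha hl.
Qed.

Lemma phi_el_acc v j : VL v -> is_pos S (rel v) j -> Ac (phi v) (nrm j) -> AccE (el false v j).
Proof.
move=> hL hp ha; have [hE hl] := VL_live hL.
have cst : C (rel v) j -> AccE (kap false (rel v) j).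
  move=> hC; apply/kap_acc => //; have [_ Jj _] := C_pos hC; rewrite nrmE // in ha.
  exact: AT_ac ha (Ob_const hl hC).
case: v hL hp ha hE hl cst => [a|w T|e T l] /= hL hp ha hE hl cst.
- have [h1 h2] := atm_argP (VQ_atm hL) hp; rewrite nrmE // in ha.
  apply/AT_rep; first exact: Eq_var h1.
  exact: AT_ac ha (Ob_arg h1).
- by case: asboolP => [hC|_]; [exact: cst|].
case: asboolP => [hC|_]; first exact: cst.
case: eqP => [ej|_] //; case: (pselect (AccE e)) => // na; move: ha; rewrite asboolF // ej.
case: hL => [[R [i [ho hu]]] _ _]; have [[_ _ hj] _] := U_facts hu; rewrite nrmE ?hj // => ha.
have [hE' _] := OccV_live ho; case: na; apply: OccV_selfacc ho _ _; first exact: hj.1.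
exact: U_ac hu hE' ha.
Qed.

Lemma el_phi_acc w v j : VL v -> Ew w (rel v) -> is_pos S (rel v) j -> J j -> AccE (el w v j) -> Ac (phi v) j.
Proof.
move=> hL hEw hp Jj; have [hE hl] := VL_live hL.
have cst : C (rel v) j -> AccE (kap w (rel v) j) -> Ac (phi v) j.
  by move=> hC /(kap_acc hC hEw) h; exact: Ac_AT h (Ob_const hl hC).
case: v hL hEw hp hE hl cst => [a|b T|e T l] /= hL hEw hp hE hl cst.
- have [h1 h2] := atm_argP (VQ_atm hL) hp; move/AT_rep => h.
  by apply: Ac_AT (Ob_arg h1); apply: h; exact: Eq_var h1.
- by case: asboolP => [hC|_]; [exact: cst | rewrite /= nrmE].
case: asboolP => [hC|_]; first exact: cst.
case: eqP => [ej|_]; last by rewrite /= nrmE.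
move=> ha; move: hl; rewrite asboolT // -ej; exact: Ac_lv.
Qed.

Lemma Rev_inv T l : Rev T l -> exists m, Rv (2, T, l) m /\ D m l.
Proof.
move: T l; suff H : forall t a, dl prog edb t a ->
  (match t, a with pRev, [:: T; l] => exists m, Rv (2, T, l) m /\ D m l | _, _ => True end) by move=> T l /H.
by dl_induct; move=> v _ [h1 h2] _; exists (v 2).
Qed.

Lemma Rv_chd f T l m : Rv (2, T, l) m -> Lv f T -> Ac f l -> Rv f m.
Proof.
move=> hr hl ha; have [hm hl2] := Rv_inv hr.
have eT : m_rel (nmeth S m) = T by case: (Lv_inv hl2) => _ [[_]|//|[]].
apply: Rv_in' => //; first by rewrite eT.
by move=> x hx; have [_ _ hD _] := inp_pos hm hx; exact: Ac_chd (Ac_rv hr hD) hl ha.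
Qed.

(** The method exposing the child type also applies to the fact in which [e] already sits, as
    position [l] is accessible there; so [e] shows at [l] in a revealed copy. *)
Lemma OccV_rev e T l : OccV e T l -> ~ C T l -> RevV e T l -> PosA e T l.
Proof.
move=> ho nC [ha hr]; have [m [hv hD]] := Rev_inv hr.
have [_ Jl] : m < size (s_meth S) /\ J l by case: (D_inv hD) => h [[_ []]|[]].
have key v : VL v -> rel v = T -> is_pos S T l -> Ac (phi v) l -> el false v l = e -> PosA e T l.
  move=> hL eT hp hac ee; exists v, m, 0; have [_ hl] := VL_live hL; rewrite eT in hl.
  split=> //; first exact: Rv_chd hv hl hac.
  by rewrite /slotA asboolT // /DX nrmE.
case: e ho ha key => [x|p|v j|v m0 k j] ho ha key.
- case: ho => [[a [v [h1 h2 ex]]]|[]//]; have [h3 h4 h5] := arg_inv h2; have [h6 h7 h8 h9] := atm_wf h1.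
  rewrite /= ex in ha; have hAT : AT (0, v, 0) := (AT_rep (Eq_var h2)).1 ha.
  apply: (key (VQ a)) => //=; [by rewrite /is_pos h8 /= -h9 | exact: Ac_AT hAT (Ob_arg h2) | by rewrite ex h5].
- by case: ho.
- have /OccV_ES [e1 hp _ e2 [hL hfr]] := ho; rewrite -e1 /= nrmE // in ha.
  apply: (key v) => //; case: v e2 hfr {ho hL ha key} => [a|b T'|e' T' l'] //= e2; rewrite e2 e1 asboolF -?e1 //.
  by case: eqP.
have /OccV_EF [e1 hp nD e2 [hr' hL]] := ho; exists v, m0, k; split=> //.
by rewrite /slotA asboolF // e1.
Qed.

Lemma PosA_OccV e R j : PosA e R j -> OccV e R j \/ exists R0 i0, OccV e R0 i0 /\ U R0 i0 R j.
Proof.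
move=> [v [m [k [hL hr eR hp <-]]]]; rewrite /slotA; have [hE _] := VL_live hL; rewrite eR in hE.
case: asboolP => hD; last by left; apply/OccV_EF.
case: v hL hr eR => [a|b T|e' T l] hL hr eR.
- have [h1 _] := atm_argP (VQ_atm hL) (eq_ind_r (fun R => is_pos S R j) hp eR).
  left; left; exists a, (var a j); split=> //; rewrite -eR; exact: VQ_atm.
- rewrite /= in eR; subst R; rewrite /=; case: asboolP => hC; first by left; right.
  by left; apply/OccV_ES.
rewrite /= in eR; subst R; rewrite /=; case: asboolP => hC; first by left; right.
case: eqP => [ej|nj]; last by left; apply/OccV_ES; split.
by right; case: hL => [[R0 [i0 [h1 h2]]] _ _]; exists R0, i0; rewrite ej.
Qed.

Lemma kap_ET w R j x : kap w R j = ET x -> x = rep (1, R, j).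
Proof. by rewrite /kap; case: ifP => // _ []. Qed.

(** If [e] occurred there and were exposed, a revealed copy would already provide the occurrence in
    world [w], and no child would have been demanded. *)
Lemma new_legit w e T l : (forall R j, Birth w e R j -> OccV e R j) ->
  new_child (Occ w e) T l -> legit_child (OccV e) e T l.
Proof.
move=> HB [[R [i [ho hu]]] nC nO]; split=> //; last first.
  by move=> [h1 h2]; apply: nO; left; exact: OccV_rev h1 nC h2.
case: ho => [/PosA_OccV[h|[R0 [i0 [h1 h2]]]]|/HB h]; last by exists R, i.
  by exists R, i.
by exists R0, i0; split=> //; exact: U_cat h2 hu.
Qed.

Lemma Birth_OccV w e R j : Birth w e R j -> OccV e R j.
Proof.
move: e R j; apply: elt_induction => [x|p|v j' hv|v m k j' hv] R j //=.
- case=> [[_ h]|[hC hE hk]]; [by left | right].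
  by split=> //; [exact: Ew_E hE | exact: kap_ET hk].
- by case=> hC hE; rewrite /kap; case: ifP => // /andP[hw /asboolPn hR] [<-]; split=> //; rewrite hw in hE.
case=> h1 h2 h3; case: v hv => [a|b T|e T l] //= hv.
  by case=> -> -> h; split.
by case=> -> h5 h6; split=> //; split=> //; exact: new_legit h6.
Qed.

Lemma Vw_VL w v : Vw w v -> VL v.
Proof.
case: v => [a|b R|e T l] /=; [by case | by case=> -> |].
by apply: new_legit => R j; exact: Birth_OccV.
Qed.
End Basics.
End ProgramFacts.

(** * The two worlds satisfy the unary inclusion dependencies *)

Module Canonical1.
Import Defs DatalogSyntax DatalogProgram ExtensionalFacts ProgramFacts.
Import all_boot zify.
Import boolp.
Section Basics.
Variables (S : schema) (q : bcq) (J : nat -> bool) (js : nat) (g : nat -> seq nat -> bool).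
Hypothesis wfS : wf_schema S.
Hypothesis wfq : wf_query S q.
Hypothesis adm : admissible S q J js.
Notation edb := (fun t a => is_true (sedb S q J g t a)).
Notation E := (dE edb). Notation C := (dC edb). Notation D := (dD edb). Notation Ob := (dOb edb).
Notation Eq := (dEq edb). Notation Lv := (dLv edb). Notation Ac := (dAc edb). Notation AT := (dAT edb).
Notation Rv := (dRv edb). Notation Rev := (dRev edb). Notation U := (dU edb). Notation E2 := (dE2 edb).
Notation P2 := (dP2 edb). Notation O2 := (dO2 edb).
Let uidP := @ProgramFacts.uidP S q J g.
Let uid_pos := @ProgramFacts.uid_pos S q J js g wfS adm.
Let atm_wf := @ProgramFacts.atm_wf S q J g wfq.
Let C_pos := @ProgramFacts.C_pos S q J js g wfS adm.
Let Lv_fun := @ProgramFacts.Lv_fun S q J g wfq.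
Notation var := (@ProgramFacts.var q).
Let arg_inv := @ProgramFacts.arg_inv S q J g.
Let atm_argP := @ProgramFacts.atm_argP S q J js g wfq adm.
Let methP := @ProgramFacts.methP S q J g.
Let Rv_inv := @ProgramFacts.Rv_inv S q J g.
Let E2_E := @ProgramFacts.E2_E S q J g.
Notation EqK := (@ProgramFacts.EqK S q J g).
Let EqK_refl := @ProgramFacts.EqK_refl S q J g.
Notation RvK := (@ProgramFacts.RvK S q J g).
Notation rel := (@ProgramFacts.rel q).
Notation rep := (@ProgramFacts.rep S q J g).
Notation repK := (@ProgramFacts.repK S q J g).
Notation nrm := (@ProgramFacts.nrm J js).
Notation DX := (@ProgramFacts.DX S q J js g).
Notation AccE := (@ProgramFacts.AccE S q J js g).
Notation phi := (@ProgramFacts.phi S q J js g).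
Notation Ew := (@ProgramFacts.Ew S q J g).
Notation RevV := (@ProgramFacts.RevV S q J js g).
Notation legit_child := (@ProgramFacts.legit_child S q J js g).
Notation OccV := (@ProgramFacts.OccV S q J js g).
Notation VL := (@ProgramFacts.VL S q J js g).
Notation kap := (@ProgramFacts.kap S q J g).
Notation el := (@ProgramFacts.el S q J g).
Notation slotA := (@ProgramFacts.slotA S q J js g).
Notation PosA := (@ProgramFacts.PosA S q J js g).
Notation new_child := (@ProgramFacts.new_child S q J g).
Notation Birth := (@ProgramFacts.Birth S q J js g).
Notation Occ := (@ProgramFacts.Occ S q J js g).
Notation Vw := (@ProgramFacts.Vw S q J js g).
Notation Iw := (@ProgramFacts.Iw S q J js g).
Let Ew_uid := @ProgramFacts.Ew_uid S q J g.
Let Ew_U := @ProgramFacts.Ew_U S q J js g wfS adm.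
Let kap_uid := @ProgramFacts.kap_uid S q J g.
Let atm_C := @ProgramFacts.atm_C S q J g.
Let DX_C := @ProgramFacts.DX_C S q J js g wfS adm.
Let VQ_atm := @ProgramFacts.VQ_atm S q J g.
Let VL_live := @ProgramFacts.VL_live S q J js g wfS adm.
Let Vw_VL := @ProgramFacts.Vw_VL S q J js g wfS wfq adm.
Lemma onth_lt T (x0 : T) s i : i < size s -> onth s i = Some (nth x0 s i).
Proof. by elim: s i => //= y s IH [|i] //= /IH. Qed.

Lemma Birth_Ew w e R j : Birth w e R j -> Ew w R.
Proof.
have PA e' R' j' : PosA e' R' j' -> Ew w R'.
  move=> [v [m [k [hL hr <- _ _]]]]; have [_ hl] := VL_live hL; have h2 := E2_rv hr hl.
  by case: w => //=; exact: E2_E.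
move: e R j; apply: elt_induction => [x|p|v j' hv|v m k j' hv] R j //=.
- by case=> [[hw [a [u [h _ _]]]]|[]] //; case: w hw {PA} => //= _; exact: E_atm h.
- by case.
- case=> _ _ _; case: v hv => [a|b T|e T l] //= hv; first by case.
  by case=> -> _ [[R0 [i0 [[/PA h|/hv h] hu]]] _ _]; exact: Ew_U hu h.
Qed.

Lemma Occ_Ew w e R j : Occ w e R j -> Ew w R.
Proof.
case=> [|/Birth_Ew //]; move=> [v [m [k [hL hr <- _ _]]]]; have [_ hl] := VL_live hL.
have h2 := E2_rv hr hl; by case: w => //=; exact: E2_E.
Qed.

Lemma Vw_Ew w v : Vw w v -> Ew w (rel v).
Proof.
case: v => [a|b R|e T l] /=.
- by case=> hw ha; case: w hw => //= _; exact: E_atm (VQ_atm ha).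
- by case.
- by case=> [[R0 [i0 [/Occ_Ew h hu]]] _ _]; exact: Ew_U hu h.
Qed.

Lemma Iw_Ew w R t : Iw w R t -> Ew w R.
Proof.
move=> [_ [[v [m [k [hL hr <- _]]]]|[v [hv <- _]]]]; last exact: Vw_Ew.
have [_ hl] := VL_live hL; have h2 := E2_rv hr hl; by case: w => //=; exact: E2_E.
Qed.

Lemma Iw_wf w : wf_instance S (Iw w).
Proof. by move=> R t [hR H]; split=> //; case: H => [[v [m [k [_ _ _ ->]]]]|[v [_ _ ->]]]; rewrite size_mkseq. Qed.

(** A method that reveals a fact of [R] determines its constants, hence they are forced into the
    second world and are not private. *)
Lemma kap_false_rev w v m R i : VL v -> rel v = R -> Rv (phi v) m -> C R i -> kap false R i = kap w R i.
Proof.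
case: w => // hL eR hr hC; rewrite /kap /=; case: asboolP => //= [[]].
have [_ hl] := VL_live hL; rewrite eR in hl.
have [hm hl2] := Rv_inv hr; have e2 := Lv_fun hl hl2.
exists (R, i); split; first exact: EqK_refl.
by apply: (P2_rv hr _ (Ob_const hl hC) hl); apply: D_C (methP hm) _; rewrite -e2.
Qed.

Lemma el_C w v i : VL v -> is_pos S (rel v) i -> C (rel v) i -> (if v is VQ _ then ~~ w else true) -> el w v i = kap w (rel v) i.
Proof.
case: v => [a|b R|e T l] /= hL hp hC hw; try by rewrite asboolT.
have [h1 _] := atm_argP (VQ_atm hL) hp.
by case: w hw => // _; rewrite /kap /= (atm_C (VQ_atm hL) h1 hC).
Qed.

Lemma Iw_C w R t i : Iw w R t -> C R i -> onth t i = Some (kap w R i).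
Proof.
move=> [hR H] hC; have [hp _ _] := C_pos hC; have /andP[_ hi] := hp.
case: H => [[v [m [k [hL hr eR ->]]]]|[v [hv eR ->]]]; rewrite (onth_lt (ET (0, 0, 0))) ?size_mkseq //; last first.
  by rewrite nth_mkseq // -eR el_C ?eR //; [exact: Vw_VL hv | case: v hv {eR} => //= a []].
rewrite nth_mkseq // /slotA; have [hm hl2] := Rv_inv hr; have [_ hl] := VL_live hL; rewrite eR in hl.
rewrite asboolT; last by apply: DX_C => //; rewrite (Lv_fun hl2 hl).
by rewrite -(kap_false_rev w hL eR hr hC) -eR el_C ?eR //; case: (v).
Qed.

Lemma Occ_fact w e R j : is_pos S R j -> Occ w e R j -> exists t, Iw w R t /\ onth t j = Some e.
Proof.
move=> hp; have /andP[hR hj] := hp.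
have mk (f : nat -> elt) : f j = e -> onth (mkseq f (arity S R)) j = Some e.
  by move=> <-; rewrite (onth_lt (ET (0, 0, 0))) ?size_mkseq // nth_mkseq.
have vv v : Vw w v -> rel v = R -> el w v j = e -> exists t, Iw w R t /\ onth t j = Some e.
  move=> hv eR ee; exists (mkseq (el w v) (arity S R)); split; last exact: mk.
  by split=> //; right; exists v.
case=> [[v [m [k [hL hr eR _ ee]]]]|].
  exists (mkseq (slotA v m k) (arity S R)); split; last exact: mk.
  by split=> //; left; exists v, m, k.
have cst : C R j -> Ew w R -> kap w R j = e -> exists t, Iw w R t /\ onth t j = Some e.
  by move=> hC hE hk; apply: (vv (VG w R)) => //=; rewrite asboolT.
case: e mk vv cst => [x|p|v j'|v m k j'] mk vv cst //=.
- case=> [[hw [a [u [h1 h2 ex]]]]|[hC hE hk]]; last exact: cst.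
  subst x.
  have [h3 h4 h5] := arg_inv h2; have [h6 h7 h8 h9] := atm_wf h1.
  by apply: (vv (VQ a)) => //=; rewrite h5.
- by case; exact: cst.
case=> ej _ nC; subst j'; case: v mk vv {cst} => [a|b T|e' T l] //= mk vv.
  by case=> eT ew hE; apply: (vv (VG b T)) => //=; rewrite ?eT ?ew // asboolF.
case=> eT nl hn; apply: (vv (VT e' T l)) => //=.
by rewrite eT asboolF //; case: eqP.
Qed.

(** Traces an entry back to where its element was born or revealed; from there it has stayed or
    travelled along dependencies. *)
Lemma Iw_Occ w R t i e : is_pos S R i -> Iw w R t -> onth t i = Some e ->
  exists R0 i0, Occ w e R0 i0 /\ ((R0, i0) = (R, i) \/ U R0 i0 R i).
Proof.
move=> hp; have /andP[hR hi] := hp => -[_ [[v [m [k [hL hr eR ->]]]]|[v [hv eR ->]]]];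
  rewrite (onth_lt e) ?size_mkseq // nth_mkseq // => -[ee].
  by exists R, i; split; [left; exists v, m, k | left].
have hL := Vw_VL hv; have hE := Vw_Ew hv; rewrite eR in hE.
have cst : C R i -> kap w R i = e -> exists R0 i0, Occ w e R0 i0 /\ ((R0, i0) = (R, i) \/ U R0 i0 R i).
  move=> hC hk; exists R, i; split; last by left.
  right; rewrite -hk /kap; case: ifP => h /=; first by rewrite /kap h.
  by right; rewrite /kap h.
case: v eR ee hv hL => [a|b T|e' T l] /= eR ee hv hL.
- exists R, i; split; last by left.
  right; rewrite -ee /=; left; split; first by case: hv.
  have ha : edb eatm [:: a; R] by rewrite -eR; exact: VQ_atm hL.
  by exists a, (var a i); split=> //; have [] := atm_argP ha hp.
- rewrite eR in ee; move: ee; case: asboolP => hC ee; first exact: cst.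
  exists R, i; split; last by left.
  by right; rewrite -ee /=; split=> //; case: hv.
rewrite eR in ee; move: ee; case: asboolP => hC; first exact: cst.
case: eqP => [-> <-|nl <-].
  by case: hv => [[R0 [i0 [h1 h2]]] _ _]; exists R0, i0; split=> //; right; rewrite -eR.
exists R, i; split; last by left.
by right; split=> //; split=> //; rewrite /new_child -eR.
Qed.

Lemma Iw_uid w u : List.In u (s_uid S) -> sat_uid (Iw w) u.
Proof.
case: u => R i T j /(uidP R i T j) hu t /= ht.
have [hpi hpj _ _ _] := uid_pos hu; have /andP[hR hi] := hpi; have /andP[hT hj] := hpj.
have hE := Iw_Ew ht.
case: (pselect (C T j)) => hC.
  exists (mkseq (el w (VG w T)) (arity S T)); split.
    by split=> //; right; exists (VG w T); split=> //=; split=> //; exact: Ew_uid hu hE.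
  rewrite (Iw_C ht (C_uid hu hC)) (onth_lt (ET (0,0,0))) ?size_mkseq // nth_mkseq //= asboolT //.
  by rewrite (kap_uid hu hC hE).
have [e he] : exists e, onth t i = Some e.
  have [_ st] := Iw_wf ht; exists (nth (ET (0,0,0)) t i); by rewrite (onth_lt (ET (0,0,0))) ?st.
rewrite he; have [R0 [i0 [ho hU]]] := Iw_Occ hpi ht he.
have hU' : U R0 i0 T j by case: hU => [[-> ->]|h]; [exact: U_uid | exact: U_trans hu h].
(* If the element does not occur in [T] at [j] yet, this is exactly the condition under which the
   world contains its child there. *)
case: (pselect (Occ w e T j)) => hO; first exact: Occ_fact.
exists (mkseq (el w (VT e T j)) (arity S T)); split.
  split=> //; right; exists (VT e T j); split=> //=; split=> //; by exists R0, i0.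
by rewrite (onth_lt e) ?size_mkseq // nth_mkseq //= asboolF // eqxx.
Qed.
End Basics.
End Canonical1.

(** * The two worlds satisfy the functional dependencies *)

Module Canonical2.
Import Defs DatalogSyntax DatalogProgram ExtensionalFacts ProgramFacts Canonical1.
Import all_boot zify.
Import boolp.
Section Basics.
Variables (S : schema) (q : bcq) (J : nat -> bool) (js : nat) (g : nat -> seq nat -> bool).
Hypothesis wfS : wf_schema S.
Hypothesis wfq : wf_query S q.
Hypothesis adm : admissible S q J js.
Notation edb := (fun t a => is_true (sedb S q J g t a)).
Notation E := (dE edb). Notation C := (dC edb). Notation D := (dD edb). Notation Ob := (dOb edb).
Notation Eq := (dEq edb). Notation Lv := (dLv edb). Notation Ac := (dAc edb). Notation AT := (dAT edb).
Notation Rv := (dRv edb). Notation Rev := (dRev edb). Notation U := (dU edb). Notation E2 := (dE2 edb).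
Notation P2 := (dP2 edb). Notation O2 := (dO2 edb).
Let fd_wf := @ProgramFacts.fd_wf S q J js g wfS adm.
Let Lv_fun := @ProgramFacts.Lv_fun S q J g wfq.
Let C_fd' := @ProgramFacts.C_fd' S q J js g adm.
Let D_fd' := @ProgramFacts.D_fd' S q J js g adm.
Notation var := (@ProgramFacts.var q).
Let atm_argP := @ProgramFacts.atm_argP S q J js g wfq adm.
Let Eq_fd' := @ProgramFacts.Eq_fd' S q J js g wfS wfq adm.
Let methP := @ProgramFacts.methP S q J g.
Let Rv_inv := @ProgramFacts.Rv_inv S q J g.
Notation EqK := (@ProgramFacts.EqK S q J g).
Notation RvK := (@ProgramFacts.RvK S q J g).
Notation rel := (@ProgramFacts.rel q).
Notation rep := (@ProgramFacts.rep S q J g).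
Notation repK := (@ProgramFacts.repK S q J g).
Notation nrm := (@ProgramFacts.nrm J js).
Notation DX := (@ProgramFacts.DX S q J js g).
Notation AccE := (@ProgramFacts.AccE S q J js g).
Notation phi := (@ProgramFacts.phi S q J js g).
Notation Ew := (@ProgramFacts.Ew S q J g).
Notation RevV := (@ProgramFacts.RevV S q J js g).
Notation legit_child := (@ProgramFacts.legit_child S q J js g).
Notation OccV := (@ProgramFacts.OccV S q J js g).
Notation VL := (@ProgramFacts.VL S q J js g).
Notation kap := (@ProgramFacts.kap S q J g).
Notation el := (@ProgramFacts.el S q J g).
Notation slotA := (@ProgramFacts.slotA S q J js g).
Notation PosA := (@ProgramFacts.PosA S q J js g).
Notation new_child := (@ProgramFacts.new_child S q J g).
Notation Birth := (@ProgramFacts.Birth S q J js g).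
Notation Occ := (@ProgramFacts.Occ S q J js g).
Notation Vw := (@ProgramFacts.Vw S q J js g).
Notation Iw := (@ProgramFacts.Iw S q J js g).
Let rep_eq := @ProgramFacts.rep_eq S q J g.
Let rep_inj := @ProgramFacts.rep_inj S q J g.
Let Eq_var := @ProgramFacts.Eq_var S q J g.
Let atm_C := @ProgramFacts.atm_C S q J g.
Let nrmE := @ProgramFacts.nrmE J js.
Let DX_C := @ProgramFacts.DX_C S q J js g wfS adm.
Let OccV_ES := @ProgramFacts.OccV_ES S q J js g.
Let OccV_EF := @ProgramFacts.OccV_EF S q J js g.
Let VQ_atm := @ProgramFacts.VQ_atm S q J g.
Let VL_live := @ProgramFacts.VL_live S q J js g wfS adm.
Let OccV_selfacc := @ProgramFacts.OccV_selfacc S q J js g wfS adm.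
Let Vw_VL := @ProgramFacts.Vw_VL S q J js g wfS wfq adm.
Let onth_lt := @Canonical1.onth_lt.
Let Iw_C := @Canonical1.Iw_C S q J js g wfS wfq adm.
Lemma Rv_rel v m : VL v -> Rv (phi v) m -> m < size (s_meth S) /\ m_rel (nmeth S m) = rel v.
Proof. by move=> /VL_live[_ hl] hr; have [hm hl2] := Rv_inv hr; split=> //; exact: (Lv_fun hl2 hl). Qed.

(** The entry belongs to slot [d] of the fact itself, as opposed to being inherited from a
    parent. *)
Definition home (e : elt) (d : nat) (v : vf elt) :=
  match v with VQ a => e = ET (rep (0, var a d, 0)) | _ => e = ES v d /\ fresh_pos v d end.

Lemma el_home b v d : ~ C (rel v) d ->
  (exists2 e, v = VT e (rel v) d & el b v d = e) \/ home (el b v d) d v.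
Proof.
case: v => [a|b' R|e T l] /= nC; first by right.
  by right; rewrite asboolF.
by rewrite asboolF //; case: eqP => [->|nl]; [left; exists e | right].
Qed.

Lemma home_OccV e d v : is_pos S (rel v) d -> ~ C (rel v) d -> home e d v -> VL v -> OccV e (rel v) d.
Proof.
case: v => [a|b' R|e' T l] hp nC /=.
- move=> -> ha; left; exists a, (var a d); split=> //; first exact: VQ_atm.
  by have [] := atm_argP (VQ_atm ha) hp.
- by case=> -> _ hE; apply/OccV_ES; split.
by case=> -> h1 h2; apply/OccV_ES; split.
Qed.

Lemma home_Birth w e d v : is_pos S (rel v) d -> ~ C (rel v) d -> home e d v -> Vw w v -> Birth w e (rel v) d.
Proof.
case: v => [a|b' R|e' T l] hp nC /=.
- move=> -> [hw ha]; left; split=> //; exists a, (var a d); split=> //; first exact: VQ_atm.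
  by have [] := atm_argP (VQ_atm ha) hp.
- by case=> -> _ [hb hE] /=.
by case=> -> h1 h2 /=.
Qed.

(** If a revealing method determines the inherited position, the child is exposed there, and another
    occurrence of [e] at that position would make it illegitimate. *)
Lemma A_conflict e T l m : VL (VT e T l) -> Rv (phi (VT e T l)) m -> J l -> D m l -> ~ OccV e T l.
Proof.
move=> /= [[R0 [i0 [ho hu]]] nC nO] hr Jl hD hO; apply: nO; split=> //.
case: asboolP hr => ha hr; first by split=> //; exact: Rev_in hr hD.
by case: ha; apply: OccV_selfacc hO Jl _; exact: Ac_rv hr hD.
Qed.

Lemma VT_rel v e T l : v = VT e T l -> rel v = T. Proof. by move->. Qed.

(* A fact of either world: a revealed copy when [a] is false (then only the positions of [DX m] carry shared elements). *)
Definition fact w R a v m k t :=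
  [/\ rel v = R, VL v, size t = arity S R,
      if a then Vw w v else Rv (phi v) m
    & forall j, is_pos S R j -> ~ C R j -> onth t j = Some (if a || `[< DX m j >] then el false v j else EF v m k j)].

Lemma el_nC b v j : ~ C (rel v) j -> el b v j = el false v j.
Proof. by case: v => [a|b' R|e T l] //= nC; rewrite asboolF. Qed.

Lemma Iw_fact w R t : Iw w R t -> exists a v m k, fact w R a v m k t.
Proof.
move=> [_ [[v [m [k [hL hr eR ->]]]]|[v [hv eR ->]]]].
  exists false, v, m, k; split=> //; first by rewrite size_mkseq.
  by move=> j /andP[_ hj] _; rewrite (onth_lt (EK (0, 0))) ?size_mkseq // nth_mkseq.
exists true, v, 0, 0; split=> //; [exact: Vw_VL hv | by rewrite size_mkseq|].
move=> j /andP[_ hj] nC; rewrite (onth_lt (EK (0, 0))) ?size_mkseq // nth_mkseq //=.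
by rewrite el_nC // eR.
Qed.

Lemma fact_conf w R a v m k t e d : fact w R a v m k t -> J d -> a || `[< DX m d >] -> v = VT e R d ->
  ~ (OccV e R d /\ Occ w e R d).
Proof.
move=> [eR hL st hk _] Jd; case: a hk => /= hk hX ev [h1 h2]; first by rewrite ev in hk; case: hk.
move/asboolP: hX; rewrite /DX nrmE // => hD; rewrite ev in hL hk; exact: A_conflict hL hk Jd hD h1.
Qed.

Lemma fact_src w R a v m k t e d : fact w R a v m k t -> is_pos S R d -> ~ C R d -> onth t d = Some e ->
  (a || `[< DX m d >] -> home e d v) -> OccV e R d /\ Occ w e R d.
Proof.
move=> [eR hL st hk ht] hp nC; rewrite (ht d hp nC) => -[he] hh; subst R.
case: a he hh hk {ht} => /= he hh hk.
  by split; [exact: home_OccV (hh isT) hL | right; exact: home_Birth (hh isT) hk].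
split; last first.
  by left; exists v, m, k; split.
case: asboolP he hh => hX he hh; first exact: home_OccV (hh isT) hL.
by rewrite -he; apply/OccV_EF.
Qed.

(** A birthplace at a nonconstant position excludes a child of the same element there, and
    conversely. What remains are fresh entries, which identify their copy, several copies of one
    fact, and query atoms with merged variables. *)
Lemma fact_pair w R a1 v1 m1 k1 t1 a2 v2 m2 k2 t2 d :
  fact w R a1 v1 m1 k1 t1 -> fact w R a2 v2 m2 k2 t2 -> is_pos S R d -> J d -> ~ C R d -> onth t1 d = onth t2 d ->
  [/\ v1 = v2, m1 = m2, k1 = k2, a1 = false & a2 = false] \/
  [/\ a1 || `[< DX m1 d >], a2 || `[< DX m2 d >]
    & v1 = v2 \/ exists b1 b2, [/\ v1 = VQ b1, v2 = VQ b2 & rep (0, var b1 d, 0) = rep (0, var b2 d, 0)]].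
Proof.
move=> f1 f2 hp Jd nC ee.
have [e1 l1 s1 h1 t1E] := f1; have [e2 l2 s2 h2 t2E] := f2.
have C1 := fact_conf f1 Jd; have C2 := fact_conf f2 Jd.
have S1 e := fact_src (e := e) f1 hp nC; have S2 e := fact_src (e := e) f2 hp nC.
move: ee S1 S2; rewrite t1E // t2E //; move: C1 C2.
case X1 : (a1 || _); case X2 : (a2 || _) => C1 C2 [ee] S1 S2.
- right; split=> //.
  have := el_home false (v := v1) (d := d); rewrite e1 => /(_ nC).
  have := el_home false (v := v2) (d := d); rewrite e2 => /(_ nC).
  move=> H2 H1; case: H1 H2 => [[x1 w1 w1e] [[x2 w2 w2e]|w2]|w1 [[x2 w2 w2e]|w2]].
  + by left; rewrite w1 w2 -w1e -w2e ee.
  + by case: (C1 x1 isT w1); rewrite -w1e; apply: S2; rewrite ee.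
  + by case: (C2 x2 isT w2); rewrite -w2e; apply: S1; rewrite -ee.
  + rewrite ee in w1; case: v1 v2 w1 w2 {t1E t2E f1 f2 e1 e2 l1 l2 h1 h2 C1 C2 S1 S2 ee} => [b1|? ?|? ? ?] [b2|? ?|? ? ?] /=.
    * by case=> h _; right; exists b1, b2; split.
    * by move=> -> [].
    * by move=> -> [].
    * by case.
    * by case=> -> _ [[-> ->]]; left.
    * by case=> -> _ [].
    * by case.
    * by case=> -> _ [].
    * by case=> -> _ [[-> -> ->]]; left.
- have := el_home false (v := v1) (d := d); rewrite e1 => /(_ nC) [[x1 w1 w1e]|w1].
    by case: (C1 x1 isT w1); rewrite -w1e; apply: S2; rewrite ?ee.
  by rewrite ee in w1; case: (v1) w1 => [?|? ?|? ? ?] /=; [|case|case].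
- have := el_home false (v := v2) (d := d); rewrite e2 => /(_ nC) [[x1 w1 w1e]|w1].
    by case: (C2 x1 isT w1); rewrite -w1e; apply: S1; rewrite ?ee.
  by rewrite -ee in w1; case: (v2) w1 => [?|? ?|? ? ?] /=; [|case|case].
- by left; split=> //; [case: (a1) X1 | case: (a2) X2].
Qed.

(** Determined positions are closed under the functional dependencies of the relation by the rules
    for [dD]. *)
Lemma fact_closed w R a v m k t i sz r : fact w R a v m k t -> edb efd [:: i; R; sz; r] ->
  (forall x, x < sz -> a || `[< DX m (nth 0 (f_lhs (nfd S i)) x) >]) -> a || `[< DX m r >].
Proof.
move=> [eR hL st hk ht] hf; have [[_ Jr _] hl] := fd_wf hf; case: a hk {ht} => //= hr H; apply/asboolP.
have [hm e] := Rv_rel hL hr; rewrite /DX nrmE //; apply: D_fd' hf _ _; first by rewrite -eR -e; exact: methP.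
by move=> x hx; have /asboolP := H x hx; rewrite /DX nrmE //; have [] := hl x hx.
Qed.

Lemma Iw_fd w f : List.In f (s_fd S) -> sat_fd (Iw w) f.
Proof.
move=> /(In_ex_nth dfd)[i hi ef] t1 t2 h1 h2 H.
have hf : edb efd [:: i; f_rel f; size (f_lhs f); f_rhs f] by rewrite /= hi /nfd ef !eqxx.
move: hf h1 h2 H; set R := f_rel f; set r := f_rhs f => hf h1 h2 H.
have [[pr Jr _] hl] := fd_wf hf.
have lhsE : f_lhs (nfd S i) = f_lhs f by rewrite /nfd ef.
case: (pselect (C R r)) => [hC|nC]; first by rewrite (Iw_C h1 hC) (Iw_C h2 hC).
have [a1 [v1 [m1 [k1 f1]]]] := Iw_fact h1; have [a2 [v2 [m2 [k2 f2]]]] := Iw_fact h2.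
(* If all positions of the left-hand side were constant, so would be the right-hand one. *)
have [x hx nx] : exists2 x, x < size (f_lhs f) & ~ C R (nth 0 (f_lhs (nfd S i)) x).
  apply: contra_notP nC => nx; apply: C_fd' hf _ => x hx.
  by apply: contrapT => n; apply: nx; exists x.
have pair y (hy : y < size (f_lhs f)) (ny : ~ C R (nth 0 (f_lhs (nfd S i)) y)) :=
  fact_pair f1 f2 (hl y hy).1 (hl y hy).2 ny (H _ (eq_ind_r (fun s => nth 0 s y \in f_lhs f) (mem_nth 0 hy) lhsE)).
have [e1 l1 s1 k1h t1E] := f1; have [e2 l2 s2 k2h t2E] := f2.
rewrite t1E // t2E //.
case: (pselect [/\ v1 = v2, m1 = m2, k1 = k2, a1 = false & a2 = false]) => [[-> -> -> -> ->] //|ns].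
have pair' y (hy : y < size (f_lhs f)) (ny : ~ C R (nth 0 (f_lhs (nfd S i)) y)) : [/\ a1 || `[< DX m1 (nth 0 (f_lhs (nfd S i)) y) >], a2 || `[< DX m2 (nth 0 (f_lhs (nfd S i)) y) >]
    & v1 = v2 \/ exists b1 b2, [/\ v1 = VQ b1, v2 = VQ b2 & rep (0, var b1 (nth 0 (f_lhs (nfd S i)) y), 0) = rep (0, var b2 (nth 0 (f_lhs (nfd S i)) y), 0)]].
  by case: (pair y hy ny).
have cl a v m k t (f0 : fact w R a v m k t) y : C R y -> a || `[< DX m y >].
  case: f0 => eR hL _ hk _ hC; case: a hk => //= hr; have [hm e] := Rv_rel hL hr.
  by apply/asboolP; apply: DX_C => //; rewrite e eR.
have X1 : a1 || `[< DX m1 r >].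
  apply: (fact_closed f1 hf) => y hy; case: (pselect (C R (nth 0 (f_lhs (nfd S i)) y))) => hC; first exact: (cl _ _ _ _ _ f1).
  by have [] := pair' y hy hC.
have X2 : a2 || `[< DX m2 r >].
  apply: (fact_closed f2 hf) => y hy; case: (pselect (C R (nth 0 (f_lhs (nfd S i)) y))) => hC; first exact: (cl _ _ _ _ _ f2).
  by have [] := pair' y hy hC.
(* Facts with the same origin agree at [r]. Two query atoms remain; merging their variables under
   functional dependencies is built into [dEq]. *)
rewrite X1 X2; have [_ _ [->//|[b1 [b2 [w1 w2 _]]]]] := pair' x hx nx.
subst v1 v2; rewrite /=; congr (Some (ET _)); apply: rep_eq.
have q1 : edb eatm [:: b1; R] by rewrite -e1; exact: VQ_atm.
have q2 : edb eatm [:: b2; R] by rewrite -e2; exact: VQ_atm.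
apply: (Eq_fd' hf q1 q2) => y hy; have [py _] := hl y hy.
have [g1 _] := atm_argP q1 py; have [g2 _] := atm_argP q2 py.
apply: rep_inj; [exact: (Eq_var g1) | exact: (Eq_var g2)|].
case: (pselect (C R (nth 0 (f_lhs (nfd S i)) y))) => hC; first by rewrite (atm_C q1 g1 hC) (atm_C q2 g2 hC).
have [_ _ [[->] //|[c1 [c2 [[->] [->]]]]]] := pair' y hy hC; exact.
Qed.
End Basics.
End Canonical2.

(** * Common outputs: plans do not separate the two worlds *)

Module Canonical3.
Import Defs DatalogSyntax DatalogProgram ExtensionalFacts ProgramFacts Canonical1 Canonical2.
Import all_boot zify.
Import boolp.
Section Basics.
Variables (S : schema) (q : bcq) (J : nat -> bool) (js : nat) (g : nat -> seq nat -> bool).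
Hypothesis wfS : wf_schema S.
Hypothesis wfq : wf_query S q.
Hypothesis adm : admissible S q J js.
Notation edb := (fun t a => is_true (sedb S q J g t a)).
Notation E := (dE edb). Notation C := (dC edb). Notation D := (dD edb). Notation Ob := (dOb edb).
Notation Eq := (dEq edb). Notation Lv := (dLv edb). Notation Ac := (dAc edb). Notation AT := (dAT edb).
Notation Rv := (dRv edb). Notation Rev := (dRev edb). Notation U := (dU edb). Notation E2 := (dE2 edb).
Notation P2 := (dP2 edb). Notation O2 := (dO2 edb).
Let atm_wf := @ProgramFacts.atm_wf S q J g wfq.
Notation var := (@ProgramFacts.var q).
Let inp_pos := @ProgramFacts.inp_pos S q J js g wfS adm.
Let Rv_in' := @ProgramFacts.Rv_in' S q J js g adm.
Notation EqK := (@ProgramFacts.EqK S q J g).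
Notation RvK := (@ProgramFacts.RvK S q J g).
Notation rel := (@ProgramFacts.rel q).
Notation rep := (@ProgramFacts.rep S q J g).
Notation repK := (@ProgramFacts.repK S q J g).
Notation nrm := (@ProgramFacts.nrm J js).
Notation DX := (@ProgramFacts.DX S q J js g).
Notation AccE := (@ProgramFacts.AccE S q J js g).
Notation phi := (@ProgramFacts.phi S q J js g).
Notation Ew := (@ProgramFacts.Ew S q J g).
Notation RevV := (@ProgramFacts.RevV S q J js g).
Notation legit_child := (@ProgramFacts.legit_child S q J js g).
Notation OccV := (@ProgramFacts.OccV S q J js g).
Notation VL := (@ProgramFacts.VL S q J js g).
Notation kap := (@ProgramFacts.kap S q J g).
Notation el := (@ProgramFacts.el S q J g).
Notation slotA := (@ProgramFacts.slotA S q J js g).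
Notation PosA := (@ProgramFacts.PosA S q J js g).
Notation new_child := (@ProgramFacts.new_child S q J g).
Notation Birth := (@ProgramFacts.Birth S q J js g).
Notation Occ := (@ProgramFacts.Occ S q J js g).
Notation Vw := (@ProgramFacts.Vw S q J js g).
Notation Iw := (@ProgramFacts.Iw S q J js g).
Let nrmE := @ProgramFacts.nrmE J js.
Let VQ_atm := @ProgramFacts.VQ_atm S q J g.
Let VL_live := @ProgramFacts.VL_live S q J js g wfS adm.
Let phi_el_acc := @ProgramFacts.phi_el_acc S q J js g wfS wfq adm.
Let el_phi_acc := @ProgramFacts.el_phi_acc S q J js g wfS wfq adm.
Let Vw_VL := @ProgramFacts.Vw_VL S q J js g wfS wfq adm.
Let onth_lt := @Canonical1.onth_lt.
Let Vw_Ew := @Canonical1.Vw_Ew S q J js g wfS adm.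
Let Iw_wf := @Canonical1.Iw_wf S q J js g.
Let kap_false_rev := @Canonical1.kap_false_rev S q J js g wfS wfq adm.
Let el_C := @Canonical1.el_C S q J js g wfq adm.
Let Iw_uid := @Canonical1.Iw_uid S q J js g wfS wfq adm.
Notation home := (@Canonical2.home S q J g).
Notation fact := (@Canonical2.fact S q J js g).
Let el_nC := @Canonical2.el_nC S q J g.
Let Iw_fd := @Canonical2.Iw_fd S q J js g wfS wfq adm.
Definition Afact R t := exists v m k, [/\ VL v, Rv (phi v) m, rel v = R & t = mkseq (slotA v m k) (arity S R)].

Lemma Afact_acc R t : is_rel S R -> Afact R t -> forall x, List.In x t -> AccE x.
Proof.
move=> hR [v [m [k [hL hr eR ->]]]] x /(In_ex_nth (EK (0, 0)))[j]; rewrite size_mkseq => hj; rewrite nth_mkseq // => <-.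
rewrite /slotA; case: asboolP => // hD; apply: phi_el_acc => //; first by rewrite eR /is_pos hR.
exact: Ac_rv hr hD.
Qed.

Definition many T (P : T -> Prop) := forall n, exists l, [/\ List.NoDup l, size l = n & forall x, List.In x l -> P x].

Lemma NoDup_mkseq T (f : nat -> T) n : injective f -> List.NoDup (mkseq f n).
Proof.
move=> hf; rewrite /mkseq; elim: n 0 => [|n IH] m /=; first exact: List.NoDup_nil.
apply: List.NoDup_cons; last exact: IH.
by move=> /(In_ex_nth (f 0))[i]; rewrite size_map size_iota => hi; rewrite (nth_map 0) ?size_iota // nth_iota // => /hf; lia.
Qed.

(** If every position is determined, the revealed copy is the fact itself. Otherwise the method is
    bounded, since an unbounded one determines everything, and there are infinitely many copies with
    the same inputs. *)
Lemma access_copies w m t : m < size (s_meth S) -> Iw w (m_rel (nmeth S m)) t ->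
  (forall x e, x \in m_in (nmeth S m) -> onth t x = Some e -> AccE e) ->
  Afact (m_rel (nmeth S m)) t \/
  m_bound (nmeth S m) <> None /\
  many (fun t' => Afact (m_rel (nmeth S m)) t' /\ forall x, x \in m_in (nmeth S m) -> onth t' x = onth t x).
Proof.
set R := m_rel _ => hm [hR [h|[v [hv eR et]]]] ha; first by left.
have hL := Vw_VL hv; have hE := Vw_Ew hv; have [_ hl] := VL_live hL.
have tE j : j < arity S R -> onth t j = Some (el w v j).
  by move=> hj; rewrite et (onth_lt (EK (0, 0))) ?size_mkseq // nth_mkseq.
have hr : Rv (phi v) m.
  apply: (Rv_in' hm); first by rewrite -/R -eR.
  move=> x hx; have [Jx px _ _] := inp_pos hm hx; rewrite -/R in px; have /andP[_ xl] := px.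
  by apply: (el_phi_acc hL hE _ Jx); rewrite ?eR //; apply: (ha x) => //; exact: tE.
have elE j : is_pos S R j -> el false v j = el w v j.
  move=> hj; case: (pselect (C R j)) => hC; last by rewrite [RHS]el_nC // eR.
  rewrite el_C ?eR // ?el_C ?eR //; [exact: kap_false_rev hL eR hr hC | by case: (v) hv => //= a []|by case: (v)].
have fA k : Afact R (mkseq (slotA v m k) (arity S R)) by exists v, m, k.
have all_in : (forall j, j < arity S R -> DX m j) -> Afact R t.
  move=> h; exists v, m, 0; split=> //; rewrite et; apply: (@eq_from_nth _ (EK (0, 0))); rewrite ?size_mkseq // => j hj.
  by rewrite !nth_mkseq // /slotA (asboolT (h j hj)) elE // /is_pos hR.
case: (pselect (forall j, j < arity S R -> DX m j)) => [/all_in h|nD]; [by left | right].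
have [j hj nj] : exists2 j, j < arity S R & ~ DX m j.
  by apply: contra_notP nD => h j hj; apply: contrapT => n; apply: h; exists j.
split.
  move=> hb; apply: nj; rewrite /DX; apply: D_unb; first by rewrite /= hm hb /=.
  by rewrite /= /nrm; case: ifP => // _; exact: adm_js adm.
(* The copies differ at the undetermined position [j], where the entry records the copy number. *)
move=> n; exists (mkseq (fun k => mkseq (slotA v m k) (arity S R)) n); split; rewrite ?size_mkseq //.
  apply: NoDup_mkseq => k1 k2 /(congr1 (fun s => onth s j)).
  rewrite !(onth_lt (EK (0, 0))) ?size_mkseq // !nth_mkseq // /slotA asboolF //=.
  by case.
move=> x /(In_ex_nth [::])[k]; rewrite size_mkseq => hk; rewrite nth_mkseq // => <-; split=> // y hy.
have [Jy py hD _] := inp_pos hm hy; rewrite -/R in py; have /andP[_ yl] := py.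
rewrite tE // (onth_lt (EK (0, 0))) ?size_mkseq // nth_mkseq // /slotA asboolT ?elE //.
by rewrite /DX nrmE.
Qed.

Lemma output_exists D0 (N : table D0) k : exists Jo : table D0,
  [/\ forall t, Jo t -> N t, at_most k Jo & forall j, j <= k -> at_least j N -> at_least j Jo].
Proof.
elim: k => [|k [Jo [h1 h2 h3]]].
  exists (fun _ => False); split=> //; first by exists [::].
  by move=> j; rewrite leqn0 => /eqP -> _; exists [::]; split; [exact: List.NoDup_nil|].
case: (pselect (at_least k.+1 N)) => [[l [l1 [l2 l3]]]|nN].
  exists (fun t => List.In t l); split=> //; first by exists l; rewrite l2.
  move=> j hj _; exists (take j l); split; last split.
  - move: l1; rewrite -{1}(cat_take_drop j l); elim: (take j l) => [|x s IH] /=; first by constructor.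
    by move=> /List.NoDup_cons_iff [a b]; constructor; [move=> hx; apply: a; apply/List.in_app_iff; left | exact: IH].
  - by rewrite size_takel // l2.
  - by move=> x hx; rewrite -(cat_take_drop j l); apply/List.in_app_iff; left.
exists Jo; split=> //; first by case: h2 => l [a b]; exists l; split=> //; exact: leqW.
by move=> j; rewrite leq_eqVlt => /orP[/eqP-> //|]; exact: h3.
Qed.

Lemma at_least_size D0 j k (A : table D0) : at_least j A -> k <= j -> at_least k A.
Proof.
move=> [l [l1 [l2 l3]]] hk; exists (take k l); split; last split.
- move: l1; rewrite -{1}(cat_take_drop k l); elim: (take k l) => [|x s IH] /=; first by constructor.
  by move=> /List.NoDup_cons_iff [a b]; constructor; [move=> hx; apply: a; apply/List.in_app_iff; left | exact: IH].
- by rewrite size_takel // l2.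
- by move=> x hx; apply: l3; rewrite -(cat_take_drop k l); apply/List.in_app_iff; left.
Qed.

Lemma Afact_Iw w R t : is_rel S R -> Afact R t -> Iw w R t.
Proof. by move=> hR h; split=> //; left. Qed.

(** The output is taken among the revealed copies. A matching tuple outside them exists only for a
    bounded method with infinitely many matching copies, so the copies alone meet the bound in
    either world. *)
Lemma common_output m b : m < size (s_meth S) -> (forall e, List.In e b -> AccE e) ->
  exists Jo : table elt, [/\ forall w, valid_output (Iw w) (nmeth S m) b Jo
    & forall t, Jo t -> forall x, List.In x t -> AccE x].
Proof.
move=> hm hb; set M := fun w => matching (Iw w) (nmeth S m) b.
set R := m_rel (nmeth S m).
have [_ [_ W]] := wfS; have := allIn W (In_nth dmeth hm); rewrite -/(nmeth S m) => /and4P[hR _ _ _].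
pose N t := Afact R t /\ M false t.
have NM w t : N t -> M w t by move=> [h [_ h2]]; split=> //; exact: Afact_Iw.
have AM w t : Afact R t -> M w t -> N t by move=> h [_ h2]; split=> //; split=> //; exact: Afact_Iw.
have key w t : M w t -> N t \/ m_bound (nmeth S m) <> None /\ many N.
  move=> [ht [sb h]]; case: (@access_copies w m t hm ht) => [x e hx he|hA|[hn hma]].
  - have [_ _ _ [i il ei]] := inp_pos hm hx; apply: hb.
    by move: (h i il); rewrite ei he (onth_lt e) ?sb // => -[->]; apply: In_nth; rewrite sb.
  - by left; apply: (AM w).
  right; split=> // n; have [l [l1 l2 l3]] := hma n; exists l; split=> // x /l3 [hx1 hx2].
  apply: (AM w) => //; split; first exact: Afact_Iw.
  by split=> // i il; rewrite hx2 ?h // mem_nth.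
have Nacc t : N t -> forall x, List.In x t -> AccE x by move=> [h _]; exact: Afact_acc h.
case e : (m_bound (nmeth S m)) => [k|]; last first.
  exists N; split=> // w; split; first by move=> t; exact: NM.
  by rewrite e => t /key[//|[]]; rewrite e.
have [Jo [h1 h2 h3]] := output_exists N k; exists Jo; split; last by move=> t /h1; exact: Nacc.
move=> w; split; first by move=> t /h1; exact: NM.
rewrite e; split=> // j hj hM; apply: h3 => //.
case: (pselect (many N)) => [/(_ j)[l [l1 l2 l3]]|nM]; first by exists l.
case: hM => l [l1 [l2 l3]]; exists l; split=> //; split=> // x /l3 /key[//|[_ //]].
Qed.

Section Lockstep.
Variables (D0 : Type) (I0 I1 : instance D0) (P : D0 -> Prop).
Hypothesis comm : forall mi m b, onth (s_meth S) mi = Some m -> (forall e, List.In e b -> P e) ->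
  exists Jo : table D0, [/\ valid_output I0 m b Jo, valid_output I1 m b Jo & forall t, Jo t -> forall x, List.In x t -> P x].

Lemma rexpr_pure env e : (forall T t x, List.In T env -> T t -> List.In x t -> P x) ->
  forall t x, rexpr_eval env e t -> List.In x t -> P x.
Proof.
move=> henv; elim: e => [i||e1 IH1 e2 IH2|e1 IH1 e2 IH2|cols e IH|i j e IH] t x /=.
- case: (ltnP i (size env)) => hi; last by rewrite nth_default.
  by apply: henv; exact: In_nth.
- by move=> ->.
- by case; [exact: IH1 | exact: IH2].
- by move=> [t1 [t2 [-> [h1 h2]]]] /List.in_app_iff [|]; [exact: IH1 | exact: IH2].
- move=> [u [hu et]] hx; have : List.In (Some x) (map (onth u) cols) by rewrite et; apply: List.in_map.
  move=> /(In_ex_nth None)[i]; rewrite size_map => hi; rewrite (nth_map 0) // => hx'.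
  apply: (IH u) => //; elim: (u) (nth 0 cols i) hx' => [|y s IHs] [|n] //=; first by case=> ->; left.
  by move=> h; right; exact: IHs h.
- by case=> h _; exact: IH h.
Qed.

(** Algebra expressions create no new values, so all bindings consist of elements satisfying [P],
    and for these both instances admit a common output. *)
Lemma lockstep cs env0 (env : seq (table D0)) : wt_cmds S env0 cs <> None ->
  (forall T t x, List.In T env -> T t -> List.In x t -> P x) ->
  exists env', exec S I0 cs env env' /\ exec S I1 cs env env'.
Proof.
elim: cs env0 env => [|[e|mi e] cs IH] env0 env /= hw henv.
- by exists env; split; constructor.
- case: (rexpr_arity env0 e) hw => // n hw.
  have [|env' [h1 h2]] := IH _ (rcons env (rexpr_eval env e)) hw.
    move=> T t x; rewrite -cats1 => /List.in_app_iff[/henv|[<-|//]]; first exact.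
    exact: rexpr_pure.
  by exists env'; split; constructor.
case em : (onth _ mi) hw => [m|] //; case: (rexpr_arity env0 e) => // n; case: ifP => // _ hw.
pose Jb b := if pselect (forall x, List.In x b -> P x) is left h then projT1 (cid (comm em h)) else fun=> False.
have hJ b : rexpr_eval env e b -> [/\ valid_output I0 m b (Jb b), valid_output I1 m b (Jb b) & forall t, Jb b t -> forall x, List.In x t -> P x].
  move=> hb; rewrite /Jb; case: pselect => [h|[]]; first exact: projT2 (cid (comm em h)).
  by move=> x; apply: rexpr_pure hb.
have [|env' [h1 h2]] := IH _ (rcons env (fun t => exists b, rexpr_eval env e b /\ Jb b t)) hw.
  move=> T t x; rewrite -cats1 => /List.in_app_iff[/henv|[<-|//]]; first exact.
  move=> [b [/hJ[_ _ hb] hj]] hx; exact: (hb t hj x hx).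
by exists env'; split; apply: (exec_acc em (J := Jb)) => //; move=> b /hJ[].
Qed.
End Lockstep.

Lemma query_holds_false : cq_holds (Iw false) q.
Proof.
exists (fun v => Some (ET (rep (0, v, 0)))) => a /(nthP datm)[i hi ea].
have ha := VQ_atm hi; have [_ _ hR hs] := atm_wf ha.
rewrite /= /natm ea in hR hs.
exists (mkseq (el false (VQ i)) (arity S a.1)); split.
  split=> //; right; exists (VQ i); split=> //=; by rewrite /natm ea.
apply: (@eq_from_nth _ None); rewrite !size_map ?size_iota ?hs // => j hj.
by rewrite (nth_map 0) ?hs // (nth_map (EK (0, 0))) ?size_mkseq // nth_mkseq //= /var /natm ea.
Qed.

(** Two executions that end in the same tables give the same answer, and in the first world the
    answer is true. *)
Theorem answerable_second_world : monotone_answerable S q -> cq_holds (Iw true) q.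
Proof.
case=> [[cs ret]] [[env0 [/= hw hret]] H].
have [envf [h1 h2]] : exists env', exec S (Iw false) cs [::] env' /\ exec S (Iw true) cs [::] env'.
  apply: (@lockstep elt (Iw false) (Iw true) AccE _ cs [::]); rewrite ?hw //.
  move=> mi m b em hb; have hmi : mi < size (s_meth S) by rewrite ltnNge; apply: contraPN em => /onth_default ->.
  have em' : m = nmeth S mi by move: em; rewrite (onth_lt dmeth) // => -[].
  by have [Jo [hJ hP]] := common_output hmi hb; exists Jo; split=> //; rewrite em'.
have sat w : sat_constraints S (Iw w) by split=> [u|f]; [exact: Iw_uid | exact: Iw_fd].
have [_ /(_ (conj erefl query_holds_false)) h] := H _ _ (@Iw_wf false) (sat false) _ h1 [::].
by have [/(_ h)[_ ]] := H _ _ (@Iw_wf true) (sat true) _ h2 [::].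
Qed.
End Basics.
End Canonical3.

(** * Derivable facts mention only numbers of the domain *)

Module Canonical4.
Import Defs DatalogSyntax DatalogProgram ExtensionalFacts ProgramFacts Canonical1 Canonical2 Canonical3.
Import all_boot zify.
Import boolp.
Section Basics.
Variables (S : schema) (q : bcq) (J : nat -> bool) (js : nat) (g : nat -> seq nat -> bool).
Hypothesis wfS : wf_schema S.
Hypothesis wfq : wf_query S q.
Hypothesis adm : admissible S q J js.
Notation edb := (fun t a => is_true (sedb S q J g t a)).
Notation E := (dE edb). Notation C := (dC edb). Notation D := (dD edb). Notation Ob := (dOb edb).
Notation Eq := (dEq edb). Notation Lv := (dLv edb). Notation Ac := (dAc edb). Notation AT := (dAT edb).
Notation Rv := (dRv edb). Notation Rev := (dRev edb). Notation U := (dU edb). Notation E2 := (dE2 edb).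
Notation P2 := (dP2 edb). Notation O2 := (dO2 edb).
Let edb_all := @ProgramFacts.edb_all S q J js g adm.
Let uid_pos := @ProgramFacts.uid_pos S q J js g wfS adm.
Let J_small := @ProgramFacts.J_small S q J js adm.
Let C_pos := @ProgramFacts.C_pos S q J js g wfS adm.
Let Lv_inv := @ProgramFacts.Lv_inv S q J g.
Notation var := (@ProgramFacts.var q).
Let methP := @ProgramFacts.methP S q J g.
Let Rv_inv := @ProgramFacts.Rv_inv S q J g.
Let Ob_inv := @ProgramFacts.Ob_inv S q J g.
Notation EqK := (@ProgramFacts.EqK S q J g).
Notation RvK := (@ProgramFacts.RvK S q J g).
Notation rel := (@ProgramFacts.rel q).
Notation rep := (@ProgramFacts.rep S q J g).
Notation repK := (@ProgramFacts.repK S q J g).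
Notation nrm := (@ProgramFacts.nrm J js).
Notation DX := (@ProgramFacts.DX S q J js g).
Notation AccE := (@ProgramFacts.AccE S q J js g).
Notation phi := (@ProgramFacts.phi S q J js g).
Notation Ew := (@ProgramFacts.Ew S q J g).
Notation RevV := (@ProgramFacts.RevV S q J js g).
Notation legit_child := (@ProgramFacts.legit_child S q J js g).
Notation OccV := (@ProgramFacts.OccV S q J js g).
Notation VL := (@ProgramFacts.VL S q J js g).
Notation kap := (@ProgramFacts.kap S q J g).
Notation el := (@ProgramFacts.el S q J g).
Notation slotA := (@ProgramFacts.slotA S q J js g).
Notation PosA := (@ProgramFacts.PosA S q J js g).
Notation new_child := (@ProgramFacts.new_child S q J g).
Notation Birth := (@ProgramFacts.Birth S q J js g).
Notation Occ := (@ProgramFacts.Occ S q J js g).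
Notation Vw := (@ProgramFacts.Vw S q J js g).
Notation Iw := (@ProgramFacts.Iw S q J js g).
Let repP := @ProgramFacts.repP S q J g.
Notation home := (@Canonical2.home S q J g).
Notation fact := (@Canonical2.fact S q J js g).
Notation Afact := (@Canonical3.Afact S q J js g).
Lemma E_J R : E R -> J R.
Proof.
move: R; suff H : forall t a, dl prog edb t a -> (match t, a with pE, [:: R] => is_true (J R) | _, _ => True end) by move=> R /H.
dl_induct; first by move=> v h _ _; have /= /and3P[] := edb_all (isT : 6 < 10) h.
by move=> v /uid_pos[_ _ _ _ [_ h]].
Qed.

Definition Jt (x : tri) := [&& J x.1.1, J x.1.2 & J x.2].

Lemma Ob_J f j x : Ob f j x -> Jt x.
Proof.
have J012 : [/\ J 0, J 1 & J 2] by split; exact: J_small.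
case: J012 => J0 J1 J2.
case/Ob_inv => [[_ h ->]|[R [_ hE h ->]]|[R [hl hC ->]]]; rewrite /Jt /=.
- by have /= /and4P[_ _ -> _] := edb_all (isT : 7 < 10) h; rewrite J0.
- by rewrite J2 (E_J hE) /=; move: h => /= /andP[_ ->].
- by have [hE _] := Lv_inv hl; have [_ -> _] := C_pos hC; rewrite J1 (E_J hE).
Qed.

Lemma Eq_J x y : Eq x y -> Jt x /\ Jt y.
Proof.
move: x y; suff H : forall t a, dl prog edb t a -> (match t, a with pEq, [:: x1; x2; x3; y1; y2; y3] => Jt (x1, x2, x3) /\ Jt (y1, y2, y3) | _, _ => True end).
  by move=> [[x1 x2] x3] [[y1 y2] y3] /H.
dl_induct.
- by move=> v _ [h1 h2] _; split; [exact: (@Ob_J (v 0, v 1, v 2) (v 3) (v 4, v 5, v 6) h1) | exact: (@Ob_J (v 0, v 1, v 2) (v 3) (v 7, v 8, v 9) h2)].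
- by move=> v _ _ [[h1 _] [_ h2]].
- move=> v [_ [h1 h2]] _ _.
  by split; [exact: (Ob_J (Ob_arg h1)) | exact: (Ob_J (Ob_arg h2))].
- move=> v h [h1 h2] _; have hT := E_uid h h2.
  by split; [exact: (Ob_J (Ob_const (Lv_gen h2) (C_uid h h1))) | exact: (Ob_J (Ob_const (Lv_gen hT) h1))].
Qed.

Lemma Lv_J f R : Lv f R -> Jt f.
Proof.
have J012 : [/\ J 0, J 1 & J 2] by split; exact: J_small.
case: J012 => J0 J1 J2; move: f R; suff H : forall t a, dl prog edb t a ->
  (match t, a with pLv, [:: x; y; z; R] => is_true (Jt (x, y, z)) | _, _ => True end) by move=> [[x y] z] R /H.
dl_induct; rewrite /Jt.
- by move=> v h _ _; have /= /and3P[-> _ _] := edb_all (isT : 6 < 10) h; rewrite /= J0.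
- by move=> v _ hE _; rewrite J1 J0 (E_J hE).
- by move=> v /uid_pos[_ _ _ -> [_ ->]] _ _; rewrite J2.
- by move=> v /uid_pos[_ _ _ -> [_ ->]] _ _; rewrite J2.
Qed.

Lemma Rv_J f m : Rv f m -> J m.
Proof. by move=> /Rv_inv[hm _]; have /= /andP[] := edb_all (isT : 3 < 10) (methP hm). Qed.

Lemma rep_J x : Eq x x -> Jt (rep x).
Proof. by move=> h; have [] := Eq_J (repP h). Qed.
End Basics.
End Canonical4.

(** * From a match in the second world to a derivation of the goal *)

Module Soundness.
Import Defs DatalogSyntax DatalogProgram ExtensionalFacts ProgramFacts Canonical1 Canonical2 Canonical3 Canonical4.
Import all_boot zify.
Import boolp.
Section Basics.
Variables (S : schema) (q : bcq) (J : nat -> bool) (js : nat) (g : nat -> seq nat -> bool).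
Hypothesis wfS : wf_schema S.
Hypothesis wfq : wf_query S q.
Hypothesis adm : admissible S q J js.
Notation edb := (fun t a => is_true (sedb S q J g t a)).
Notation E := (dE edb). Notation C := (dC edb). Notation D := (dD edb). Notation Ob := (dOb edb).
Notation Eq := (dEq edb). Notation Lv := (dLv edb). Notation Ac := (dAc edb). Notation AT := (dAT edb).
Notation Rv := (dRv edb). Notation Rev := (dRev edb). Notation U := (dU edb). Notation E2 := (dE2 edb).
Notation P2 := (dP2 edb). Notation O2 := (dO2 edb).
Let edb_all := @ProgramFacts.edb_all S q J js g adm.
Let J_small := @ProgramFacts.J_small S q J js adm.
Let J_atm := @ProgramFacts.J_atm S q J js adm.
Let J_q := @ProgramFacts.J_q S q J js adm.
Let atm_wf := @ProgramFacts.atm_wf S q J g wfq.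
Let C_pos := @ProgramFacts.C_pos S q J js g wfS adm.
Let Lv_inv := @ProgramFacts.Lv_inv S q J g.
Notation var := (@ProgramFacts.var q).
Let atm_argP := @ProgramFacts.atm_argP S q J js g wfq adm.
Let Rv_inv := @ProgramFacts.Rv_inv S q J g.
Let E2_E := @ProgramFacts.E2_E S q J g.
Let U_facts := @ProgramFacts.U_facts S q J js g wfS adm.
Let U_ac := @ProgramFacts.U_ac S q J js g wfS adm.
Let acc_child_unrevealed := @ProgramFacts.acc_child_unrevealed S q J g.
Notation EqK := (@ProgramFacts.EqK S q J g).
Let EqK_sym := @ProgramFacts.EqK_sym S q J g.
Let EqK_C := @ProgramFacts.EqK_C S q J g.
Notation RvK := (@ProgramFacts.RvK S q J g).
Let Eq_const := @ProgramFacts.Eq_const S q J g.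
Let RvK_P2 := @ProgramFacts.RvK_P2 S q J g.
Notation rel := (@ProgramFacts.rel q).
Notation rep := (@ProgramFacts.rep S q J g).
Notation repK := (@ProgramFacts.repK S q J g).
Notation nrm := (@ProgramFacts.nrm J js).
Notation DX := (@ProgramFacts.DX S q J js g).
Notation AccE := (@ProgramFacts.AccE S q J js g).
Notation phi := (@ProgramFacts.phi S q J js g).
Notation Ew := (@ProgramFacts.Ew S q J g).
Notation RevV := (@ProgramFacts.RevV S q J js g).
Notation legit_child := (@ProgramFacts.legit_child S q J js g).
Notation OccV := (@ProgramFacts.OccV S q J js g).
Notation VL := (@ProgramFacts.VL S q J js g).
Notation kap := (@ProgramFacts.kap S q J g).
Notation el := (@ProgramFacts.el S q J g).
Notation slotA := (@ProgramFacts.slotA S q J js g).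
Notation PosA := (@ProgramFacts.PosA S q J js g).
Notation new_child := (@ProgramFacts.new_child S q J g).
Notation Birth := (@ProgramFacts.Birth S q J js g).
Notation Occ := (@ProgramFacts.Occ S q J js g).
Notation Vw := (@ProgramFacts.Vw S q J js g).
Notation Iw := (@ProgramFacts.Iw S q J js g).
Let repP := @ProgramFacts.repP S q J g.
Let AT_rep := @ProgramFacts.AT_rep S q J g.
Let repKP := @ProgramFacts.repKP S q J g.
Let Eq_var := @ProgramFacts.Eq_var S q J g.
Let nrmE := @ProgramFacts.nrmE J js.
Let OccV_ES := @ProgramFacts.OccV_ES S q J js g.
Let OccV_EF := @ProgramFacts.OccV_EF S q J js g.
Let VQ_atm := @ProgramFacts.VQ_atm S q J g.
Let OccV_live := @ProgramFacts.OccV_live S q J js g wfS adm.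
Let VL_live := @ProgramFacts.VL_live S q J js g wfS adm.
Let OccV_selfacc := @ProgramFacts.OccV_selfacc S q J js g wfS adm.
Let Rev_inv := @ProgramFacts.Rev_inv S q J g.
Let PosA_OccV := @ProgramFacts.PosA_OccV S q J js g wfS wfq adm.
Let Birth_OccV := @ProgramFacts.Birth_OccV S q J js g wfS wfq adm.
Let onth_lt := @Canonical1.onth_lt.
Let Vw_Ew := @Canonical1.Vw_Ew S q J js g wfS adm.
Let Iw_Ew := @Canonical1.Iw_Ew S q J js g wfS adm.
Let kap_false_rev := @Canonical1.kap_false_rev S q J js g wfS wfq adm.
Let el_C := @Canonical1.el_C S q J js g wfq adm.
Let Iw_C := @Canonical1.Iw_C S q J js g wfS wfq adm.
Let Iw_Occ := @Canonical1.Iw_Occ S q J js g wfS wfq adm.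
Notation home := (@Canonical2.home S q J g).
Let el_home := @Canonical2.el_home S q J g.
Notation fact := (@Canonical2.fact S q J js g).
Let Iw_fact := @Canonical2.Iw_fact S q J js g wfS wfq adm.
Notation Afact := (@Canonical3.Afact S q J js g).
Let E_J := @Canonical4.E_J S q J js g wfS adm.
Notation Jt := (@Canonical4.Jt J).
Let Lv_J := @Canonical4.Lv_J S q J js g wfS adm.
Let Rv_J := @Canonical4.Rv_J S q J js g adm.
Let rep_J := @Canonical4.rep_J S q J js g wfS adm.
Section Hom.
Hypothesis gF : forall t a, g t a = false.
Variables (hv : nat -> elt) (src : nat -> bool * vf elt * nat * nat).
Hypothesis hvP : forall a, a < size q -> Iw true (natm q a).1 (map hv (natm q a).2).
Hypothesis srcP : forall a, a < size q ->
  fact true (natm q a).1 (src a).1.1.1 (src a).1.1.2 (src a).1.2 (src a).2 (map hv (natm q a).2).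

(** The child is attached to its parent: it is a fact of the second world, or accesses expose its
    inherited position. Otherwise it can enter a match only through copies, and counts as a root. *)
Definition CK e T l := Vw true (VT e T l) \/ RevV e T l.

(** A revealed copy is fresh even at the inherited position when this is undetermined. For an
    attached child the parent is put back in its place, which simplifies the description of the
    match. *)
Fixpoint nfe (e : elt) : elt :=
  match e with
  | EF v m k j =>
      match v with VT e' T l => if `[< CK e' T l >] && (j == l) then nfe e' else e | _ => e end
  | _ => e
  end.

Definition vars := flatten [seq a.2 | a <- q].
(** A null is named by the first occurrence of a variable with that normal form as image, so the
    names are bounded by the size of the query. *)
Definition zof n := find (fun u => `[< nfe (hv u) = n >]) vars.
(** Elements that are named by an object of the criterion. [None] marks the nulls, which the guess
    has to describe. *)
Definition core n : option tri :=
  match n with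
  | ET x => Some x
  | ES (VG false R) j => Some (2, R, j)
  | ES (VT e T l) j => if `[< CK e T l >] then None else Some (2, T, j)
  | _ => None
  end.
Definition lbl e : tri := if core (nfe e) is Some x then x else (3, zof (nfe e), 0).
Definition known e := exists2 u, u \in vars & nfe (hv u) = nfe e.
Definition o3 : tri := (0, 0, 0).
(** A parent outside the image of the query is not tracked: its child is described as an arbitrary
    fact of the relation. *)
Definition cdesc e l : nat * tri * nat := if `[< known e >] then (1, lbl e, l) else (2, o3, 0).
Definition delta (n : elt) : nat * tri * nat * nat * nat :=
  match n with
  | ET _ => (2, o3, 0, 0, 0)
  | EK p => (2, o3, 0, p.1, p.2)
  | ES (VT e T l) j => (cdesc e l, T, j)
  | ES v j => (2, o3, 0, rel v, j)
  | EF (VG true R) m k j => (2, o3, 0, R, j)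
  | EF (VT e T l) m k j => if `[< CK e T l >] then (cdesc e l, T, j) else (0, (1, T, 0), m, T, j)
  | EF v m k j => (0, phi v, m, rel v, j)
  end.
Definition lf u := lbl (hv u).
Definition kf a : nat * tri * nat :=
  match (src a).1.1.2 with
  | VG true _ => (2, o3, 0)
  | VT e T l => if `[< CK e T l >] then (1, lbl e, l) else (0, (1, T, 0), (src a).1.2)
  | v => (0, phi v, (src a).1.2)
  end.
Definition nf z := delta (nfe (hv (nth 0 vars z))).

Notation edb1 := (fun t a => is_true (sedb S q J (guess lf kf nf) t a)).
Notation Pi1 := (dPi edb1).

Lemma up_edb t a : edb t a -> edb1 t a.
Proof.
rewrite /sedb; move: t a; do 13 (case=> [//|]); case=> [a|]; first by rewrite gF.
by case=> [a|]; [rewrite gF | case=> [a|//]; rewrite gF].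
Qed.

(** The worlds are built with the empty guess; adding a guess only enlarges the extensional
    facts. *)
Lemma up t a : dl prog edb t a -> dl prog edb1 t a.
Proof. exact: (dl_mono up_edb). Qed.

Lemma Pi_inv x R i : Pi1 x R i -> dP2 edb1 x R i \/ exists z s y l T j,
  [/\ x = (3, z, 0), edb1 enul [:: z; s; y.1.1; y.1.2; y.2; l; T; j], dNO edb1 z & dO2 edb1 T j R i].
Proof.
move: x R i; suff H : forall t a, dl prog edb1 t a -> (match t, a with pPi, [:: x1; x2; x3; R; i] =>
  dP2 edb1 (x1, x2, x3) R i \/ exists z s (y : tri) l T j,
  [/\ (x1, x2, x3) = (3, z, 0), edb1 enul [:: z; s; y.1.1; y.1.2; y.2; l; T; j], dNO edb1 z & dO2 edb1 T j R i] | _, _ => True end).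
  by move=> [[x1 x2] x3] R i /H.
dl_induct.
- by move=> v h [h1 h2] _; right; exists (v 0), (v 1), (v 2, v 3, v 4), (v 5), (v 6), (v 7).
- by move=> v _ h _; left.
Qed.

Lemma Pi_uid x R i T j : edb euid [:: R; i; T; j] -> Pi1 x R i -> Pi1 x T j.
Proof.
move=> /up_edb hu /Pi_inv [h|[z [s [y [l [T' [j' [-> h1 h2 h3]]]]]]]]; first exact: Pi_core (P2_uid hu h).
exact: Pi_null h1 h2 (O2_uid hu h3).
Qed.

Lemma Pi_U x R i T l : Pi1 x R i -> U R i T l -> Pi1 x T l.
Proof.
move=> hp h; move: R i T l h hp; suff H : forall t a, dl prog edb t a ->
  (match t, a with pU, [:: R; i; T; l] => Pi1 x R i -> Pi1 x T l | _, _ => True end) by move=> R i T l /H.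
dl_induct; first by move=> v h _ _; exact: Pi_uid h.
by move=> v h _ H hp; exact: Pi_uid h (H hp).
Qed.

Lemma P2_Pi x R i : P2 x R i -> Pi1 x R i.
Proof. by move=> h; apply: Pi_core; exact: up h. Qed.

Lemma zofP e : known e -> zof (nfe e) < size vars /\ nfe (hv (nth 0 vars (zof (nfe e)))) = nfe e.
Proof.
move=> [u hu eu]; have hh : has (fun u => `[< nfe (hv u) = nfe e >]) vars.
  by apply/hasP; exists u => //; apply/asboolP.
split; first by rewrite /zof -has_find.
by have /asboolP := nth_find 0 hh.
Qed.

Lemma size_vars : size vars <= \sum_(a <- q) (size a.2).+1.
Proof. by rewrite /vars; elim: (q) => [|a s IH] /=; rewrite ?big_nil // big_cons size_cat; lia. Qed.

Lemma zof_J e : known e -> J (zof (nfe e)).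
Proof. by case/zofP => h _; apply: (adm_small adm); have := size_vars; lia. Qed.

Lemma null_J e : known e -> Jt (3, zof (nfe e), 0).
Proof. by move=> h; apply/and3P; split; [exact: J_small | exact: zof_J | exact: J_small]. Qed.

Lemma lbl_J e : core (nfe e) = None -> known e -> Jt (lbl e).
Proof. by rewrite /lbl => ->; exact: null_J. Qed.

Lemma nulP e s y l T j : known e -> delta (nfe e) = (s, y, l, T, j) ->
  s <= 2 -> Jt y -> J l -> J T -> J j -> edb1 enul [:: zof (nfe e); s; y.1.1; y.1.2; y.2; l; T; j].
Proof.
move=> hk ed hs /and3P[h1 h2 h3] h4 h5 h6; have [_ ez] := zofP hk.
rewrite /= /nf ez ed -!surjective_pairing eqxx /= zof_J // h1 h2 h3 h4 h5 h6 !andbT /=.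
by apply: J_small; lia.
Qed.

Lemma null_Pi e s y l T j R i : known e -> core (nfe e) = None -> delta (nfe e) = (s, y, l, T, j) ->
  Jt y -> J l -> J T -> J j ->
  [\/ [/\ s = 0, Rv y l & Lv y T], s = 1 /\ Pi1 y T l | s = 2 /\ E2 T] -> O2 T j R i -> Pi1 (lbl e) R i.
Proof.
move=> hk hc hd h1 h2 h3 h4 hs ho; rewrite /lbl hc.
have hs2 : s <= 2 by case: hs => [[-> _ _]|[-> _]|[-> _]].
have hn := nulP hk hd hs2 h1 h2 h3 h4; apply: (Pi_null hn _ (up ho)).
case: hs => [[es hr hl]|[es hp]|[es he]]; rewrite es in hn.
- exact: NO_root hn (up hr) (up hl).
- exact: NO_chd hn hp.
- exact: NO_top hn (up he).
Qed.

Lemma O2_self R j : is_pos S R j -> J j -> E2 R -> O2 R j R j.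
Proof. by move=> h1 h2; apply: O2_refl; rewrite /= h1. Qed.

Lemma O2_U A k R i T l : O2 A k R i -> U R i T l -> O2 A k T l.
Proof.
move=> hp h; move: R i T l h hp; suff H : forall t a, dl prog edb t a ->
  (match t, a with pU, [:: R; i; T; l] => O2 A k R i -> O2 A k T l | _, _ => True end) by move=> R i T l /H.
dl_induct; first by move=> v h _ _; exact: O2_uid h.
by move=> v h _ H hp; exact: O2_uid h (H hp).
Qed.

Lemma O2_EqK A k p p' : EqK p p' -> O2 A k p.1 p.2 -> O2 A k p'.1 p'.2.
Proof.
by move=> h; elim: h => //= [R i T j _ IH hu hC hE|R i T j _ IH hu hC hE] /IH h; [exact: O2_uid hu h | exact: O2_back hu h hC hE].
Qed.

Lemma Jt_o3 : Jt o3.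
Proof. by rewrite /Jt /= J_small. Qed.

Lemma Rev_E2 T l : Rev T l -> E2 T.
Proof.
move=> /Rev_inv[m [hr _]]; have [_ hl] := Rv_inv hr; have h := E2_rv hr hl.
by case: (Lv_inv hl) h => _ [[_]|//|[->]].
Qed.

(** Invariant for elements in the image of the query: the label is placed by [dPi] wherever the
    element occurs in the second world or has an exposed child, which is what attached children need
    of their parent. *)
Definition Qe e := known e ->
  [/\ forall R i T l, OccV e R i -> U R i T l -> RevV e T l -> Pi1 (lbl e) T l,
      forall R i, J i -> Occ true e R i -> Pi1 (lbl e) R i
    & forall R i, J i -> OccV e R i -> Jt (lbl e)].

Lemma CK_facts e T l : Qe e -> VL (VT e T l) -> CK e T l ->
  [/\ E2 T, J T, J l & known e -> Pi1 (lbl e) T l /\ Jt (lbl e)].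
Proof.
move=> hQ hL hc; have hL0 := hL; have [hE _] := VL_live hL; case: hL => [[R0 [i0 [ho hu]]] _ _].
have [[_ _ [Ji Jl]] _] := U_facts hu.
split=> //; [|exact: E_J|].
  by case: hc => [/Vw_Ew|[_ /Rev_E2]].
move=> /hQ [h1 h2 h3]; split; last exact: h3 Ji ho.
case: hc => [[[R1 [i1 [ho1 hu1]]] _ _]|hr]; last exact: h1 ho hu hr.
have [[_ _ [Ji1 _]] _] := U_facts hu1; exact: Pi_U (h2 _ _ Ji1 ho1) hu1.
Qed.

Lemma child_null e e' T l j : nfe e = e -> core e = None -> delta e = (cdesc e' l, T, j) -> known e ->
  Qe e' -> VL (VT e' T l) -> CK e' T l -> is_pos S T j -> J j ->
  forall R i, O2 T j R i -> Pi1 (lbl e) R i.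
Proof.
move=> hn hc hd hk hQ hL hCK hp Jj R i ho; have [hE JT Jl hP] := CK_facts hQ hL hCK.
move: hd; rewrite /cdesc; case: asboolP => [/hP[h1 h2] hd|_ hd].
  by apply: (null_Pi (e := e)) ho; rewrite ?hn; [exact: hk|exact: hc|exact: hd|exact: h2|exact: Jl|exact: JT|exact: Jj|by apply: Or32].
by apply: (null_Pi (e := e)) ho; rewrite ?hn; [exact: hk|exact: hc|exact: hd|exact: Jt_o3|exact: J_small|exact: JT|exact: Jj|by apply: Or33].
Qed.

(** An unattached child has an inaccessible parent or an unrevealed type; either way it offers
    accesses nothing beyond the generic fact, except its inherited position. *)
Lemma rootVT e T l : VL (VT e T l) -> ~ CK e T l ->
  [/\ forall j, Ac (phi (VT e T l)) j -> j = l \/ Ac (1, T, 0) j,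
      forall m, Rv (phi (VT e T l)) m -> Rv (1, T, 0) m
    & forall m, Rv (phi (VT e T l)) m -> ~ D m l].
Proof.
move=> hL nCK /=; case: asboolP => ha.
  have nR : ~ Rev T l by move=> hR; apply: nCK; right.
  have [h1 h2] := acc_child_unrevealed nR; split=> // m hr hD; apply: nR; exact: Rev_in hr hD.
split=> [j h|//|m hr hD]; first by right.
case: hL => [[R0 [i0 [ho hu]]] _ _]; have [[_ _ [Ji _]] _] := U_facts hu.
have [hE _] := OccV_live ho; apply: ha; apply: OccV_selfacc ho Ji _.
apply: (U_ac hu hE); exact: Ac_rv hr hD.
Qed.

Lemma EF_Pi v m k j : sub_ok Qe v -> VL v -> Rv (phi v) m -> is_pos S (rel v) j -> J j ->
  known (EF v m k j) -> Pi1 (lbl (EF v m k j)) (rel v) j /\ Jt (lbl (EF v m k j)).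
Proof.
move=> hQ hL hr hp Jj hk; have [hE hl] := VL_live hL; have h2 := E2_rv hr hl.
have Jm := Rv_J hr; have JR := E_J hE; have ho := O2_self hp Jj h2.
case: v hQ hL hr hp hk hE hl h2 JR ho => [a|b R|e T l] /= hQ hL hr hp hk hE hl h2 JR ho.
- split; last exact: lbl_J.
  by apply: (null_Pi (e := EF (VQ a) m k j)) ho => //=; [exact: Lv_J hl | apply: Or31].
- split; last by apply: lbl_J => //=; case: (b).
  case: b hL hr hk {hp} => hL hr hk.
    by apply: (null_Pi (e := EF (VG true R) m k j)) ho => //=; [exact: Jt_o3|exact: J_small | apply: Or33].
  by apply: (null_Pi (e := EF (VG false R) m k j)) ho => //=; [exact: Lv_J hl | apply: Or31].
have [hCK|nCK] := pselect (CK e T l).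
  have [_ JT Jl hP] := CK_facts hQ hL hCK.
  have [ej|nj] := eqVneq j l.
    have en : nfe (EF (VT e T l) m k j) = nfe e by rewrite /= asboolT // ej eqxx.
    have /hP[h3 h4] : known e by case: hk => u hu eu; exists u => //; rewrite eu.
    by rewrite /lbl en ej.
  have en : nfe (EF (VT e T l) m k j) = EF (VT e T l) m k j by rewrite /= (negbTE nj) andbF.
  split; last by apply: lbl_J hk; rewrite en.
  by apply: (child_null en _ _ hk hQ hL hCK hp Jj ho) => //=; rewrite asboolT.
have en : nfe (EF (VT e T l) m k j) = EF (VT e T l) m k j by rewrite /= asboolF.
split; last by apply: lbl_J hk; rewrite en.
have [_ hr1 _] := rootVT hL nCK; have hl1 := Lv_gen hE.
apply: (null_Pi (e := EF (VT e T l) m k j) hk) ho; rewrite ?en /=; [by []|by rewrite asboolF|exact: Lv_J hl1|exact: Jm|exact: JR|exact: Jj|apply: Or31; split=> //; exact: hr1].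
Qed.

Definition null_slot (v : vf elt) := match v with VG b _ => b : Prop | VT e T l => CK e T l | _ => False end.

Lemma ES_null v j : sub_ok Qe v -> VL v -> null_slot v -> is_pos S (rel v) j -> J j -> known (ES v j) ->
  (forall R i, O2 (rel v) j R i -> Pi1 (lbl (ES v j)) R i) /\ E2 (rel v).
Proof.
move=> hQ hL hn hp Jj hk; have [hE _] := VL_live hL; have JR := E_J hE.
case: v hQ hL hn hp hk hE JR => [//|[] // R|e T l] hQ hL hn hp hk hE JR.
  by split=> // A i ho; apply: (null_Pi (e := ES (VG true R) j)) ho => //=; [exact: Jt_o3|exact: J_small | apply: Or33].
have [h2 _ _ _] := CK_facts hQ hL hn; split=> // R i ho.
by apply: (child_null (e := ES (VT e T l) j)) ho => //=; rewrite asboolT.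
Qed.

Definition nonQ (v : vf elt) : Prop := if v is VQ _ then False else True.

Lemma ES_core v j : VL v -> nonQ v -> ~ null_slot v -> lbl (ES v j) = (2, rel v, j) /\
  ((forall i, Ac (phi v) i -> fresh_pos v i -> Ac (1, rel v, 0) i) /\ (forall m, Rv (phi v) m -> Rv (1, rel v, 0) m)).
Proof.
case: v => [//|[] R|e T l] /= hL _ nn //.
rewrite /lbl /= asboolF //; have [h1 h2 _] := rootVT hL nn; do !split=> //.
by move=> i /h1 [->|].
Qed.

Lemma kap_true_Pi R j : C R j -> E2 R -> known (kap true R j) -> Pi1 (lbl (kap true R j)) R j.
Proof.
move=> hC hE; rewrite /kap /=; case: asboolP => /= hR hk.
  apply: P2_Pi; rewrite /lbl /=; apply: (P2_eq (RvK_P2 hR hC hE)); apply: repP; exact: (Eq_const (E2_E hE)).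
have [hp Jj _] := C_pos hC; have h := repKP (R, j); have [hC' hE'] := EqK_C h hC hE.
have [hp' Jj' _] := C_pos hC'.
apply: (null_Pi (e := EK (repK (R, j))) hk) _ => //=; [exact: Jt_o3|exact: J_small|exact: (E_J (E2_E hE'))|by apply: Or33|].
by apply: (O2_EqK (EqK_sym h)); exact: O2_self.
Qed.

Lemma kap_rev v m R j b : VL v -> rel v = R -> Rv (phi v) m -> C R j -> kap b R j = kap true R j /\ E2 R.
Proof.
move=> hL eR hr hC; split; last by have [_ hl] := VL_live hL; rewrite -eR; exact: E2_rv hr hl.
by case: b => //; exact: kap_false_rev hL eR hr hC.
Qed.

Definition sub e := match e with ES v _ | EF v _ _ _ => sub_ok Qe v | _ => True end.

Lemma PosA_Pi e : sub e -> known e ->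
  (forall R i T l, OccV e R i -> U R i T l -> RevV e T l -> Pi1 (lbl e) T l) ->
  forall R i, J i -> PosA e R i -> Pi1 (lbl e) R i.
Proof.
move=> hs hk h1 R i Ji [v [m [k [hL hr eR hp]]]]; rewrite /slotA; have [hE hl] := VL_live hL.
case: asboolP => hD ee; last first.
  by subst e; rewrite -eR; rewrite -eR in hp; case: (EF_Pi hs hL hr hp Ji hk).
rewrite /DX nrmE // in hD.
case: (pselect (C R i)) => hC.
  have [e2 hE2] := kap_rev false hL eR hr hC.
  have e3 : e = kap true R i by rewrite -ee -e2 -eR el_C ?eR //; case: (v).
  by rewrite e3 in hk *; exact: kap_true_Pi.
have := el_home false (v := v) (d := i); rewrite eR ee => /(_ hC) [[e0 ev ee0]|hh].
  subst e0 v; have [[R0 [i0 [ho hu]]] _ _] := hL; apply: (h1 _ _ _ _ ho hu).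
  move: hr => /=; case: asboolP => ha hr; first by split=> //; exact: Rev_in hr hD.
  have [[_ _ [Ji0 _]] _] := U_facts hu; have [hE0 _] := OccV_live ho; case: ha.
  by apply: (OccV_selfacc ho Ji0); apply: (U_ac hu hE0); exact: Ac_rv hr hD.
rewrite -eR in hp hC *.
case: v hL hr hp hC hE hl hh {eR ee} => [a|b T|e' T l] hL hr hp hC hE hl /=.
- move=> ex; subst e; rewrite /lbl /=; have [h2 _] := atm_argP (VQ_atm hL) hp.
  apply: P2_Pi; apply: (P2_eq (P2_rv hr hD (Ob_arg h2) hl)); apply: repP; exact: Eq_var h2.
- case=> ee hf; subst e; have [hn|hn] := pselect (null_slot (VG b T)).
    have [h3 h4] := ES_null hs hL hn hp Ji hk; apply: h3; exact: O2_self.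
  have [-> [_ h3]] := ES_core i hL I hn; apply: P2_Pi; apply: (P2_rv (h3 _ hr) hD _ (Lv_gen hE)).
  by apply: Ob_gen => //=; rewrite hp.
case=> ee hf; subst e; have [hn|hn] := pselect (null_slot (VT e' T l)).
  have [h3 h4] := ES_null hs hL hn hp Ji hk; apply: h3; exact: O2_self.
have [-> [_ h3]] := ES_core i hL I hn; apply: P2_Pi; apply: (P2_rv (h3 _ hr) hD _ (Lv_gen hE)).
by apply: Ob_gen => //=; rewrite hp.
Qed.

Lemma OccV_ET x R i : J i -> OccV (ET x) R i -> Jt x /\ (AT x -> exists f y, [/\ Lv f R, Ob f i y, Eq y x & Ac f i]).
Proof.
move=> Ji [[a [v [h1 h2 ->]]]|[hC hE ->]].
  have hx := Eq_var h2; split; first exact: rep_J.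
  move=> /(AT_rep hx) h; exists (0, a, 0), (0, v, 0); split; [exact: Lv_atm h1 | exact: Ob_arg h2 | exact: repP|].
  exact: Ac_AT h (Ob_arg h2).
have hx := Eq_const hE hC; split; first exact: rep_J.
move=> /(AT_rep hx) h; have hO := Ob_const (Lv_gen hE) hC.
exists (1, R, 0), (1, R, i); split=> //; [exact: Lv_gen | exact: repP|]; exact: Ac_AT h hO.
Qed.

(** Induction on how the element was created: a description refers at most to the parent of the fact
    in which the element was born. *)
Lemma Qe_all e : Qe e.
Proof.
elim/elt_induction: e => [x|p|v j hQ|v m k j hQ] hk.
- have p1 R i T l : OccV (ET x) R i -> U R i T l -> RevV (ET x) T l -> Pi1 (lbl (ET x)) T l.
    move=> ho hu [ha hr]; have [[_ _ [Ji _]] _] := U_facts hu; have [_ /(_ ha)[f [y [h1 h2 h3 h4]]]] := OccV_ET Ji ho.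
    by apply: P2_Pi; exact: (P2_eq (P2_chd h4 h2 h1 hu hr) h3).
  split=> // [R i Ji|R i Ji ho]; last by have [] := OccV_ET Ji ho.
  case; first exact: PosA_Pi.
  by case=> [[]//|[hC hE ek]]; rewrite -ek in hk *; exact: kap_true_Pi.
- have p1 R i T l : OccV (EK p) R i -> U R i T l -> RevV (EK p) T l -> Pi1 (lbl (EK p)) T l.
    move=> [hC hE nR ep] hu _; have ek : kap true R i = EK p by rewrite /kap asboolF //= ep.
    by rewrite -ek in hk *; exact: Pi_U (kap_true_Pi hC hE hk) hu.
  split=> // [R i Ji|R i _ _]; last exact: lbl_J.
  case; first exact: PosA_Pi.
  by case=> hC hE ek; rewrite -ek in hk *; exact: kap_true_Pi.
- have p1 R i T l : OccV (ES v j) R i -> U R i T l -> RevV (ES v j) T l -> Pi1 (lbl (ES v j)) T l.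
    move=> /OccV_ES[ei hp hC eR [hL hf]] hu [ha hr]; subst j R; have [[_ _ [Ji _]] _] := U_facts hu.
    have [hE hl] := VL_live hL.
    have [hn|hn] := pselect (null_slot v).
      have [h3 h4] := ES_null hQ hL hn hp Ji hk; apply: h3; apply: O2_U hu; exact: O2_self.
    have nq : nonQ v by case: (v) hf.
    have [-> [h3 _]] := ES_core i hL nq hn; apply: P2_Pi; apply: (P2_chd (f := (1, rel v, 0)) _ _ (Lv_gen hE) hu hr).
      by apply: h3 => //; move: ha; rewrite /= nrmE //; case: (v).
    by apply: Ob_gen => //=; rewrite hp.
  split=> // R i Ji.
    case; first exact: PosA_Pi.
    move=> hB; have hO := Birth_OccV hB; have /OccV_ES[ei hp hC eR [hL hf]] := hO; subst j R.
    have hn : null_slot v.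
      case: v hB {hQ hk p1 hO hp hC hL hf} => [a|b T|e T l] /= [_ _ _] //; first by case=> _ -> _.
      by case=> _ _ h; left.
    have [h3 h4] := ES_null hQ hL hn hp Ji hk; apply: h3; exact: O2_self.
  move=> /OccV_ES[ei hp hC eR [hL hf]]; subst j R; have [hn|hn] := pselect (null_slot v).
    by apply: lbl_J hk; case: v hn {hQ p1 hp hC hL hf} => [a|[] T|e T l] //= hn; rewrite asboolT.
  have nq : nonQ v by case: (v) hf.
  have [hE _] := VL_live hL; have [-> _] := ES_core i hL nq hn.
  by rewrite /Jt /= Ji (E_J hE) J_small.
have p1 R i : J i -> OccV (EF v m k j) R i -> Pi1 (lbl (EF v m k j)) R i /\ Jt (lbl (EF v m k j)).
  by move=> Ji /OccV_EF[ei hp hD eR [hr hL]]; subst j R; exact: EF_Pi.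
have p2 R i T l : OccV (EF v m k j) R i -> U R i T l -> RevV (EF v m k j) T l -> Pi1 (lbl (EF v m k j)) T l.
  move=> ho hu _; have [[_ _ [Ji _]] _] := U_facts hu; have [h _] := p1 _ _ Ji ho; exact: Pi_U h hu.
split=> // [R i Ji|R i Ji ho]; last by have [] := p1 _ _ Ji ho.
by case=> //; exact: PosA_Pi.
Qed.

Lemma vars_in a j : a < size q -> j < size (natm q a).2 -> var a j \in vars.
Proof.
move=> ha hj; apply/flattenP; exists (natm q a).2; last exact: mem_nth.
by apply/mapP; exists (natm q a) => //; exact: mem_nth.
Qed.

Lemma img_J a j : a < size q -> is_pos S (natm q a).1 j -> J j -> Jt (lbl (hv (var a j))).
Proof.
move=> ha hp Jj; have [_ _ hR hs] := atm_wf (VQ_atm ha); have /andP[_ hj] := hp; rewrite -hs in hj.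
have hk : known (hv (var a j)) by exists (var a j) => //; exact: vars_in.
have ht : onth (map hv (natm q a).2) j = Some (hv (var a j)).
  by rewrite (onth_lt (ET o3)) ?size_map // (nth_map 0).
have [R0 [i0 [ho hu]]] := Iw_Occ hp (hvP ha) ht; have [_ _ h3] := Qe_all hk.
have Ji0 : J i0 by case: hu => [[_ ->]|/U_facts[[_ _ []]]].
case: ho => [/PosA_OccV[|[R1 [i1 [h1 /U_facts[[_ _ [Ji1 _]] _]]]]]|/Birth_OccV]; [exact: h3|exact: h3 h1|exact: h3].
Qed.

Lemma kfP a s y l : a < size q -> kf a = (s, y, l) -> s <= 2 -> Jt y -> J l -> edb1 ekind [:: a; s; y.1.1; y.1.2; y.2; l].
Proof.
move=> ha ek hs /and3P[h1 h2 h3] hl.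
rewrite /= ek -!surjective_pairing eqxx /= h1 h2 h3 hl !andbT (J_q (ltnW ha)) /=.
by apply: J_small; lia.
Qed.

Lemma lfP a j R : edb eatm [:: a; R] -> is_pos S R j ->
  edb1 earg [:: a; j; var a j] /\ let y := lbl (hv (var a j)) in edb1 elab [:: var a j; y.1.1; y.1.2; y.2].
Proof.
move=> hA hp; have [h1 Jj] := atm_argP hA hp; have [ha eR _ _] := atm_wf hA; subst R.
split; first exact: up_edb h1.
have /and3P[h2 h3 h4] := img_J ha hp Jj.
have /= /and4P[_ _ Jv _] := edb_all (isT : 7 < 10) h1.
by rewrite /= /lf -!surjective_pairing eqxx /= Jv h2 h3 h4.
Qed.

Lemma SO_all a : a < size q -> dAO edb1 a 0 /\ forall j, is_pos S (natm q a).1 j -> dSO edb1 a j.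
Proof.
move=> ha; have hA : edb eatm [:: a; (natm q a).1] := VQ_atm ha; set R := (natm q a).1 in hA *.
have [_ _ hR hs] := atm_wf hA; have [] := srcP ha; rewrite -/R.
set v := (src a).1.1.2; set m := (src a).1.2; set k := (src a).2; move=> eR hL st hk ht.
have hA1 := up_edb hA.
have [hE hl] := VL_live hL; have E2R := Iw_Ew (hvP ha); rewrite /= -/R in E2R.
have at0 x (y : elt) : onth (map hv (natm q a).2) x = Some y -> is_pos S R x -> y = hv (var a x).
  by move=> + /andP[_ hx]; rewrite (onth_lt (ET o3)) ?size_map ?hs // (nth_map 0) ?hs // => -[].
have tE x : is_pos S R x -> ~ C R x -> hv (var a x) = if (src a).1.1.1 || `[< DX m x >] then el false v x else EF v m k x.
  by move=> hx hC; rewrite -(at0 _ _ (ht x hx hC) hx).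
have kn x : is_pos S R x -> known (hv (var a x)).
  by move=> /andP[_ hx]; exists (var a x) => //; apply: vars_in; rewrite ?hs.
have cst x : is_pos S R x -> C R x -> dSO edb1 a x.
  move=> hx hC; have ex := at0 _ _ (Iw_C (hvP ha) hC) hx; have hkx := kn x hx; rewrite -ex in hkx.
  have [h1 h2] := lfP hA hx; have h3 := kap_true_Pi hC E2R hkx; rewrite ex in h3.
  exact: SO_const h1 h2 hA1 (up hC) h3.
have nul x s y l : is_pos S R x -> J x -> kf a = (s, y, l) -> s <= 2 -> Jt y -> J l ->
    core (nfe (hv (var a x))) = None -> delta (nfe (hv (var a x))) = (s, y, l, R, x) -> dSO edb1 a x.
  move=> hx Jx ek h1 h2 h3 h4 h5; have [h6 h7] := lfP hA hx.
  move: h7; rewrite /lbl h4 => /= h7; have h8 := kfP ha ek h1 h2 h3.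
  have h9 := nulP (kn x hx) h5 h1 h2 h3 (E_J (eq_ind _ E hE _ eR)) Jx.
  exact: (SO_null h8 hA1 h6 h7 h9).
have Jpos x : is_pos S R x -> J x by move=> hx; have [] := atm_argP hA hx.
have Rm : (src a).1.1.1 = false -> Rv (phi v) m by move=> h; move: hk; rewrite h.
have root (f : tri) : kf a = (0, f, m) -> Rv f m -> Lv f R ->
    (forall x, is_pos S R x -> ~ C R x -> D m x -> exists y, Ob f x y /\ Eq y (lbl (hv (var a x)))) ->
    (forall x, is_pos S R x -> ~ C R x -> ~ D m x -> core (nfe (hv (var a x))) = None /\ delta (nfe (hv (var a x))) = (0, f, m, R, x)) ->
    dAO edb1 a 0 /\ forall j, is_pos S R j -> dSO edb1 a j.
  move=> ek hr hf hD hN; have ke := kfP ha ek (isT : 0 <= 2) (Lv_J hf) (Rv_J hr).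
  split=> [|j hj]; first exact: AO_root ke hA1 (up hr) (up hf).
  case: (pselect (C R j)) => hC; first exact: cst.
  have [h6 h7] := lfP hA hj; case: (pselect (D m j)) => hd.
    have [y [h1 h2]] := hD j hj hC hd.
    exact: (SO_root ke h6 h7 (up hd) (up h1) (up h2)).
  by have [h1 h2] := hN j hj hC hd; apply: (nul _ _ _ _ hj (Jpos _ hj) ek) => //; [exact: Lv_J hf | exact: Rv_J hr].
have top : kf a = (2, o3, 0) ->
    (forall x, is_pos S R x -> ~ C R x -> core (nfe (hv (var a x))) = None /\ delta (nfe (hv (var a x))) = (2, o3, 0, R, x)) ->
    dAO edb1 a 0 /\ forall j, is_pos S R j -> dSO edb1 a j.
  move=> ek hN; have ke := kfP ha ek (isT : 2 <= 2) Jt_o3 (J_small (isT : 0 <= 50)).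
  split=> [|j hj]; first exact: AO_top ke hA1 (up E2R).
  case: (pselect (C R j)) => hC; first exact: cst.
  by have [h1 h2] := hN j hj hC; apply: (nul _ _ _ _ hj (Jpos _ hj) ek) => //; [exact: Jt_o3 | exact: J_small].
have DXE x : is_pos S R x -> `[< DX m x >] = `[< D m x >] by move=> /Jpos Jx; rewrite /DX nrmE.
have ekf : kf a = match v with VG true _ => (2, o3, 0)
  | VT e T l => if `[< CK e T l >] then (1, lbl e, l) else (0, (1, T, 0), m) | v => (0, phi v, m) end by rewrite /kf -/v -/m; case: (v).
move: eR hL hk hE hl tE Rm ekf {ht}; case: v => [b|[] R'|e T l] eR hL hk hE hl tE Rm ekf; rewrite /= in eR ekf.
- case e1 : (src a).1.1.1 hk tE Rm => hk tE Rm; first by case: hk.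
  apply: (root (0, b, 0)) => // [|x hx hC hD|x hx hC nD]; first by rewrite -eR.
    rewrite tE // DXE // asboolT //= /lbl /=.
    have hB : edb eatm [:: b; R] by rewrite -eR; exact: VQ_atm.
    have [h1 _] := atm_argP hB hx; exists (0, var b x, 0); split; first exact: Ob_arg h1.
    by apply: repP; exact: Eq_var h1.
  by rewrite tE // DXE // asboolF //= eR.
- subst R'; apply: top => // x hx hC; rewrite tE //.
  by case: ifP => _ //=; rewrite asboolF.
- subst R'; case e1 : (src a).1.1.1 hk tE Rm => hk tE Rm; first by case: hk.
  apply: (root (1, R, 0)) => // [x hx hC hD|x hx hC nD].
    rewrite tE // DXE // asboolT //= asboolF // /lbl /=.
    have ho : Ob (1, R, 0) x (2, R, x) by apply: Ob_gen => //=; rewrite hx Jpos.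
    by exists (2, R, x); split=> //; exact: (Eq_ob ho ho).
  by rewrite tE // DXE // asboolF.
subst T; have nCl : ~ C R l by case: (hL).
case: (pselect (CK e R l)) => hCK; last first.
  rewrite asboolF // in ekf; case e1 : (src a).1.1.1 hk tE Rm => hk tE Rm; first by case: hCK; left.
  have [_ hr1 hr2] := rootVT hL hCK.
  apply: (root (1, R, 0)) => // [||x hx hC hD|x hx hC nD]; [exact: hr1 (Rm erefl) | exact: Lv_gen|..].
    have nl : x == l = false by apply/eqP => xl; subst x; exact: hr2 (Rm erefl) hD.
    rewrite tE // DXE // asboolT //= asboolF // nl /lbl /= asboolF //.
    have ho : Ob (1, R, 0) x (2, R, x) by apply: Ob_gen => //=; rewrite hx Jpos.
    by exists (2, R, x); split=> //; exact: (Eq_ob ho ho).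
  rewrite tE // DXE // asboolF //.
  have -> : nfe (EF (VT e R l) m k x) = EF (VT e R l) m k x by rewrite /= asboolF.
  by rewrite /= asboolF.
rewrite asboolT // in ekf; have [hx2 JT Jl hP] := CK_facts (Qe_all (e := e)) hL hCK.
have lp : is_pos S R l by case: hL => [[R0 [i0 [ho /U_facts[[]]]]]].
have el_l : nfe (hv (var a l)) = nfe e.
  rewrite tE //; case: ifP => _ /=; first by rewrite asboolF // eqxx.
  by rewrite asboolT // eqxx.
have ke : known e.
  (* The inherited slot of the matched fact has the parent as normal form, which puts the parent in
     the image of the query. *)
  by have [u hu eu] := kn l lp; exists u => //; rewrite eu.
have [h1 h2] := hP ke.
have kE := kfP ha ekf (isT : 1 <= 2) h2 Jl.
split=> [|j hj]; first exact: AO_chd kE hA1 h1.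
case: (pselect (C R j)) => hC; first exact: cst.
have [h6 h7] := lfP hA hj; case: (eqVneq j l) => [ej|nj].
  by rewrite -ej in kE; move: h7; rewrite /lbl ej el_l -/(lbl e) => h7; rewrite ej in h6 kE *; exact: SO_chd kE h6 h7.
apply: (nul _ _ _ _ hj (Jpos _ hj) ekf) => //; rewrite tE //; case: ifP => _ /=.
- by rewrite asboolF // (negbTE nj) /= asboolT.
- by rewrite asboolT // (negbTE nj).
- by rewrite asboolF // (negbTE nj) /= /cdesc asboolT.
- by rewrite asboolT // (negbTE nj) /= asboolT // /cdesc asboolT.
Qed.

Lemma Goal_derived : dGoal edb1.
Proof.
suff AL i : i <= size q -> dAL edb1 i by apply: (Goal_in (n := size q)); [rewrite /= eqxx | exact: AL].
elim: i => [|i IH] hi; first by apply: AL_0; exact: (J_small (isT : 0 <= 50)).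
have hA : edb eatm [:: i; (natm q i).1] := VQ_atm hi; have [_ _ hR hs] := atm_wf hA.
have hz : edb1 easz [:: i; size (natm q i).2] by rewrite /= hi eqxx.
have hsu : edb1 esucc [:: i; i.+1] by rewrite /= eqxx (J_q (ltnW hi)) J_q.
apply: (AL_S hz hsu (IH (ltnW hi))).
have [AO0 SOj] := SO_all hi.
suff AO j : j <= size (natm q i).2 -> dAO edb1 i j by exact: AO.
elim: j => [//|j IHj] hj.
have hp : is_pos S (natm q i).1 j by rewrite /is_pos hR -hs.
have hsu2 : edb1 esucc [:: j; j.+1] by rewrite /= eqxx (J_atm hi (ltnW hj)) (J_atm hi hj).
exact: (AO_S hsu2 (IHj (ltnW hj)) (SOj _ hp)).
Qed.
End Hom.

(** The worlds come from derivations without a guess; the guess is then read off a match of the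
    query in the second world. *)
Theorem answerable_Goal : (forall t a, g t a = false) -> monotone_answerable S q ->
  exists lf kf nf, dGoal (fun t a => is_true (sedb S q J (guess lf kf nf) t a)).
Proof.
move=> gF hq; have [v hv] : cq_holds (Iw true) q by exact: answerable_second_world.
pose h u := if v u is Some e then e else ET (0, 0, 0).
have hvP a : a < size q -> Iw true (natm q a).1 (map h (natm q a).2).
  move=> ha; have [t [h1 h2]] := hv _ (mem_nth datm ha); rewrite -/(natm q a) in h1 h2.
  suff -> : map h (natm q a).2 = t by [].
  apply: (@inj_map _ _ (@Some elt)) => [x y [] //|]; rewrite -h2 -map_comp; apply/eq_in_map => u hu.
  rewrite /= /h; case e : (v u) => //; exfalso.
  have hi : index u (natm q a).2 < size t by rewrite -(size_map (@Some elt)) -h2 size_map index_mem.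
  have := congr1 (fun s => nth None s (index u (natm q a).2)) h2.
  by rewrite (nth_map 0) ?index_mem // nth_index // e (nth_map (ET (0, 0, 0))).
have [a|src srcP] := @choice nat (bool * vf elt * nat * nat) (fun a x => a < size q ->
    fact true (natm q a).1 x.1.1.1 x.1.1.2 x.1.2 x.2 (map h (natm q a).2)).
  case: (pselect (a < size q)) => [ha|]; last by exists (true, VQ 0, 0, 0).
  by have [b [u [m [k hf]]]] := Iw_fact (hvP a ha); exists (b, u, m, k).
by exists (lf h), (kf h src), (nf h); exact: (Goal_derived gF hvP srcP).
Qed.
End Basics.
End Soundness.

(** * Meaning of the rules in a run of the plan: constants, determined positions, equalities *)

Module Completeness1.
Import Defs DatalogSyntax DatalogProgram ExtensionalFacts ProgramFacts Canonical1 Canonical4.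
Import all_boot zify.
Import boolp.
Section Basics.
Variables (S : schema) (q : bcq) (J : nat -> bool) (js : nat) (g : nat -> seq nat -> bool).
Hypothesis wfS : wf_schema S.
Hypothesis wfq : wf_query S q.
Hypothesis adm : admissible S q J js.
Notation edb := (fun t a => is_true (sedb S q J g t a)).
Notation E := (dE edb). Notation C := (dC edb). Notation D := (dD edb). Notation Ob := (dOb edb).
Notation Eq := (dEq edb). Notation Lv := (dLv edb). Notation Ac := (dAc edb). Notation AT := (dAT edb).
Notation Rv := (dRv edb). Notation Rev := (dRev edb). Notation U := (dU edb). Notation E2 := (dE2 edb).
Notation P2 := (dP2 edb). Notation O2 := (dO2 edb).
Let uidP := @ProgramFacts.uidP S q J g.
Let uid_pos := @ProgramFacts.uid_pos S q J js g wfS adm.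
Let fd_wf := @ProgramFacts.fd_wf S q J js g wfS adm.
Let atm_wf := @ProgramFacts.atm_wf S q J g wfq.
Let C_pos := @ProgramFacts.C_pos S q J js g wfS adm.
Let Lv_inv := @ProgramFacts.Lv_inv S q J g.
Let Lv_fun := @ProgramFacts.Lv_fun S q J g wfq.
Let fd_sz := @ProgramFacts.fd_sz S q J g.
Notation var := (@ProgramFacts.var q).
Let arg_inv := @ProgramFacts.arg_inv S q J g.
Let meth_inv := @ProgramFacts.meth_inv S q J g.
Let Ob_inv := @ProgramFacts.Ob_inv S q J g.
Notation EqK := (@ProgramFacts.EqK S q J g).
Notation RvK := (@ProgramFacts.RvK S q J g).
Notation rel := (@ProgramFacts.rel q).
Notation rep := (@ProgramFacts.rep S q J g).
Notation repK := (@ProgramFacts.repK S q J g).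
Notation nrm := (@ProgramFacts.nrm J js).
Notation DX := (@ProgramFacts.DX S q J js g).
Notation AccE := (@ProgramFacts.AccE S q J js g).
Notation phi := (@ProgramFacts.phi S q J js g).
Notation Ew := (@ProgramFacts.Ew S q J g).
Notation RevV := (@ProgramFacts.RevV S q J js g).
Notation legit_child := (@ProgramFacts.legit_child S q J js g).
Notation OccV := (@ProgramFacts.OccV S q J js g).
Notation VL := (@ProgramFacts.VL S q J js g).
Notation kap := (@ProgramFacts.kap S q J g).
Notation el := (@ProgramFacts.el S q J g).
Notation slotA := (@ProgramFacts.slotA S q J js g).
Notation PosA := (@ProgramFacts.PosA S q J js g).
Notation new_child := (@ProgramFacts.new_child S q J g).
Notation Birth := (@ProgramFacts.Birth S q J js g).
Notation Occ := (@ProgramFacts.Occ S q J js g).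
Notation Vw := (@ProgramFacts.Vw S q J js g).
Notation Iw := (@ProgramFacts.Iw S q J js g).
Let VQ_atm := @ProgramFacts.VQ_atm S q J g.
Let onth_lt := @Canonical1.onth_lt.
Notation Jt := (@Canonical4.Jt J).
(** What is used of an execution on an instance where [ch] matches the query. [cAF n] and [cAc n]
    are the facts and values known after [n] rounds, and [c_run] says that a round tries every
    method on all known values. Quantifying over contexts makes the number of rounds uniform in the
    instance. *)
Record ctx := Ctx {
  cD : Type;
  cI : instance cD;
  ch : nat -> cD;
  cK : nat;
  cAF : nat -> nat -> seq cD -> Prop;
  cAc : nat -> cD -> Prop;
  c_wf : wf_instance S cI;
  c_sat : sat_constraints S cI;
  c_q : forall a, a < size q -> cI (natm q a).1 (map ch (natm q a).2);
  c_mono : forall n m d, n <= m -> cAc n d -> cAc m d;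
  c_monoF : forall n m R t, n <= m -> cAF n R t -> cAF m R t;
  c_AFI : forall n R t, cAF n R t -> cI R t;
  c_AFAc : forall n R t x, cAF n R t -> List.In x t -> cAc n x;
  c_run : forall n m t, n < cK -> m < size (s_meth S) -> cI (m_rel (nmeth S m)) t ->
    (forall x, x \in m_in (nmeth S m) -> exists d, onth t x = Some d /\ cAc n d) ->
    exists t', [/\ cAF n.+1 (m_rel (nmeth S m)) t', forall x, x \in m_in (nmeth S m) -> onth t' x = onth t x
      & m_bound (nmeth S m) = None -> t' = t] }.

Lemma onth_In T (t : seq T) j d : onth t j = Some d -> List.In d t.
Proof. by elim: t j => [|x t IH] [|j] //=; [case=> ->; left | move=> /IH h; right]. Qed.

Lemma onth_pos c R j t : is_pos S R j -> cI (c := c) R t -> exists d, onth t j = Some d.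
Proof.
move=> /andP[_ hj] /c_wf[_ st]; case e : (onth t j) => [d|]; first by exists d.
by move: hj; rewrite -st => hj; case: t hj e {st} => // x t hj; rewrite (onth_lt x).
Qed.

Lemma uid_sem c R i T j t d : edb euid [:: R; i; T; j] -> cI (c := c) R t -> onth t i = Some d ->
  exists t', cI (c := c) T t' /\ onth t' j = Some d.
Proof. by move=> /uidP h ht <-; have [/(_ _ h) H _] := c_sat c; exact: H ht. Qed.

Lemma fd_sem c k R sz r t t' : edb efd [:: k; R; sz; r] -> cI (c := c) R t -> cI (c := c) R t' ->
  (forall x, x < sz -> onth t (nth 0 (f_lhs (nfd S k)) x) = onth t' (nth 0 (f_lhs (nfd S k)) x)) -> onth t r = onth t' r.
Proof.
move=> h ht ht' H; have [[_ _ hin] _] := fd_wf h; have [_ es e1 e2] := fd_sz h; subst R r.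
have [_ /(_ _ hin) hs] := c_sat c; apply: (hs _ _ ht ht') => d /(nthP 0)[x hx <-].
by apply: H; rewrite es.
Qed.

Definition sem0 t a : Prop :=
  match t, a with
  | pE, [:: R] => forall c, exists t, cI (c := c) R t
  | pC, [:: R; j] => forall c t t', cI (c := c) R t -> cI (c := c) R t' -> onth t j = onth t' j
  | pFC, [:: k; i] => forall c t t', cI (c := c) (f_rel (nfd S k)) t -> cI (c := c) (f_rel (nfd S k)) t' ->
      forall x, x < i -> onth t (nth 0 (f_lhs (nfd S k)) x) = onth t' (nth 0 (f_lhs (nfd S k)) x)
  | pD, [:: m; j] => forall c t t', let M := nmeth S m in cI (c := c) (m_rel M) t -> cI (c := c) (m_rel M) t' ->
      (forall x, x \in m_in M -> onth t' x = onth t x) -> (m_bound M = None -> t' = t) -> onth t' j = onth t j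
  | pFD, [:: k; m; i] => f_rel (nfd S k) = m_rel (nmeth S m) /\ forall c t t', let M := nmeth S m in
      cI (c := c) (m_rel M) t -> cI (c := c) (m_rel M) t' ->
      (forall x, x \in m_in M -> onth t' x = onth t x) -> (m_bound M = None -> t' = t) ->
      forall x, x < i -> onth t' (nth 0 (f_lhs (nfd S k)) x) = onth t (nth 0 (f_lhs (nfd S k)) x)
  | pU, [:: R; i; T; j] => forall c t d, cI (c := c) R t -> onth t i = Some d ->
      exists t', cI (c := c) T t' /\ onth t' j = Some d
  | _, _ => True
  end.

Lemma lhs_inv k i d : edb elhs [:: k; i; d] -> [/\ k < size (s_fd S), i < size (f_lhs (nfd S k)) & d = nth 0 (f_lhs (nfd S k)) i].
Proof. by move=> /= /and3P[h1 h2 /eqP<-]. Qed.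

Lemma succ_inv i i' : edb esucc [:: i; i'] -> i' = i.+1.
Proof. by move=> /= /and3P[/eqP]. Qed.

Lemma inp_inv m i x : edb einp [:: m; i; x] -> [/\ m < size (s_meth S), i < size (m_in (nmeth S m)) & x = nth 0 (m_in (nmeth S m)) i].
Proof. by move=> /= /and3P[h1 h2 /eqP<-]. Qed.

Lemma sem0P t a : dl prog edb t a -> sem0 t a.
Proof.
move: t a; dl_induct2.
- by move=> v /atm_wf[h <- _ _] _ _ c; eexists; exact: (c_q c h).
- move=> v h _ H c; have [t ht] := H c; have [hp _ _ _ _] := uid_pos h; have [d hd] := onth_pos hp ht.
  by have [t' [h1 _]] := uid_sem h ht hd; exists t'.
- move=> v [/lhs_inv[h1 h2 h3] [h4 /succ_inv->]] _ [H1 H2] c t t' ht ht' x; rewrite ltnS leq_eqVlt => /orP[/eqP->|]; last exact: H1.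
  by rewrite -h3; apply: H2; have [_ _ <- _] := fd_sz h4.
- move=> v h _ H c t t' ht ht'; apply: (fd_sem h ht ht'); apply: H; by have [_ _ -> _] := fd_sz h.
- move=> v h _ H c t t' ht ht'; have [hp _ _ _ _] := uid_pos h.
  have [d hd] := onth_pos hp ht; have [d' hd'] := onth_pos hp ht'; rewrite hd hd'.
  have [u [h1 h2]] := uid_sem h ht hd; have [u' [h3 h4]] := uid_sem h ht' hd'.
  by rewrite -h2 -h4; exact: H h1 h3.
- by move=> v /inp_inv[h1 h2 ->] _ _ c t t' _ _ H _; apply: H; exact: mem_nth.
- move=> v /meth_inv[h1 h2 _] _ H c t t' ht ht' _ _; rewrite h2 in ht ht'; exact: H ht' ht.
- by move=> v [/fd_sz[_ _ e1 _] /meth_inv[_ e2 _]] _ _; rewrite e1 e2.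
- move=> v [/lhs_inv[h1 h2 h3] /succ_inv->] _ [[H0 H1] H2]; split=> // c t t' ht ht' hi hb x.
  rewrite ltnS leq_eqVlt => /orP[/eqP->|]; last exact: H1.
  by rewrite -h3; apply: H2.
- move=> v h _ [H0 H1] c t t' ht ht' hi hb; have [_ _ e1 _] := fd_sz h; rewrite e1 in H0.
  have := H1 c t t' ht ht' hi hb; rewrite -H0 in ht ht'; exact: (fd_sem h ht' ht).
- by move=> v [/= /andP[_ /eqP h] _] _ _ c t t' _ _ _ /(_ h) ->.
- by move=> v h _ _ c t d; exact: uid_sem h.
- move=> v h _ H c t d ht hd; have [t' [h1 h2]] := H c t d ht hd; exact: uid_sem h h1 h2.
Qed.

Lemma E_sem R c : E R -> exists t, cI (c := c) R t. Proof. by move=> /sem0P. Qed.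
Lemma C_sem R j c t t' : C R j -> cI (c := c) R t -> cI (c := c) R t' -> onth t j = onth t' j.
Proof. by move=> /sem0P; apply. Qed.
Lemma D_sem m j c t t' : D m j -> cI (c := c) (m_rel (nmeth S m)) t -> cI (c := c) (m_rel (nmeth S m)) t' ->
  (forall x, x \in m_in (nmeth S m) -> onth t' x = onth t x) -> (m_bound (nmeth S m) = None -> t' = t) -> onth t' j = onth t j.
Proof. by move=> /sem0P; apply. Qed.
Lemma U_sem R i T j c t d : U R i T j -> cI (c := c) R t -> onth t i = Some d -> exists t', cI (c := c) T t' /\ onth t' j = Some d.
Proof. by move=> /sem0P; apply. Qed.

Definition relf (f : tri) := if f.1.1 == 0 then (natm q f.1.2).1 else f.1.2.

Lemma Lv_rel f R : Lv f R -> relf f = R.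
Proof. by move=> /Lv_inv[_ [[h ->]|->|->]]; rewrite /relf //=; case: (atm_wf h). Qed.

Lemma Ob_pos f j x : Ob f j x -> is_pos S (relf f) j.
Proof.
case/Ob_inv => [[-> h _]|[R [-> _ h _]]|[R [hl /C_pos[h _ _] _]]]; last by rewrite (Lv_rel hl).
  have [h1 h2 _] := arg_inv h; have [_ _ h3 h4] := atm_wf (VQ_atm h1).
  by rewrite /relf /= /is_pos h3 -h4.
by move: h => /= /andP[].
Qed.

(** A variable or a constant has one value; an entry of the generic fact has as many as there are
    facts of the relation. *)
Definition Val c (x : tri) d := if x.1.1 == 0 then d = ch c x.1.2 else exists t, cI (c := c) x.1.2 t /\ onth t x.2 = Some d.

Arguments Val c x d : clear implicits.

Lemma onth_atom c a j : j < size (natm q a).2 -> onth (map (ch c) (natm q a).2) j = Some (ch c (var a j)).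
Proof. by move=> h; rewrite (onth_lt (ch c 0)) ?size_map // (nth_map 0). Qed.

(** Uniqueness of the value is claimed for distinct names only: [(2,R,j)] equals itself and may have
    many values. *)
Definition EqV (x y : tri) := [/\ x.1.1 <= 2, y.1.1 <= 2 & forall c, (forall d, Val c x d <-> Val c y d) /\
  (x = y \/ forall d d', Val c x d -> Val c y d' -> d = d')].

Lemma EqV_sym x y : EqV x y -> EqV y x.
Proof.
move=> [h1 h2 H]; split=> // c; have [H1 H2] := H c; split; first by move=> d; split=> /H1.
by case: H2 => [->|h]; [left | right => d d' a b; exact: esym (h _ _ b a)].
Qed.

Lemma EqV_trans x y z : EqV x y -> EqV y z -> EqV x z.
Proof.
move=> [h1 h2 H] [h3 h4 K]; split=> // c; have [H1 H2] := H c; have [K1 K2] := K c; split.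
  by move=> d; split=> [/H1/K1|/K1/H1].
case: H2 => [->//|h]; case: K2 => [<-|k]; first by right.
by right=> d d' /H1 a b; exact: k a b.
Qed.

Lemma Val_C R j c d d' : C R j -> Val c (1, R, j) d -> Val c (1, R, j) d' -> d = d'.
Proof. by move=> hC [t [h1 h2]] [t' [h3 h4]]; have := C_sem hC h1 h3; rewrite /= in h2 h4; rewrite h2 h4 => -[]. Qed.

Lemma Val_atom a j R c : edb earg [:: a; j; var a j] -> edb eatm [:: a; R] -> Val c (1, R, j) (ch c (var a j)).
Proof.
move=> /arg_inv[h1 h2 _] /atm_wf[_ <- _ _]; exists (map (ch c) (natm q a).2); split; first exact: c_q.
exact: onth_atom.
Qed.

Lemma EqV_atom a j R : edb earg [:: a; j; var a j] -> edb eatm [:: a; R] -> C R j -> EqV (0, var a j, 0) (1, R, j).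
Proof.
move=> h1 h2 hC; split=> // c; have hv := Val_atom c h1 h2; split.
  by move=> d; split=> [->//|h]; exact: Val_C hC h hv.
by right=> d d' -> h; exact: Val_C hC hv h.
Qed.

Lemma Eq_ob_sem f j x y : Ob f j x -> Ob f j y -> EqV x y.
Proof.
have refl z : z.1.1 <= 2 -> EqV z z by move=> h; split=> // c; split=> //; left.
have atm a R : Lv (0, a, 0) R -> edb eatm [:: a; R] by move=> /Lv_inv[_ [[]|//|//]].
move=> /Ob_inv h1 /Ob_inv h2; case: h1 => [[ef h3 ->]|[R [ef hE h3 ->]]|[R [hl hC ->]]]; case: h2 => [[ef' h4 ->]|[R' [ef' hE' h4 ->]]|[R' [hl' hC' ->]]].
- by have [_ _ ->] := arg_inv h3; have [_ _ ->] := arg_inv h4; exact: refl.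
- by rewrite ef in ef'.
- have [_ _ ev] := arg_inv h3; rewrite ev in h3 *; rewrite ef in hl'; exact: EqV_atom h3 (atm _ _ hl') hC'.
- by rewrite ef in ef'.
- by rewrite ef in ef'; case: ef' => ->; exact: refl.
- rewrite ef in hl'; have eR := Lv_rel hl'; rewrite /relf /= in eR; subst R'.
  by split=> // c; split=> //; right=> d d' h5 h6; exact: Val_C hC' h5 h6.
- have [_ _ ev] := arg_inv h4; rewrite ev in h4 *; rewrite ef' in hl; apply: EqV_sym; exact: EqV_atom h4 (atm _ _ hl) hC.
- rewrite ef' in hl; have eR := Lv_rel hl; rewrite /relf /= in eR; subst R.
  by split=> // c; split=> //; right=> d d' h5 h6; exact: Val_C hC h5 h6.
- by rewrite (Lv_fun hl hl'); exact: refl.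
Qed.

Definition semq t a : Prop :=
  match t, a with
  | pEq, [:: x; y; z; x'; y'; z'] => EqV (x, y, z) (x', y', z')
  | pFE, [:: k; a; b; i] => (natm q a).1 = f_rel (nfd S k) /\ (natm q b).1 = f_rel (nfd S k) /\ (a < size q /\ b < size q) /\ forall c x, x < i ->
      onth (map (ch c) (natm q a).2) (nth 0 (f_lhs (nfd S k)) x) = onth (map (ch c) (natm q b).2) (nth 0 (f_lhs (nfd S k)) x)
  | _, _ => True
  end.

Lemma semqP t a : dl prog edb t a -> semq t a.
Proof.
move: t a; dl_induct2.
- move=> v _ [h1 h2] _; exact (@Eq_ob_sem (v 0, v 1, v 2) (v 3) (v 4, v 5, v 6) (v 7, v 8, v 9) h1 h2).
- by move=> v _ _; exact: EqV_sym.
- by move=> v _ _ [h1 h2]; exact: EqV_trans h1 h2.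
- by move=> v [/fd_sz[_ _ e1 _] [/atm_wf[h2 e2 _ _] /atm_wf[h3 e3 _ _]]] _ _; rewrite e1 e2 e3.
- move=> v [/lhs_inv[h1 h2 h3] [/arg_inv[h4 h5 h6] [/arg_inv[h7 h8 h9] /succ_inv->]]] _ [[H1 [H2 [H3 H4]]] H5].
  split=> //; split=> //; split=> // c x; rewrite ltnS leq_eqVlt => /orP[/eqP->|]; last exact: H4.
  rewrite -h3 !onth_atom // -h6 -h9; case: H5 => _ _ /(_ c) [/(_ (ch c (v 5)))]; rewrite /Val /= => -[/(_ erefl) -> _] _ //.
- move=> v [h1 [/arg_inv[h4 h5 h6] /arg_inv[h7 h8 h9]]] _ [H1 [H2 [_ H4]]].
  have [_ _ e1 _] := fd_sz h1; split=> // c; have := c_q c h4; rewrite H1 e1 => ha; have := c_q c h7; rewrite H2 e1 => hb.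
  have := fd_sem h1 ha hb (H4 c); rewrite !onth_atom // -h6 -h9 => -[ee].
  by rewrite /Val /= ee; split=> //; right=> d d' -> ->.
- move=> v h [h1 h2] _; split=> // c; have hC := C_uid h h1.
  have [t ht] := E_sem c h2; have [hp _ _ _ _] := uid_pos h; have [d hd] := onth_pos hp ht.
  have [t' [ht' hd']] := uid_sem h ht hd.
  have V1 : Val c (1, v 0, v 1) d by exists t.
  have V2 : Val c (1, v 2, v 3) d by exists t'.
  split; last by right=> x y hx hy; rewrite (Val_C hC hx V1) (Val_C h1 hy V2).
  by move=> x; split=> hx; [rewrite (Val_C hC hx V1) | rewrite (Val_C h1 hx V2)].
Qed.

Lemma Eq_sem x y : Eq x y -> EqV x y. Proof. by move: x y => [[x1 x2] x3] [[y1 y2] y3] /semqP. Qed.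
End Basics.
End Completeness1.

(** * Meaning of the rules in a run of the plan: liveness and accessibility *)

Module Completeness2.
Import Defs DatalogSyntax DatalogProgram ExtensionalFacts ProgramFacts Canonical1 Canonical4 Completeness1.
Import all_boot zify.
Import boolp.
Section Basics.
Variables (S : schema) (q : bcq) (J : nat -> bool) (js : nat) (g : nat -> seq nat -> bool).
Hypothesis wfS : wf_schema S.
Hypothesis wfq : wf_query S q.
Hypothesis adm : admissible S q J js.
Notation edb := (fun t a => is_true (sedb S q J g t a)).
Notation E := (dE edb). Notation C := (dC edb). Notation D := (dD edb). Notation Ob := (dOb edb).
Notation Eq := (dEq edb). Notation Lv := (dLv edb). Notation Ac := (dAc edb). Notation AT := (dAT edb).
Notation Rv := (dRv edb). Notation Rev := (dRev edb). Notation U := (dU edb). Notation E2 := (dE2 edb).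
Notation P2 := (dP2 edb). Notation O2 := (dO2 edb).
Let uid_pos := @ProgramFacts.uid_pos S q J js g wfS adm.
Let atm_wf := @ProgramFacts.atm_wf S q J g wfq.
Notation var := (@ProgramFacts.var q).
Let arg_inv := @ProgramFacts.arg_inv S q J g.
Let meth_inv := @ProgramFacts.meth_inv S q J g.
Let inp_pos := @ProgramFacts.inp_pos S q J js g wfS adm.
Let Rv_inv := @ProgramFacts.Rv_inv S q J g.
Let Ob_inv := @ProgramFacts.Ob_inv S q J g.
Notation EqK := (@ProgramFacts.EqK S q J g).
Notation RvK := (@ProgramFacts.RvK S q J g).
Notation rel := (@ProgramFacts.rel q).
Notation rep := (@ProgramFacts.rep S q J g).
Notation repK := (@ProgramFacts.repK S q J g).
Notation nrm := (@ProgramFacts.nrm J js).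
Notation DX := (@ProgramFacts.DX S q J js g).
Notation AccE := (@ProgramFacts.AccE S q J js g).
Notation phi := (@ProgramFacts.phi S q J js g).
Notation Ew := (@ProgramFacts.Ew S q J g).
Notation RevV := (@ProgramFacts.RevV S q J js g).
Notation legit_child := (@ProgramFacts.legit_child S q J js g).
Notation OccV := (@ProgramFacts.OccV S q J js g).
Notation VL := (@ProgramFacts.VL S q J js g).
Notation kap := (@ProgramFacts.kap S q J g).
Notation el := (@ProgramFacts.el S q J g).
Notation slotA := (@ProgramFacts.slotA S q J js g).
Notation PosA := (@ProgramFacts.PosA S q J js g).
Notation new_child := (@ProgramFacts.new_child S q J g).
Notation Birth := (@ProgramFacts.Birth S q J js g).
Notation Occ := (@ProgramFacts.Occ S q J js g).
Notation Vw := (@ProgramFacts.Vw S q J js g).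
Notation Iw := (@ProgramFacts.Iw S q J js g).
Let VQ_atm := @ProgramFacts.VQ_atm S q J g.
Notation Jt := (@Canonical4.Jt J).
Notation ctx := (@Completeness1.ctx S q).
Let onth_In := @Completeness1.onth_In.
Let onth_pos := @Completeness1.onth_pos S q.
Let uid_sem := @Completeness1.uid_sem S q J g.
Notation sem0 := (@Completeness1.sem0 S q).
Let succ_inv := @Completeness1.succ_inv S q J g.
Let inp_inv := @Completeness1.inp_inv S q J g.
Let E_sem := @Completeness1.E_sem S q J js g wfS wfq adm.
Let C_sem := @Completeness1.C_sem S q J js g wfS wfq adm.
Let D_sem := @Completeness1.D_sem S q J js g wfS wfq adm.
Notation relf := (@Completeness1.relf q).
Let Lv_rel := @Completeness1.Lv_rel S q J g wfq.
Notation Val c x d := (@Completeness1.Val S q c x d).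
Let onth_atom := @Completeness1.onth_atom S q.
Notation EqV := (@Completeness1.EqV S q).
Notation semq := (@Completeness1.semq S q).
Let Eq_sem := @Completeness1.Eq_sem S q J js g wfS wfq adm.
(** For a type [(2,T,l)] the inherited element has to be known at stage [s]. *)
Definition Real (c : ctx) s (f : tri) (t : seq (cD c)) : Prop :=
  if f.1.1 == 0 then f.1.2 < size q /\ t = map (ch c) (natm q f.1.2).2
  else cI (c := c) f.1.2 t /\ (f.1.1 = 1 \/ exists d, onth t f.2 = Some d /\ cAc (c := c) s d).

Lemma Real_I (c : ctx) s f t : Real s f t -> cI (c := c) (relf f) t.
Proof. by rewrite /Real /relf; case: eqP => _ [h1 h2] //; rewrite h2; exact: c_q. Qed.

Lemma Real_mono (c : ctx) s s' f t : s <= s' -> Real (c := c) s f t -> Real s' f t.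
Proof.
rewrite /Real => hs; case: eqP => // _ [h1 h2]; split=> //; case: h2 => [|[d [h2 h3]]]; [by left | right].
by exists d; split=> //; exact: c_mono hs h3.
Qed.

(* Delays are relative to the stage [s] at which the fact is available, and only the first [cK] rounds count. *)
Definition sem1 t a : Prop :=
  match t, a with
  | pOb, [:: f1; f2; f3; j; x1; x2; x3] => exists N, forall (c : ctx) d, N <= cK c -> Val c (x1, x2, x3) d ->
      exists t, Real (c := c) N (f1, f2, f3) t /\ onth t j = Some d
  | pLv, [:: f1; f2; f3; R] => exists N, forall c : ctx, N <= cK c -> exists t, Real (c := c) N (f1, f2, f3) t
  | pAc, [:: f1; f2; f3; j] => exists N, forall (c : ctx) s t d, s + N <= cK c -> Real (c := c) s (f1, f2, f3) t ->
      onth t j = Some d -> cAc (s + N) d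
  | pAT, [:: x1; x2; x3] => exists N, forall (c : ctx) d, N <= cK c -> Val c (x1, x2, x3) d -> cAc (c := c) N d
  | pRI, [:: f1; f2; f3; m; i] => m < size (s_meth S) /\ relf (f1, f2, f3) = m_rel (nmeth S m) /\ exists N, forall (c : ctx) s t, s + N <= cK c ->
      Real (c := c) s (f1, f2, f3) t -> forall k, k < i -> exists d, onth t (nth 0 (m_in (nmeth S m)) k) = Some d /\ cAc (s + N) d
  | pRv, [:: f1; f2; f3; m] => exists N, forall (c : ctx) s t, s + N <= cK c -> Real (c := c) s (f1, f2, f3) t ->
      exists t', cAF (s + N) (m_rel (nmeth S m)) t' /\ forall j, D m j -> onth t' j = onth t j
  | pRev, [:: T; l] => exists N, forall (c : ctx) s t d, s + N <= cK c -> cI (c := c) T t -> onth t l = Some d -> cAc s d ->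
      exists t', cAF (s + N) T t' /\ onth t' l = Some d
  | _, _ => True
  end.

Lemma Ob_val (c : ctx) s f j x t d : Ob f j x -> Real (c := c) s f t -> onth t j = Some d -> Val c x d.
Proof.
case/Ob_inv => [[-> h ->]|[R [-> hE h ->]]|[R [hl hC ->]]] hr hd.
- move: hr => [_ et]; have [h1 h2 h3] := arg_inv h; move: hd; rewrite et onth_atom // -h3 => -[<-]; exact: erefl.
- by exists t; split=> //; case: hr.
- by exists t; split=> //; have := Real_I hr; rewrite (Lv_rel hl).
Qed.

Lemma Ac_Lv f j : Ac f j -> exists R, Lv f R.
Proof.
have atm a k v : edb earg [:: a; k; v] -> Lv (0, a, 0) (natm q a).1.
  by move=> /arg_inv[h _ _]; exact: Lv_atm (VQ_atm h).
move: f j; suff H : forall t a, dl prog edb t a -> (match t, a with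
  | pAc, [:: f1; f2; f3; j] => exists R, Lv (f1, f2, f3) R
  | _, _ => True end) by move=> [[f1 f2] f3] j /H.
dl_induct2; try (by move=> v _ h; eexists; exact h).
- by move=> v _ [_ h2] _; case: (@Ob_inv (v 3, v 4, v 5) (v 6) (v 0, v 1, v 2) h2) => [[-> /atm h _]|[R [-> h _ _]]|[R [h _ _]]];
    eexists; [exact: h | exact: Lv_gen h | exact: h].
- by move=> v _ [h _] _; have [_ h2] := @Rv_inv (v 0, v 1, v 2) _ h; eexists; exact: h2.
- by move=> v _ [_ h] _; eexists; exact: h.
- by move=> v _ [_ h] _; eexists; exact: h.
- by move=> v _ [_ [h _]] _; eexists; exact: h.
Qed.

Lemma Lv2_pos T l R : Lv (2, T, l) R -> is_pos S T l.
Proof.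
move: T l R; suff H : forall t a, dl prog edb t a -> (match t, a with
  | pLv, [:: 2; T; l; R] => is_true (is_pos S T l) | _, _ => True end) by move=> T l R /H.
by dl_induct2; move=> v /uid_pos[].
Qed.

(** Each rule computes its delay from those of its premises, never from the instance. *)
Lemma sem1P t a : dl prog edb t a -> sem1 t a.
Proof.
move: t a; apply: dl_cases; cbn -[sedb dl leq onth nth mem in_mem eq_op is_true Real relf addn Val]; dl_each; try by []; try by move=> ? _ _ [].
- move=> v h _ _; exists 0 => c d _ ->; have [h1 h2 h3] := arg_inv h; exists (map (ch c) (natm q (v 0)).2).
  by rewrite onth_atom // /= -h3.
- by move=> v _ _ _; exists 0 => c d _ [t [h1 h2]]; exists t; split=> //; split=> //; left.
- move=> v _ [hl hC] [[N H] _]; exists N => c d hN [t [h1 h2]]; have [t' ht'] := H c hN; exists t'; split=> //.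
  rewrite -h2; apply: (C_sem hC) => //; have := Real_I ht'.
  by rewrite (@Lv_rel (v 0, v 1, v 2) _ hl).
- move=> v h _ _; exists 0 => c _; exists (map (ch c) (natm q (v 0)).2); split=> //.
  by have [] := atm_wf h.
- by move=> v _ h _; exists 0 => c _; have [t ht] := E_sem c h; exists t; split=> //; left.
- move=> v h [hl ha] [[N1 H1] [N2 H2]]; exists (N1 + N2) => c hN.
  have [t ht] : exists t, Real (c := c) N1 (v 4, v 5, v 6) t by apply: H1; lia.
  have hI := Real_I ht; rewrite (@Lv_rel (v 4, v 5, v 6) _ hl) in hI.
  have [hp _ _ _ _] := uid_pos h; have [d hd] := onth_pos hp hI.
  have [t' [h1 h2]] := uid_sem h hI hd; exists t'; split=> //; right; exists d; split=> //.
  exact: H2 hN ht hd.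
- move=> v h [hl ha] [[N1 H1] [N2 H2]]; exists (N1 + N2) => c hN.
  have [t ht] : exists t, Real (c := c) N1 (v 4, v 5, v 6) t by apply: H1; lia.
  have [t1 [h1 _]] := H2 _ _ _ hN ht; have [_ hl2] := @Rv_inv (v 4, v 5, v 6) _ ha.
  have hI := c_AFI h1; rewrite -(Lv_rel hl2) (@Lv_rel (v 4, v 5, v 6) _ hl) in hI h1.
  have [hp _ _ _ _] := uid_pos h; have [d hd] := onth_pos hp hI.
  have [t' [h3 h4]] := uid_sem h hI hd; exists t'; split=> //; right; exists d; split=> //.
  exact: c_AFAc h1 (onth_In hd).
- move=> v _ hl _; exists 0 => c s t d _ [_ [//|[d' [h1 h2]]]] hd.
  by rewrite addn0; move: hd; rewrite h1 => -[<-].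
- move=> v _ [h1 h2] [[N1 H1] [N2 H2]]; exists (N2 + N1) => c d hN hV.
  have [t [h3 h4]] := H2 c d (leq_trans (leq_addr _ _) hN) hV; exact: H1 hN h3 h4.
- move=> v _ [h1 h2] [[N H] _]; exists N => c d hN hV; apply: H => //.
  by have [_ _ /(_ c)[h3 _]] := @Eq_sem (v 0, v 1, v 2) (v 3, v 4, v 5) h2; apply/h3.
- move=> v _ [h1 h2] [[N H] _]; exists N => c s t d hN ht hd.
  apply: (c_mono (leq_addl s N)); apply: H; first by lia.
  exact: (@Ob_val c s (v 3, v 4, v 5) _ (v 0, v 1, v 2) _ _ h2 ht hd).
- move=> v /meth_inv[h1 h2 _] hl _; split=> //; split; last by exists 0.
  by rewrite (@Lv_rel (v 0, v 1, v 2) _ hl) h2.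
- move=> v [/inp_inv[h1 h2 h3] /succ_inv->] _ [[H1 [H2 [N1 H3]]] [N2 H4]]; split=> //; split=> //; exists (N1 + N2) => c s t hN ht k.
  rewrite ltnS leq_eqVlt => /orP[/eqP->|hk].
    have hI := Real_I ht; rewrite H2 in hI; have [_ hp _ _] := inp_pos h1 (mem_nth 0 h2).
    have [d hd] := onth_pos hp hI; exists d; split=> //; rewrite -h3 in hd.
    have := H4 _ s _ _ _ ht hd; move=> /(_ ltac:(lia)); apply: c_mono; lia.
  have [|d [h5 h6]] := H3 _ s _ _ ht _ hk; first by lia.
  exists d; split=> //; apply: c_mono h6; lia.
(* All inputs are known after [N] rounds, and one more round performs the access. *)
- move=> v h hr [h1 [h2 [N H]]]; exists N.+1 => c s t hN ht; have hI := Real_I ht; rewrite h2 in hI.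
  have [||t' [h3 h4 h5]] := @c_run _ _ c (s + N) (v 3) t _ h1 hI; first by lia.
    move=> x /(nthP 0)[k hk <-]; apply: (H c s t _ ht); first by lia.
    by have [_ _ ->] := meth_inv h.
  exists t'; rewrite addnS; split=> // j hj; exact: D_sem hj hI (c_AFI h3) h4 h5.
- move=> v _ [h1 h2] [[N H] _]; exists N => c s t d hN ht hd.
  have [t' [h3 h4]] := H c s t hN ht; apply: (c_AFAc h3); apply: (@onth_In _ _ (v 4)); by rewrite h4.
- move=> v _ [h1 h2] [[N H] _]; exists N => c s t d hN ht hd; apply: (H c s t d hN) => //.
  have := Real_I ht; rewrite (@Lv_rel (v 2, v 3, v 4) _ h2) => hI; by split=> //; left.
- move=> v h [h1 h2] [[N H] _]; exists N => c s t d hN ht hd.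
  have hI := Real_I ht; rewrite (@Lv_rel (v 4, v 5, v 6) _ h2) in hI.
  have [t' [h3 h4]] := uid_sem h hI hd; apply: (H c s t' d hN) => //; by split=> //; left.
- move=> v _ [h1 [h2 h3]] [[N1 H1] [_ [N2 H2]]]; exists (N2 + N1) => c s t d hN ht hd.
  have hI := Real_I ht; rewrite (@Lv_rel (v 3, v 4, v 5) _ h2) in hI.
  have [R0 hL] := @Ac_Lv (2, v 0, v 1) _ h1; have hp := Lv2_pos hL.
  have [d' hd'] := onth_pos hp hI; rewrite addnA; apply: (H1 c (s + N2) t d) => //; first by rewrite -addnA.
  split=> //; right; exists d'; split=> //; apply: (H2 c s t d') => //; lia.
- move=> v _ [h1 h2] [[N H] _]; exists N => c s t d hN ht hd ha.
  have hR : Real (c := c) s (2, v 0, v 1) t by split=> //; right; exists d.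
  have [t' [h3 h4]] := H c s t hN hR; exists t'; have [hm hl] := @Rv_inv (2, v 0, v 1) _ h1.
  have eR := Lv_rel hl; rewrite /relf /= in eR; rewrite eR; split=> //; by rewrite h4.
Qed.
End Basics.
End Completeness2.

(** * Correctness of the goal in an instance that provides the retrieved facts *)

Module Completeness3.
Import Defs DatalogSyntax DatalogProgram ExtensionalFacts ProgramFacts Canonical1 Canonical4 Completeness1 Completeness2.
Import all_boot zify.
Import boolp.
Section Basics.
Variables (S : schema) (q : bcq) (J : nat -> bool) (js : nat) (g : nat -> seq nat -> bool).
Hypothesis wfS : wf_schema S.
Hypothesis wfq : wf_query S q.
Hypothesis adm : admissible S q J js.
Notation edb := (fun t a => is_true (sedb S q J g t a)).
Notation E := (dE edb). Notation C := (dC edb). Notation D := (dD edb). Notation Ob := (dOb edb).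
Notation Eq := (dEq edb). Notation Lv := (dLv edb). Notation Ac := (dAc edb). Notation AT := (dAT edb).
Notation Rv := (dRv edb). Notation Rev := (dRev edb). Notation U := (dU edb). Notation E2 := (dE2 edb).
Notation P2 := (dP2 edb). Notation O2 := (dO2 edb).
Let uidP := @ProgramFacts.uidP S q J g.
Let uid_pos := @ProgramFacts.uid_pos S q J js g wfS adm.
Let fd_wf := @ProgramFacts.fd_wf S q J js g wfS adm.
Let atm_wf := @ProgramFacts.atm_wf S q J g wfq.
Let fd_sz := @ProgramFacts.fd_sz S q J g.
Notation var := (@ProgramFacts.var q).
Let arg_inv := @ProgramFacts.arg_inv S q J g.
Let Ob_inv := @ProgramFacts.Ob_inv S q J g.
Notation EqK := (@ProgramFacts.EqK S q J g).
Notation RvK := (@ProgramFacts.RvK S q J g).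
Notation rel := (@ProgramFacts.rel q).
Notation rep := (@ProgramFacts.rep S q J g).
Notation repK := (@ProgramFacts.repK S q J g).
Notation nrm := (@ProgramFacts.nrm J js).
Notation DX := (@ProgramFacts.DX S q J js g).
Notation AccE := (@ProgramFacts.AccE S q J js g).
Notation phi := (@ProgramFacts.phi S q J js g).
Notation Ew := (@ProgramFacts.Ew S q J g).
Notation RevV := (@ProgramFacts.RevV S q J js g).
Notation legit_child := (@ProgramFacts.legit_child S q J js g).
Notation OccV := (@ProgramFacts.OccV S q J js g).
Notation VL := (@ProgramFacts.VL S q J js g).
Notation kap := (@ProgramFacts.kap S q J g).
Notation el := (@ProgramFacts.el S q J g).
Notation slotA := (@ProgramFacts.slotA S q J js g).
Notation PosA := (@ProgramFacts.PosA S q J js g).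
Notation new_child := (@ProgramFacts.new_child S q J g).
Notation Birth := (@ProgramFacts.Birth S q J js g).
Notation Occ := (@ProgramFacts.Occ S q J js g).
Notation Vw := (@ProgramFacts.Vw S q J js g).
Notation Iw := (@ProgramFacts.Iw S q J js g).
Let VQ_atm := @ProgramFacts.VQ_atm S q J g.
Let onth_lt := @Canonical1.onth_lt.
Notation Jt := (@Canonical4.Jt J).
Notation ctx := (@Completeness1.ctx S q).
Notation sem0 := (@Completeness1.sem0 S q).
Let lhs_inv := @Completeness1.lhs_inv S q J g.
Let succ_inv := @Completeness1.succ_inv S q J g.
Notation relf := (@Completeness1.relf q).
Let Lv_rel := @Completeness1.Lv_rel S q J g wfq.
Let Ob_pos := @Completeness1.Ob_pos S q J js g wfS wfq adm.
Notation Val c x d := (@Completeness1.Val S q c x d).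
Notation EqV := (@Completeness1.EqV S q).
Notation semq := (@Completeness1.semq S q).
Let Eq_sem := @Completeness1.Eq_sem S q J js g wfS wfq adm.
Notation Real := (@Completeness2.Real S q).
Notation sem1 := (@Completeness2.sem1 S q J g).
Section Second.
Variables (lf : nat -> tri) (kf : nat -> nat * tri * nat) (nf : nat -> nat * tri * nat * nat * nat).
Hypothesis gG : forall t a, g t a = guess lf kf nf t a.
Variables (D0 : Type) (I : instance D0) (val : tri -> option D0) (rho : tri -> nat -> seq D0).
Hypothesis Iwf : wf_instance S I.
Hypothesis Isat : sat_constraints S I.
Hypothesis rhoP : forall f m, Rv f m -> I (relf f) (rho f m) /\ forall j x, D m j -> Ob f j x -> onth (rho f m) j = val x.
Hypothesis chdP : forall f j x R T l, Ac f j -> Ob f j x -> Lv f R -> U R j T l -> Rev T l ->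
  exists t d, [/\ I T t, onth t l = Some d & val x = Some d].
Hypothesis valEq : forall x y, Eq x y -> val x = val y.

(** One fact is fixed for each element, relation and position, so a null and the atom in which it
    was born refer to the same tuple. *)
Definition pick d T l : seq D0 := if pselect (exists t, I T t /\ onth t l = Some d) is left h then projT1 (cid h) else [::].
Definition pickT T : seq D0 := if pselect (exists t, I T t) is left h then projT1 (cid h) else [::].

Lemma pickP d T l t : I T t -> onth t l = Some d -> I T (pick d T l) /\ onth (pick d T l) l = Some d.
Proof. by move=> h1 h2; rewrite /pick; case: pselect => [h|[]]; [exact: projT2 (cid h) | exists t]. Qed.

Lemma pickTP T t : I T t -> I T (pickT T).
Proof. by move=> h1; rewrite /pickT; case: pselect => [h|[]]; [exact: projT2 (cid h) | exists t]. Qed.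

(** The value of an object under the guess. It is inductive because a guess may let nulls refer to
    each other in a circle; such nulls get no value, and existence of values comes from
    derivability. *)
Inductive VZ : tri -> D0 -> Prop :=
| VZ_core x d : x.1.1 <= 2 -> val x = Some d -> VZ x d
| VZ_root z f m T j d : nf z = (0, f, m, T, j) -> onth (rho f m) j = Some d -> VZ (3, z, 0) d
| VZ_chd z y l T j c d : nf z = (1, y, l, T, j) -> VZ y c -> onth (pick c T l) j = Some d -> VZ (3, z, 0) d
| VZ_top z y l T j d : nf z = (2, y, l, T, j) -> onth (pickT T) j = Some d -> VZ (3, z, 0) d.

Lemma VZ_fun x d d' : VZ x d -> VZ x d' -> d = d'.
Proof.
move=> h; elim: h d' => {x d} [x d h1 h2|z f m T j d h1 h2|z y l T j c d h1 h2 IH h3|z y l T j d h1 h2] d' h'; inversion h'; subst => //.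
- by move: h2; rewrite H0 => -[].
- by rewrite h1 in H0; case: H0 => e1 e2 e3 e4; subst; move: h2; rewrite H1 => -[].
- by rewrite h1 in H0.
- by rewrite h1 in H0.
- by rewrite h1 in H0.
- rewrite h1 in H0; case: H0 => e1 e2 e3 e4; subst.
  by rewrite -(IH _ H1) in H2; move: h3; rewrite H2 => -[].
- by rewrite h1 in H0.
- by rewrite h1 in H0.
- by rewrite h1 in H0.
- by rewrite h1 in H0; case: H0 => e1 e2 e3 e4; subst; move: h2; rewrite H1 => -[].
Qed.

Definition hom v : option D0 := if pselect (exists d, VZ (lf v) d) is left h then Some (projT1 (cid h)) else None.

Lemma homE v d : VZ (lf v) d -> hom v = Some d.
Proof. by move=> h; rewrite /hom; case: pselect => [h'|[]]; [rewrite (VZ_fun (projT2 (cid h')) h) | exists d]. Qed.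

Definition AFact a t := I (natm q a).1 t /\
  let: (s, y, l) := kf a in
  [\/ [/\ s = 0, Rv y l & t = rho y l], s = 1 /\ exists c, [/\ VZ y c, t = pick c (natm q a).1 l & onth t l = Some c]
    | s = 2 /\ t = pickT (natm q a).1].

Definition semC t a : Prop :=
  match t, a with
  | pC, [:: R; j] => forall t t', I R t -> I R t' -> onth t j = onth t' j
  | pFC, [:: k; i] => forall t t', I (f_rel (nfd S k)) t -> I (f_rel (nfd S k)) t' ->
      forall x, x < i -> onth t (nth 0 (f_lhs (nfd S k)) x) = onth t' (nth 0 (f_lhs (nfd S k)) x)
  | _, _ => True
  end.

Lemma pos_some R j t : is_pos S R j -> I R t -> exists d, onth t j = Some d.
Proof.
move=> /andP[_ hj] /Iwf[_ st]; case e : (onth t j) => [d|]; first by exists d.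
by move: hj; rewrite -st => hj; case: t hj e {st} => // x t hj; rewrite (onth_lt x).
Qed.

Lemma uid_I R i T j t d : edb euid [:: R; i; T; j] -> I R t -> onth t i = Some d -> exists t', I T t' /\ onth t' j = Some d.
Proof. by move=> /uidP h ht <-; have [/(_ _ h) H _] := Isat; exact: H ht. Qed.

Lemma semCP t a : dl prog edb t a -> semC t a.
Proof.
move: t a; dl_induct2.
- move=> v [/lhs_inv[h1 h2 h3] [h4 /succ_inv->]] _ [H1 H2] t t' ht ht' x; rewrite ltnS leq_eqVlt => /orP[/eqP->|]; last exact: H1.
  by rewrite -h3; apply: H2; have [_ _ <- _] := fd_sz h4.
- move=> v h _ H t t' ht ht'; have [[_ _ hin] _] := fd_wf h; have [_ es e1 e2] := fd_sz h.
  have [_ /(_ _ hin) hs] := Isat; rewrite -e1 in ht ht'; rewrite -e2; apply: (hs _ _ ht ht') => d /(nthP 0)[x hx <-].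
  by apply: H => //; rewrite es.
- move=> v h _ H t t' ht ht'; have [hp _ _ _ _] := uid_pos h.
  have [d hd] := pos_some hp ht; have [d' hd'] := pos_some hp ht'; rewrite hd hd'.
  have [u [h1 h2]] := uid_I h ht hd; have [u' [h3 h4]] := uid_I h ht' hd'.
  by rewrite -h2 -h4; exact: H h1 h3.
Qed.

Lemma C_I R j t t' : C R j -> I R t -> I R t' -> onth t j = onth t' j.
Proof. by move=> /semCP; apply. Qed.

Lemma nul_inv z s y1 y2 y3 l T j : edb enul [:: z; s; y1; y2; y3; l; T; j] -> nf z = (s, (y1, y2, y3), l, T, j).
Proof. by move=> /andP[]; rewrite gG => /eqP <-. Qed.

Lemma lab_inv v y1 y2 y3 : edb elab [:: v; y1; y2; y3] -> lf v = (y1, y2, y3).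
Proof. by move=> /andP[]; rewrite gG => /eqP <-. Qed.

Lemma kind_inv a s y1 y2 y3 l : edb ekind [:: a; s; y1; y2; y3; l] -> kf a = (s, (y1, y2, y3), l).
Proof. by move=> /andP[]; rewrite gG => /eqP <-. Qed.

(** For [pSO]: whatever tuple the kind prescribes for the atom, its slot carries the value of the
    variable. The facts found slot by slot thus fit one and the same tuple. *)
Definition semB t a : Prop :=
  match t, a with
  | pE2, [:: R] => exists t, I R t
  | pP2, [:: x1; x2; x3; R; i] => x1 <= 2 /\ exists t d, [/\ I R t, onth t i = Some d & val (x1, x2, x3) = Some d]
  | pO2, [:: A; k; R; i] => forall t, I A t -> exists d t', [/\ onth t k = Some d, I R t' & onth t' i = Some d]
  | pNO, [:: z] => forall s y l T j, nf z = (s, y, l, T, j) -> exists t, I T t /\ forall d, onth t j = Some d -> VZ (3, z, 0) d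
  | pPi, [:: x1; x2; x3; R; i] => exists d t, [/\ VZ (x1, x2, x3) d, I R t & onth t i = Some d]
  | pSO, [:: a; j] => forall t, AFact a t -> onth t j = hom (var a j)
  | pAO, [:: a; i] => exists t, AFact a t /\ forall j, j < i -> onth t j = hom (var a j)
  | pAL, [:: i] => forall a, a < i -> exists t, AFact a t /\ forall j, j < size (natm q a).2 -> onth t j = hom (var a j)
  | pGoal, [::] => cq_holds I q
  | _, _ => True
  end.

Lemma semBP t a : dl prog edb t a -> semB t a.
Proof.
move: t a; apply: dl_cases; cbn -[sedb dl leq onth nth mem in_mem eq_op is_true relf addn AFact cq_holds]; dl_each; try by []; try by move=> ? _ _ [].
- move=> v _ [h1 h2] _; have [h3 _] := @rhoP (v 0, v 1, v 2) _ h1; rewrite (@Lv_rel (v 0, v 1, v 2) _ h2) in h3.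
  by exists (rho (v 0, v 1, v 2) (v 3)).
- move=> v h _ [t ht]; have [hp _ _ _ _] := uid_pos h; have [d hd] := pos_some hp ht.
  by have [t' [h1 _]] := uid_I h ht hd; exists t'.
- move=> v _ [h1 [h2 [h3 h4]]] _; have eR := @Lv_rel (v 0, v 1, v 2) _ h4.
  have [h5 h6] := @rhoP (v 0, v 1, v 2) _ h1; rewrite eR in h5.
  have hp := @Ob_pos (v 0, v 1, v 2) (v 4) (v 5, v 6, v 7) h3; rewrite eR in hp.
  have [d hd] := pos_some hp h5; split.
    by case: (@Ob_inv (v 0, v 1, v 2) (v 4) (v 5, v 6, v 7) h3) => [[_ _ [->]]|[R [_ _ _ [->]]]|[R [_ _ [->]]]] *; exact: isT.
  by exists (rho (v 0, v 1, v 2) (v 3)), d; split=> //; rewrite -(h6 _ (v 5, v 6, v 7) h2 h3).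
- move=> v _ [h1 [h2 [h3 [h4 h5]]]] _; split.
    by case: (@Ob_inv (v 0, v 1, v 2) (v 3) (v 4, v 5, v 6) h2) => [[_ _ [->]]|[R [_ _ _ [->]]]|[R [_ _ [->]]]] *; exact: isT.
  exact: (@chdP (v 0, v 1, v 2) (v 3) (v 4, v 5, v 6) (v 7)).
- move=> v h _ [hx [t [d [h1 h2 h3]]]]; split=> //; have [t' [h4 h5]] := uid_I h h1 h2; by exists t', d.
- move=> v h [_ [hC _]] [[hx [t [d [h1 h2 h3]]]] [_ [t' ht']]]; split=> //; have [hp _ _ _ _] := uid_pos h.
  have [d' hd'] := pos_some hp ht'; have [u [h4 h5]] := uid_I h ht' hd'.
  by have := C_I hC h1 h4; rewrite h2 h5 => -[ed]; subst d'; exists t', d.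
- move=> v _ [_ he] [[hx [t [d [h1 h2 h3]]]] _]; have [_ hy _] := @Eq_sem (v 0, v 1, v 2) (v 5, v 6, v 7) he.
  by split=> //; exists t, d; rewrite -(@valEq (v 0, v 1, v 2) (v 5, v 6, v 7) he).
- move=> v /= /andP[hp _] _ _ t ht; have [d hd] := pos_some hp ht; by exists d, t.
- move=> v h _ H t /H[d [t' [h1 h2 h3]]]; have [t2 [h4 h5]] := uid_I h h2 h3; by exists d, t2.
- move=> v h [_ [hC _]] [H [_ [u hu]]] t /H[d [t' [h1 h2 h3]]]; have [hp _ _ _ _] := uid_pos h.
  have [d' hd'] := pos_some hp hu; have [w [h4 h5]] := uid_I h hu hd'.
  by have := C_I hC h2 h4; rewrite h3 h5 => -[ed]; subst d'; exists d, u.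
- move=> v /nul_inv h [h1 h2] _ s y l T j; rewrite h => -[_ _ _ <- <-].
  have [h3 _] := @rhoP (v 1, v 2, v 3) _ h1; rewrite (@Lv_rel (v 1, v 2, v 3) _ h2) in h3.
  by exists (rho (v 1, v 2, v 3) (v 4)); split=> // d; exact: (VZ_root h).
- move=> v /nul_inv h _ [c [t [h1 h2 h3]]] s y l T j; rewrite h => -[_ _ _ <- <-].
  have [h4 h5] := pickP h2 h3; exists (pick c (v 5) (v 4)); split=> // d; exact: (VZ_chd h h1).
- move=> v /nul_inv h _ [t ht] s y l T j; rewrite h => -[_ _ _ <- <-].
  exists (pickT (v 5)); split; [exact: pickTP ht | move=> d; exact: (VZ_top h)].
- move=> v /nul_inv h _ [H1 H2]; have [t [h1 h2]] := H1 _ _ _ _ _ h; have [d [t' [h3 h4 h5]]] := H2 t h1.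
  by exists d, t'; split=> //; exact: h2.
- move=> v _ _ [hx [t [d [h1 h2 h3]]]]; exists d, t; split=> //; exact: VZ_core.
- move=> v [/kind_inv hk [hA [/arg_inv[ha hj hv] [/lab_inv hl /nul_inv hn]]]] _ _ t [ht].
  have [_ eR hR hs] := atm_wf hA; rewrite hk eR => hh; rewrite -hv.
  have [d hd] : exists d, onth t (v 7) = Some d.
    by apply: (pos_some _ ht); rewrite /is_pos eR hR -hs.
  rewrite hd; symmetry; apply: homE; rewrite hl.
  case: hh => [[es hr et]|[es [c [h1 h2 h3]]]|[es et]]; rewrite es in hn.
  + by apply: (VZ_root hn); rewrite -et.
  + by apply: (VZ_chd hn h1); rewrite -h2.
  + by apply: (VZ_top hn); rewrite -et.
- move=> v [/kind_inv hk [/arg_inv[ha hj hv] /lab_inv hl]] [h1 [h2 h3]] _ t [ht]; rewrite hk => hh; rewrite -hv.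
  case: hh => [[_ hr et]|[//]|[//]]; have [_ h4] := @rhoP (v 1, v 2, v 3) _ hr; have [_ hy _] := @Eq_sem (v 10, v 11, v 12) (v 7, v 8, v 9) h3.
  have [d hd] : exists d, onth t (v 5) = Some d.
    by apply: (pos_some _ ht); have [_ _ hR hs] := atm_wf (VQ_atm ha); rewrite /is_pos hR -hs.
  rewrite hd; symmetry; apply: homE; rewrite hl; apply: VZ_core => //.
  by rewrite -(@valEq (v 10, v 11, v 12) (v 7, v 8, v 9) h3) -(h4 (v 5) (v 10, v 11, v 12) h1 h2) -et.
- move=> v [/arg_inv[ha hj hv] [/lab_inv hl hA]] [hC _] [_ [d [t' [h1 h2 h3]]]] t [ht _].
  have [_ eR _ _] := atm_wf hA; rewrite eR in ht; rewrite -hv (C_I hC ht h2) h3; symmetry; apply: homE; by rewrite hl.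
- move=> v [/kind_inv hk [/arg_inv[ha hj hv] /lab_inv hl]] _ _ t [ht]; rewrite hk => hh; rewrite -hv.
  case: hh => [[//]|[_ [c [h1 h2 h3]]]|[//]]; rewrite h3; symmetry; apply: homE; by rewrite hl.
- move=> v [/kind_inv hk hA] [h1 h2] _; have [_ eR _ _] := atm_wf hA.
  have [h3 _] := @rhoP (v 1, v 2, v 3) _ h1; rewrite (@Lv_rel (v 1, v 2, v 3) _ h2) in h3.
  exists (rho (v 1, v 2, v 3) (v 4)); split=> //; rewrite /AFact hk eR; split=> //; exact: Or31.
- move=> v [/kind_inv hk hA] _ [c [t [h1 h2 h3]]]; have [_ eR _ _] := atm_wf hA; have [h4 h5] := pickP h2 h3.
  exists (pick c (v 5) (v 4)); split=> //; rewrite /AFact hk eR; split=> //; apply: Or32; split=> //; by exists c.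
- move=> v [/kind_inv hk hA] _ [t ht]; have [_ eR _ _] := atm_wf hA.
  exists (pickT (v 5)); split=> //; rewrite /AFact hk eR; split; [exact: pickTP ht | exact: Or33].
- move=> v /succ_inv-> _ [[t [h1 h2]] h3]; exists t; split=> // j; rewrite ltnS leq_eqVlt => /orP[/eqP->|]; [exact: h3 | exact: h2].
- move=> v [/= /andP[_ /eqP hz] /succ_inv->] _ [h1 h2] a; rewrite ltnS leq_eqVlt => /orP[/eqP->|]; [by rewrite hz | exact: h1].
- move=> v /= /eqP en _ H; exists hom => a /(nthP datm)[i hi <-]; rewrite -/(natm q i).
  have [t [[h1 _] h2]] := H i ltac:(by rewrite en); exists t; split=> //.
  have [_ st] := Iwf h1; have [_ _ _ hs] := atm_wf (VQ_atm hi).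
  apply: (@eq_from_nth _ None); rewrite !size_map ?st ?hs // => j hj.
  rewrite (nth_map 0) ?hs // -h2 ?hs //; case: t st {h1 h2} hj => [<- //|x t] st hj.
  by rewrite (nth_map x) ?st // (onth_lt x) ?st.
Qed.

Lemma Goal_sound : dGoal edb -> cq_holds I q. Proof. exact: semBP. Qed.
End Second.
End Basics.
End Completeness3.

(** * The conjunctive query evaluated on the retrieved facts *)

Module Completeness4.
Import Defs DatalogSyntax DatalogProgram ExtensionalFacts ProgramFacts Canonical1 Canonical4 Completeness1 Completeness2 Completeness3.
Import all_boot zify.
Import boolp.
Section Basics.
Variables (S : schema) (q : bcq) (J : nat -> bool) (js : nat) (g : nat -> seq nat -> bool).
Hypothesis wfS : wf_schema S.
Hypothesis wfq : wf_query S q.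
Hypothesis adm : admissible S q J js.
Notation edb := (fun t a => is_true (sedb S q J g t a)).
Notation E := (dE edb). Notation C := (dC edb). Notation D := (dD edb). Notation Ob := (dOb edb).
Notation Eq := (dEq edb). Notation Lv := (dLv edb). Notation Ac := (dAc edb). Notation AT := (dAT edb).
Notation Rv := (dRv edb). Notation Rev := (dRev edb). Notation U := (dU edb). Notation E2 := (dE2 edb).
Notation P2 := (dP2 edb). Notation O2 := (dO2 edb).
Let atm_wf := @ProgramFacts.atm_wf S q J g wfq.
Let C_pos := @ProgramFacts.C_pos S q J js g wfS adm.
Let Lv_inv := @ProgramFacts.Lv_inv S q J g.
Let Lv_fun := @ProgramFacts.Lv_fun S q J g wfq.
Notation var := (@ProgramFacts.var q).
Let arg_inv := @ProgramFacts.arg_inv S q J g.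
Let Rv_inv := @ProgramFacts.Rv_inv S q J g.
Let U_facts := @ProgramFacts.U_facts S q J js g wfS adm.
Let Ob_inv := @ProgramFacts.Ob_inv S q J g.
Notation EqK := (@ProgramFacts.EqK S q J g).
Notation RvK := (@ProgramFacts.RvK S q J g).
Notation rel := (@ProgramFacts.rel q).
Notation rep := (@ProgramFacts.rep S q J g).
Notation repK := (@ProgramFacts.repK S q J g).
Notation nrm := (@ProgramFacts.nrm J js).
Notation DX := (@ProgramFacts.DX S q J js g).
Notation AccE := (@ProgramFacts.AccE S q J js g).
Notation phi := (@ProgramFacts.phi S q J js g).
Notation Ew := (@ProgramFacts.Ew S q J g).
Notation RevV := (@ProgramFacts.RevV S q J js g).
Notation legit_child := (@ProgramFacts.legit_child S q J js g).
Notation OccV := (@ProgramFacts.OccV S q J js g).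
Notation VL := (@ProgramFacts.VL S q J js g).
Notation kap := (@ProgramFacts.kap S q J g).
Notation el := (@ProgramFacts.el S q J g).
Notation slotA := (@ProgramFacts.slotA S q J js g).
Notation PosA := (@ProgramFacts.PosA S q J js g).
Notation new_child := (@ProgramFacts.new_child S q J g).
Notation Birth := (@ProgramFacts.Birth S q J js g).
Notation Occ := (@ProgramFacts.Occ S q J js g).
Notation Vw := (@ProgramFacts.Vw S q J js g).
Notation Iw := (@ProgramFacts.Iw S q J js g).
Let rep_eq := @ProgramFacts.rep_eq S q J g.
Let repP := @ProgramFacts.repP S q J g.
Let E_J := @Canonical4.E_J S q J js g wfS adm.
Notation Jt := (@Canonical4.Jt J).
Let Ob_J := @Canonical4.Ob_J S q J js g wfS adm.
Let Lv_J := @Canonical4.Lv_J S q J js g wfS adm.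
Let Rv_J := @Canonical4.Rv_J S q J js g adm.
Notation ctx := (@Completeness1.ctx S q).
Let onth_pos := @Completeness1.onth_pos S q.
Notation sem0 := (@Completeness1.sem0 S q).
Let E_sem := @Completeness1.E_sem S q J js g wfS wfq adm.
Let C_sem := @Completeness1.C_sem S q J js g wfS wfq adm.
Let U_sem := @Completeness1.U_sem S q J js g wfS wfq adm.
Notation relf := (@Completeness1.relf q).
Let Lv_rel := @Completeness1.Lv_rel S q J g wfq.
Let Ob_pos := @Completeness1.Ob_pos S q J js g wfS wfq adm.
Notation Val c x d := (@Completeness1.Val S q c x d).
Let onth_atom := @Completeness1.onth_atom S q.
Notation EqV := (@Completeness1.EqV S q).
Notation semq := (@Completeness1.semq S q).
Let Eq_sem := @Completeness1.Eq_sem S q J js g wfS wfq adm.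
Notation Real := (@Completeness2.Real S q).
Let Real_I := @Completeness2.Real_I S q.
Notation sem1 := (@Completeness2.sem1 S q J g).
Let sem1P := @Completeness2.sem1P S q J js g wfS wfq adm.
Notation AFact := (@Completeness3.AFact S q J g).
Notation semC := (@Completeness3.semC S).
Let pos_some := @Completeness3.pos_some S.
Notation semB := (@Completeness3.semB S q J g).
Let Goal_sound := @Completeness3.Goal_sound S q J js g wfS wfq adm.
Section Witness.
Variable B : nat.
Hypothesis hJB : forall i, J i -> i <= B.

Definition ri := iota 0 B.+1.
Definition box3 : seq tri := [seq (p, z) | p <- [seq (x, y) | x <- ri, y <- ri], z <- ri].
Definition rootL : seq (tri * nat) := [seq p <- [seq (f, m) | f <- box3, m <- ri] | `[< Rv p.1 p.2 >]].
(** The premises under which a revealed child places [x] in the second world; the query on the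
    retrieved facts has one atom for each such triple. *)
Definition chd_ok (x : tri) T l := exists f j R, [/\ Ac f j, Ob f j x, Lv f R, U R j T l & Rev T l].
Definition chdL : seq (tri * (nat * nat)) :=
  [seq p <- [seq (x, p) | x <- box3, p <- [seq (T, l) | T <- ri, l <- ri]] | `[< chd_ok p.1 p.2.1 p.2.2 >]].

Lemma mem_ri i : J i -> i \in ri.
Proof. by move=> /hJB; rewrite mem_iota add0n. Qed.

Lemma mem_box x : Jt x -> x \in box3.
Proof.
case: x => [[x y] z] /and3P[h1 h2 h3]; apply/allpairsP; exists ((x, y), z); split=> //; last exact: mem_ri h3.
by apply/allpairsP; exists (x, y); split=> //; exact: mem_ri.
Qed.

Lemma mem_rootL f m : Rv f m -> (f, m) \in rootL.
Proof.
move=> h; rewrite mem_filter; apply/andP; split; first exact/asboolP.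
by have [_ hl] := Rv_inv h; apply/allpairsP; exists (f, m); split=> //; [exact: mem_box (Lv_J hl) | exact: mem_ri (Rv_J h)].
Qed.

Lemma mem_chdL x T l : chd_ok x T l -> (x, (T, l)) \in chdL.
Proof.
move=> h; rewrite mem_filter; apply/andP; split; first exact/asboolP.
have [f [j [R [h1 h2 h3 h4 h5]]]] := h.
have [[_ _ [_ Jl]] [hE _ _]] := U_facts h4; have [hER _] := Lv_inv h3.
apply/allpairsP; exists (x, (T, l)); split=> //; first exact: mem_box (Ob_J h2).
by apply/allpairsP; exists (T, l); split=> //; apply: mem_ri => //; exact: E_J (hE hER).
Qed.

Definition cx (x : tri) := (pickle (rep x)).*2.
Definition cp (x : tri) (a j k : nat) := (pickle (x, a, j, k)).*2.+1.
Definition vroot f m j := if pselect (exists x, D m j /\ Ob f j x) is left h then cx (projT1 (cid h)) else cp f m j 0.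
Definition vchd x T l j := if j == l then cx x else cp x T j l.+1.
(* Even codes are classes of known values; odd codes are private to one position of one atom. *)
Definition W : bcq := [seq (relf p.1, mkseq (vroot p.1 p.2) (arity S (relf p.1))) | p <- rootL]
  ++ [seq (p.2.1, mkseq (vchd p.1 p.2.1 p.2.2) (arity S p.2.1)) | p <- chdL].

Lemma Ob_eq f j x : Ob f j x -> Eq x x. Proof. by move=> h; exact: (Eq_ob h h). Qed.

(** The choice of the object does not matter: two objects at one position of a fact type are equal,
    hence have the same representative. *)
Lemma vrootP f m j x : D m j -> Ob f j x -> vroot f m j = cx x.
Proof.
move=> h1 h2; rewrite /vroot; case: pselect => [h|[]]; last by exists x.
by have [_ h3] := projT2 (cid h); rewrite /cx (rep_eq (Eq_ob h3 h2)).
Qed.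

Lemma map_onth T (v : nat -> option T) f n t j : map v (mkseq f n) = map Some t -> j < n -> onth t j = v (f j).
Proof. by move=> h hj; rewrite onthE -h (nth_map 0) ?size_mkseq // nth_mkseq. Qed.

Lemma onth_map T (v : nat -> option T) f n t : size t = n -> (forall j, j < n -> v (f j) = onth t j) -> map v (mkseq f n) = map Some t.
Proof.
move=> st H; apply: (@eq_from_nth _ None); rewrite !size_map size_iota ?st // => j hj.
by rewrite (nth_map 0) ?size_mkseq // nth_mkseq // H // onthE.
Qed.

(** A match of [W] supplies the values of the objects and the revealed tuples from which the
    derivation of the goal builds a match of the query. *)
Lemma W_sound lf kf nf (D0 : Type) (I : instance D0) : (forall t a, g t a = guess lf kf nf t a) ->
  wf_instance S I -> sat_constraints S I -> cq_holds I W -> dGoal edb -> cq_holds I q.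
Proof.
move=> gG Iwf Isat [v hv].
pose rho f m := if pselect (exists t, I (relf f) t /\ map v (mkseq (vroot f m) (arity S (relf f))) = map Some t) is left h then projT1 (cid h) else [::].
apply: (@Goal_sound lf kf nf gG D0 I (fun x => v (cx x)) rho Iwf Isat) => [f m hr|f j x R T l h1 h2 h3 h4 h5|x y /rep_eq h]; last by rewrite /cx h.
- have he : exists t, I (relf f) t /\ map v (mkseq (vroot f m) (arity S (relf f))) = map Some t.
    by apply: (hv (relf f, _)); rewrite mem_cat; apply/orP; left; apply/mapP; exists (f, m) => //; exact: mem_rootL.
  rewrite /rho; case: pselect => // h; have [h1 h2] := projT2 (cid h); split=> // j x hD hO.
  by rewrite (map_onth h2) ?(vrootP hD hO) //; case/andP: (Ob_pos hO).
have [t [ht et]] : exists t, I T t /\ map v (mkseq (vchd x T l) (arity S T)) = map Some t.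
  apply: (hv (T, _)); rewrite mem_cat; apply/orP; right; apply/mapP; exists (x, (T, l)) => //.
  by apply: mem_chdL; exists f, j, R; split.
have [[_ hp _] _] := U_facts h4; have /andP[_ hl] := hp.
have [d hd] := pos_some Iwf hp ht; exists t, d; split=> //.
by rewrite -hd (map_onth et hl) /vchd eqxx.
Qed.

Definition rR (c : ctx) R : seq (cD c) := if pselect (exists t, cI (c := c) R t) is left h then projT1 (cid h) else [::].
(** Reference values: generic entries are read in one fact fixed for each relation. *)
Definition v1 (c : ctx) (x : tri) : option (cD c) := if x.1.1 == 0 then Some (ch c x.1.2) else onth (rR c x.1.2) x.2.

Lemma rRP (c : ctx) R : E R -> cI (c := c) R (rR c R).
Proof. by move=> /(E_sem c) h; rewrite /rR; case: pselect => // h'; exact: projT2 (cid h'). Qed.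

Lemma v1_Val (c : ctx) f j x : Ob f j x -> exists d, v1 c x = Some d /\ Val c x d.
Proof.
case/Ob_inv => [[-> h ->]|[R [_ hE h ->]]|[R [hl hC ->]]].
- by exists (ch c x.1.2); split=> //; exact: erefl.
- have hp : is_pos S R j by move: h => /= /andP[].
  have [d hd] := onth_pos hp (rRP c hE); exists d; split=> //; exists (rR c R); split=> //; exact: rRP.
- have [hE _] := Lv_inv hl; have [hp _ _] := C_pos hC.
  have [d hd] := onth_pos hp (rRP c hE); exists d; split=> //; exists (rR c R); split=> //; exact: rRP.
Qed.

Lemma Eq_Obs x y : Eq x y -> (exists f j, Ob f j x) /\ exists f j, Ob f j y.
Proof.
move: x y; suff H : forall t a, dl prog edb t a -> (match t, a with pEq, [:: x1; x2; x3; y1; y2; y3] =>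
  (exists f j, Ob f j (x1, x2, x3)) /\ exists f j, Ob f j (y1, y2, y3) | _, _ => True end).
  by move=> [[x1 x2] x3] [[y1 y2] y3] /H.
dl_induct2.
- by move=> v _ [h1 h2] _; split; exists (v 0, v 1, v 2), (v 3); [exact: h1 | exact: h2].
- by move=> v _ _ [[h1 _] [_ h2]].
- by move=> v [_ [h1 h2]] _ _; split; eexists _, _; [exact: Ob_arg h1 | exact: Ob_arg h2].
- move=> v h [h1 h2] _; split; eexists _, _; [exact: Ob_const (Lv_gen h2) (C_uid h h1) | exact: Ob_const (Lv_gen (E_uid h h2)) h1].
Qed.

Lemma v1_Eq (c : ctx) x y : Eq x y -> v1 c x = v1 c y.
Proof.
move=> h; have [[f [j hx]] [f' [j' hy]]] := Eq_Obs h.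
have [d [e1 d1]] := v1_Val c hx; have [d' [e2 d2]] := v1_Val c hy.
by have [_ _ /(_ c)[_ [->//|H]]] := Eq_sem h; rewrite e1 e2 (H _ _ d1 d2).
Qed.

(** The realisation is the image of the atom, the fixed fact of the relation, or, for a type
    [(2,T,l)], any realisation, as constants are its only objects. *)
Lemma canon f R : Lv f R -> exists N, forall c : ctx, N <= cK c -> exists t, Real (c := c) N f t /\
  forall j x, Ob f j x -> onth t j = v1 c x.
Proof.
move=> hl; have cst (c : ctx) N t j : Real (c := c) N f t -> C R j -> onth t j = v1 c (1, R, j).
  move=> /Real_I ht hC; rewrite (Lv_rel hl) in ht; have [hE _] := Lv_inv hl.
  exact: C_sem hC ht (rRP c hE).
have [hE [[h ef]|ef|ef]] := Lv_inv hl.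
- exists 0 => c _; exists (map (ch c) (natm q f.1.2).2); have [ha _ _ _] := atm_wf h.
  have hr : Real (c := c) 0 f (map (ch c) (natm q f.1.2).2) by rewrite ef.
  split=> // j x /Ob_inv [[_ h2 ->]|[R' [ef' _ _ _]]|[R' [hl' hC ->]]].
  + by have [h3 h4 h5] := arg_inv h2; rewrite onth_atom // -h5.
  + by rewrite ef in ef'.
  + by rewrite (Lv_fun hl' hl) in hC *; exact: cst hr hC.
- exists 0 => c _; exists (rR c R); have hr : Real (c := c) 0 f (rR c R) by rewrite ef; split; [exact: rRP | left].
  split=> // j x /Ob_inv [[ef' _ _]|[R' [ef' _ _ ->]]|[R' [hl' hC ->]]].
  + by rewrite ef in ef'.
  + by rewrite ef in ef'; case: ef' => ->.
  + by rewrite (Lv_fun hl' hl) in hC *; exact: cst hr hC.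
have [N H] : exists N, forall c : ctx, N <= cK c -> exists t, Real (c := c) N f t.
  by move: hl; case: (f) => [[f1 f2] f3] /sem1P.
exists N => c /H[t ht]; exists t; split=> // j x /Ob_inv [[ef' _ _]|[R' [ef' _ _ _]]|[R' [hl' hC ->]]].
- by rewrite ef in ef'.
- by rewrite ef in ef'.
- by rewrite (Lv_fun hl' hl) in hC *; exact: cst ht hC.
Qed.

Definition rootok N f m (c : ctx) t := cAF (c := c) N (relf f) t /\ forall j x, D m j -> Ob f j x -> onth t j = v1 c x.
Definition chdok N x T l (c : ctx) t := cAF (c := c) N T t /\ onth t l = v1 c x.

Lemma root_avail f m : Rv f m -> exists N, forall c : ctx, N <= cK c -> exists t, rootok N f m (c := c) t.
Proof.
move=> hr; have [hm hl] := Rv_inv hr; have [N1 H1] := canon hl.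
have [N2 H2] : exists N, forall (c : ctx) s t, s + N <= cK c -> Real (c := c) s f t ->
      exists t', cAF (s + N) (m_rel (nmeth S m)) t' /\ forall j, D m j -> onth t' j = onth t j.
  by move: hr; case: (f) => [[f1 f2] f3] /sem1P.
exists (N1 + N2) => c hN; have [t [h1 h2]] := H1 c (leq_trans (leq_addr _ _) hN).
have [t' [h3 h4]] := H2 c _ _ hN h1; exists t'; split; first by rewrite (Lv_rel hl).
by move=> j x hD hO; rewrite h4 // (h2 j x).
Qed.

Lemma chd_avail x T l : chd_ok x T l -> exists N, forall c : ctx, N <= cK c -> exists t, chdok N x T l (c := c) t.
Proof.
move=> [f [j [R [ha ho hl hu hr]]]]; have [N1 H1] := canon hl.
have [N2 H2] : exists N, forall (c : ctx) s t d, s + N <= cK c -> Real (c := c) s f t -> onth t j = Some d -> cAc (s + N) d.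
  by move: ha {ho hl H1}; case: (f) => [[f1 f2] f3] /sem1P.
have [N3 H3] := sem1P hr; exists (N1 + N2 + N3) => c hN.
have [|t [h1 h2]] := H1 c _; first by lia.
have [d [hd _]] := v1_Val c ho; have hj := h2 _ _ ho; rewrite hd in hj.
have hA := H2 c N1 t d ltac:(lia) h1 hj; have ht := Real_I h1; rewrite (Lv_rel hl) in ht.
have [t1 [h3 h4]] := U_sem hu ht hj; have [t2 [h5 h6]] := H3 c _ _ _ hN h3 h4 hA.
by exists t2; split=> //; rewrite hd.
Qed.

Lemma fin_max (T : eqType) (l : seq T) (P : T -> nat -> Prop) : (forall x n m, n <= m -> P x n -> P x m) ->
  (forall x, x \in l -> exists N, P x N) -> exists N, forall x, x \in l -> P x N.
Proof.
move=> mono; elim: l => [|x l IH] H; first by exists 0.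
have [|N1 H1] := IH; first by move=> y hy; apply: H; rewrite inE hy orbT.
have [N2 H2] := H x (mem_head _ _); exists (N1 + N2) => y; rewrite inE => /orP[/eqP->|/H1].
  exact: mono (leq_addl _ _) H2.
exact: mono (leq_addr _ _).
Qed.

Lemma W_complete : exists N, forall c : ctx, N <= cK c -> cq_holds (cAF (c := c) N) W.
Proof.
have [|p hp|N1 H1] := @fin_max _ rootL (fun p N => forall c : ctx, N <= cK c -> exists t, rootok N p.1 p.2 (c := c) t).
- move=> p n m hnm H c hm; have [t [h1 h2]] := H c (leq_trans hnm hm); exists t; split=> //; exact: c_monoF hnm h1.
- by apply: root_avail; move: hp; rewrite mem_filter => /andP[/asboolP].
have [|p hp|N2 H2] := @fin_max _ chdL (fun p N => forall c : ctx, N <= cK c -> exists t, chdok N p.1 p.2.1 p.2.2 (c := c) t).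
- move=> p n m hnm H c hm; have [t [h1 h2]] := H c (leq_trans hnm hm); exists t; split=> //; exact: c_monoF hnm h1.
- by apply: chd_avail; move: hp; rewrite mem_filter => /andP[/asboolP].
exists (N1 + N2) => c hN.
pose F1 f m := if pselect (exists t, rootok (N1 + N2) f m (c := c) t) is left h then projT1 (cid h) else [::].
pose F2 x T l := if pselect (exists t, chdok (N1 + N2) x T l (c := c) t) is left h then projT1 (cid h) else [::].
(* Shared variables take the reference value of their object, private ones the entry of the tuple
   chosen for their atom. *)
pose vv code := if odd code then
    if @unpickle (tri * nat * nat * nat)%type code./2 is Some p then
      if p.2 == 0 then onth (F1 p.1.1.1 p.1.1.2) p.1.2 else onth (F2 p.1.1.1 p.1.1.2 p.2.-1) p.1.2
    else None
  else if @unpickle tri code./2 is Some x then v1 c x else None.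
have vcx f j x : Ob f j x -> vv (cx x) = v1 c x.
  move=> ho; rewrite /vv /cx odd_double doubleK pickleK; symmetry; apply: v1_Eq; apply: repP; exact: Ob_eq ho.
have vcp x a j k : vv (cp x a j k) = if k == 0 then onth (F1 x a) j else onth (F2 x a k.-1) j.
  rewrite /vv /cp; have := @pickleK (tri * nat * nat * nat)%type (x, a, j, k); move: (pickle _) => n hn.
  by rewrite oddS odd_double -[n.*2.+1./2]/(uphalf n.*2) uphalf_double hn.
exists vv => a; rewrite mem_cat => /orP[/mapP[[f m] hp ->]|/mapP[[x [T l]] hp ->]] /=.
- have hF : rootok (N1 + N2) f m (c := c) (F1 f m).
    rewrite /F1; case: pselect => [h|[]]; first exact: projT2 (cid h).
    have [t [h1 h2]] := H1 _ hp c (leq_trans (leq_addr _ _) hN); exists t; split=> //; exact: c_monoF (leq_addr _ _) h1.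
  exists (F1 f m); split; first by case: hF.
  have [_ st] := c_wf (c_AFI hF.1); apply: onth_map => // j hj; rewrite {1}/vroot.
  case: pselect => [h|_]; last by rewrite vcp.
  by have [h1 h2] := projT2 (cid h); rewrite (vcx _ _ _ h2) (hF.2 _ _ h1 h2).
have hF : chdok (N1 + N2) x T l (c := c) (F2 x T l).
  rewrite /F2; case: pselect => [h|[]]; first exact: projT2 (cid h).
  have [t [h1 h2]] := H2 _ hp c (leq_trans (leq_addl _ _) hN); exists t; split=> //; exact: c_monoF (leq_addl _ _) h1.
exists (F2 x T l); split; first by case: hF.
have [_ st] := c_wf (c_AFI hF.1); apply: onth_map => // j hj; rewrite {1}/vchd.
case: eqP => [->|_]; last by rewrite vcp.
have : chd_ok x T l by move: hp; rewrite mem_filter => /andP[/asboolP].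
by move=> [f [k [R [_ ho _ _ _]]]]; rewrite (vcx _ _ _ ho) hF.2.
Qed.
End Witness.
End Basics.
End Completeness4.

(** * The plan: rounds of accesses followed by one conjunctive query *)

Module Completeness5.
Import Defs DatalogSyntax DatalogProgram ExtensionalFacts ProgramFacts Canonical1 Canonical2 Canonical3 Canonical4 Completeness1 Completeness2 Completeness3 Completeness4.
Import all_boot zify.
Import boolp.
Section Basics.
Variables (S : schema) (q : bcq) (J : nat -> bool) (js : nat) (g : nat -> seq nat -> bool).
Hypothesis wfS : wf_schema S.
Hypothesis wfq : wf_query S q.
Hypothesis adm : admissible S q J js.
Notation edb := (fun t a => is_true (sedb S q J g t a)).
Notation E := (dE edb). Notation C := (dC edb). Notation D := (dD edb). Notation Ob := (dOb edb).
Notation Eq := (dEq edb). Notation Lv := (dLv edb). Notation Ac := (dAc edb). Notation AT := (dAT edb).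
Notation Rv := (dRv edb). Notation Rev := (dRev edb). Notation U := (dU edb). Notation E2 := (dE2 edb).
Notation P2 := (dP2 edb). Notation O2 := (dO2 edb).
Notation var := (@ProgramFacts.var q).
Notation EqK := (@ProgramFacts.EqK S q J g).
Notation RvK := (@ProgramFacts.RvK S q J g).
Notation rel := (@ProgramFacts.rel q).
Notation rep := (@ProgramFacts.rep S q J g).
Notation repK := (@ProgramFacts.repK S q J g).
Notation nrm := (@ProgramFacts.nrm J js).
Notation DX := (@ProgramFacts.DX S q J js g).
Notation AccE := (@ProgramFacts.AccE S q J js g).
Notation phi := (@ProgramFacts.phi S q J js g).
Notation Ew := (@ProgramFacts.Ew S q J g).
Notation RevV := (@ProgramFacts.RevV S q J js g).
Notation legit_child := (@ProgramFacts.legit_child S q J js g).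
Notation OccV := (@ProgramFacts.OccV S q J js g).
Notation VL := (@ProgramFacts.VL S q J js g).
Notation kap := (@ProgramFacts.kap S q J g).
Notation el := (@ProgramFacts.el S q J g).
Notation slotA := (@ProgramFacts.slotA S q J js g).
Notation PosA := (@ProgramFacts.PosA S q J js g).
Notation new_child := (@ProgramFacts.new_child S q J g).
Notation Birth := (@ProgramFacts.Birth S q J js g).
Notation Occ := (@ProgramFacts.Occ S q J js g).
Notation Vw := (@ProgramFacts.Vw S q J js g).
Notation Iw := (@ProgramFacts.Iw S q J js g).
Let onth_lt := @Canonical1.onth_lt.
Let Iw_wf := @Canonical1.Iw_wf S q J js g.
Let Iw_uid := @Canonical1.Iw_uid S q J js g wfS wfq adm.
Notation home := (@Canonical2.home S q J g).
Notation fact := (@Canonical2.fact S q J js g).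
Let Iw_fd := @Canonical2.Iw_fd S q J js g wfS wfq adm.
Notation Afact := (@Canonical3.Afact S q J js g).
Let output_exists := @Canonical3.output_exists.
Let lockstep := @Canonical3.lockstep S.
Let query_holds_false := @Canonical3.query_holds_false S q J js g wfq.
Notation Jt := (@Canonical4.Jt J).
Notation ctx := (@Completeness1.ctx S q).
Notation sem0 := (@Completeness1.sem0 S q).
Notation relf := (@Completeness1.relf q).
Notation Val c x d := (@Completeness1.Val S q c x d).
Notation EqV := (@Completeness1.EqV S q).
Notation semq := (@Completeness1.semq S q).
Notation Real := (@Completeness2.Real S q).
Notation sem1 := (@Completeness2.sem1 S q J g).
Notation AFact := (@Completeness3.AFact S q J g).
Notation semC := (@Completeness3.semC S).
Notation semB := (@Completeness3.semB S q J g).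
Notation rootL := (@Completeness4.rootL S q J g).
Notation chd_ok := (@Completeness4.chd_ok S q J g).
Notation chdL := (@Completeness4.chdL S q J g).
Notation cx := (@Completeness4.cx S q J g).
Notation vroot := (@Completeness4.vroot S q J g).
Notation vchd := (@Completeness4.vchd S q J g).
Notation W := (@Completeness4.W S q J g).
Let W_sound := @Completeness4.W_sound S q J js g wfS wfq adm.
Notation rR := (@Completeness4.rR S q).
Notation v1 := (@Completeness4.v1 S q).
Notation rootok := (@Completeness4.rootok S q J g).
Notation chdok := (@Completeness4.chdok S q).
Let W_complete := @Completeness4.W_complete S q J js g wfS wfq adm.
Section ThePlan.
(** For each table written so far its arity and the relation whose facts it holds; [None] marks a
    placeholder. *)
Definition tstate := seq (nat * option nat).
Definition st0 : nat * option nat := (0, None).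

Definition cols (st : tstate) : seq rexpr :=
  [seq EProj [:: p.2] (ETab p.1) | p <- flatten [seq [seq (i, c) | c <- iota 0 (nth st0 st i).1] | i <- iota 0 (size st)]].
Definition unions (l : seq rexpr) : option rexpr := if l is e :: l' then Some (foldr EUnion e l') else None.
Definition bind k e := iter k (EProd e) EUnit.
(** As long as no table has a column, a method with inputs has nothing to bind. A placeholder then
    takes its turn, so that the index of a table can be computed from round and method. *)
Definition cmdm (st : tstate) mi : command * (nat * option nat) :=
  let m := nmeth S mi in let tg := (arity S (m_rel m), Some (m_rel m)) in
  if m_in m is [::] then (CAcc mi EUnit, tg)
  else if unions (cols st) is Some u then (CAcc mi (bind (size (m_in m)) u), tg) else (CMid EUnit, st0).
Fixpoint gen (ms : seq nat) (st : tstate) : seq command * tstate :=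
  if ms is mi :: ms' then let c := cmdm st mi in let r := gen ms' (rcons st c.2) in (c.1 :: r.1, r.2) else ([::], st).

Definition relE (st : tstate) R : option rexpr := unions [seq ETab i | i <- iota 0 (size st) & (nth st0 st i).2 == Some R].
Fixpoint prodE (st : tstate) (w : bcq) : option rexpr :=
  if w is a :: w' then
    if relE st a.1 is Some e1 then if prodE st w' is Some e2 then Some (EProd e1 e2) else None else None
  else Some EUnit.
Definition pairs (w : bcq) := let vs := flatten [seq a.2 | a <- w] in
  [seq p <- [seq (i, j) | i <- iota 0 (size vs), j <- iota 0 (size vs)] | nth 0 vs p.1 == nth 0 vs p.2].
(** A conjunctive query as the product of its atoms, with equality selections between all columns of
    the same variable, projected to arity zero. *)
Definition cqE (w : bcq) e := EProj [::] (foldr (fun p e => ESel p.1 p.2 e) e (pairs w)).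

Lemma unions_ar env l e n : all (fun e => rexpr_arity env e == Some n) l -> unions l = Some e -> rexpr_arity env e = Some n.
Proof.
case: l => // e0 l /= /andP[/eqP h0 hl] [<-]; elim: l hl => //= e1 l IH /andP[/eqP -> /IH ->]; by rewrite eqxx.
Qed.

Lemma bind_ar env k e : rexpr_arity env e = Some 1 -> rexpr_arity env (bind k e) = Some k.
Proof. by move=> h; elim: k => //= k IH; rewrite h IH. Qed.

Lemma onth_fst (st : tstate) i : i < size st -> onth [seq x.1 | x <- st] i = Some (nth st0 st i).1.
Proof. by move=> h; rewrite (onth_lt 0) ?size_map // (nth_map st0). Qed.

Lemma all_cols (st : tstate) : all (fun e => rexpr_arity [seq x.1 | x <- st] e == Some 1) (cols st).
Proof.
rewrite all_map; apply/allP => p /flattenP[l /mapP[i]]; rewrite mem_iota => /andP[_ hi] -> /mapP[c].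
by rewrite mem_iota => /andP[_ hc] -> /=; rewrite onth_fst // hc.
Qed.

Lemma gen_wt ms st : all (fun mi => mi < size (s_meth S)) ms ->
  wt_cmds S [seq x.1 | x <- st] (gen ms st).1 = Some [seq x.1 | x <- (gen ms st).2].
Proof.
elim: ms st => // mi ms IH st /= /andP[hm hms]; have := IH (rcons st (cmdm st mi).2) hms; rewrite map_rcons.
have om : onth (s_meth S) mi = Some (nmeth S mi) by rewrite (onth_lt dmeth).
rewrite /cmdm; case em : (m_in (nmeth S mi)) => [|x l]; first by move=> h; rewrite /= om em /=.
case eu : (unions _) => [u|] h; last by rewrite /=.
have := bind_ar (size (x :: l)) (unions_ar (all_cols st) eu); move: (bind _ u) h => bb h hb.
by rewrite /= om hb em eqxx.
Qed.

Lemma relE_ar st R e : relE st R = Some e -> (forall i, (nth st0 st i).2 = Some R -> (nth st0 st i).1 = arity S R) ->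
  rexpr_arity [seq x.1 | x <- st] e = Some (arity S R).
Proof.
move=> h H; apply: unions_ar h; rewrite all_map; apply/allP => i; rewrite mem_filter mem_iota => /andP[/eqP h2 /andP[_ hi]] /=.
by rewrite onth_fst // H.
Qed.

Definition tags_ok (st : tstate) := forall i R, (nth st0 st i).2 = Some R -> (nth st0 st i).1 = arity S R.

Lemma gen_tags ms st : tags_ok st -> tags_ok (gen ms st).2.
Proof.
elim: ms st => //= mi ms IH st h; apply: IH => i R; rewrite nth_rcons; case: ltnP => _; first exact: h.
case: eqP => // _; rewrite /cmdm; case: (m_in _) => [|x l] /=; first by case=> ->.
by case: (unions _) => [u|] //= -[->].
Qed.

Lemma prodE_ar st w e : tags_ok st -> (forall a, a \in w -> size a.2 = arity S a.1) -> prodE st w = Some e ->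
  rexpr_arity [seq x.1 | x <- st] e = Some (size (flatten [seq a.2 | a <- w])).
Proof.
move=> ht; elim: w e => [|a w IH] e /= hw; first by case=> <-.
case e1 : (relE st a.1) => [x|] //; case e2 : (prodE st w) => [y|] // -[<-] /=.
rewrite (relE_ar e1); last by move=> i; exact: ht.
rewrite (IH y) // ?size_cat ?(hw a) ?mem_head // => b hb; apply: hw; by rewrite inE hb orbT.
Qed.

Lemma cqE_ar env w e : rexpr_arity env e = Some (size (flatten [seq a.2 | a <- w])) -> rexpr_arity env (cqE w e) = Some 0.
Proof.
move=> h; rewrite /cqE /=; set n := size _ in h.
have hp : all (fun p => (p.1 < n) && (p.2 < n)) (pairs w).
  by apply/allP => p; rewrite mem_filter => /andP[_ /allpairsP[[i j] [hi hj ->]]]; move: hi hj; rewrite !mem_iota !add0n -/n /= => -> ->.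
suff -> : rexpr_arity env (foldr (fun p e => ESel p.1 p.2 e) e (pairs w)) = Some n by [].
by elim: (pairs w) hp => //= p l IH /andP[h1 /IH ->]; rewrite h1.
Qed.

Lemma exec_acc_inv (D0 : Type) (I : instance D0) mi e cs env envf : exec S I (CAcc mi e :: cs) env envf ->
  exists m (Jo : seq D0 -> table D0), [/\ onth (s_meth S) mi = Some m, forall b, rexpr_eval env e b -> valid_output I m b (Jo b)
    & exec S I cs (rcons env (fun t => exists b, rexpr_eval env e b /\ Jo b t)) envf].
Proof. by move=> h; inversion h; subst; eexists _, _; split; eassumption. Qed.

Lemma exec_mid_inv (D0 : Type) (I : instance D0) e cs env envf : exec S I (CMid e :: cs) env envf ->
  exec S I cs (rcons env (rexpr_eval env e)) envf.
Proof. by move=> h; inversion h; subst. Qed.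

Lemma exec_nil_inv (D0 : Type) (I : instance D0) env envf : exec S I [::] env envf -> envf = env.
Proof. by move=> h; inversion h; subst. Qed.

Section Eval.
Variables (D0 : Type) (I : instance D0).
Hypothesis Iwf : wf_instance S I.
Hypothesis Isat : sat_constraints S I.
Notation tb env i := (nth (fun _ : seq D0 => False) env i).

Definition AFt (st : tstate) (env : seq (table D0)) n R t := exists i, [/\ i < n, (nth st0 st i).2 = Some R & tb env i t].
Definition Av (env : seq (table D0)) n d := exists i t c, [/\ i < n, tb env i t & onth t c = Some d].
Definition inv (st : tstate) (env : seq (table D0)) := size env = size st /\ forall i t, tb env i t ->
  if (nth st0 st i).2 is Some R then I R t else t = [::].

Lemma unions_eval (env : seq (table D0)) l e t : unions l = Some e -> rexpr_eval env e t <-> exists2 e', List.In e' l & rexpr_eval env e' t.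
Proof.
case: l => // e0 l /= [<-]; elim: l => [|e1 l IH] /=.
  by split=> [h|[e' [<-|]] //]; exists e0 => //; left.
rewrite IH; split=> [[h|[e' [<-|h1] h2]]|[e' [<-|[<-|h1]] h2]].
- by exists e1 => //; right; left.
- by exists e0 => //; left.
- by exists e' => //; right; right.
- by right; exists e0 => //; left.
- by left.
- by right; exists e' => //; right.
Qed.

Lemma tb_size (env : seq (table D0)) i t : tb env i t -> i < size env.
Proof. by case: (ltnP i (size env)) => // h; rewrite nth_default. Qed.

Lemma In_mem (T : eqType) (x : T) l : List.In x l <-> x \in l.
Proof. by elim: l => //= y l IH; rewrite inE; split=> [[->|/IH->]|/orP[/eqP->|/IH]]; rewrite ?eqxx ?orbT //; [left | right]. Qed.

Lemma Av_cols st env d : tags_ok st -> inv st env -> Av env (size env) d ->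
  exists i c t, [/\ List.In (EProj [:: c] (ETab i)) (cols st), tb env i t & onth t c = Some d].
Proof.
move=> htg [es H] [i [t [c [hi ht hc]]]]; exists i, c, t; split=> //.
apply: (List.in_map (fun p : nat * nat => EProj [:: p.2] (ETab p.1)) _ (i, c)); apply/In_mem; apply/flattenP.
exists [seq (i, c) | c <- iota 0 (nth st0 st i).1]; first by apply: map_f; rewrite mem_iota add0n -es.
apply: map_f; rewrite mem_iota add0n /=; have := H i t ht; have := htg i.
case: (nth st0 st i) => [n [R|]] /= h1 h2; last by move: hc; rewrite h2; case: (c).
rewrite (h1 R erefl); have [_ <-] := Iwf h2; rewrite ltnNge; apply: contraPN hc => h; by rewrite onth_default.
Qed.

Lemma cols_eval st env u d : tags_ok st -> inv st env -> unions (cols st) = Some u ->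
  rexpr_eval env u [:: d] <-> Av env (size env) d.
Proof.
move=> htg hi hu; rewrite (unions_eval _ _ hu); split=> [[e' /List.in_map_iff[[i c] [<- _]]]|] /=.
  by move=> [t [h1 [h2]]]; exists i, t, c; split=> //; exact: tb_size h1.
by move=> /(Av_cols htg hi)[i [c [t [h1 h2 h3]]]]; exists (EProj [:: c] (ETab i)) => //=; exists t; rewrite h3.
Qed.

Lemma bind_eval (env : seq (table D0)) u k b : size b = k -> (forall d, List.In d b -> rexpr_eval env u [:: d]) -> rexpr_eval env (bind k u) b.
Proof.
elim: k b => [|k IH] [|x b] //= [hs] H; exists [:: x], b; split=> //; split; first by apply: H; left.
by apply: IH => // d hd; apply: H; right.
Qed.

Definition step mi (st : tstate) (env : seq (table D0)) p := let m := nmeth S mi in forall t, I (m_rel m) t ->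
  (forall x, x \in m_in m -> exists d, onth t x = Some d /\ Av env p d) ->
  (nth st0 st p).2 = Some (m_rel m) /\ exists t', [/\ tb env p t', forall x, x \in m_in m -> onth t' x = onth t x & m_bound m = None -> t' = t].

Lemma Av_take (env : seq (table D0)) n m d : n <= m -> Av (take m env) n d <-> Av env n d.
Proof.
move=> h; split=> -[i [t [c [h1 h2 h3]]]]; exists i, t, c; split=> //.
  by move: h2; rewrite nth_take // (leq_trans h1).
by rewrite nth_take // (leq_trans h1).
Qed.

Lemma out_step mi e (Jo : seq D0 -> table D0) st env : mi < size (s_meth S) -> tags_ok st -> inv st env -> cmdm st mi = (CAcc mi e, (arity S (m_rel (nmeth S mi)), Some (m_rel (nmeth S mi)))) ->
  (forall b, rexpr_eval env e b -> valid_output I (nmeth S mi) b (Jo b)) ->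
  forall t, I (m_rel (nmeth S mi)) t -> (forall x, x \in m_in (nmeth S mi) -> exists d, onth t x = Some d /\ Av env (size env) d) ->
  exists t', [/\ exists b, rexpr_eval env e b /\ Jo b t', forall x, x \in m_in (nmeth S mi) -> onth t' x = onth t x & m_bound (nmeth S mi) = None -> t' = t].
Proof.
move=> hmi htg hinv hc hJ t ht hx; set m := nmeth S mi in hc hJ ht hx *.
have [b [hb hsz hbt]] : exists b, [/\ rexpr_eval env e b, size b = size (m_in m) & forall k, k < size (m_in m) -> onth t (nth 0 (m_in m) k) = onth b k].
  move: hc hx; rewrite /cmdm -/m; case em : (m_in m) => [|x l].
    by case=> <- _; exists [::].
  rewrite -em => + hx; case eu : (unions _) => [u|] // -[<-].
  have [s hs] : exists s, map (onth t) (m_in m) = map Some s /\ forall d, List.In d s -> Av env (size env) d.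
    elim: (m_in m) hx {em eu} => [|y l' IH] hx; first by exists [::].
    have [|s [h1 h2]] := IH; first by move=> z hz; apply: hx; rewrite inE hz orbT.
    have [d [h3 h4]] := hx y (mem_head _ _); exists (d :: s); split; first by rewrite /= h3 h1.
    by move=> d' /= [<-|/h2].
  have [h1 h2] := hs; have ss : size s = size (m_in m) by rewrite -(size_map Some) -h1 size_map.
  exists s; split=> //; first by apply: bind_eval => // d /h2 hd; apply/(cols_eval _ htg hinv eu).
  by move=> k hk; rewrite [RHS]onthE -h1 (nth_map 0).
have [h1 h2] := hJ b hb; have tM : matching I m b t by [].
have [_ [_ W]] := wfS; have := allIn W (In_nth dmeth hmi); rewrite -/(nmeth S mi) -/m => /and4P[_ _ _ hk].
move: h2 hk; case e1 : (m_bound m) => [k|] => h2 hk; last by exists t; split=> //; exists b; split=> //; exact: h2.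
(* A result bound is positive, so one matching tuple guarantees one tuple in the output, with the
   same inputs. *)
have [_ /(_ 1 hk)] := h2; case.
  exists [:: t]; split; last by split=> // x [<-|].
  by constructor => //; constructor.
move=> l [_ [sl hh]]; case: l sl hh => [|t' [|? ?]] // _ hh; have ht' := hh t' (or_introl erefl); have [_ [_ h3]] := h1 _ ht'.
exists t'; split=> //; first by exists b.
by move=> x /(nthP 0)[i hi <-]; rewrite h3 // -hbt.
Qed.

Lemma gen_exec ms st env envf : all (fun mi => mi < size (s_meth S)) ms -> tags_ok st -> inv st env -> exec S I (gen ms st).1 env envf ->
  [/\ size envf = size env + size ms, take (size env) envf = env, take (size env) (gen ms st).2 = st, inv (gen ms st).2 envf
    & forall p, p < size ms -> step (nth 0 ms p) (gen ms st).2 envf (size env + p)].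
Proof.
elim: ms st env => [|mi ms IH] st env.
  move=> _ htg hinv /= hex; inversion hex; subst; case: (hinv) => es _; split=> //; rewrite ?addn0 ?take_size //.
  by rewrite es take_size.
move=> /andP[hmi hms] htg hinv /= hex; have es : size env = size st by case: hinv.
have htg' : tags_ok (rcons st (cmdm st mi).2) by exact: (@gen_tags [:: mi] st htg).
suff [T [hT hi' hst]] : exists T, [/\ exec S I (gen ms (rcons st (cmdm st mi).2)).1 (rcons env T) envf,
   inv (rcons st (cmdm st mi).2) (rcons env T) &
   forall t, I (m_rel (nmeth S mi)) t -> (forall x, x \in m_in (nmeth S mi) -> exists d, onth t x = Some d /\ Av env (size env) d) ->
     (cmdm st mi).2.2 = Some (m_rel (nmeth S mi)) /\
     exists t', [/\ T t', forall x, x \in m_in (nmeth S mi) -> onth t' x = onth t x & m_bound (nmeth S mi) = None -> t' = t]].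
  have [h1 h2 h3 h4 h5] := IH _ _ hms htg' hi' hT; rewrite size_rcons in h1 h2 h3 h5.
  have e2 : take (size env) envf = env.
    by rewrite -(take_takel envf (leqnSn (size env))) h2 -cats1 take_size_cat.
  have n2 i : i < (size env).+1 -> tb envf i = tb (rcons env T) i by move=> hi; rewrite -h2 nth_take.
  have e3 : nth st0 (gen ms (rcons st (cmdm st mi).2)).2 (size env) = (cmdm st mi).2.
    by rewrite -(nth_take st0 (ltnSn (size env))) h3 nth_rcons es ltnn eqxx.
  split=> //.
  - by rewrite h1 addSnnS.
  - by rewrite -(take_takel _ (leqnSn (size env))) h3 es -cats1 take_size_cat.
  case=> [|p] hp; last by rewrite -addSnnS; exact: h5.
  rewrite addn0 /step /= => t ht hx; have [|h6 [t' [h7 h8 h9]]] := hst t ht.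
    by move=> x /hx[d [k1 k2]]; exists d; split=> //; rewrite -{1}e2; apply/Av_take.
  rewrite e3; split=> //; exists t'; split=> //; by rewrite n2 // nth_rcons ltnn eqxx.
have rc (T : table D0) (tg : nat * option nat) : (forall t, T t -> if tg.2 is Some R then I R t else t = [::]) -> inv (rcons st tg) (rcons env T).
  move=> H; split; first by rewrite !size_rcons es.
  move=> i t; rewrite !nth_rcons es; case: ltnP => _; first by case: hinv => _; apply.
  by case: eqP => // _; exact: H.
have om : onth (s_meth S) mi = Some (nmeth S mi) by rewrite (onth_lt dmeth).
have acc e : cmdm st mi = (CAcc mi e, (arity S (m_rel (nmeth S mi)), Some (m_rel (nmeth S mi)))) ->
   exec S I (CAcc mi e :: (gen ms (rcons st (cmdm st mi).2)).1) env envf -> exists T, [/\ exec S I (gen ms (rcons st (cmdm st mi).2)).1 (rcons env T) envf,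
   inv (rcons st (cmdm st mi).2) (rcons env T) &
   forall t, I (m_rel (nmeth S mi)) t -> (forall x, x \in m_in (nmeth S mi) -> exists d, onth t x = Some d /\ Av env (size env) d) ->
     (cmdm st mi).2.2 = Some (m_rel (nmeth S mi)) /\
     exists t', [/\ T t', forall x, x \in m_in (nmeth S mi) -> onth t' x = onth t x & m_bound (nmeth S mi) = None -> t' = t]].
  move=> hc /exec_acc_inv[m [Jo [hm hJ hex1]]].
  rewrite om in hm; case: hm => hm; subst m; eexists; split; first exact: hex1.
    by apply: rc => t [b [h1 h2]]; rewrite hc /=; have [h3 _] := hJ b h1; have [] := h3 _ h2.
  by move=> t ht hx; split; [rewrite hc | exact: (out_step hmi htg hinv hc hJ ht hx)].
have : (exists e, cmdm st mi = (CAcc mi e, (arity S (m_rel (nmeth S mi)), Some (m_rel (nmeth S mi))))) \/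
    cmdm st mi = (CMid EUnit, st0) /\ exists x, x \in m_in (nmeth S mi) /\ unions (cols st) = None.
  rewrite /cmdm; case em : (m_in (nmeth S mi)) => [|x l]; first by left; eexists.
  case eu : (unions (cols st)) => [u|]; first by left; eexists.
  by right; split=> //; exists x; rewrite mem_head.
case=> [[e hc]|[hc [x [hx eu]]]].
  have h1 : (cmdm st mi).1 = CAcc mi e by rewrite hc.
  by rewrite h1 in hex; exact: (acc e hc hex).
have h1 : (cmdm st mi).1 = CMid EUnit by rewrite hc.
rewrite h1 in hex; eexists; split; first exact: (exec_mid_inv hex).
  by apply: rc => t ->; rewrite hc.
(* A placeholder is written only when no column exists, and then no value is known for the input
   [x]. *)
move=> t ht /(_ x hx)[d [_ /(Av_cols htg hinv)[i [c' [t' [hin _ _]]]]]].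
by move: eu hin; case: (cols st).
Qed.

Lemma relE_eval st env R e t : inv st env -> relE st R = Some e -> rexpr_eval env e t <-> AFt st env (size st) R t.
Proof.
move=> hi h; rewrite (unions_eval _ _ h); split=> [[e' /List.in_map_iff[i [<- /In_mem]]]|[i [h1 h2 h3]]] /=.
  by rewrite mem_filter mem_iota => /andP[/eqP h1 /andP[_ h2]] h3; exists i.
exists (ETab i) => //=; apply: List.in_map; apply/In_mem; by rewrite mem_filter h2 eqxx mem_iota.
Qed.

Lemma prodE_eval st env w e : inv st env -> (forall a, a \in w -> size a.2 = arity S a.1) -> prodE st w = Some e ->
  (exists u, rexpr_eval env (foldr (fun p e => ESel p.1 p.2 e) e (pairs w)) u) <-> cq_holds (AFt st env (size st)) w.
Proof.
move=> hi hw he.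
have selE l u : rexpr_eval env (foldr (fun p e => ESel p.1 p.2 e) e l) u <-> rexpr_eval env e u /\ forall p, p \in l -> onth u p.1 = onth u p.2.
  elim: l => [|p l IH] /=; first by split=> // -[].
  rewrite IH; split=> [[[h1 h2] h3]|[h1 h2]].
    by split=> // p'; rewrite inE => /orP[/eqP->|/h2].
  by split; [split=> // p' hp; apply: h2; rewrite inE hp orbT | apply: h2; exact: mem_head].
have AFs R t : AFt st env (size st) R t -> size t = arity S R.
  by move=> [i [_ h2 h3]]; case: hi => _ /(_ _ _ h3); rewrite h2 => /Iwf[].
have eqS : injective (@Some D0) by move=> x y [].
have cat2 (v : nat -> option D0) l1 l2 u1 u2 : size l1 = size u1 -> map v (l1 ++ l2) = map Some (u1 ++ u2) <-> map v l1 = map Some u1 /\ map v l2 = map Some u2.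
  rewrite !map_cat => hs; split=> [h|[-> ->] //].
  have h1 := congr1 (take (size l1)) h; have h2 := congr1 (drop (size l1)) h.
  by move: h1 h2; rewrite {1 3}hs !take_size_cat ?drop_size_cat ?size_map // => -> ->; rewrite !take_size_cat ?drop_size_cat ?size_map ?hs.
have SZ u : rexpr_eval env e u -> size u = size (flatten [seq a.2 | a <- w]).
  elim: w e u hw he {selE} => [|a w IH] e u hw /=; first by case=> <- /= ->.
  case e1 : (relE st a.1) => [x|] //; case e2 : (prodE st w) => [y|] // -[<-] /= [t1 [t2 [-> [/(relE_eval _ hi e1) h1 h2]]]].
  rewrite !size_cat (AFs _ _ h1) -hw ?mem_head //; congr (_ + _).
  by apply: IH h2; rewrite // => b hb; apply: hw; rewrite inE hb orbT.
have PW (v : nat -> option D0) u : map v (flatten [seq a.2 | a <- w]) = map Some u ->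
    rexpr_eval env e u <-> forall a, a \in w -> exists t, AFt st env (size st) a.1 t /\ map v a.2 = map Some t.
  elim: w e u hw he {SZ selE} => [|a w IH] e u hw /=; first by case=> <- /=; case: u.
  case e1 : (relE st a.1) => [x|] //; case e2 : (prodE st w) => [y|] // -[<-] /= hu.
  have hw' b : b \in w -> size b.2 = arity S b.1 by move=> hb; apply: hw; rewrite inE hb orbT.
  have ha := hw a (mem_head _ _).
  split=> [[t1 [t2 [eu [/(relE_eval _ hi e1) h1 h2]]]]|H].
    move: hu; rewrite eu cat2; last by rewrite ha (AFs _ _ h1).
    case=> h3 h4 b; rewrite inE => /orP[/eqP->|hb]; first by exists t1.
    by have /(IH y t2 hw' e2 h4) := h2; apply.
  have [t1 [h1 h3]] := H a (mem_head _ _); have st1 : size t1 = size a.2 by rewrite ha (AFs _ _ h1).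
  have eu : u = t1 ++ drop (size a.2) u.
    rewrite -{1}(cat_take_drop (size a.2) u); congr (_ ++ _); apply: (inj_map eqS).
    by rewrite map_take -hu map_cat take_size_cat ?size_map.
  exists t1, (drop (size a.2) u); split=> //; split; first by apply/(relE_eval _ hi e1).
  have h4 : map v (flatten [seq a.2 | a <- w]) = map Some (drop (size a.2) u).
    by rewrite map_drop -hu map_cat drop_size_cat ?size_map.
  by apply/(IH y _ hw' e2 h4) => b hb; apply: H; rewrite inE hb orbT.
set vs := flatten _ in SZ PW *; rewrite /cqE.
split=> [[u /selE[h1 h2]]|[v hv]].
  (* A variable takes the value of the column where it first occurs; the selections make its other
     columns agree. *)
  have su := SZ u h1; exists (fun x => onth u (index x vs)); apply/(PW _ u) => //.
  apply: (@eq_from_nth _ None); rewrite !size_map // => k hk.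
  rewrite (nth_map 0) // -onthE; apply: (h2 (index (nth 0 vs k) vs, k)).
  rewrite mem_filter /= nth_index ?mem_nth // eqxx /=; apply/allpairsP; exists (index (nth 0 vs k) vs, k); split=> //=.
    by rewrite mem_iota /= add0n index_mem mem_nth.
  by rewrite mem_iota.
have [u hu] : exists u, map v vs = map Some u.
  rewrite /vs; elim: (w) hv => [|a w' IH] hv; first by exists [::].
  have [|u1 h1] := IH; first by move=> b hb; apply: hv; rewrite inE hb orbT.
  by have [t [_ h2]] := hv a (mem_head _ _); exists (t ++ u1); rewrite /= !map_cat h1 h2.
exists u; apply/selE; split; first by apply/(PW v u hu).
move=> p; rewrite mem_filter => /andP[/eqP h1 /allpairsP[[i j] [/= hi1 hj1 ep]]].
move: hi1 hj1 h1; rewrite !mem_iota !add0n ep /= -/vs => hi1 hj1 h1.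
by rewrite !onthE -hu !(nth_map 0) // h1.
Qed.

(** Compiling [w] needs a table for each of its relations. This concerns the plan alone, but one
    execution in which [w] holds proves it. *)
Lemma prodE_some st env w : cq_holds (AFt st env (size st)) w -> exists e, prodE st w = Some e.
Proof.
move=> [v]; elim: w => [|a w IH] hv /=; first by exists EUnit.
have [|e ->] := IH; first by move=> b hb; apply: hv; rewrite inE hb orbT.
have [t [[i [h1 h2 _]] _]] := hv a (mem_head _ _); rewrite /relE /unions.
have : i \in [seq i <- iota 0 (size st) | (nth st0 st i).2 == Some a.1] by rewrite mem_filter h2 eqxx mem_iota.
by case: [seq i <- _ | _] => // x l _ /=; eexists.
Qed.

Definition rounds N := flatten (nseq N (iota 0 (size (s_meth S)))).

Lemma size_rounds N : size (rounds N) = N * size (s_meth S).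
Proof. by rewrite /rounds; elim: N => //= N IH; rewrite size_cat IH size_iota mulSn. Qed.

Lemma nth_rounds N n m : n < N -> m < size (s_meth S) -> nth 0 (rounds N) (n * size (s_meth S) + m) = m.
Proof.
rewrite /rounds => + hm; elim: N n => //= N IH [|n] hn; rewrite nth_cat size_iota.
  by rewrite mul0n hm nth_iota.
by rewrite mulSn -addnA ltnNge leq_addr /= addKn IH.
Qed.

Lemma rounds_ok N : all (fun mi => mi < size (s_meth S)) (rounds N).
Proof.
by rewrite /rounds; elim: N => //= N IH; rewrite all_cat IH andbT; apply/allP => i; rewrite mem_iota.
Qed.

Lemma onth_mapf (T1 T2 : Type) (f : T1 -> T2) s i : onth (map f s) i = omap f (onth s i).
Proof. by elim: s i => [|x s IH] [|i] //=. Qed.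

Variable N : nat.
Notation ms := (rounds N).
Notation stf := (gen ms [::]).2.

(* The context lives over [option D0] so that the query's valuation is total even when [D0] is empty. *)
Lemma run_ctx env w : exec S I (gen ms [::]).1 [::] env -> cq_holds I q ->
  (forall c : ctx, N <= cK c -> cq_holds (cAF (c := c) N) w) -> cq_holds (AFt stf env (size stf)) w.
Proof.
move=> hex [v hv] H; set M := size (s_meth S).
have tg0 : tags_ok [::] by case.
have in0 : inv [::] ([::] : seq (table D0)) by split=> // -[].
have [es _ _ hinv hstep] := gen_exec (rounds_ok N) tg0 in0 hex.
rewrite add0n size_rounds in es; have est : size stf = N * M by case: hinv; rewrite es.
have AFmono n m R t : n <= m -> AFt stf env n R t -> AFt stf env m R t.
  by move=> h [i [h1 h2 h3]]; exists i; split=> //; exact: leq_trans h.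
have Avmono n m d : n <= m -> Av env n d -> Av env m d.
  by move=> h [i [t [c [h1 h2 h3]]]]; exists i, t, c; split=> //; exact: leq_trans h.
have AFI n R t : AFt stf env n R t -> I R t.
  by move=> [i [_ h2 h3]]; case: hinv => _ /(_ i t h3); rewrite h2.
pose Io R (t' : seq (option D0)) := exists t, I R t /\ t' = map Some t.
have Siwf : wf_instance S Io by move=> R t' [t [h ->]]; rewrite size_map; exact: Iwf.
have Sisat : sat_constraints S Io.
  have [K1 K2] := Isat; split=> [u hu t' [t [h ->]]|f hf t1' t2' [t1 [h1 ->]] [t2 [h2 ->]] h].
    have [t2 [h1 h2]] := K1 u hu t h; exists (map Some t2); split; first by exists t2.
    by rewrite !onth_mapf h2.
  rewrite !onth_mapf (K2 f hf t1 t2 h1 h2) // => d /h; rewrite !onth_mapf.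
  by case: (onth t1 d) => [x|]; case: (onth t2 d) => [y|] //= [->].
have Sq a : a < size q -> Io (natm q a).1 (map v (natm q a).2).
  by move=> ha; have [t [h1 h2]] := hv _ (mem_nth datm ha); exists t.
have Smono n m (d : option D0) : n <= m -> (exists d0, d = Some d0 /\ Av env (n * M) d0) -> exists d0, d = Some d0 /\ Av env (m * M) d0.
  by move=> h [d0 [e1 h1]]; exists d0; split=> //; apply: Avmono h1; rewrite leq_mul2r h orbT.
have SmonoF n m R (t' : seq (option D0)) : n <= m -> (exists t, AFt stf env (n * M) R t /\ t' = map Some t) -> exists t, AFt stf env (m * M) R t /\ t' = map Some t.
  by move=> h [t [h1 h2]]; exists t; split=> //; apply: AFmono h1; rewrite leq_mul2r h orbT.
have SAFI n R (t' : seq (option D0)) : (exists t, AFt stf env (n * M) R t /\ t' = map Some t) -> Io R t'.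
  by move=> [t [h1 h2]]; exists t; split=> //; exact: AFI h1.
have SAFAc n R (t' : seq (option D0)) x : (exists t, AFt stf env (n * M) R t /\ t' = map Some t) -> List.In x t' -> exists d0, x = Some d0 /\ Av env (n * M) d0.
  move=> [t [[i [h1 h2 h3]] ->]] /List.in_map_iff[d0 [<- hin]]; exists d0; split=> //.
  by have [c hc ec] := In_ex_nth d0 hin; exists i, t, c; split=> //; rewrite (onth_lt d0) // ec.
have Srun n m (t' : seq (option D0)) : n < N -> m < size (s_meth S) -> Io (m_rel (nmeth S m)) t' ->
    (forall x, x \in m_in (nmeth S m) -> exists d, onth t' x = Some d /\ exists d0, d = Some d0 /\ Av env (n * M) d0) ->
    exists u', [/\ exists u, AFt stf env (n.+1 * M) (m_rel (nmeth S m)) u /\ u' = map Some u, forall x, x \in m_in (nmeth S m) -> onth u' x = onth t' x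
      & m_bound (nmeth S m) = None -> u' = t'].
  move=> hn hm [t [ht ->]] hx; have hp : n * M + m < size ms by rewrite size_rounds -/M; nia.
  have := hstep _ hp; rewrite (nth_rounds hn hm) add0n /step => /(_ t ht)[|h1 [u [h2 h3 h4]]].
    move=> x /hx[d [e1 [d0 [e2 h0]]]]; exists d0; split; last by apply: Avmono h0; exact: leq_addr.
    by move: e1; rewrite onth_mapf e2; case: (onth t x) => //= y [->].
  exists (map Some u); split; last by move=> /h4 ->.
    by exists u; split=> //; exists (n * M + m); split=> //; rewrite mulSn addnC ltn_add2r.
  by move=> x /h3 e1; rewrite !onth_mapf e1.
pose c0 : ctx := @Ctx S q (option D0) Io v N (fun n R t' => exists t, AFt stf env (n * M) R t /\ t' = map Some t) (fun n d => exists d0, d = Some d0 /\ Av env (n * M) d0)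
  Siwf Sisat Sq Smono SmonoF SAFI SAFAc Srun.
have [v' hv'] := H c0 (leqnn _); exists (fun x => if v' x is Some y then y else None) => a /hv'[t' [[t [h1 ->]] h2]].
exists t; split; first by rewrite est.
apply: (@eq_from_nth _ None); first by move/(congr1 size): h2; rewrite !size_map.
move=> i; rewrite size_map => hi; have := congr1 (fun s => nth None s i) h2.
have hi' : i < size t by move/(congr1 size): h2; rewrite !size_map => <-.
by rewrite !(nth_map 0) // (nth_map None) ?size_map // => ->.
Qed.
End Eval.

Lemma exec_rcons (D0 : Type) (I : instance D0) cs c env envf : exec S I (rcons cs c) env envf ->
  exists env1, exec S I cs env env1 /\ exec S I [:: c] env1 envf.
Proof.
elim: cs env => [|[e|mi e] cs IH] env /= h; first by exists env; split=> //; constructor.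
  by have [env1 [h1 h2]] := IH _ (exec_mid_inv h); exists env1; split=> //; constructor.
have [m [Jo [hm hJ hx]]] := exec_acc_inv h; have [env1 [h1 h2]] := IH _ hx.
by exists env1; split=> //; exact: (exec_acc hm hJ h1).
Qed.

Theorem Goal_answerable lf kf nf B : (forall t a, g t a = guess lf kf nf t a) -> (forall i, J i -> i <= B) ->
  dGoal edb -> monotone_answerable S q.
Proof.
move=> gG hJB hG; have [N HN] := W_complete B; set w := W B in HN.
have hw a : a \in w -> size a.2 = arity S a.1.
  by rewrite mem_cat => /orP[/mapP[p _ ->]|/mapP[p _ ->]]; rewrite size_mkseq.
have tg0 : tags_ok [::] by case.
have wt := gen_wt [::] (rounds_ok N).
(* The first world satisfies the query; running the accesses there shows that the tables needed by
   [w] exist. *)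
have [env [hex _]] : exists env, exec S (Iw false) (gen (rounds N) [::]).1 [::] env /\ exec S (Iw false) (gen (rounds N) [::]).1 [::] env.
  apply: (@lockstep elt (Iw false) (Iw false) (fun _ => True) _ _ [::]); rewrite ?wt //.
  move=> mi m b _ _; have [Jo [h1 h2 h3]] := output_exists (matching (Iw false) m b) (if m_bound m is Some k then k else 0).
  case em : (m_bound m) h2 h3 => [k|] h2 h3.
    by exists Jo; split=> //; split=> //; rewrite em.
  by exists (matching (Iw false) m b); split=> //; split=> //; rewrite em.
have sat0 : sat_constraints S (Iw false) by split=> [u|f]; [exact: Iw_uid | exact: Iw_fd].
have hq0 : cq_holds (Iw false) q by exact: query_holds_false.
have [e he] := prodE_some (run_ctx (@Iw_wf false) sat0 hex hq0 HN).
exists (Plan (rcons (gen (rounds N) [::]).1 (CMid (cqE w e))) (size (rounds N))); split.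
  have wtc l cs c : wt_cmds S l (rcons cs c) = obind (fun l' => wt_cmds S l' [:: c]) (wt_cmds S l cs).
    elim: cs l => //= c0 cs IH l; case: c0 => [e0|mi e0]; first by case: (rexpr_arity _ _).
    by case: (onth _ _) => // m; case: (rexpr_arity _ _) => // n; case: ifP.
  exists (rcons [seq x.1 | x <- (gen (rounds N) [::]).2] 0); split; last first.
    have in0 : inv (Iw false) [::] [::] by split=> // -[].
    have [es _ _ hinv _] := gen_exec (@Iw_wf false) (rounds_ok N) tg0 in0 hex.
    by rewrite /= size_rcons size_map; case: hinv => <- _; rewrite es.
  have := cqE_ar (prodE_ar (gen_tags tg0) hw he); move: (cqE w e) => ee har.
  by rewrite /p_cmds wtc wt /= har.
move=> D0 I Iwf Isat envf /= /exec_rcons [env1 [hx1 hx2]] t.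
have in0 : inv I [::] [::] by split=> // -[].
have [es _ _ hinv _] := gen_exec Iwf (rounds_ok N) tg0 in0 hx1.
have -> : envf = rcons env1 (rexpr_eval env1 (cqE w e)).
  exact: exec_nil_inv (exec_mid_inv hx2).
rewrite nth_rcons es ltnn eqxx; have hE := prodE_eval Iwf hinv hw he.
split=> [/= [u [hu]]|[-> hq]].
  case: t => // _; split=> //; have /hE[v hv] : exists u, rexpr_eval env1 (foldr (fun p e => ESel p.1 p.2 e) e (pairs w)) u by exists u.
  apply: (W_sound hJB gG Iwf Isat _ hG); exists v => a /hv[t' [[i [_ h2 h3]] h4]]; exists t'; split=> //.
  by case: hinv => _ /(_ i t' h3); rewrite h2.
have /hE[u hu] := run_ctx Iwf Isat hx1 hq HN; by exists u.
Qed.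
End ThePlan.
End Basics.
End Completeness5.

(** * Finite sets of facts coded by numbers *)

Module BoundedSearch.
Import all_boot zify.
Import Defs Expressions Definable DatalogSyntax.

(** Digits in base [Y] closed by a final 1, which makes the code injective across lists of different
    lengths. *)
Fixpoint pk (Y : nat) (l : seq nat) := if l is x :: l' then x + Y * pk Y l' else 1.

Lemma pk_gt0 Y l : 0 < Y -> 0 < pk Y l.
Proof. by move=> hY; elim: l => //= x l IH; rewrite addn_gt0 muln_gt0 hY IH orbT. Qed.

Lemma pk_inj Y l1 l2 : 1 < Y -> all (fun x => x < Y) l1 -> all (fun x => x < Y) l2 -> pk Y l1 = pk Y l2 -> l1 = l2.
Proof.
move=> hY; have hY0 : 0 < Y by lia.
elim: l1 l2 => [|x l1 IH] [|y l2] //= h1 h2 h.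
- by have := @pk_gt0 Y l2 hY0; nia.
- by have := @pk_gt0 Y l1 hY0; nia.
case/andP: h1 => hx h1; case/andP: h2 => hy h2.
have hm := congr1 (fun z => z %% Y) h; rewrite /= !(addnC _ (Y * _)) ![Y * _]mulnC !modnMDl !modn_small // in hm.
have hd := congr1 (fun z => z %/ Y) h; rewrite /= !(addnC _ (Y * _)) ![Y * _]mulnC !divnMDl // !divn_small // !addn0 in hd.
by rewrite hm (IH l2).
Qed.

Lemma pk_lt Y l : 1 < Y -> all (fun x => x < Y) l -> pk Y l < Y ^ (size l).+1.
Proof.
move=> hY; elim: l => [|x l IH] /=; first by rewrite expn1.
by move=> /andP[hx /IH h]; rewrite [Y ^ _.+2]expnS; move: h; move: (Y ^ _) => Z h; nia.
Qed.

(** A set is a number whose digits in base [Z] are the codes of its members plus one, so the digits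
    0 beyond the last member code nothing. *)
Definition mem N Y Z w (l : seq nat) := exb N (fun i => digit N Z w i == (pk Y l).+1).

Lemma pw_min N b e : 0 < b -> pw N b e = minn N (b ^ e).
Proof.
move=> hb; rewrite /pw; elim: e => [|e IH] /=; first by rewrite expn0.
rewrite IH expnS; move: (b ^ e) => A; case: (leqP N A) => h; last by rewrite mulnC.
have h1 : N <= N * b by nia.
have h2 : N <= b * A by nia.
by rewrite (minn_idPl h1) (minn_idPl h2).
Qed.

Definition build Y Z (ls : seq (seq nat)) := foldr (fun l acc => (pk Y l).+1 + Z * acc) 0 ls.

Lemma build_lt Y Z ls : (forall l, l \in ls -> (pk Y l).+1 < Z) -> build Y Z ls < Z ^ size ls.
Proof.
elim: ls => [|l ls IH] H //=; have h1 := H l (mem_head _ _).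
have h2 : build Y Z ls < Z ^ size ls by apply: IH => l' hl'; apply: H; rewrite inE hl' orbT.
by rewrite expnS; move: h2; move: (Z ^ _) (build _ _ _) => A b h2; nia.
Qed.

Lemma build_digit Y Z ls i : (forall l, l \in ls -> (pk Y l).+1 < Z) -> i < size ls ->
  (build Y Z ls %/ Z ^ i) %% Z = (pk Y (nth [::] ls i)).+1.
Proof.
elim: ls i => [|l ls IH] [|i] H //= hi; have h1 := H l (mem_head _ _).
  by rewrite expn0 divn1 addnC mulnC modnMDl modn_small.
rewrite expnS divnMA addnC mulnC divnMDl; last by lia.
rewrite (divn_small h1) addn0; apply: IH => // l' hl'; apply: H; by rewrite inE hl' orbT.
Qed.

Lemma mem_build N Y Z ls : 1 < Y -> (forall l, l \in ls -> all (fun x => x < Y) l /\ (pk Y l).+1 < Z) ->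
  Z ^ size ls <= N -> 1 < Z -> build Y Z ls < N /\
  forall l, all (fun x => x < Y) l -> mem N Y Z (build Y Z ls) l = (l \in ls).
Proof.
move=> hY H hN hZ; have H' l : l \in ls -> (pk Y l).+1 < Z by move=> /H[].
have hb := build_lt H'; split; first exact: leq_trans hb hN.
move=> l hl; apply/exbP/idP => [[i hi /eqP]|hin].
  rewrite /digit pw_min; last by lia.
  case: (ltnP i (size ls)) => his.
    have hZi : Z ^ i <= N by apply: leq_trans hN; rewrite leq_exp2l // ltnW.
    rewrite (minn_idPr hZi) build_digit // => -[] /(pk_inj hY _ hl) <-; first exact: mem_nth.
    by have [] := H _ (mem_nth [::] his).
  rewrite divn_small ?mod0n //; apply: leq_trans hb _; rewrite leq_min hN /=.
  by rewrite leq_exp2l.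
exists (index l ls); last first.
  have his : index l ls < size ls by rewrite index_mem.
  have hZi : Z ^ index l ls <= N by apply: leq_trans hN; rewrite leq_exp2l // ltnW.
  by rewrite /digit pw_min ?(minn_idPr hZi) ?build_digit ?nth_index //; lia.
apply: leq_trans hN; apply: leq_ltn_trans (index_size _ _) _.
exact: ltn_expl.
Qed.

Lemma def_pk (Y : seq nat -> nat) (fs : seq (seq nat -> nat)) : def Y -> (forall f, List.In f fs -> def f) ->
  def (fun r => pk (Y r) (map (fun f => f r) fs)).
Proof.
move=> hY; elim: fs => [|f fs IH] H /=; first exact: def_cst.
have h1 : def f by apply: H; left.
have h2 : def (fun r => pk (Y r) (map (fun f => f r) fs)) by apply: IH => f' hf'; apply: H; right.
by apply: (@def_add f (fun r => Y r * pk (Y r) (map (fun f => f r) fs))) => //; exact: (@def_mul Y).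
Qed.

Lemma def_mem N Y Z w (fs : seq (seq nat -> nat)) : def N -> def Y -> def Z -> def w -> (forall f, List.In f fs -> def f) ->
  defb (fun r => mem (N r) (Y r) (Z r) (w r) (map (fun f => f r) fs)).
Proof.
move=> hN hY hZ hw hfs; have hp := def_pk hY hfs.
apply: (@def_exb N (fun r i => digit (N r) (Z r) (w r) i == (pk (Y r) (map (fun f => f r) fs)).+1)) => //.
apply: (@def_eq (fun r => digit (N (drop 1 r)) (Z (drop 1 r)) (w (drop 1 r)) (nth 0 r 0))).
  apply: (@def_digit (fun r => N (drop 1 r)) (fun r => Z (drop 1 r)) (fun r => w (drop 1 r))); try exact: def_shift; exact: def_var.
apply: def_succ; exact: (def_shift 1 hp).
Qed.

Definition tmax (t : trm) := if t is V i then i.+1 else 0.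
Definition amax (a : datom) := foldr maxn 0 (map tmax a.2).
Definition cmax (c : clause) := maxn (foldr maxn 0 (map amax (c_edb c ++ c_idb c))) (amax (c_hd c)).

Fixpoint forallv (k Y : nat) (p : seq nat -> bool) (v : seq nat) : bool :=
  if k is k'.+1 then allb Y (fun x => forallv k' Y p (x :: v)) else p v.

Lemma forallvP k Y p v : forallv k Y p v <-> forall u, size u = k -> all (fun x => x < Y) u -> p (u ++ v).
Proof.
elim: k v => [|k IH] v /=; first by split=> [h [|//] _ _|h] //; exact: (h [::]).
split=> [/allbP h u hu|h].
  case/lastP: u hu => // u x; rewrite size_rcons all_rcons => -[hu] /andP[hx hall].
  by rewrite cat_rcons; have /IH := h x hx; apply.
apply/allbP => x hx; apply/IH => u hu hall; rewrite -cat_rcons; apply: h; first by rewrite size_rcons hu.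
by rewrite all_rcons hx.
Qed.

Lemma nth_take_pad k r i : i < k -> nth 0 (take k (r ++ nseq k 0)) i = nth 0 r i.
Proof.
move=> hi; rewrite nth_take // nth_cat; case: ltnP => // h; rewrite nth_nseq (nth_default _ h); by case: ifP.
Qed.

Lemma take_pad_cons j r : take j.+1 (r ++ nseq j.+1 0) = nth 0 r 0 :: take j (drop 1 r ++ nseq j 0).
Proof.
have sz k (l : seq nat) : size (take k (l ++ nseq k 0)) = k by rewrite size_takel // size_cat size_nseq leq_addl.
apply: (@eq_from_nth _ 0); first by rewrite sz [RHS]/= sz.
by rewrite sz => -[|i] hi; rewrite nth_take_pad //= nth_take_pad // nth_drop.
Qed.

(** The quantified values are the initial segment of the environment; padding with zeros covers
    environments that are too short. *)
Lemma def_forallv k (Y : seq nat -> nat) (p : seq nat -> seq nat -> bool) j : def Y ->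
  defb (fun r => p (drop (k + j) r) (take (k + j) (r ++ nseq (k + j) 0))) ->
  defb (fun r => forallv k (Y (drop j r)) (p (drop j r)) (take j (r ++ nseq j 0))).
Proof.
move=> hY; elim: k j => [|k IH] j hp //=.
have h1 : def (fun r => Y (drop j r)) by exact: def_shift.
apply: (@def_ext (fun r => nat_of_bool (allb (Y (drop j r)) (fun x => forallv k (Y (drop j r)) (p (drop j r)) (x :: take j (r ++ nseq j 0)))))) => //.
apply: (@def_allb (fun r => Y (drop j r)) (fun r x => forallv k (Y (drop j r)) (p (drop j r)) (x :: take j (r ++ nseq j 0)))) => //.
have := IH j.+1; rewrite -addSnnS => /(_ hp); apply: def_ext => r; congr (nat_of_bool _).
rewrite drop_drop addn1; congr (forallv _ _ _ _).
by rewrite take_pad_cons.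
Qed.

(* The environment lists the candidate model, the guess, the input number, the input length and the bound. *)
Definition eN (r : seq nat) := nth 0 r 4.
(** Exceeds every number of the domain: those read from the input are below [2 ^ n], the small
    indices are at most [n + 50], and [2 ^ n] itself stands for the absent positions. *)
Definition eY r := pw (eN r) 2 (nth 0 r 3) + nth 0 r 3 + 60.
(** A tag with at most ten arguments has a code below [Y ^ 12]; one more power leaves room for the
    shift by one. *)
Definition eZ r := pw (eN r) (eY r) 13.
Definition es (r : seq nat) := nth 0 r 0.

Lemma def_eN : def eN. Proof. exact: def_var. Qed.
Lemma def_eY : def eY.
Proof.
apply: def_add; last exact: def_cst.
apply: (@def_add (fun r => pw (eN r) 2 (nth 0 r 3))); last exact: def_var.
by apply: (@def_pw eN (fun _ => 2) (fun r => nth 0 r 3)); [exact: def_eN | exact: def_cst | exact: def_var].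
Qed.
Lemma def_eZ : def eZ.
Proof. by apply: (@def_pw eN eY (fun _ => 13)); [exact: def_eN | exact: def_eY | exact: def_cst]. Qed.

Section Closed.
Variables (xedb : seq nat -> nat -> seq nat -> bool).

Definition xmem r (a : nat) (l : seq nat) := mem (eN r) (eY r) (eZ r) (es r) (a :: l).

Definition clause_ok (c : clause) r v :=
  all (fun a => xedb r a.1 (map (tval (nth 0 v)) a.2)) (c_edb c) ==>
  (all (fun a => xmem r a.1 (map (tval (nth 0 v)) a.2)) (c_idb c) ==> xmem r (c_hd c).1 (map (tval (nth 0 v)) (c_hd c).2)).

Definition closedb prog r := all (fun c => forallv (cmax c) (eY r) (clause_ok c r) [::]) prog.

Hypothesis def_xedb : forall k t l, defb (fun r => xedb (drop k r) t (map (tval (nth 0 r)) l)).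

Lemma map_pad k r l : foldr maxn 0 (map tmax l) <= k -> map (tval (nth 0 (take k (r ++ nseq k 0)))) l = map (tval (nth 0 r)) l.
Proof.
by elim: l => //= t l IH; rewrite geq_max => /andP[ht /IH ->]; case: t ht => [i|c] //= hi; rewrite nth_take_pad.
Qed.

Lemma def_xmem k t l : defb (fun r => xmem (drop k r) t (map (tval (nth 0 r)) l)).
Proof.
have := @def_mem _ _ _ _ ((fun _ => t) :: map (fun u r => tval (nth 0 r) u) l) (def_shift k def_eN) (def_shift k def_eY) (def_shift k def_eZ) (def_shift k (def_var 0)).
move=> H; apply: (def_ext _ (H _)) => [r|f] /=; first by rewrite -map_comp.
case=> [<-|/List.in_map_iff[[i|c] [<- _]]] /=; [exact: def_cst | exact: def_var | exact: def_cst].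
Qed.

Lemma def_all_atoms k (P : seq nat -> nat -> seq nat -> bool) l : (forall t l, defb (fun r => P (drop k r) t (map (tval (nth 0 r)) l))) ->
  foldr maxn 0 (map amax l) <= k ->
  defb (fun r => all (fun a => P (drop k r) a.1 (map (tval (nth 0 (take k (r ++ nseq k 0)))) a.2)) l).
Proof.
move=> H; elim: l => [|a l IH] /=; first by move=> _; exact: def_true.
rewrite geq_max => /andP[ha /IH hl]; apply: def_and => //.
by apply: (def_ext _ (H a.1 a.2)) => r; rewrite map_pad.
Qed.

Lemma foldr_maxn_cat (l1 l2 : seq nat) : foldr maxn 0 (l1 ++ l2) = maxn (foldr maxn 0 l1) (foldr maxn 0 l2).
Proof. by elim: l1 => [|x l1 IH] /=; rewrite ?max0n // IH maxnA. Qed.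

Lemma def_closedb prog : defb (closedb prog).
Proof.
elim: prog => [|c p IH]; first exact: def_true.
apply: (@def_and (fun r => forallv (cmax c) (eY r) (clause_ok c r) [::])) => //.
have := @def_forallv (cmax c) eY (fun r => clause_ok c r) 0 def_eY.
rewrite addn0 => H; apply: (def_ext _ (H _)); first by move=> r; rewrite drop0 cats0 take0.
have hm : cmax c <= cmax c by []. rewrite {1}/cmax geq_max map_cat foldr_maxn_cat geq_max in hm.
case/andP: hm => /andP[h1 h2] h3; set k := cmax c in h1 h2 h3 *.
apply: (@def_imp (fun r => all _ _)); first exact: (@def_all_atoms k xedb (c_edb c)).
apply: (@def_imp (fun r => all _ _)); first exact: (@def_all_atoms k xmem (c_idb c) (def_xmem k)).
by apply: (def_ext _ (def_xmem k (c_hd c).1 (c_hd c).2)) => r; rewrite map_pad.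
Qed.
End Closed.

Definition tvar_in (l : seq datom) (t : trm) := match t with K c => c <= 4 | V i => has (fun a : datom => has (fun u => if u is V j then i == j else false) a.2) l end.
(** Head variables occur in the body and head constants are small, so derived facts never leave the
    domain. *)
Definition safe_clause (c : clause) := all (tvar_in (c_edb c ++ c_idb c)) (c_hd c).2 && (size (c_hd c).2 <= 10) && ((c_hd c).1 <= 24).
Definition smallK (c : clause) := all (fun a : datom => (a.1 <= 24) && all (fun u => if u is K k then k <= 4 else true) a.2) (c_hd c :: c_edb c ++ c_idb c).

Section Decide.
Variables (prog : seq clause) (xedb : seq nat -> nat -> seq nat -> bool) (r : seq nat -> seq nat).
Variables (edb : nat -> seq nat -> bool) (Jl : seq nat) (N Y Z : nat).
Hypothesis safe : all safe_clause prog && all smallK prog.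
Hypothesis edbJ : forall t a, edb t a -> {subset a <= Jl}.
Hypothesis Jsmall : forall i, i <= 4 -> i \in Jl.
Hypothesis JY : forall i, i \in Jl -> i < Y.
Hypothesis Y24 : 24 < Y.
Hypothesis ZE : Z = Y ^ 13.
Hypothesis NE : Z ^ (25 * (size Jl).+1 ^ 10) <= N.

Lemma In_all T (p : T -> bool) (s : seq T) x : all p s -> List.In x s -> p x.
Proof. by elim: s => //= y s IH /andP[py ps] [<-|]; [|exact: IH]. Qed.

Lemma In_has T (p : T -> bool) (s : seq T) : has p s -> exists2 x, List.In x s & p x.
Proof.
elim: s => //= x s IH /orP[h|/IH[y h1 h2]]; first by exists x => //; left.
by exists y => //; right.
Qed.

Lemma dl_bounded t a : dl prog edb t a -> [/\ t <= 24, size a <= 10 & {subset a <= Jl}].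
Proof.
move: t a; apply: dl_ind => c v hc he _ hi; have /andP[s1 _] := safe.
have /andP[/andP[h1 h2] h3] := In_all s1 hc.
rewrite size_map; split=> // x; rewrite /tvals; move: h1; elim: (c_hd c).2 {h2} => //= u l IH /andP[hu /IH hl].
rewrite inE => /orP[/eqP->|] //; case: u hu => [i|k] /=; last exact: Jsmall.
case/In_has => -[p w] hin /In_has[[j|] hj //= /eqP eij]; subst j.
have hvi : v i \in map (tval v) w by elim: w hj {hin} => //= y w IHw [->|/IHw h]; rewrite inE ?eqxx ?h ?orbT.
have /List.in_app_iff [h|h] := hin.
  by have := (holdsP _ _ _).1 he _ h; move/edbJ; apply.
by have [_ _] := (holdsP _ _ _).1 hi _ h; apply.
Qed.

Fixpoint lists k : seq (seq nat) := if k is k'.+1 then [::] :: [seq x :: l | x <- Jl, l <- lists k'] else [:: [::]].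

Lemma size_lists k : size (lists k) <= (size Jl).+1 ^ k.
Proof.
elim: k => //= k IH; rewrite size_allpairs expnS.
have : 0 < (size Jl).+1 ^ k by rewrite expn_gt0.
by move: IH; move: (_ ^ k) (size (lists k)) => A B; nia.
Qed.

Lemma mem_lists k l : size l <= k -> {subset l <= Jl} -> l \in lists k.
Proof.
elim: k l => [|k IH] [|x l] //= hs hJ; rewrite inE /=; apply/allpairsP; exists (x, l); split=> //=.
  by apply: hJ; exact: mem_head.
by apply: IH => // y hy; apply: hJ; rewrite inE hy orbT.
Qed.

Lemma lists_sub k l : l \in lists k -> size l <= k /\ {subset l <= Jl}.
Proof.
elim: k l => [|k IH] l /=; first by rewrite inE => /eqP->.
rewrite inE => /orP[/eqP->|/allpairsP[[x l'] [/= hx /IH[h1 h2] ->]]] //; split=> // y.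
by rewrite inE => /orP[/eqP->|/h2].
Qed.

(** There are at most [25 * (size Jl).+1 ^ 10] facts over the domain, and that many digits in base
    [Z] fit below [N]. *)
Lemma set_exists (Pb : nat -> seq nat -> bool) : (forall t a, Pb t a -> [/\ t <= 24, size a <= 10 & {subset a <= Jl}]) ->
  exists2 s, s < N & forall t a, t < Y -> all (fun x => x < Y) a -> mem N Y Z s (t :: a) = Pb t a.
Proof.
move=> H; set ls := [seq p.1 :: p.2 | p <- [seq (t, l) | t <- iota 0 25, l <- lists 10] & Pb p.1 p.2].
have Y1 : 1 < Y by lia.
have hsz : size ls <= 25 * (size Jl).+1 ^ 10.
  rewrite size_map; apply: leq_trans (size_subseq (filter_subseq _ _)) _.
  by rewrite size_allpairs size_iota leq_mul2l size_lists orbT.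
have Z1 : 1 < Z by rewrite ZE -(exp1n 13) ltn_exp2r.
have hls l : l \in ls -> all (fun x => x < Y) l /\ (pk Y l).+1 < Z.
  case/mapP => -[t a]; rewrite mem_filter => /andP[_ /allpairsP[[t' a'] [ht /lists_sub[h1 h2] [-> ->]]]] ->.
  rewrite -[(t', a').1]/t' -[(t', a').2]/a' in ht h1 h2 *.
  have hall : all (fun x => x < Y) (t' :: a').
    rewrite /=; apply/andP; split; first by move: ht; rewrite mem_iota; lia.
    by apply/allP => x /h2 /JY.
  split=> //; have h := pk_lt Y1 hall; apply: leq_ltn_trans h _.
  by rewrite ZE ltn_exp2l //=; lia.
have hZN : Z ^ size ls <= N by apply: leq_trans NE; rewrite leq_exp2l.
have [h1 h2] := mem_build Y1 hls hZN Z1.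
exists (build Y Z ls) => // t a ht ha; rewrite h2 /= ?ht //; apply/mapP/idP => [[[t' a']]|hP].
  by rewrite mem_filter => /andP[/= hP _] [-> ->].
exists (t, a) => //; rewrite mem_filter; apply/andP; split; first exact: hP.
have [h3 h4 h5] := H _ _ hP; by apply/allpairsP; exists (t, a); split=> //; [by rewrite mem_iota /= add0n ltnS | exact: mem_lists].
Qed.
End Decide.
End BoundedSearch.

(** * Reading the encoded input by bounded formulas *)

Module Parsing.
Import all_boot zify.
Import Defs Expressions TopMachine Definable DatalogSyntax DatalogProgram ExtensionalFacts ProgramFacts BoundedSearch.

Section Parse.
Variables (X n N : nat).
Definition bt o := bitat X n N o.
(** Offset of the [j]-th item of the list at [o], where [sk] skips one item. Items are preceded by
    the flag [true], and the walk halts at the closing [false]. *)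
Definition lpos (sk : nat -> nat) o j := iteri j (fun _ p => minn N (ifb (bt p) (sk p.+1) p)) (minn N o).
Definition sklist sk o := (lpos sk o n).+1.
Definition sknat o := sklist succn o.
(** Binary digits come least significant first, each behind a flag; hence the stride 2 and the
    reading from the far end. *)
Definition natv o := let L := (sknat o - o.+1) %/ 2 in
  iteri L (fun j acc => minn N (acc * 2 + bt (o + 2 * (L - j.+1)).+1)) (minn N 0).
Definition skuid p := sknat (sknat (sknat (sknat p))).
Definition skfd p := sknat (sklist sknat (sknat p)).
Definition skopt p := ifb (bt p) (sknat p.+1) p.+1.
Definition skmeth p := skopt (sklist sknat (sknat p)).
Definition skatom p := sklist sknat (sknat p).
Definition o2 := sklist sknat 0.
Definition o3 := sklist skuid o2.
Definition o4 := sklist skfd o3.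
Definition o5 := sklist skmeth o4.
Definition szis sk o z := ~~ bt (lpos sk o z) && allb z (fun i => bt (lpos sk o i)).
Definition x0 a b c d := exb n (fun j => bt (lpos skuid o2 j) && (natv (lpos skuid o2 j).+1 == a) && (natv (sknat (lpos skuid o2 j).+1) == b)
  && (natv (sknat (sknat (lpos skuid o2 j).+1)) == c) && (natv (sknat (sknat (sknat (lpos skuid o2 j).+1))) == d)).
Definition fdp k := (lpos skfd o3 k).+1.
Definition x1 k R z r := bt (lpos skfd o3 k) && (natv (fdp k) == R) && szis sknat (sknat (fdp k)) z && (natv (sklist sknat (sknat (fdp k))) == r).
Definition x2 k i d := bt (lpos skfd o3 k) && bt (lpos sknat (sknat (fdp k)) i) && (natv (lpos sknat (sknat (fdp k)) i).+1 == d).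
Definition mp k := (lpos skmeth o4 k).+1.
Definition x3 k R z := bt (lpos skmeth o4 k) && (natv (mp k) == R) && szis sknat (sknat (mp k)) z.
Definition x4 k i d := bt (lpos skmeth o4 k) && bt (lpos sknat (sknat (mp k)) i) && (natv (lpos sknat (sknat (mp k)) i).+1 == d).
Definition x5 k := bt (lpos skmeth o4 k) && ~~ bt (sklist sknat (sknat (mp k))).
Definition ap k := (lpos skatom o5 k).+1.
Definition x6 k R := bt (lpos skatom o5 k) && (natv (ap k) == R).
Definition x7 k i d := bt (lpos skatom o5 k) && bt (lpos sknat (sknat (ap k)) i) && (natv (lpos sknat (sknat (ap k)) i).+1 == d).
Definition x8 k z := bt (lpos skatom o5 k) && szis sknat (sknat (ap k)) z.
Definition x9 z := szis skatom o5 z.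
Definition xpos R j := bt (lpos sknat 0 R) && (j < natv (lpos sknat 0 R).+1).
(** The domain: small indices, every number that can be read at some offset, and [2 ^ n] in the role
    of [js]. *)
Definition xJ j := (j <= n + 50) || (exb n (fun o => natv o == j) || (j == pw N 2 n)).
End Parse.

Ltac deft_sh := match goal with H : def ?f |- def (fun r => ?f (drop ?k r)) => exact: (def_shift k H) | H : def ?f |- def _ => exact: H end.

Definition defsk (sk : nat -> nat -> nat -> nat -> nat) := forall X n N o, def X -> def n -> def N -> def o -> def (fun r => sk (X r) (n r) (N r) (o r)).

Lemma def_bt X n N o : def X -> def n -> def N -> def o -> defb (fun r => bt (X r) (n r) (N r) (o r)).
Proof. exact: def_bitat. Qed.

Lemma def_lpos sk : defsk sk -> forall X n N o j, def X -> def n -> def N -> def o -> def j ->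
  def (fun r => lpos (X r) (n r) (N r) (sk (X r) (n r) (N r)) (o r) (j r)).
Proof.
move=> hsk X n N o j hX hn hN ho hj.
apply: (@def_iter N j o (fun r _ p => ifb (bt (X r) (n r) (N r) p) (sk (X r) (n r) (N r) p.+1) p)) => //.
have h1 := def_shift 2 hX; have h2 := def_shift 2 hn; have h3 := def_shift 2 hN; have h4 := def_var 1.
apply: def_ifb; [exact: (def_bt h1 h2 h3 h4) | exact: (hsk _ _ _ _ h1 h2 h3 (def_succ h4)) | exact: h4].
Qed.

Lemma def_sklist sk : defsk sk -> defsk (fun X n N => sklist X n N (sk X n N)).
Proof. by move=> hsk X n N o hX hn hN ho; apply: def_succ; exact: (def_lpos hsk). Qed.

Lemma def_sknat : defsk sknat.
Proof. by apply: (@def_sklist (fun _ _ _ => succn)) => X n N o _ _ _ ho; exact: def_succ. Qed.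

Lemma def_natv : defsk natv.
Proof.
move=> X n N o hX hn hN ho; have hs := def_sknat hX hn hN ho.
pose L r := (sknat (X r) (n r) (N r) (o r) - (o r).+1) %/ 2.
have hL : def L by apply: (@def_div _ (fun _ => 2)); [apply: def_sub => //; exact: def_succ | exact: def_cst].
apply: (@def_iter N L (fun _ => 0) (fun r j acc => acc * 2 + bt (X r) (n r) (N r) (o r + 2 * (L r - j.+1)).+1)) => //; first exact: def_cst.
have h1 := def_shift 2 hX; have h2 := def_shift 2 hn; have h3 := def_shift 2 hN; have h4 := def_var 1; have h0 := def_var 0.
apply: def_add; first by apply: def_mul h4 _; exact: def_cst.
apply: (def_bt h1 h2 h3); apply: def_succ; apply: def_add; first exact: (def_shift 2 ho).
by apply: def_mul; [exact: def_cst | apply: def_sub; [exact: (def_shift 2 hL) | exact: def_succ]].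
Qed.

Lemma defsk_comp s1 s2 : defsk s1 -> defsk s2 -> defsk (fun X n N o => s1 X n N (s2 X n N o)).
Proof. by move=> h1 h2 X n N o hX hn hN ho; apply: h1 => //; exact: h2. Qed.

Lemma defsk_succ s : defsk s -> defsk (fun X n N o => (s X n N o).+1).
Proof. by move=> h X n N o hX hn hN ho; apply: def_succ; exact: h. Qed.

Lemma defsk_id : defsk (fun _ _ _ o => o). Proof. by []. Qed.
Lemma defsk_cst c : defsk (fun _ _ _ _ => c). Proof. by move=> *; exact: def_cst. Qed.

Lemma def_skuid : defsk skuid. Proof. by do 3 apply: (defsk_comp def_sknat); exact: def_sknat. Qed.
Definition skl X n N o := sklist X n N (sknat X n N) o.
Lemma def_skl : defsk skl. Proof. exact: (def_sklist def_sknat). Qed.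
Lemma def_skfd : defsk skfd. Proof. by apply: (defsk_comp def_sknat); apply: (defsk_comp def_skl); exact: def_sknat. Qed.
Lemma def_skopt : defsk skopt.
Proof.
move=> X n N o hX hn hN ho; apply: def_ifb; [exact: def_bt | apply: def_sknat => //; exact: def_succ | exact: def_succ].
Qed.
Lemma def_skmeth : defsk skmeth. Proof. by apply: (defsk_comp def_skopt); apply: (defsk_comp def_skl); exact: def_sknat. Qed.
Lemma def_skatom : defsk skatom. Proof. by apply: (defsk_comp def_skl); exact: def_sknat. Qed.
Lemma def_o2 : defsk (fun X n N _ => o2 X n N). Proof. by apply: (defsk_comp def_skl); exact: defsk_cst. Qed.
Lemma def_o3 : defsk (fun X n N _ => o3 X n N). Proof. by apply: (defsk_comp (def_sklist def_skuid)); exact: def_o2. Qed.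
Lemma def_o4 : defsk (fun X n N _ => o4 X n N). Proof. by apply: (defsk_comp (def_sklist def_skfd)); exact: def_o3. Qed.
Lemma def_o5 : defsk (fun X n N _ => o5 X n N). Proof. by apply: (defsk_comp (def_sklist def_skmeth)); exact: def_o4. Qed.

Section Ctx.
Variables (X n N : seq nat -> nat).
Hypotheses (hX : def X) (hn : def n) (hN : def N).

Lemma lp sk s j : defsk sk -> defsk s -> def j -> def (fun r => lpos (X r) (n r) (N r) (sk (X r) (n r) (N r)) (s (X r) (n r) (N r) 0) (j r)).
Proof. by move=> h1 h2 hj; apply: (def_lpos h1) => //; apply: h2 => //; exact: def_cst. Qed.

Lemma lq sk (o : seq nat -> nat) j : defsk sk -> def o -> def j -> def (fun r => lpos (X r) (n r) (N r) (sk (X r) (n r) (N r)) (o r) (j r)).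
Proof. by move=> h1 h2 hj; exact: (def_lpos h1). Qed.

Lemma natv_eq o a : def o -> def a -> defb (fun r => natv (X r) (n r) (N r) (o r) == a r).
Proof. by move=> ho ha; apply: def_eq => //; exact: def_natv. Qed.

Lemma bt_d o : def o -> defb (fun r => bt (X r) (n r) (N r) (o r)).
Proof. exact: def_bt. Qed.
End Ctx.

Lemma def_szis X n N sk o z : def X -> def n -> def N -> defsk sk -> def o -> def z ->
  defb (fun r => szis (X r) (n r) (N r) (sk (X r) (n r) (N r)) (o r) (z r)).
Proof.
move=> hX hn hN hsk ho hz; apply: def_and; first by apply: def_neg; apply: bt_d => //; exact: lq.
apply: (@def_allb z (fun r i => bt (X r) (n r) (N r) (lpos (X r) (n r) (N r) (sk (X r) (n r) (N r)) (o r) i))) => //.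
have h1 := def_shift 1 hX; have h2 := def_shift 1 hn; have h3 := def_shift 1 hN.
apply: (bt_d h1 h2 h3); apply: (lq h1 h2 h3 hsk); [exact: (def_shift 1 ho) | exact: def_var].
Qed.

Ltac dp := repeat (first
  [ assumption | exact: def_cst | exact: def_sknat | exact: def_skuid | exact: def_skfd | exact: def_skmeth | exact: def_skatom
  | apply: def_and | apply: natv_eq | apply: bt_d | apply: def_neg | apply: def_succ
  | apply: def_szis | apply: def_sknat | apply: def_skl ]).

Section Defx.
Variables (X n N : seq nat -> nat).
Hypotheses (hX : def X) (hn : def n) (hN : def N).
Variables (a b c d : seq nat -> nat).
Hypotheses (ha : def a) (hb : def b) (hc : def c) (hd : def d).

Lemma lo2 j : def j -> def (fun r => lpos (X r) (n r) (N r) (skuid (X r) (n r) (N r)) (o2 (X r) (n r) (N r)) (j r)).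
Proof. exact: (lp hX hn hN def_skuid def_o2). Qed.
Lemma lo3 j : def j -> def (fun r => lpos (X r) (n r) (N r) (skfd (X r) (n r) (N r)) (o3 (X r) (n r) (N r)) (j r)).
Proof. exact: (lp hX hn hN def_skfd def_o3). Qed.
Lemma lo4 j : def j -> def (fun r => lpos (X r) (n r) (N r) (skmeth (X r) (n r) (N r)) (o4 (X r) (n r) (N r)) (j r)).
Proof. exact: (lp hX hn hN def_skmeth def_o4). Qed.
Lemma lo5 j : def j -> def (fun r => lpos (X r) (n r) (N r) (skatom (X r) (n r) (N r)) (o5 (X r) (n r) (N r)) (j r)).
Proof. exact: (lp hX hn hN def_skatom def_o5). Qed.
Lemma lo1 j : def j -> def (fun r => lpos (X r) (n r) (N r) (sknat (X r) (n r) (N r)) 0 (j r)).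
Proof. exact: (lp hX hn hN def_sknat (defsk_cst 0)). Qed.
Lemma lin o j : def o -> def j -> def (fun r => lpos (X r) (n r) (N r) (sknat (X r) (n r) (N r)) (o r) (j r)).
Proof. by move=> h1 h2; exact: (def_lpos def_sknat). Qed.
Lemma lsn o : def o -> def (fun r => sknat (X r) (n r) (N r) (o r)). Proof. exact: def_sknat. Qed.
Lemma lsl o : def o -> def (fun r => sklist (X r) (n r) (N r) (sknat (X r) (n r) (N r)) (o r)). Proof. exact: def_skl. Qed.

Lemma def_x1 : defb (fun r => x1 (X r) (n r) (N r) (a r) (b r) (c r) (d r)).
Proof. have h := def_succ (lo3 ha); apply: def_and; [apply: def_and; [apply: def_and|]|]; [exact: bt_d (lo3 ha) | exact: natv_eq | apply: def_szis => //; [exact: def_sknat | exact: lsn] | apply: natv_eq => //; exact: lsl (lsn h)]. Qed.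
Lemma def_x2 : defb (fun r => x2 (X r) (n r) (N r) (a r) (b r) (c r)).
Proof. have h := lin (lsn (def_succ (lo3 ha))) hb; apply: def_and; [apply: def_and|]; [exact: bt_d (lo3 ha) | exact: bt_d h | apply: natv_eq => //; exact: def_succ]. Qed.
Lemma def_x3 : defb (fun r => x3 (X r) (n r) (N r) (a r) (b r) (c r)).
Proof. have h := def_succ (lo4 ha); apply: def_and; [apply: def_and|]; [exact: bt_d (lo4 ha) | exact: natv_eq | apply: def_szis => //; [exact: def_sknat | exact: lsn]]. Qed.
Lemma def_x4 : defb (fun r => x4 (X r) (n r) (N r) (a r) (b r) (c r)).
Proof. have h := lin (lsn (def_succ (lo4 ha))) hb; apply: def_and; [apply: def_and|]; [exact: bt_d (lo4 ha) | exact: bt_d h | apply: natv_eq => //; exact: def_succ]. Qed.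
Lemma def_x5 : defb (fun r => x5 (X r) (n r) (N r) (a r)).
Proof. have h := def_succ (lo4 ha); apply: def_and; [exact: bt_d (lo4 ha) | apply: def_neg; apply: bt_d => //; exact: lsl (lsn h)]. Qed.
Lemma def_x6 : defb (fun r => x6 (X r) (n r) (N r) (a r) (b r)).
Proof. have h := def_succ (lo5 ha); apply: def_and; [exact: bt_d (lo5 ha) | exact: natv_eq]. Qed.
Lemma def_x7 : defb (fun r => x7 (X r) (n r) (N r) (a r) (b r) (c r)).
Proof. have h := lin (lsn (def_succ (lo5 ha))) hb; apply: def_and; [apply: def_and|]; [exact: bt_d (lo5 ha) | exact: bt_d h | apply: natv_eq => //; exact: def_succ]. Qed.
Lemma def_x8 : defb (fun r => x8 (X r) (n r) (N r) (a r) (b r)).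
Proof. have h := def_succ (lo5 ha); apply: def_and; [exact: bt_d (lo5 ha) | apply: def_szis => //; [exact: def_sknat | exact: lsn]]. Qed.
Lemma def_x9 : defb (fun r => x9 (X r) (n r) (N r) (a r)).
Proof. apply: def_szis => //; [exact: def_skatom | exact: (def_o5 hX hn hN (def_cst 0))]. Qed.
Lemma def_xpos : defb (fun r => xpos (X r) (n r) (N r) (a r) (b r)).
Proof. have h := lo1 ha; apply: def_and; [exact: bt_d h | apply: def_leq; [exact: def_succ | apply: def_natv => //; exact: def_succ]]. Qed.
End Defx.

Lemma def_xJ X n N a : def X -> def n -> def N -> def a -> defb (fun r => xJ (X r) (n r) (N r) (a r)).
Proof.
move=> hX hn hN ha; apply: def_or; first by apply: def_leq => //; apply: def_add => //; exact: def_cst.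
apply: def_or; last by apply: def_eq => //; apply: def_pw => //; exact: def_cst.
apply: (@def_exb n (fun r o => natv (X r) (n r) (N r) o == a r)) => //.
by apply: natv_eq; try exact: (def_shift 1 _); exact: def_var.
Qed.

Lemma def_x0 X n N a b c d : def X -> def n -> def N -> def a -> def b -> def c -> def d ->
  defb (fun r => x0 (X r) (n r) (N r) (a r) (b r) (c r) (d r)).
Proof.
move=> hX hn hN ha hb hc hd.
have kX := def_shift 1 hX; have kn := def_shift 1 hn; have kN := def_shift 1 hN.
have h0 := lo2 kX kn kN (def_var 0); have h := def_succ h0.
apply: (@def_exb n (fun r j => bt (X r) (n r) (N r) (lpos (X r) (n r) (N r) (skuid (X r) (n r) (N r)) (o2 (X r) (n r) (N r)) j) && _ && _ && _ && _)) => //.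
apply: def_and; [apply: def_and; [apply: def_and; [apply: def_and|]|]|].
- exact: (bt_d kX kn kN h0).
- exact: (natv_eq kX kn kN h (def_shift 1 ha)).
- exact: (natv_eq kX kn kN (lsn kX kn kN h) (def_shift 1 hb)).
- exact: (natv_eq kX kn kN (lsn kX kn kN (lsn kX kn kN h)) (def_shift 1 hc)).
- exact: (natv_eq kX kn kN (lsn kX kn kN (lsn kX kn kN (lsn kX kn kN h))) (def_shift 1 hd)).
Qed.

Section Correct.
Variables (x : seq bool) (N : nat).
Notation n := (size x).
Hypothesis hN : 2 ^ (n.+2) <= N.
Notation Bt := (bt (num x) n N). Notation Lpos := (lpos (num x) n N). Notation Sklist := (sklist (num x) n N).
Notation Sknat := (sknat (num x) n N). Notation Natv := (natv (num x) n N).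

Lemma num_rcons s b : num (rcons s b) = 2 * num s + b.
Proof. by rewrite /num -cats1 foldl_cat. Qed.

Lemma num_bit (s : seq bool) i : i < size s -> odd (num s %/ 2 ^ (size s - i.+1)) = nth false s i.
Proof.
elim/last_ind: s => // s b IH; rewrite size_rcons ltnS leq_eqVlt nth_rcons num_rcons => /orP[/eqP->|hi].
  by rewrite ltnn eqxx subnn expn0 divn1 oddD mul2n odd_double; case: b.
rewrite hi -(IH hi) subSn // expnS divnMA; congr (odd (_ %/ _)).
by rewrite mulnC divnMDl // divn_small ?addn0 //; case: b.
Qed.

Lemma nN : n.+2 <= N.
Proof. by apply: leq_trans hN; exact: ltnW (ltn_expl _ _). Qed.

Lemma btE i : Bt i = nth false x i.
Proof.
rewrite /bt /bitat; case: (ltnP i n) => hi; last by rewrite nth_default.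
rewrite pwE // ?num_bit //; apply: leq_trans hN; rewrite leq_exp2l //; lia.
Qed.

(* [at_ o s]: the word [s] occurs in the input at offset [o]. *)
Definition at_ o (s : seq bool) := take (size s) (drop o x) = s.

Lemma at_cat o s1 s2 : at_ o (s1 ++ s2) -> at_ o s1 /\ at_ (o + size s1) s2.
Proof.
rewrite /at_ size_cat => h; split.
  by have := congr1 (take (size s1)) h; rewrite take_takel ?leq_addr // take_size_cat.
by rewrite (addnC o) -drop_drop take_drop [size s2 + _]addnC h drop_size_cat.
Qed.

Lemma at_size o s : at_ o s -> 0 < size s -> o + size s <= n.
Proof. by move=> /(congr1 size); rewrite size_take_min size_drop; lia. Qed.

Lemma at_bit o b s : at_ o (b :: s) -> Bt o = b.
Proof.
move=> h; rewrite btE; have h1 := at_size h isT; rewrite /= in h1.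
by have := congr1 (fun t => nth false t 0) h; rewrite nth_take //= nth_drop addn0.
Qed.

Definition skok T (sk : nat -> nat) (f : T -> seq bool) := forall o a, at_ o (f a) -> o <= n -> sk o = o + size (f a).

Section Lst.
Variables (T : Type) (sk : nat -> nat) (f : T -> seq bool).
Hypothesis hsk : skok sk f.
Notation fl s := (flatten [seq true :: f y | y <- s]).

Lemma enc_split d s j : j < size s ->
  enc_list f s = fl (take j s) ++ ((true :: f (nth d s j)) ++ (fl (drop j.+1 s) ++ [:: false])).
Proof.
elim: s j => // y s IH [|j] hj; first by rewrite /enc_list /= drop0 -catA.
by rewrite /enc_list /= -!catA; congr (_ :: _ ++ _); have := IH j hj; rewrite /enc_list /= -?catA.
Qed.

Lemma lposP o s j : at_ o (enc_list f s) -> Lpos sk o j = o + size (fl (take j s)).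
Proof.
move=> h; have ho := at_size h; rewrite /enc_list size_cat addn1 in ho; have {}ho := ho isT.
elim: j => [|j IH]; first by rewrite take0 addn0 /lpos /=; apply/minn_idPr; have := nN; lia.
have E1 : Lpos sk o j.+1 = minn N (ifb (Bt (Lpos sk o j)) (sk (Lpos sk o j).+1) (Lpos sk o j)) by [].
rewrite E1 IH; case: (ltnP j (size s)) => hj.
  case: s hj h ho {IH} => // y0 s0; set s := y0 :: s0 => hj h ho.
  have es := take_nth y0 hj.
  have e2 := enc_split y0 hj.
  rewrite e2 in h; have [_ h1] := at_cat h; have [h2 _] := at_cat h1.
  have hb := at_size h2 isT; rewrite (at_bit h2) /ifb.
  have [_ h3] := @at_cat _ [:: true] (f (nth y0 s j)) h2; rewrite addn1 in h3.
  rewrite (hsk h3); last by rewrite /= in hb; lia.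
  rewrite es map_rcons flatten_rcons size_cat /= addnA addSnnS.
  by apply/minn_idPr; have := nN; rewrite /= in hb; lia.
rewrite (take_oversize (leqW hj)) (take_oversize hj).
have [_ h1] := at_cat h; rewrite (at_bit h1) /ifb; apply/minn_idPr; have := nN; lia.
Qed.

Lemma lpos_bt o s j : at_ o (enc_list f s) -> Bt (Lpos sk o j) = (j < size s) /\
  forall d, j < size s -> at_ (Lpos sk o j).+1 (f (nth d s j)) /\ (Lpos sk o j).+1 <= n.
Proof.
move=> h; rewrite (lposP j h); case: (ltnP j (size s)) => hj; last first.
  by split=> //; rewrite take_oversize //; have [_ h1] := at_cat h; exact: at_bit h1.
have key d : at_ (o + size (fl (take j s))) (true :: f (nth d s j)).
  have e2 := enc_split d hj.
  by move: h; rewrite e2 => /at_cat[_ /at_cat[]].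
case: s hj h key => // y0 s0 hj h key; split; first exact: at_bit (key y0).
move=> d _; have h1 := key d; have hs := at_size h1 isT; split; last by rewrite /= in hs; lia.
by have [_] := @at_cat _ [:: true] _ h1; rewrite addn1.
Qed.

Lemma size_fl s : size s <= size (fl s).
Proof. by elim: s => //= y s IH; rewrite size_cat; lia. Qed.

Lemma sklistP : skok (Sklist sk) (enc_list f).
Proof.
move=> o s h _; rewrite /sklist (lposP _ h) take_oversize; first by rewrite /enc_list size_cat /=; lia.
have := at_size h; rewrite /enc_list size_cat /= addn1 => /(_ isT); have := size_fl s; lia.
Qed.

Lemma szisP o s z : at_ o (enc_list f s) -> szis (num x) n N sk o z = (z == size s).
Proof.
move=> h; rewrite /szis (lpos_bt _ h).1 -leqNgt; apply/andP/eqP => [[h1 /allbP h2]|->].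
  apply/eqP; rewrite eqn_leq h1 andbT; case: z h2 {h1} => // z h2.
  by have := h2 z (ltnSn z); rewrite (lpos_bt _ h).1.
by split=> //; apply/allbP => i hi; rewrite (lpos_bt _ h).1.
Qed.
End Lst.

Lemma enc_natE v : enc_nat v = enc_list (fun b => [:: b]) (binary v). Proof. by []. Qed.

Lemma bitok : skok succn (fun b : bool => [:: b]). Proof. by move=> o b _ _; rewrite addn1. Qed.

Lemma sknatP : skok Sknat enc_nat. Proof. by move=> o v h ho; rewrite /sknat (sklistP bitok h). Qed.

Definition val2 (s : seq bool) := foldr (fun (b : bool) acc => acc * 2 + b) 0 s.

Lemma val2_lt s : val2 s < 2 ^ size s.
Proof. by elim: s => //= b s IH; rewrite expnS; case: b; lia. Qed.

Lemma val2_bin v : val2 (binary v) = v.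
Proof.
rewrite /binary; suff H f : forall v, v <= f -> val2 (bin_aux f v) = v by exact: H.
elim: f => [|f IH] {}v /=; first by case: v.
case: eqP => [->//|/eqP v0 hv] /=; rewrite IH; last by lia.
by rewrite muln2 addnC odd_double_half.
Qed.

Lemma fl_bits s : size (flatten [seq true :: [:: b] | b <- s]) = 2 * size s.
Proof. by elim: s => //= b s ->; lia. Qed.

Lemma natvP o v : at_ o (enc_nat v) -> o <= n -> Natv o = v.
Proof.
move=> h ho; rewrite /natv (sknatP h ho); set s := binary v.
have hsz : size (enc_nat v) = (2 * size s).+1 by rewrite enc_natE /enc_list size_cat fl_bits addn1.
have -> : (o + size (enc_nat v) - o.+1) %/ 2 = size s by rewrite hsz addnS subSS addKn mulKn.
have hn := at_size h; rewrite hsz in hn; have {}hn := hn isT.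
have hbit j : j < size s -> Bt (o + 2 * j).+1 = nth false s j.
  move=> hj; have [_ /(_ false hj)[h1 _]] := lpos_bt bitok j (s := s) h.
  rewrite (lposP bitok j (s := s) h) fl_bits size_takel // in h1; last exact: ltnW.
  exact: at_bit h1.
suff H k : k <= size s -> iteri k (fun j acc => minn N (acc * 2 + Bt (o + 2 * (size s - j.+1)).+1)) (minn N 0) = val2 (drop (size s - k) s).
  by rewrite H // subnn drop0 val2_bin.
elim: k => [|k IH] hk /=; first by rewrite subn0 drop_size minn0.
rewrite IH ?(ltnW hk) // hbit; last by lia.
rewrite (@drop_nth _ false (size s - k.+1)); last by lia.
rewrite -[(size s - k.+1).+1](_ : size s - k = _) /=; last by lia.
apply/minn_idPr; have h1 := val2_lt (nth false s (size s - k.+1) :: drop (size s - k) s).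
rewrite /= size_drop in h1; apply: leq_trans (ltnW h1) _; apply: leq_trans hN; rewrite leq_exp2l //; lia.
Qed.

(** Holds at every offset, meaningful or not, since at most [n] digits are read. It separates
    [2 ^ n] from all numbers read from the input. *)
Lemma natv_lt o : Natv o < 2 ^ n.
Proof.
rewrite /natv; set L := _ %/ 2; have hL : L <= n.
  have hl k : lpos (num x) n N succn o k <= o + 2 * k.
    elim: k => [|k IH]; first by rewrite addn0 /lpos /= geq_minr.
    have E1 : lpos (num x) n N succn o k.+1 = minn N (ifb (Bt (lpos (num x) n N succn o k)) (lpos (num x) n N succn o k).+2 (lpos (num x) n N succn o k)) by [].
    rewrite E1; apply: leq_trans (geq_minr _ _) _; move: (lpos _ _ _ _ _ _) IH => p IH.
    by rewrite /ifb; case: (Bt p); lia.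
  have h := hl n; have h2 : L <= (2 * n) %/ 2.
    by rewrite /L /sknat /sklist; apply: leq_div2r; move: (lpos _ _ _ _ _ _) h => p h; lia.
  by rewrite mulKn in h2.
suff H k : iteri k (fun j acc => minn N (acc * 2 + Bt (o + 2 * (L - j.+1)).+1)) (minn N 0) < 2 ^ k.
  by apply: leq_trans (H L) _; rewrite leq_exp2l.
elim: k => [|k IH] /=; first by rewrite minn0.
by apply: leq_ltn_trans (geq_minr _ _) _; rewrite expnS; case: (bt _ _ _ _); lia.
Qed.
End Correct.
End Parsing.

(** * Agreement of the parsed facts with schema and query *)

Module InputFacts.
Import all_boot zify.
Import boolp.
Import Defs TapeRegisters LoopCompiler Expressions TopMachine Definable DatalogSyntax DatalogProgram ExtensionalFacts ProgramFacts BoundedSearch Parsing.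

Notation rX r := (nth 0 r 2). Notation rn r := (nth 0 r 3). Notation rN r := (nth 0 r 4).
Definition xg (r : seq nat) t a := mem (eN r) (eY r) (eZ r) (nth 0 r 1) (t :: a).
Definition xJr (r : seq nat) j := xJ (rX r) (rn r) (rN r) j.
Definition xedb (r : seq nat) (t : nat) (a : seq nat) : bool :=
  match t with
  | 0 => x0 (rX r) (rn r) (rN r) (nth 0 a 0) (nth 0 a 1) (nth 0 a 2) (nth 0 a 3)
  | 1 => x1 (rX r) (rn r) (rN r) (nth 0 a 0) (nth 0 a 1) (nth 0 a 2) (nth 0 a 3)
  | 2 => x2 (rX r) (rn r) (rN r) (nth 0 a 0) (nth 0 a 1) (nth 0 a 2)
  | 3 => x3 (rX r) (rn r) (rN r) (nth 0 a 0) (nth 0 a 1) (nth 0 a 2)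
  | 4 => x4 (rX r) (rn r) (rN r) (nth 0 a 0) (nth 0 a 1) (nth 0 a 2)
  | 5 => x5 (rX r) (rn r) (rN r) (nth 0 a 0)
  | 6 => x6 (rX r) (rn r) (rN r) (nth 0 a 0) (nth 0 a 1)
  | 7 => x7 (rX r) (rn r) (rN r) (nth 0 a 0) (nth 0 a 1) (nth 0 a 2)
  | 8 => x8 (rX r) (rn r) (rN r) (nth 0 a 0) (nth 0 a 1)
  | 9 => x9 (rX r) (rn r) (rN r) (nth 0 a 0)
  | 10 => xpos (rX r) (rn r) (rN r) (nth 0 a 0) (nth 0 a 1) && xJr r (nth 0 a 1)
  | 11 => xJr r (nth 0 a 0)
  | 12 => (nth 0 a 1 == (nth 0 a 0).+1) && (xJr r (nth 0 a 0) && xJr r (nth 0 a 1))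
  | 13 | 14 | 15 => xg r t a && all (xJr r) a
  | _ => false
  end.

Lemma def_arg (l : seq trm) i : def (fun r => nth 0 (map (tval (nth 0 r)) l) i).
Proof.
elim: l i => [|u l IH] [|i] /=; try exact: def_cst; last exact: IH.
by case: u => [j|c] /=; [exact: def_var | exact: def_cst].
Qed.

Lemma def_xedb k t l : defb (fun r => xedb (drop k r) t (map (tval (nth 0 r)) l)).
Proof.
have hX := def_shift k (def_var 2); have hn := def_shift k (def_var 3); have hN := def_shift k (def_var 4).
have h0 := def_arg l 0; have h1 := def_arg l 1; have h2 := def_arg l 2; have h3 := def_arg l 3.
have hJ a : def a -> defb (fun r => xJr (drop k r) (a r)) by exact: (def_xJ hX hn hN).
have hall : defb (fun r => all (xJr (drop k r)) (map (tval (nth 0 r)) l)).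
  elim: l {h0 h1 h2 h3} => [|u l IH]; first exact: def_true.
  apply: (@def_and (fun r => xJr (drop k r) (tval (nth 0 r) u))) => //; apply: hJ.
  by case: u => [j|c] /=; [exact: def_var | exact: def_cst].
have hg t' : defb (fun r => xg (drop k r) t' (map (tval (nth 0 r)) l)).
  have := @def_mem _ _ _ _ ((fun _ => t') :: map (fun u r => tval (nth 0 r) u) l) (def_shift k def_eN) (def_shift k def_eY) (def_shift k def_eZ) (def_shift k (def_var 1)).
  move=> H; apply: (def_ext _ (H _)) => [r|f] /=; first by rewrite -map_comp.
  case=> [<-|/List.in_map_iff[[i|c] [<- _]]] /=; [exact: def_cst | exact: def_var | exact: def_cst].
case: t => [|[|[|[|[|[|[|[|[|[|[|[|[|[|[|[|t]]]]]]]]]]]]]]]]; last exact: def_false.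
- exact: (def_x0 hX hn hN h0 h1 h2 h3).
- exact: (def_x1 hX hn hN h0 h1 h2 h3).
- exact: (def_x2 hX hn hN h0 h1 h2).
- exact: (def_x3 hX hn hN h0 h1 h2).
- exact: (def_x4 hX hn hN h0 h1 h2).
- exact: (def_x5 hX hn hN h0).
- exact: (def_x6 hX hn hN h0 h1).
- exact: (def_x7 hX hn hN h0 h1 h2).
- exact: (def_x8 hX hn hN h0 h1).
- exact: (def_x9 hX hn hN h0).
- by apply: def_and; [exact: (def_xpos hX hn hN h0 h1) | exact: hJ].
- exact: hJ.
- by apply: def_and; [apply: def_eq => //; exact: def_succ | apply: def_and; exact: hJ].
- exact: (@def_and (fun r => xg (drop k r) 13 _)).
- exact: (@def_and (fun r => xg (drop k r) 14 _)).
- exact: (@def_and (fun r => xg (drop k r) 15 _)).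
Qed.

(* The guessed relations 13, 14 and 15 are graphs of functions of their first argument. *)
Definition funct t k r := forallv (k + k).+1 (eY r) (fun v =>
  (xg r t (map (nth 0 v) (0 :: iota 1 k)) && xg r t (map (nth 0 v) (0 :: iota k.+1 k))) ==>
  all (fun i => nth 0 v i == nth 0 v (k + i)) (iota 1 k)) [::].

Definition goal_formula (r : seq nat) := closedb xedb prog r ==> xmem r 24 [::].

Section Input.
Variables (S : schema) (q : bcq).
Hypothesis wfS : wf_schema S.
Hypothesis wfq : wf_query S q.
Notation x := (enc_input S q). Notation n := (size x).
Variable N : nat.
Hypothesis hN : 2 ^ (n.+2) <= N.
Notation X := (num x).
Notation J := (xJ X n N).
Notation At := (at_ x).

Notation Natv := (natv X n N). Notation Sk := (sknat X n N). Notation Skl := (sklist X n N (sknat X n N)).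
Notation Lp := (lpos X n N).
Let sn := sknatP hN.

Lemma at_le o s : At o s -> 0 < size s -> o <= n.
Proof. by move=> h hs; have := at_size hN h hs; lia. Qed.

Lemma enc_list_gt0 T (f : T -> seq bool) s : 0 < size (enc_list f s).
Proof. by rewrite /enc_list size_cat addn1. Qed.
Lemma enc_nat_gt0 v : 0 < size (enc_nat v). Proof. exact: enc_list_gt0. Qed.

Lemma fld T sk (f : T -> seq bool) t a o : skok x sk f -> At o (f a ++ t) -> o <= n -> 0 < size t ->
  [/\ At o (f a), At (sk o) t & sk o <= n].
Proof.
move=> hs h ho ht; have [h1 h2] := at_cat h; rewrite -(hs _ _ h1 ho) in h2; split=> //; exact: at_le h2 ht.
Qed.

Lemma skcat T U s1 s2 (f : U -> seq bool) (g : T -> seq bool) p : skok x s1 f -> skok x s2 g -> (forall a, 0 < size (g a)) ->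
  skok x (fun o => s2 (s1 o)) (fun a => f (p a) ++ g a).
Proof.
move=> h1 h2 hg o a h ho; have [k1 k2 k3] := fld h1 h ho (hg a).
by rewrite (h2 _ _ k2 k3) (h1 _ _ k1 ho) size_cat addnA.
Qed.

Lemma cat_gt0 (s t : seq bool) : 0 < size t -> 0 < size (s ++ t).
Proof. by rewrite size_cat addn_gt0 => ->; rewrite orbT. Qed.

Let sl := sklistP hN sn.

Lemma sk_pre T (p : T -> nat) : skok x Sk (fun a => enc_nat (p a)). Proof. by move=> o a; exact: sn. Qed.

Lemma skuidP : skok x (skuid X n N) enc_uid.
Proof.
move=> o u h1 b1.
have [k1 k2 b2] := fld sn h1 b1 ltac:(by do 2 apply: cat_gt0; exact: enc_nat_gt0).
have [k3 k4 b3] := fld sn k2 b2 ltac:(by apply: cat_gt0; exact: enc_nat_gt0).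
have [k5 k6 b4] := fld sn k4 b3 (enc_nat_gt0 _).
by rewrite /skuid (sn k6 b4) (sn k5 b3) (sn k3 b2) (sn k1 b1) /enc_uid !size_cat !addnA.
Qed.

Lemma skfdP : skok x (skfd X n N) enc_fd.
Proof.
move=> o u h1 b1.
have [k1 k2 b2] := fld sn h1 b1 ltac:(by apply: cat_gt0; exact: enc_nat_gt0).
have [k3 k4 b3] := fld sl k2 b2 (enc_nat_gt0 _).
by rewrite /skfd (sn k4 b3) (sl k3 b2) (sn k1 b1) /enc_fd !size_cat !addnA.
Qed.

Lemma skoptP : skok x (skopt X n N) (enc_option enc_nat).
Proof.
move=> o [v|] h ho; rewrite /skopt (at_bit hN h) /= ?addn1 //.
have [_ h2] := @at_cat x o [:: true] (enc_nat v) h; rewrite addn1 in h2.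
by rewrite (sn h2 (at_le h2 (enc_nat_gt0 v))) addSnnS.
Qed.

Lemma opt_gt0 (o : option nat) : 0 < size (enc_option enc_nat o). Proof. by case: o. Qed.

Lemma skmethP : skok x (skmeth X n N) enc_method.
Proof.
move=> o u h1 b1.
have [k1 k2 b2] := fld sn h1 b1 ltac:(by apply: cat_gt0; exact: opt_gt0).
have [k3 k4 b3] := fld sl k2 b2 (opt_gt0 _).
by rewrite /skmeth (skoptP k4 b3) (sl k3 b2) (sn k1 b1) /enc_method !size_cat !addnA.
Qed.

Lemma skatomP : skok x (skatom X n N) enc_atom.
Proof.
by apply: (skcat (p := fst) sn (fun o a => sl (a := a.2))) => a; exact: enc_list_gt0.
Qed.

Lemma at_input : [/\ At 0 (enc_list enc_nat (s_ar S)), At (o2 X n N) (enc_list enc_uid (s_uid S)),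
  At (o3 X n N) (enc_list enc_fd (s_fd S)), At (o4 X n N) (enc_list enc_method (s_meth S)) & At (o5 X n N) (enc_list enc_atom q)].
Proof.
have h : At 0 (enc_list enc_nat (s_ar S) ++ enc_list enc_uid (s_uid S) ++ enc_list enc_fd (s_fd S) ++ enc_list enc_method (s_meth S) ++ enc_list enc_atom q).
  by rewrite /at_ drop0 /enc_input /enc_schema -!catA take_size.
have [h1 k1 b1] := fld sl h (leq0n _) ltac:(by do 3 apply: cat_gt0; exact: enc_list_gt0).
have [h2 k2 b2] := fld (sklistP hN skuidP) k1 b1 ltac:(by do 2 apply: cat_gt0; exact: enc_list_gt0).
have [h3 k3 b3] := fld (sklistP hN skfdP) k2 b2 ltac:(by apply: cat_gt0; exact: enc_list_gt0).
have [h4 k4 b4] := fld (sklistP hN skmethP) k3 b3 (enc_list_gt0 _ _).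
by split.
Qed.

Lemma JP o v : At o (enc_nat v) -> J v.
Proof.
move=> h; have hs := at_size hN h (enc_nat_gt0 v); have h0 := enc_nat_gt0 v.
apply/orP; right; apply/orP; left; apply/exbP; exists o; first by lia.
by rewrite (natvP hN h) //; lia.
Qed.

Lemma val_lt o v : At o (enc_nat v) -> v < 2 ^ n.
Proof. by move=> h; rewrite -(natvP hN h (at_le h (enc_nat_gt0 v))); exact: (natv_lt hN o). Qed.

Lemma enc_list_size T (f : T -> seq bool) s : (size s).+1 <= size (enc_list f s).
Proof. by rewrite /enc_list size_cat addn1 ltnS; elim: s => //= y s IH; rewrite size_cat; lia. Qed.

Lemma size_at T (f : T -> seq bool) o s : At o (enc_list f s) -> size s < n.
Proof. by move=> h; have := at_size hN h (enc_list_gt0 f s); have := enc_list_size f s; lia. Qed.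

Lemma J_le i : i <= n + 50 -> J i. Proof. by move=> h; rewrite /xJ h. Qed.

Lemma nats_at o l i : At o (enc_list enc_nat l) -> bt X n N (Lp Sk o i) = (i < size l) /\
  (i < size l -> [/\ Natv (Lp Sk o i).+1 = nth 0 l i, J (nth 0 l i), nth 0 l i < 2 ^ n & J i]).
Proof.
move=> h; have [e H] := lpos_bt hN sn i h; split=> // hi; have [h1 h2] := H 0 hi.
split; [exact: (natvP hN h1 h2) | exact: JP h1 | exact: val_lt h1 | apply: J_le; have := size_at h; lia].
Qed.

Lemma uid_at j : bt X n N (Lp (skuid X n N) (o2 X n N) j) = (j < size (s_uid S)) /\
  forall d, j < size (s_uid S) -> let p := (Lp (skuid X n N) (o2 X n N) j).+1 in let u := nth d (s_uid S) j in
  [/\ (Natv p = u_src u) /\ J (u_src u), (Natv (Sk p) = u_spos u) /\ (J (u_spos u) /\ u_spos u < 2 ^ n), (Natv (Sk (Sk p)) = u_tgt u) /\ J (u_tgt u)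
   & (Natv (Sk (Sk (Sk p))) = u_tpos u) /\ J (u_tpos u)].
Proof.
have [_ h _ _ _] := at_input; have [e H] := lpos_bt hN skuidP j h; split=> // d hj; have [h1 b1] := H d hj.
have [k1 k2 b2] := fld sn h1 b1 ltac:(by do 2 apply: cat_gt0; exact: enc_nat_gt0).
have [k3 k4 b3] := fld sn k2 b2 ltac:(by apply: cat_gt0; exact: enc_nat_gt0).
have [k5 k6 b4] := fld sn k4 b3 (enc_nat_gt0 _).
by split; split; try (exact: natvP); try (exact: JP); try (by split; [exact: JP k3 | exact: val_lt k3]);
  first [exact: (natvP hN k1 b1) | exact: (JP k1) | exact: (natvP hN k3 b2) | exact: (natvP hN k5 b3) | exact: (JP k5) | exact: (natvP hN k6 b4) | exact: (JP k6)].
Qed.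

Lemma fd_at k : bt X n N (Lp (skfd X n N) (o3 X n N) k) = (k < size (s_fd S)) /\
  (k < size (s_fd S) -> let p := fdp X n N k in let f := nfd S k in
  [/\ Natv p = f_rel f, At (Sk p) (enc_list enc_nat (f_lhs f)), Natv (Skl (Sk p)) = f_rhs f, J (f_rel f)
   & [/\ J (f_rhs f), f_rhs f < 2 ^ n & J k]]).
Proof.
have [_ _ h _ _] := at_input; have [e H] := lpos_bt hN skfdP k h; split=> // hj; have [h1 b1] := H dfd hj.
have [k1 k2 b2] := fld sn h1 b1 ltac:(by apply: cat_gt0; exact: enc_nat_gt0).
have [k3 k4 b3] := fld sl k2 b2 (enc_nat_gt0 _).
split=> //; [exact: (natvP hN k1 b1) | exact: (natvP hN k4 b3) | exact: (JP k1) |].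
split; [exact: (JP k4) | exact: (val_lt k4) | apply: J_le; have := size_at h; lia].
Qed.

Lemma meth_at k : bt X n N (Lp (skmeth X n N) (o4 X n N) k) = (k < size (s_meth S)) /\
  (k < size (s_meth S) -> let p := mp X n N k in let m := nmeth S k in
  [/\ Natv p = m_rel m, At (Sk p) (enc_list enc_nat (m_in m)), bt X n N (Skl (Sk p)) = (m_bound m != None), J (m_rel m) & J k]).
Proof.
have [_ _ _ h _] := at_input; have [e H] := lpos_bt hN skmethP k h; split=> // hj; have [h1 b1] := H dmeth hj.
have [k1 k2 b2] := fld sn h1 b1 ltac:(by apply: cat_gt0; exact: opt_gt0).
have [k3 k4 b3] := fld sl k2 b2 (opt_gt0 _).
split=> //; [exact: (natvP hN k1 b1) | | exact: (JP k1) | apply: J_le; have := size_at h; lia].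
by rewrite /nmeth; case: (m_bound _) k4 => [v|] k4; exact: (at_bit hN k4).
Qed.

Lemma atom_at k : bt X n N (Lp (skatom X n N) (o5 X n N) k) = (k < size q) /\
  (k < size q -> let p := ap X n N k in let a := natm q k in
  [/\ Natv p = a.1, At (Sk p) (enc_list enc_nat a.2), J a.1 & J k]).
Proof.
have [_ _ _ _ h] := at_input; have [e H] := lpos_bt hN skatomP k h; split=> // hj; have [h1 b1] := H datm hj.
have [k1 k2 b2] := fld sn h1 b1 (enc_list_gt0 _ _).
split=> //; [exact: (natvP hN k1 b1) | exact: (JP k1) | apply: J_le; have := size_at h; lia].
Qed.

Definition ear t := nth 0 [:: 4; 4; 3; 3; 3; 1; 2; 3; 2; 1; 2; 1; 2; 4; 6; 8] t.

Lemma xedbE s w t a : size a = ear t -> t < 16 -> xedb [:: s; w; X; n; N] t a = sedb S q J (xg [:: s; w; X; n; N]) t a.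
Proof.
case: t => [|[|[|[|[|[|[|[|[|[|[|[|[|[|[|[|t]]]]]]]]]]]]]]]]; last (by []); rewrite /ear /=.
- case: a => [|us [|up [|ut [|tp [|? ?]]]]] // _ _; apply/exbP/(has_nthP (UID 0 0 0 0)) => /= [[j hj]|[j hj]]; have [e H] := uid_at j.
    rewrite /nth e -!andbA => /andP[h1]; have [[-> _] [-> _] [-> _] [-> _]] := H (UID 0 0 0 0) h1; by exists j.
  have [_ h2 _ _ _] := at_input; have := size_at h2 => hs; exists j; first by lia.
  by rewrite e hj; have [[-> _] [-> _] [-> _] [-> _]] := H (UID 0 0 0 0) hj; rewrite -!andbA.
- case: a => [|k [|R [|z [|r [|? ?]]]]] // _ _; rewrite /x1 /=; have [-> H] := fd_at k; case: ltnP H => //= hk /(_ isT)[-> h -> _ _].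
  by rewrite (szisP hN sn _ h) [z == _]eq_sym -andbA.
- case: a => [|k [|i [|d [|? ?]]]] // _ _; rewrite /x2 /=; have [-> H] := fd_at k; case: ltnP H => //= hk /(_ isT)[_ h _ _ _].
  by have [-> H2] := nats_at i h; case: ltnP H2 => //= hi /(_ isT)[-> _ _ _].
- case: a => [|k [|R [|z [|? ?]]]] // _ _; rewrite /x3 /=; have [-> H] := meth_at k; case: ltnP H => //= hk /(_ isT)[-> h _ _ _].
  by rewrite (szisP hN sn _ h) [z == _]eq_sym.
- case: a => [|k [|i [|d [|? ?]]]] // _ _; rewrite /x4 /=; have [-> H] := meth_at k; case: ltnP H => //= hk /(_ isT)[_ h _ _ _].
  by have [-> H2] := nats_at i h; case: ltnP H2 => //= hi /(_ isT)[-> _ _ _].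
- case: a => [|k [|? ?]] // _ _; rewrite /x5 /=; have [-> H] := meth_at k; case: ltnP H => //= hk /(_ isT)[_ _ -> _ _].
  by rewrite negbK.
- case: a => [|k [|R [|? ?]]] // _ _; rewrite /x6 /=; have [-> H] := atom_at k; case: ltnP H => //= hk /(_ isT)[-> _ _ _] //.
- case: a => [|k [|i [|d [|? ?]]]] // _ _; rewrite /x7 /=; have [-> H] := atom_at k; case: ltnP H => //= hk /(_ isT)[_ h _ _].
  by have [-> H2] := nats_at i h; case: ltnP H2 => //= hi /(_ isT)[-> _ _ _].
- case: a => [|k [|z [|? ?]]] // _ _; rewrite /x8 /=; have [-> H] := atom_at k; case: ltnP H => //= hk /(_ isT)[_ h _ _].
  by rewrite (szisP hN sn _ h) [z == _]eq_sym.
- case: a => [|z [|? ?]] // _ _; rewrite /x9 /=; have [_ _ _ _ h] := at_input; exact: (szisP hN skatomP z h).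
- case: a => [|R [|j [|? ?]]] // _ _; rewrite /xpos /=; have [h _ _ _ _] := at_input; have [-> H] := nats_at R h.
  by rewrite /is_pos /is_rel /arity; case: ltnP H => //= hR /(_ isT)[-> _ _ _].
- by case: a => [|j [|? ?]].
- by case: a => [|i [|i' [|? ?]]].
- by [].
- by [].
- by [].
Qed.

Lemma size_sum T (f : T -> seq bool) (F : T -> nat) s : (forall a, F a <= size (f a)) -> \sum_(a <- s) F a <= size (enc_list f s).
Proof.
move=> h; rewrite /enc_list size_cat; apply: leq_trans (leq_addr _ _).
by elim: s => [|a s IH]; rewrite ?big_nil // big_cons /= size_cat; have := h a; lia.
Qed.

(** Every position mentioned in the input is below [2 ^ n], so [2 ^ n] is fresh; list indices are
    bounded by the length of the encoding. *)
Lemma adm : admissible S q J (2 ^ n).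
Proof.
have p2 : pw N 2 n = 2 ^ n by apply: pwE => //; apply: leq_trans hN; rewrite leq_exp2l //; lia.
split.
- move=> t a ht; case: t ht => [|[|[|[|[|[|[|[|[|[|t]]]]]]]]]] // _ /=.
  + case: a => [|us [|up [|ut [|tp [|? ?]]]]] // /(has_nthP (UID 0 0 0 0))[j hj /and4P[/eqP<- /eqP<- /eqP<- /eqP<-]].
    have [_ H] := uid_at j; have [[_ e1] [_ [e2 _]] [_ e3] [_ e4]] := H (UID 0 0 0 0) hj; by rewrite /= e1 e2 e3 e4.
  + case: a => [|k [|R [|z [|r [|? ?]]]]] // /and4P[hk /eqP<- /eqP<- /eqP<-].
    have [_ /(_ hk)[_ h _ h1 [h2 _ h3]]] := fd_at k; rewrite /= h1 h2 h3 !andbT /= J_le //; have := size_at h; lia.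
  + case: a => [|k [|i [|d [|? ?]]]] // /and3P[hk hi /eqP<-]; have [_ /(_ hk)[_ h _ _ [_ _ h3]]] := fd_at k.
    by have [_ /(_ hi)[_ h4 _ h5]] := nats_at i h; rewrite /= h3 h4 h5.
  + case: a => [|k [|R [|z [|? ?]]]] // /and3P[hk /eqP<- /eqP<-].
    have [_ /(_ hk)[_ h _ h1 h3]] := meth_at k; rewrite /= h1 h3 !andbT /= J_le //; have := size_at h; lia.
  + case: a => [|k [|i [|d [|? ?]]]] // /and3P[hk hi /eqP<-]; have [_ /(_ hk)[_ h _ _ h3]] := meth_at k.
    by have [_ /(_ hi)[_ h4 _ h5]] := nats_at i h; rewrite /= h3 h4 h5.
  + case: a => [|k [|? ?]] // /andP[hk _]; by have [_ /(_ hk)[_ _ _ _ h3]] := meth_at k; rewrite /= h3.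
  + case: a => [|k [|R [|? ?]]] // /andP[hk /eqP<-]; by have [_ /(_ hk)[_ _ h1 h3]] := atom_at k; rewrite /= h1 h3.
  + case: a => [|k [|i [|d [|? ?]]]] // /and3P[hk hi /eqP<-]; have [_ /(_ hk)[_ h _ h3]] := atom_at k.
    by have [_ /(_ hi)[_ h4 _ h5]] := nats_at i h; rewrite /= h3 h4 h5.
  + case: a => [|k [|z [|? ?]]] // /andP[hk /eqP<-]; have [_ /(_ hk)[_ h _ h3]] := atom_at k.
    rewrite /= h3 andbT /= J_le //; have := size_at h; lia.
  + case: a => [|z [|? ?]] // /eqP->; have [_ _ _ _ h] := at_input; rewrite /= andbT J_le //; have := size_at h; lia.
- move=> i hi; apply: J_le; apply: leq_trans hi _; rewrite leq_add2r.
  have h1 := @size_sum _ enc_atom (fun a => (size a.2).+1) q (fun a => ltac:(rewrite /enc_atom size_cat; have := enc_list_size enc_nat a.2; lia)).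
  have h2 := @size_sum _ enc_fd (fun a => (size (f_lhs a)).+1) (s_fd S) (fun a => ltac:(apply: leq_trans (enc_list_size enc_nat (f_lhs a)) _; rewrite /enc_fd size_cat (size_cat (enc_list enc_nat (f_lhs a))); lia)).
  have h3 := @size_sum _ enc_method (fun a => (size (m_in a)).+1) (s_meth S) (fun a => ltac:(apply: leq_trans (enc_list_size enc_nat (m_in a)) _; rewrite /enc_method size_cat (size_cat (enc_list enc_nat (m_in a))); lia)).
  rewrite /enc_input /enc_schema; move: (enc_list enc_atom q) (enc_list enc_fd (s_fd S)) (enc_list enc_method (s_meth S)) h1 h2 h3 => A B C h1 h2 h3; rewrite !size_cat; lia.
- by apply/orP; right; apply/orP; right; rewrite p2.
- move=> m i /and3P[hk hi /eqP e]; have [_ /(_ hk)[_ h _ _ _]] := meth_at m.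
  by have [_ /(_ hi)[_ _]] := nats_at i h; rewrite e ltnn.
- move=> k R sz /and4P[hk _ _ /eqP e]; have [_ /(_ hk)[_ _ _ _ [_ ]]] := fd_at k; by rewrite e ltnn.
- move=> R T i /(has_nthP (UID 0 0 0 0))[j hj /and4P[_ /eqP e _ _]].
  have [_ H] := uid_at j; have [_ [_ [_ hl]] _ _] := H (UID 0 0 0 0) hj; by move: hl; rewrite e ltnn.
Qed.

Definition Jlist := iota 0 (n + 51) ++ [seq Natv o | o <- iota 0 n] ++ [:: 2 ^ n].

Lemma J_Jlist j : J j -> j \in Jlist.
Proof.
have p2 : pw N 2 n = 2 ^ n by apply: pwE => //; apply: leq_trans hN; rewrite leq_exp2l //; lia.
rewrite /xJ !mem_cat => /orP[h|/orP[/exbP[o ho /eqP<-]|/eqP->]].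
- by rewrite mem_iota; apply/orP; left; lia.
- by apply/orP; right; apply/orP; left; apply: map_f; rewrite mem_iota.
- by rewrite p2 inE eqxx !orbT.
Qed.

Lemma Jlist_lt j : j \in Jlist -> j < 2 ^ n + n + 60.
Proof.
rewrite !mem_cat mem_iota inE => /orP[|/orP[/mapP[o _ ->]|/eqP->]]; [lia | have := natv_lt hN o; lia | lia].
Qed.
End Input.
End InputFacts.

(** * The decision formula and its running time *)

Import all_boot zify.
Import boolp.
Import Defs TapeRegisters LoopCompiler Expressions TopMachine Definable DatalogSyntax DatalogProgram ExtensionalFacts ProgramFacts Soundness Completeness5 BoundedSearch Parsing InputFacts.

Lemma eval_nth e r r' : (forall i, nth 0 r i = nth 0 r' i) -> eval e r = eval e r'.
Proof.
elim: e r r' => /= [i|c|a IHa b IHb|a IHa b IHb|a IHa b IHb|b IHb n IHn i IHi e IHe] r r' H //; rewrite ?(IHa _ _ H) ?(IHb _ _ H) //.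
rewrite (IHn _ _ H) (IHi _ _ H); apply: eq_iteri => j acc; congr (minn _ _).
by apply: IHe => -[|[|k]] /=.
Qed.

Lemma def_xg t k l : defb (fun r => xg (drop k r) t (map (nth 0 r) l)).
Proof.
have := @def_mem _ _ _ _ ((fun _ => t) :: map (fun i r => nth 0 r i) l) (def_shift k def_eN) (def_shift k def_eY) (def_shift k def_eZ) (def_shift k (def_var 1)).
move=> H; apply: (def_ext _ (H _)) => [r|f] /=; first by rewrite -map_comp.
case=> [<-|/List.in_map_iff[i [<- _]]] /=; [exact: def_cst | exact: def_var].
Qed.

Lemma def_funct t k : defb (funct t k).
Proof.
set K := (k + k).+1.
have := @def_forallv K eY (fun r v => (xg r t (map (nth 0 v) (0 :: iota 1 k)) && xg r t (map (nth 0 v) (0 :: iota k.+1 k))) ==> all (fun i => nth 0 v i == nth 0 v (k + i)) (iota 1 k)) 0 def_eY.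
rewrite addn0 => H; apply: (def_ext _ (H _)); first by move=> r; rewrite drop0 cats0 take0.
have hall l : defb (fun r => all (fun i => nth 0 r i == nth 0 r (k + i)) l).
  elim: l => [|i l IH]; first exact: def_true.
  by apply: (@def_and (fun r => nth 0 r i == nth 0 r (k + i))) => //; apply: def_eq; exact: def_var.
apply: (def_ext _ (def_imp (def_and (def_xg t K (0 :: iota 1 k)) (def_xg t K (0 :: iota k.+1 k))) (hall (iota 1 k)))) => r.
have E l : all (fun i => i < K) l -> map (nth 0 (take K (r ++ nseq K 0))) l = map (nth 0 r) l.
  by move/allP=> h; apply/eq_in_map => i /h hi; rewrite nth_take_pad.
rewrite !E; first last.
- by apply/allP => i; rewrite inE mem_iota /K => /orP[/eqP->|]; lia.
- by apply/allP => i; rewrite inE mem_iota /K => /orP[/eqP->|]; lia.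
congr (nat_of_bool (_ ==> _)); apply: eq_in_all => i; rewrite mem_iota => hi; rewrite !nth_take_pad /K //; lia.
Qed.

Lemma functP t k r a b c : funct t k r -> size b = k -> size c = k ->
  all (fun i => i < eY r) (a :: b) -> all (fun i => i < eY r) (a :: c) -> xg r t (a :: b) -> xg r t (a :: c) -> b = c.
Proof.
move=> /forallvP H hb hc hab hac xb xc.
have hall : all (fun i => i < eY r) (a :: b ++ c).
  by rewrite -cat_cons all_cat hab; have [_ h] := andP hac; exact: h.
have hsz : size (a :: b ++ c) = (k + k).+1 by rewrite /= size_cat hb hc.
have := H _ hsz hall; rewrite cats0 /=.
have -> : map (nth 0 (a :: b ++ c)) (iota 1 k) = b.
  apply: (@eq_from_nth _ 0); first by rewrite size_map size_iota.
  by move=> i; rewrite size_map size_iota => hi; rewrite (nth_map 0) ?size_iota // nth_iota //= nth_cat hb hi.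
have -> : map (nth 0 (a :: b ++ c)) (iota k.+1 k) = c.
  apply: (@eq_from_nth _ 0); first by rewrite size_map size_iota.
  move=> i; rewrite size_map size_iota => hi; rewrite (nth_map 0) ?size_iota // nth_iota // addSn /= nth_cat hb.
  by rewrite ltnNge leq_addr addKn.
rewrite xb xc => /allP h; apply: (@eq_from_nth _ 0); first by rewrite hb.
move=> i hi; have hik : i < k by rewrite -hb.
have hm : i.+1 \in iota 1 k by rewrite mem_iota; lia.
have /eqP := h _ hm; rewrite addnS /= !nth_cat hb hik.
have -> : (k + i < k) = false by lia.
by rewrite addKn.
Qed.

(** Where the coded relation gives no value the function is arbitrary: a total guess only adds
    extensional facts. *)
Lemma funct_fun t k r : funct t k r -> exists F, forall a c, size c = k -> all (fun i => i < eY r) (a :: c) -> xg r t (a :: c) -> F a = c.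
Proof.
move=> H.
have /choice[F HF] : forall a, exists b, forall c, size c = k -> all (fun i => i < eY r) (a :: c) -> xg r t (a :: c) -> b = c.
  move=> a; case: (pselect (exists c, [/\ size c = k, all (fun i => i < eY r) (a :: c) & xg r t (a :: c)])) => [[b [h1 h2 h3]]|h].
    by exists b => c h4 h5 h6; exact: (functP H h1 h4 h2 h5 h3 h6).
  by exists [::] => c h4 h5 h6; case: h; exists c.
by exists F.
Qed.

Definition body (r : seq nat) := funct 13 3 r && (funct 14 5 r && (funct 15 7 r && goal_formula r)).
(** The goal lies in the least model iff it lies in every closed set. With sets coded by numbers,
    this is one existential quantifier for the guess and one universal quantifier for the closed
    set. *)
Definition formula (r : seq nat) := exb (nth 0 r 2) (fun w => allb (nth 0 r 2) (fun s => body [:: s, w & r])).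

Lemma def_body : defb body.
Proof.
apply: def_and; first exact: def_funct. apply: def_and; first exact: def_funct. apply: def_and; first exact: def_funct.
apply: def_imp; first exact: (def_closedb def_xedb).
by apply: (def_ext _ (def_xmem 0 24 [::])) => r; rewrite drop0.
Qed.

Lemma def_formula : defb formula.
Proof.
apply: (@def_exb (fun r => nth 0 r 2) (fun r w => allb (nth 0 r 2) (fun s => body [:: s, w & r]))); first exact: def_var.
apply: (@def_allb (fun r => nth 0 (drop 1 r) 2) (fun r s => body [:: s, nth 0 r 0 & drop 1 r])).
  exact: (def_shift 1 (def_var 2)).
have [e He] := def_body; exists e => r; rewrite -He; apply: eval_nth => -[|[|i]] //=; by rewrite !nth_drop.
Qed.

Lemma all_In T (p : T -> bool) (s : seq T) : (forall x, List.In x s -> p x) -> all p s.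
Proof. by elim: s => //= y s IH H; rewrite H ?IH //; [move=> x hx; apply: H; right | left]. Qed.

Lemma foldr_maxn_In T (f : T -> nat) (s : seq T) x : List.In x s -> f x <= foldr maxn 0 (map f s).
Proof. by elim: s => //= y s IH [->|/IH h]; rewrite leq_max ?leqnn // h orbT. Qed.

(** Cuts an assignment down to values below [Y]; a variable whose value changes does not occur in
    [l]. *)
Lemma tval_bounded Y k v l : foldr maxn 0 (map tmax l) <= k -> all (fun x => x < Y) (tvals v l) ->
  map (tval (nth 0 (mkseq (fun i => if v i < Y then v i else 0) k))) l = tvals v l.
Proof.
elim: l => //= t l IH; rewrite geq_max => /andP[ht /IH h] /andP[hv /h ->].
by case: t ht hv => [i|c] //= hi hv; rewrite nth_mkseq // hv.
Qed.

Lemma prog_edb : all (fun c => all (fun a : datom => (a.1 < 16) && (size a.2 == ear a.1)) (c_edb c)) prog.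
Proof. by vm_compute. Qed.
Lemma prog_safe : all safe_clause prog && all smallK prog.
Proof. by vm_compute. Qed.

Section Equiv.
Variables (S : schema) (q : bcq).
Hypothesis wfS : wf_schema S.
Hypothesis wfq : wf_query S q.
Notation x := (enc_input S q). Notation n := (size x).
Variable N : nat.
Hypothesis hN : 2 ^ (n.+2) <= N.
Notation X := (num x).
Notation J := (xJ X n N).
Notation Jl := (Jlist S q N).
Let Y := 2 ^ n + n + 60.
Let Z := Y ^ 13.
Hypothesis NE : Z ^ (25 * (size Jl).+1 ^ 10) <= N.
Notation R := (fun s w => [:: s; w; X; n; N]).

Lemma eY_E s w : eY (R s w) = Y.
Proof.
have p2 : pw N 2 n = 2 ^ n by apply: pwE => //; apply: leq_trans hN; rewrite leq_exp2l //; lia.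
by rewrite /eY /eN /= p2.
Qed.

Lemma eZ_E s w : eZ (R s w) = Z.
Proof.
have h : pw N Y 13 = Y ^ 13.
  apply: pwE; first by rewrite /Y; lia.
  apply: leq_trans NE; rewrite -/Z -{1}[Z]expn1; apply: leq_pexp2l; first by rewrite /Z expn_gt0 /Y; lia.
  by rewrite muln_gt0 expn_gt0.
by rewrite /eZ eY_E; exact: h.
Qed.

Lemma sedb_mono (g g' : nat -> seq nat -> bool) t a :
  (forall t a, 12 < t -> t < 16 -> size a = ear t -> all J a -> g t a -> g' t a) -> t < 16 -> size a = ear t ->
  sedb S q J g t a -> sedb S q J g' t a.
Proof.
move=> H ht hs; case: t ht hs => [|[|[|[|[|[|[|[|[|[|[|[|[|[|[|[|t]]]]]]]]]]]]]]]] // _ hs;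
 by move=> /andP[h1 h2]; apply/andP; split=> //; apply: H.
Qed.

Lemma Hadm : admissible S q J (2 ^ n).
Proof. by first [exact: (adm hN) | exact: (adm wfS wfq hN) | exact: (adm wfS hN)]. Qed.

Lemma xedb_sedb s w t a : size a = ear t -> t < 16 -> xedb (R s w) t a = sedb S q J (xg (R s w)) t a.
Proof. by move=> h1 h2; first [exact: (xedbE hN) | exact: (xedbE wfS wfq hN) | exact: (xedbE wfS hN)]. Qed.

Lemma sedb_Jl (g : nat -> seq nat -> bool) t a : sedb S q J g t a -> {subset a <= Jl}.
Proof.
move=> h; suff /allP hJ : all J a by move=> y /hJ; exact: (J_Jlist hN).
case: (ltnP t 10) => ht.
  by apply: (adm_edb Hadm ht); case: t ht h => [|[|[|[|[|[|[|[|[|[|t]]]]]]]]]].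
case: t ht h => [|[|[|[|[|[|[|[|[|[|[|[|[|[|[|[|t]]]]]]]]]]]]]]]] // _; try by case/andP.
- case: a => [|y [|j [|? ?]]] // /andP[h1 h2]; apply/andP; split; last by apply/andP.
  have [h _ _ _ _] := at_input hN; have hs := size_at hN h.
  by move: h1; rewrite /is_pos /is_rel => /andP[h1 _]; rewrite /xJ; apply/orP; left; lia.
- by case: a => [|y [|? ?]] // h; apply/andP.
- case: a => [|y [|z [|? ?]]] // /and3P[_ h1 h2]; apply/andP; split=> //; exact/andP.
Qed.

Lemma J_small i : i <= 4 -> i \in Jl.
Proof. by move=> h; apply: (J_Jlist hN); rewrite /xJ; apply/orP; left; lia. Qed.
Lemma Jl_Y i : i \in Jl -> i < Y. Proof. exact: (Jlist_lt hN). Qed.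
Lemma Y24 : 24 < Y. Proof. by rewrite /Y; lia. Qed.

Lemma allY a : {subset a <= Jl} -> all (fun i => i < Y) a.
Proof. by move=> h; apply/allP => i /h /Jl_Y. Qed.

Lemma mem_eq s w t a w' : mem (eN (R s w)) (eY (R s w)) (eZ (R s w)) w' (t :: a) = mem N Y Z w' (t :: a).
Proof. by rewrite eY_E eZ_E. Qed.

(** The set of facts derivable with the guess read off [w] is itself one of the numbers [s]. It is
    closed, so the formula puts the goal into it. *)
Lemma formula_dGoal : formula [:: X; n; N] -> exists lf kf nf, dGoal (sedb S q J (guess lf kf nf)).
Proof.
move=> /exbP[w _ /allbP H].
have N0 : 0 < N by apply: leq_trans hN; rewrite expn_gt0.
(* The conjuncts about the guess do not involve [s], so they can be read at [s = 0]. *)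
have := H 0 N0; rewrite /body => /and4P[f13 f14 f15 _].
have [F3 H3] := funct_fun f13; have [F4 H4] := funct_fun f14; have [F5 H5] := funct_fun f15.
rewrite eY_E in H3; rewrite eY_E in H4; rewrite eY_E in H5.
pose lf v := (nth 0 (F3 v) 0, nth 0 (F3 v) 1, nth 0 (F3 v) 2).
pose kf v := (nth 0 (F4 v) 0, (nth 0 (F4 v) 1, nth 0 (F4 v) 2, nth 0 (F4 v) 3), nth 0 (F4 v) 4).
pose nf v := (nth 0 (F5 v) 0, (nth 0 (F5 v) 1, nth 0 (F5 v) 2, nth 0 (F5 v) 3), nth 0 (F5 v) 4, nth 0 (F5 v) 5, nth 0 (F5 v) 6).
exists lf, kf, nf; set edb := sedb _ _ _ _.
have edbJl : forall t a, edb t a -> {subset a <= Jl} by move=> t a; exact: sedb_Jl.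
have [s hs Hs] := set_exists prog_safe Jl_Y Y24 (erefl Z) NE
  (Pb := fun t a => `[< dl prog edb t a >]) (fun t a h => dl_bounded prog_safe edbJl J_small (asboolW h)).
have := H s hs; rewrite /body => /and4P[_ _ _]; rewrite /goal_formula => /implyP G.
have xm t a : t < Y -> all (fun i => i < Y) a -> xmem (R s w) t a = `[< dl prog edb t a >].
  by move=> ht ha; rewrite /xmem mem_eq Hs.
suff hcl : closedb xedb prog (R s w).
  by move: (G hcl); rewrite (xm 24 [::] Y24 isT) => /asboolP h; exact: h.
rewrite /closedb; apply: all_In => c hc; apply/forallvP => u hu; rewrite eY_E cats0 => hY.
have nY i : nth 0 u i < Y.
  case: (ltnP i (size u)) => hi; first by exact: (allP hY _ (mem_nth 0 hi)).
  by rewrite nth_default // /Y; lia.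
have /andP[_ hsm] := prog_safe; have hsc : smallK c := In_all hsm hc.
have aY (a : datom) : List.In a (c_hd c :: c_edb c ++ c_idb c) -> a.1 < Y /\ all (fun i => i < Y) (map (tval (nth 0 u)) a.2).
  move=> ha; have /andP[h1 h2] := In_all hsc ha.
  split; first by have := Y24; lia.
  elim: a.2 h2 => //= t l IH /andP[h3 /IH ->]; rewrite andbT; case: t h3 => [i|k] //= h3; have := Y24; lia.
rewrite /clause_ok; apply/implyP => he; apply/implyP => hi.
have [h1 h2] := aY _ (or_introl erefl).
have hE : holds edb (nth 0 u) (c_edb c).
  apply/holdsP => a ha; have h : xedb (R s w) a.1 (map (tval (nth 0 u)) a.2) := In_all he ha.
  have /andP[h3 /eqP h4] := In_all (In_all prog_edb hc) ha.
  have hsz : size (map (tval (nth 0 u)) a.2) = ear a.1 by rewrite size_map.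
  rewrite xedb_sedb // in h; apply: (sedb_mono _ h3 hsz h) => t b ht1 ht2 hb hJ hg.
  have bY : all (fun i => i < Y) b by apply: allY => i hib; apply: (J_Jlist hN); exact: (allP hJ).
  case: t ht1 ht2 hb hg => [|[|[|[|[|[|[|[|[|[|[|[|[|[|[|[|t]]]]]]]]]]]]]]]] // _ _ hb hg; rewrite /ear /= in hb.
  - case: b bY hb hg {hJ} => [|v [|y1 [|y2 [|y3 [|? ?]]]]] // bY _ hg.
    by rewrite /guess /lf (H3 v [:: y1; y2; y3] erefl bY hg).
  - case: b bY hb hg {hJ} => [|v [|y1 [|y2 [|y3 [|y4 [|y5 [|? ?]]]]]]] // bY _ hg.
    by rewrite /guess /kf (H4 v [:: y1; y2; y3; y4; y5] erefl bY hg).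
  - case: b bY hb hg {hJ} => [|v [|y1 [|y2 [|y3 [|y4 [|y5 [|y6 [|y7 [|? ?]]]]]]]]] // bY _ hg.
    by rewrite /guess /nf (H5 v [:: y1; y2; y3; y4; y5; y6; y7] erefl bY hg).
have hI : holds (dl prog edb) (nth 0 u) (c_idb c).
  apply/holdsP => a ha; have h : xmem (R s w) a.1 (map (tval (nth 0 u)) a.2) := In_all hi ha.
  have [h3 h5] := aY a (or_intror (List.in_or_app _ _ _ (or_intror ha))).
  by move: h; rewrite xm // => /asboolP.
rewrite xm //; apply/asboolP; exact: (@dl_rule prog _ c (nth 0 u) hc hE hI).
Qed.

Lemma guess_bounded lf kf nf t a : guess lf kf nf t a -> t <= 24 /\ size a <= 10.
Proof.
case: t => [|[|[|[|[|[|[|[|[|[|[|[|[|[|[|[|t]]]]]]]]]]]]]]]] //=;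
 by case: a => [|? [|? [|? [|? [|? [|? [|? [|? [|? ?]]]]]]]]].
Qed.

(** The guess, restricted to the domain, is coded by [w]; every closed set then contains all
    derivable facts by induction on derivations. *)
Lemma dGoal_formula lf kf nf : dGoal (sedb S q J (guess lf kf nf)) -> formula [:: X; n; N].
Proof.
move=> G.
have hb : forall t a, guess lf kf nf t a && all J a -> [/\ t <= 24, size a <= 10 & {subset a <= Jl}].
  by move=> t a /andP[/guess_bounded[h1 h2] /allP hJ]; split=> // i /hJ; exact: (J_Jlist hN).
have [w hw Hw] := set_exists prog_safe Jl_Y Y24 (erefl Z) NE hb.
have xm s t a : t < Y -> all (fun i => i < Y) a -> xg (R s w) t a = guess lf kf nf t a && all J a.
  by move=> ht ha; rewrite /xg mem_eq Hw.
have hY := Y24; have Y0 : 0 < Y by lia.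
have fun_ t k s : t <= 24 ->
  (forall a b c, size b = k -> size c = k -> guess lf kf nf t (a :: b) -> guess lf kf nf t (a :: c) -> b = c) -> funct t k (R s w).
  move=> ht Hf; apply/forallvP => u hu; rewrite eY_E cats0 => hall; have tY : t < Y by lia.
  have uY l : all (fun i => i < Y) (map (nth 0 u) l).
    apply/allP => _ /mapP[i _ ->]; case: (ltnP i (size u)) => hi; [exact: (allP hall _ (mem_nth 0 hi)) | by rewrite nth_default].
  apply/implyP; rewrite (xm s t _ tY (uY (0 :: iota 1 k))) (xm s t _ tY (uY (0 :: iota k.+1 k))) => /andP[/andP[g1 _] /andP[g2 _]].
  have e := Hf (nth 0 u 0) (map (nth 0 u) (iota 1 k)) (map (nth 0 u) (iota k.+1 k)) ltac:(by rewrite size_map size_iota) ltac:(by rewrite size_map size_iota) g1 g2.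
  apply/allP => i; rewrite mem_iota => hi; have hi' : i.-1 < k by lia.
  have e2 : nth 0 (map (nth 0 u) (iota 1 k)) i.-1 = nth 0 (map (nth 0 u) (iota k.+1 k)) i.-1 by rewrite e.
  rewrite !(nth_map 0) ?size_iota // !nth_iota // in e2.
  have e3 : 1 + i.-1 = i by lia. have e4 : k.+1 + i.-1 = k + i by lia.
  by rewrite e3 e4 in e2; apply/eqP.
apply/exbP; exists w => //; apply/allbP => s hs; rewrite /body; apply/and4P; split.
- apply: fun_ => // a [|x1 [|x2 [|x3 [|? ?]]]] // [|y1 [|y2 [|y3 [|? ?]]]] // _ _ /= /eqP e1 /eqP; rewrite -e1; by case=> -> -> ->.
- apply: fun_ => // a [|x1 [|x2 [|x3 [|x4 [|x5 [|? ?]]]]]] // [|y1 [|y2 [|y3 [|y4 [|y5 [|? ?]]]]]] // _ _ /= /eqP e1 /eqP; rewrite -e1; by case=> -> -> -> -> ->.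
- apply: fun_ => // a [|x1 [|x2 [|x3 [|x4 [|x5 [|x6 [|x7 [|? ?]]]]]]]] // [|y1 [|y2 [|y3 [|y4 [|y5 [|y6 [|y7 [|? ?]]]]]]]] // _ _ /= /eqP e1 /eqP; rewrite -e1; by case=> -> -> -> -> -> -> ->.
rewrite /goal_formula; apply/implyP => cl.
have edbJl : forall t a, sedb S q J (guess lf kf nf) t a -> {subset a <= Jl} by move=> t a; exact: sedb_Jl.
suff HH : forall t a, dl prog (sedb S q J (guess lf kf nf)) t a -> xmem (R s w) t a by exact: HH G.
apply: (@dl_ind _ _ (fun t a => is_true (xmem (R s w) t a))) => c v hc he hd hi.
pose u := mkseq (fun i => if v i < Y then v i else 0) (cmax c).
have cm (a : datom) : List.In a (c_edb c ++ c_idb c) -> foldr maxn 0 (map tmax a.2) <= cmax c.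
  by move=> ha; apply: leq_trans (foldr_maxn_In amax ha) _; exact: leq_maxl.
have bnd t a := @dl_bounded prog (sedb S q J (guess lf kf nf)) Jl prog_safe edbJl J_small t a.
have uE (a : datom) : List.In a (c_edb c ++ c_idb c) -> all (fun i => i < Y) (tvals v a.2) -> map (tval (nth 0 u)) a.2 = tvals v a.2.
  by move=> ha h; apply: tval_bounded => //; exact: cm.
have hd' : dl prog (sedb S q J (guess lf kf nf)) (c_hd c).1 (tvals v (c_hd c).2) by exact: (@dl_rule prog _ c v hc he hd).
have hh : map (tval (nth 0 u)) (c_hd c).2 = tvals v (c_hd c).2.
  apply: tval_bounded; first exact: leq_maxr.
  by have [_ _ h] := bnd _ _ hd'; exact: allY.
have Hc : forallv (cmax c) (eY (R s w)) (clause_ok xedb c (R s w)) [::] := In_all cl hc.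
have uY : all (fun i => i < eY (R s w)) u.
  by rewrite eY_E; apply/allP => _ /mapP[i _ ->]; case: ifP.
have := proj1 (forallvP _ _ _ _) Hc u (size_mkseq _ _) uY; rewrite cats0 /clause_ok hh => /implyP K; apply: (implyP (K _)).
  apply: all_In => a ha; have h := proj1 (holdsP _ _ _) he a ha.
  have /andP[h3 /eqP h4] := In_all (In_all prog_edb hc) ha.
  have hs' : size (tvals v a.2) = ear a.1 by rewrite size_map.
  have hin : List.In a (c_edb c ++ c_idb c) by apply: List.in_or_app; left.
  rewrite (uE _ hin (allY (edbJl _ _ h))) xedb_sedb //; apply: (sedb_mono _ h3 hs' h) => t b ht1 ht2 hb' hJ hg.
  rewrite xm; [by rewrite hg hJ | by lia | ].
  by apply: allY => i hib; apply: (J_Jlist hN); exact: (allP hJ).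
apply: all_In => a ha; have h := proj1 (holdsP _ _ _) hi a ha; have h' := proj1 (holdsP _ _ _) hd a ha.
have hin : List.In a (c_edb c ++ c_idb c) by apply: List.in_or_app; right.
by have [_ _ k] := bnd _ _ h'; rewrite (uE _ hin (allY k)).
Qed.

Lemma formula_correct : formula [:: X; n; N] <-> monotone_answerable S q.
Proof.
split=> [/formula_dGoal[lf [kf [nf G]]]|A].
  apply: (Goal_answerable (B := Y) wfS wfq Hadm (fun _ _ => erefl) _ G).
  by move=> i /(J_Jlist hN) /Jl_Y; exact: ltnW.
have [lf [kf [nf G]]] := answerable_Goal (g := fun _ _ => false) wfS wfq Hadm (fun _ _ => erefl) A.
exact: (dGoal_formula G).
Qed.
End Equiv.

(** With [m = k + 2] one has [k + 7 <= m ^ 3], [13 * 25 <= m ^ 9] and [2 * k + 53 <= m ^ 6]; the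
    exponents add up to [3 + 9 + 60 = 72]. *)
Lemma tower_bound k : ((2 ^ k + k + 60) ^ 13) ^ (25 * (2 * k + 53) ^ 10) <= 2 ^ (k.+2 ^ 72).
Proof.
have hY : 2 ^ k + k + 60 <= 2 ^ (k + 7).
  rewrite expnD; have h0 : 2 ^ 7 = 128 by []. rewrite h0; have := ltn_expl k (isT : 1 < 2); move: (2 ^ k) => A h; lia.
set m := k.+2.
have p j : 0 < j -> 2 ^ j <= m ^ j by move=> hj; rewrite leq_exp2r.
have h1 : k + 7 <= m ^ 3 by rewrite expnS; apply: leq_trans (_ : m * 4 <= _); [rewrite /m; lia | rewrite leq_mul2l; apply/orP; right; exact: (p 2 isT)].
have h2 : 13 * 25 <= m ^ 9 by apply: leq_trans (p 9 isT).
have h3 : 2 * k + 53 <= m ^ 6 by rewrite expnS; apply: leq_trans (_ : m * 32 <= _); [rewrite /m; lia | rewrite leq_mul2l; apply/orP; right; exact: (p 5 isT)].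
have -> : m ^ 72 = m ^ 3 * (m ^ 9 * (m ^ 6) ^ 10) by rewrite -expnM -!expnD.
have h4 : (2 * k + 53) ^ 10 <= (m ^ 6) ^ 10 by rewrite leq_exp2r.
have h0 : 0 < (2 * k + 53) ^ 10 by rewrite expn_gt0 addn_gt0 orbT.
move: ((2 * k + 53) ^ 10) ((m ^ 6) ^ 10) h4 h0 => A B h4 h0.
rewrite -expnM; apply: leq_trans (_ : (2 ^ (k + 7)) ^ (13 * (25 * A)) <= _).
  by rewrite leq_exp2r // !muln_gt0.
by rewrite -expnM leq_exp2l // [13 * (25 * A)]mulnA; apply: leq_mul => //; apply: leq_mul.
Qed.

Lemma bound_N S q N : ((2 ^ size (enc_input S q) + size (enc_input S q) + 60) ^ 13) ^ (25 * (size (Jlist S q N)).+1 ^ 10)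
  <= 2 ^ ((size (enc_input S q)).+2 ^ 72).
Proof.
have -> : (size (Jlist S q N)).+1 = 2 * size (enc_input S q) + 53.
  by rewrite /Jlist; move: (size (enc_input S q)) => n; rewrite size_cat size_cat size_map !size_iota /=; lia.
exact: tower_bound.
Qed.

Theorem mainTheorem9 :
  exists (M : TM) (c : nat),
    forall (S : schema) (q : bcq),
      wf_schema S -> wf_query S q ->
      exists n : nat,
        n <= 2 ^ ((size (enc_input S q)).+2 ^ c) /\
        tm_decides_in M (enc_input S q) n (monotone_answerable S q).
Proof.
(* With exponent 72 the number [N] can code every set of facts. The time [N ^ K] equals
   [2 ^ (m ^ 72 * K)] for [m] the length plus 2, and [K <= m ^ K] moves [K] into the exponent. *)
have [e He] := def_formula; have [K HK] := top_ok e (isT : 0 < 72).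
exists (machine (top_prog e 72) (top_regs e 72)), (72 + K) => S q wfS wfq.
have h0 : 0 < size (enc_input S q).
  have := enc_list_gt0 enc_nat (s_ar S); rewrite /enc_input /enc_schema; move: (enc_list enc_nat (s_ar S)) => A hA.
  by rewrite !size_cat; lia.
have := HK _ h0; cbv zeta; case=> n hn hs; exists n; split.
  apply: leq_trans hn _; rewrite -expnM leq_exp2l // expnD leq_mul2l; apply/orP; right.
  by case: K {HK} => // K; apply: leq_trans (ltnW (ltn_expl K.+1 (isT : 1 < 2))) _; rewrite leq_exp2r.
rewrite /tm_decides_in; cbv zeta; rewrite hs He lt0b; set b := formula _.
have hb : b <-> monotone_answerable S q.
  apply: (formula_correct wfS wfq); last exact: bound_N.
  by rewrite leq_exp2l //; have := leq_pexp2l (isT : 0 < (size (enc_input S q)).+2) (isT : 1 <= 72); rewrite expn1.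
case: b hb => hb; split.
- by apply/orP; left; apply/eqP.
- by split=> _; [exact: (proj1 hb isT) | apply/eqP].
- by apply/orP; right; apply/eqP.
- by split=> [/eqP h|h]; [discriminate h | have := proj2 hb h].
Qed.
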